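(* Let $\Omega$ be a separable and $\sigma$-finite measure space and let $X_0,X_1,X_2,X_3$ be $A$-convex quasi-Banach function spaces over $\Omega$, where either $X_0$ or $X_3$ is separable and $X_0\cap X_3$ is dense in $X_1$ and in $X_2$. Further, let $\theta,\eta,\lambda,\mu\in[0,1]$ satisfy (i) $0<\theta<\eta<1$, (ii) $\theta=\lambda\eta$, (iii) $\eta=(1-\mu)\theta+\mu$. If $X_1=[X_0,X_2]_\lambda$ and $X_2=[X_1,X_3]_\mu$, then $X_1=[X_0,X_3]_\theta$ and $X_2=[X_0,X_3]_\eta$. Here all equalities of spaces are understood up to equivalence of quasi-norms.
   Context: All vector spaces are over $\mathbb{C}$. A quasi-Banach space is a complete quasi-normed space. A quasi-Banach space is separable if it has a countable dense subset. Equality of spaces up to equivalence of quasi-norms means equality as sets with equivalent quasi-norms. That $X_0\cap X_3$ is dense in $X_j$ includes that $X_0\cap X_3\subseteq X_j$. Separable measure space: a measure space $\Omega$ (with measure $|\cdot|$) is called separable if there is a sequence of measurable sets $(A_n)_n$ in $\Omega$ such that for every measurable $E\subseteq\Omega$ with $|E|<\infty$ and every $\varepsilon>0$ there is $n\in\mathbb{N}$ with $|A_n\Delta E|<\varepsilon$. $\mathrm{L}^0(\Omega)$ denotes the space of $\mathbb{C}$-valued measurable functions on $\Omega$, modulo equality almost everywhere. Quasi-Banach function space over $\Omega$: a quasi-Banach space $X\subseteq \mathrm{L}^0(\Omega)$ such that (i) there exists $f\in X$ with $f>0$ a.e. (weak order unit); (ii) if $f\in X$, $g\in \mathrm{L}^0(\Omega)$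 and $|g|\le|f|$ a.e., then $g\in X$ and $\|g\|_X\le\|f\|_X$ (lattice property). $A$-convexity: a quasi-Banach function space $X$ over $\Omega$ is $A$-convex if there is $C\ge1$ such that $\|P(0)\|_X\le C\sup_{|z|=1}\|P(z)\|_X$ for all polynomials $P:\overline{\mathbb{D}}\to X$ (with coefficients in $X$), where $\mathbb{D}$ is the open unit disc in $\mathbb{C}$. Complex interpolation: let $Y_0,Y_1$ be quasi-Banach function spaces over $\Omega$. The sum $Y_0+Y_1\subseteq \mathrm{L}^0(\Omega)$ carries the quasi-norm $\|f\|_{Y_0+Y_1}=\inf\{\|f_0\|_{Y_0}+\|f_1\|_{Y_1} : f=f_0+f_1,\ f_j\in Y_j\}$ and is again a quasi-Banach function space over $\Omega$. Let $\mathbb{S}=\{z\in\mathbb{C} : \mathrm{Re}(z)\in(0,1)\}$. A function $F:\mathbb{S}\to Y_0+Y_1$ is analytic if for every $z_0\in\mathbb{S}$ there is $r\in(0,\mathrm{dist}(z_0,\partial\mathbb{S}))$ such that $F(z)=\sum_{k=0}^\infty f_k(z-z_0)^k$ with convergence in $Y_0+Y_1$ for every $z\in B_r(z_0)$. The space $\mathcal{F}$ of admissible functions consists of all bounded analytic functions $F:\mathbb{S}\to Y_0+Y_1$ that extend continuously to $\overline{\mathbb{S}}$ such that for $j=0,1$ the traces $t\mapsto F(j+\mathrm{i}t)$ are continuous and bounded functions from $\mathbb{R}$ into $Y_j$. It is endowed with $$\|F\|_{\mathcal{F}}=\max\Bigl\{\sup_{t\in\mathbb{R}}\|F(\mathrm{i}t)\|_{Y_0},\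 \sup_{t\in\mathbb{R}}\|F(1+\mathrm{i}t)\|_{Y_1},\ \sup_{z\in\mathbb{S}}\|F(z)\|_{Y_0+Y_1}\Bigr\}.$$ For $\vartheta\in(0,1)$, $[Y_0,Y_1]_\vartheta=\{F(\vartheta) : F\in\mathcal{F}\}$ with quasi-norm $\|f\|_{[Y_0,Y_1]_\vartheta}=\inf\{\|F\|_{\mathcal{F}} : F\in\mathcal{F},\ F(\vartheta)=f\}$. (The conditions (i)–(iii) force $\lambda,\mu\in(0,1)$, so all interpolation spaces in the claim are defined.) *)

(* Defs.v *)
From mathcomp Require Import all_boot all_order all_algebra.
From mathcomp Require Import all_classical all_reals all_analysis.
From mathcomp Require Import complex.

Set Implicit Arguments.
Unset Strict Implicit.
Unset Printing Implicit Defensive.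

Import Order.TTheory GRing.Theory Num.Theory.
Import numFieldNormedType.Exports.
Local Open Scope classical_set_scope.
Local Open Scope ring_scope.
Local Open Scope complex_scope.

Definition separable_measure d (T : measurableType d) (R : realType)
    (m : {measure set T -> \bar R}) : Prop :=
  exists A : nat -> set T, (forall n, measurable (A n)) /\
    forall E : set T, measurable E -> (m E < +oo)%E ->
    forall e : R, 0 < e -> exists n, (m (A n `+` E) < e%:E)%E.

(* Elements of L^0(T) are handled through representatives: total functions
   T -> R[i] satisfying [L0], identified up to equality m-a.e. *)
Definition L0 d (T : measurableType d) (R : realType) : set (T -> R[i]) :=
  [set f | measurable_fun setT (fun x => complex.Re (f x)) /\
           measurable_fun setT (fun x => complex.Im (f x))].

(* A set of functions with a real-valued functional; the value of [fs_norm]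
   is relevant only on members of the set. *)
Record fspace (T : Type) (R : realType) := FSpace {
  fs_mem :> (T -> R[i]) -> Prop;
  fs_norm : (T -> R[i]) -> R }.

Section quasi_normed_spaces.
Context d (T : measurableType d) (R : realType).
Variable m : {measure set T -> \bar R}.
Implicit Types (X Y : fspace T R) (f g : T -> R[i]).

(* [qn_ae] says that the set and the quasi-norm are well defined on classes
   modulo a.e. equality. *)
Record quasi_normed X : Prop := {
  qn_L0 : fs_mem X `<=` @L0 d T R;
  qn_ae : forall f g, X f -> @L0 d T R g -> f = g %[ae m] ->
    X g /\ fs_norm X g = fs_norm X f;
  qn_zero : X 0;
  qn_linear : forall (a : R[i]) f g, X f -> X g -> X (a *: f + g);
  qn_ge0 : forall f, X f -> 0 <= fs_norm X f;
  qn_eq0 : forall f, X f -> fs_norm X f = 0 -> f = 0 %[ae m];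
  qn_scale : forall (a : R[i]) f, X f ->
    fs_norm X (a *: f) = Normc.normc a * fs_norm X f;
  qn_triangle : exists2 K : R, 1 <= K &
    forall f g, X f -> X g ->
      fs_norm X (f + g) <= K * (fs_norm X f + fs_norm X g) }.

Definition qn_cvg X (u : nat -> T -> R[i]) f : Prop :=
  fs_norm X (u n - f) @[n --> \oo] --> (0 : R).

Definition qn_cauchy X (u : nat -> T -> R[i]) : Prop :=
  forall e : R, 0 < e -> exists N : nat, forall k l : nat,
    (N <= k)%N -> (N <= l)%N -> fs_norm X (u k - u l) < e.

Definition quasi_banach X : Prop :=
  quasi_normed X /\
  forall u, (forall n, X (u n)) -> qn_cauchy X u ->
    exists2 f, X f & qn_cvg X u f.

Definition qn_dense (D : set (T -> R[i])) X : Prop :=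
  D `<=` fs_mem X /\
  forall f, X f -> forall e : R, 0 < e ->
    exists2 g, D g & fs_norm X (f - g) < e.

Definition qn_separable X : Prop :=
  exists2 D : set (T -> R[i]), countable D & qn_dense D X.

Definition qn_equiv X Y : Prop :=
  fs_mem X = fs_mem Y /\
  exists2 c : R, 0 < c & forall f, X f ->
    c^-1 * fs_norm X f <= fs_norm Y f <= c * fs_norm X f.

(* In R[i], [0 < z] means that z is real and positive. *)
Definition qbfs X : Prop :=
  [/\ quasi_banach X,
      exists2 f, X f & \forall x \ae m, 0 < f x &
      forall f g, X f -> @L0 d T R g ->
        (\forall x \ae m, `|g x| <= `|f x|) ->
        X g /\ fs_norm X g <= fs_norm X f].

Definition A_convex X : Prop :=
  qbfs X /\
  exists2 C : R, 1 <= C &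
    forall (n : nat) (a : nat -> T -> R[i]), (forall k, X (a k)) ->
      let P := fun z : R[i] => \sum_(k < n) z ^+ k *: a k in
      fs_norm X (P 0) <=
        C * sup [set fs_norm X (P z) | z in [set z | `|z| = 1]].

End quasi_normed_spaces.

Section complex_interpolation.
Context d (T : measurableType d) (R : realType).
Variable m : {measure set T -> \bar R}.
Implicit Types (X Y : fspace T R) (f g : T -> R[i]).

Definition sum_space Y0 Y1 : fspace T R := FSpace
  [set f | @L0 d T R f /\
    exists f0 f1, [/\ Y0 f0, Y1 f1 & f = f0 + f1 %[ae m]]]
  (fun f => inf [set r | exists f0 f1,
    [/\ Y0 f0, Y1 f1, f = f0 + f1 %[ae m] &
       r = fs_norm Y0 f0 + fs_norm Y1 f1]]).

Definition strip : set R[i] := [set z | 0 < complex.Re z < 1].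
Definition closed_strip : set R[i] := [set z | 0 <= complex.Re z <= 1].

(* The distance from z0 to the boundary of the strip is
   min (Re z0) (1 - Re z0). *)
Definition analytic_on_strip Y (F : R[i] -> T -> R[i]) : Prop :=
  (forall z, strip z -> Y (F z)) /\
  forall z0, strip z0 ->
    exists r : R,
      0 < r < Num.min (complex.Re z0) (1 - complex.Re z0) /\
      exists2 a : nat -> T -> R[i], (forall k, Y (a k)) &
        forall z, `|z - z0| < r%:C ->
          qn_cvg Y (fun n => \sum_(k < n) (z - z0) ^+ k *: a k) (F z).

Definition continuous_on_closed_strip Y (F : R[i] -> T -> R[i]) : Prop :=
  (forall z, closed_strip z -> Y (F z)) /\
  forall z0, closed_strip z0 ->
    fs_norm Y (F z - F z0) @[z --> within closed_strip (nbhs (z0 : R[i]^o))]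
      --> (0 : R).

Definition continuous_bounded_trace Y (h : R -> T -> R[i]) : Prop :=
  [/\ forall t, Y (h t),
      forall t0 : R, fs_norm Y (h t - h t0) @[t --> t0] --> (0 : R) &
      exists M : R, forall t, fs_norm Y (h t) <= M].

(* A function on the open strip together with its (unique) continuous
   extension is given as one function F, of which only the values on the
   closed strip are relevant. *)
Definition admissible Y0 Y1 (F : R[i] -> T -> R[i]) : Prop :=
  [/\ analytic_on_strip (sum_space Y0 Y1) F,
      exists M : R, forall z, strip z -> fs_norm (sum_space Y0 Y1) (F z) <= M,
      continuous_on_closed_strip (sum_space Y0 Y1) F,
      continuous_bounded_trace Y0 (fun t => F (0 +i* t)) &
      continuous_bounded_trace Y1 (fun t => F (1 +i* t))].

Definition admissible_norm Y0 Y1 (F : R[i] -> T -> R[i]) : R :=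
  Num.max (Num.max
    (sup (range (fun t : R => fs_norm Y0 (F (0 +i* t)))))
    (sup (range (fun t : R => fs_norm Y1 (F (1 +i* t))))))
    (sup [set fs_norm (sum_space Y0 Y1) (F z) | z in strip]).

Definition interp Y0 Y1 (theta : R) : fspace T R := FSpace
  [set f | @L0 d T R f /\
    exists2 F, admissible Y0 Y1 F & F theta%:C = f %[ae m]]
  (fun f => inf [set admissible_norm Y0 Y1 F | F in
    [set F | admissible Y0 Y1 F /\ F theta%:C = f %[ae m]]]).

End complex_interpolation.

(* Main.v *)
(* Idea.  If Y0 and Y1 are A-convex and one of them is order continuous, then [Y0, Y1]_th
   is the Calderon product Y0^(1-th) Y1^th.  A product is interpolated by
   F(z) = g0^(1-z) g1^z.  For the converse, |F|^p is almost submean on small circles; a walk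
   in the strip, stopped near the boundary, therefore bounds |F(th)|^p a.e. by p-means of
   boundary values of F with weights e^(kappa Re z), simultaneously for all bounded kappa,
   and for small p A-convexity bounds p-means independently of the number of terms.
   Optimizing kappa at each point gives the two factors.

   Separability of X0 or X3 makes X0 or X3, and by density also X1 and X2, order continuous,
   so X1 = X0^(1-lambda) X2^lambda and X2 = X1^(1-mu) X3^mu.  Substituting these identities
   into each other indefinitely converges, because lambda (1 - mu) < 1, and gives
   X1 <= X0^(1-theta) X3^theta.  Conversely, for a in X0 and b in X3 with a/b bounded above
   and below, phi = a^(1-theta) b^theta and gam = a^(1-eta) b^eta lie in X0 and X3, hence in
   X1 and X2, and phi = a^(1-lambda) gam^lambda, gam = phi^(1-mu) b^mu; so the (finite) norms
   of phi in X1 and gam in X2 control each other and are bounded in terms of a and b. *)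

Require Import Defs.
From mathcomp Require Import all_boot all_order all_algebra.
From mathcomp Require Import all_classical all_reals all_analysis.
From mathcomp Require Import measurable_realfun complex ring lra.

Set Implicit Arguments.
Unset Strict Implicit.
Unset Printing Implicit Defensive.

Import Order.TTheory GRing.Theory Num.Theory.
Import numFieldNormedType.Exports.
Local Open Scope classical_set_scope.
Local Open Scope ring_scope.

(** * Measurable functions and domination in a quasi-Banach lattice *)

(** A quasi-norm need not be continuous and its balls need not be convex, so vector-valued
    integrals, Poisson kernels and duality are out of reach, and A-convexity speaks of polynomials
    only. This shapes the proof. Estimates are a.e. dominations by an element of a ball ([dom]).
    Harmonic measure on the boundary of the strip is replaced by the uniform measure on the finite
    list of endpoints of a walk, and the only means that occur are p-means of finitely many
    functions, bounded uniformly in their number. Finite lists also keep every exceptional set a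
    countable union of null sets, although the interior estimate must hold for all weights [kap] at
    once. Wherever infinitely many functions are summed, their norms decay geometrically with a
    ratio of order 1/K, which absorbs the constant K of the quasi-triangle inequality; this is the
    origin of the recurring conditions 2 K q <= 1 and 4 K q <= 1. *)

Notation nc := Normc.normc.

Section modulus.
Variable R : realType.
Implicit Types z w : R[i].

Lemma normC_nc z : `|z| = (nc z)%:C%C.
Proof. by []. Qed.

Lemma nc_ge0 z : 0 <= nc z.
Proof. by case: z => a b; exact: sqrtr_ge0. Qed.

Lemma nc_eq0 z : (nc z == 0) = (z == 0).
Proof.
apply/eqP/eqP => [/Normc.eq0_normc//|->]; exact: Normc.normc0.
Qed.

Lemma nc_real (a : R) : nc (a%:C)%C = `|a|.
Proof. by rewrite /= expr0n /= addr0 sqrtr_sqr. Qed.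

Lemma ler_ncD z w : nc (z + w) <= nc z + nc w.
Proof. exact: le_normcD. Qed.

Lemma ncN z : nc (- z) = nc z.
Proof. exact: normcN. Qed.

Lemma ncB z w : nc (z - w) = nc (w - z).
Proof. by rewrite -ncN opprB. Qed.

Lemma ler_ncB z w : nc z - nc w <= nc (z - w).
Proof. by rewrite lerBlDr (le_trans _ (ler_ncD _ _)) // subrK. Qed.

Lemma ncX z n : nc (z ^+ n) = nc z ^+ n.
Proof.
by elim: n => [|n IH]; rewrite ?expr0 ?Normc.normc1 // !exprS Normc.normcM IH.
Qed.

Lemma nc_Re z : `|complex.Re z| <= nc z.
Proof.
case: z => a b /=; rewrite -sqrtr_sqr ler_wsqrtr// lerDl sqr_ge0 //.
Qed.

Lemma nc_Im z : `|complex.Im z| <= nc z.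
Proof.
case: z => a b /=; rewrite -sqrtr_sqr ler_wsqrtr// lerDr sqr_ge0 //.
Qed.

Lemma nc_leD z : nc z <= `|complex.Re z| + `|complex.Im z|.
Proof.
rewrite -(ger0_norm (addr_ge0 (normr_ge0 (complex.Re z)) (normr_ge0 (complex.Im z)))).
case: z => a b /=; rewrite -sqrtr_sqr ler_wsqrtr// sqrrD !real_normK ?num_real//.
by rewrite -addrA [_ *+ 2 + _]addrC addrA lerDl mulrn_wge0 // mulr_ge0.
Qed.

Lemma ler_nc_sum (I : Type) (s : seq I) (P : pred I) (F : I -> R[i]) :
  nc (\sum_(i <- s | P i) F i) <= \sum_(i <- s | P i) nc (F i).
Proof.
elim/big_rec2: _ => [|i y x _ IH]; first by rewrite Normc.normc0.
by rewrite (le_trans (ler_ncD _ _)) // lerD2l.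
Qed.

Lemma nc_prod (I : Type) (s : seq I) (P : pred I) (F : I -> R[i]) :
  nc (\prod_(i <- s | P i) F i) = \prod_(i <- s | P i) nc (F i).
Proof.
elim/big_rec2: _ => [|i y x _ IH]; first by rewrite Normc.normc1.
by rewrite Normc.normcM IH.
Qed.

Lemma le_nc_real z (a : R) : (`|z| <= a%:C%C) = (nc z <= a).
Proof. by rewrite normC_nc lecR. Qed.

Lemma lt_nc_real z (a : R) : (`|z| < a%:C%C) = (nc z < a).
Proof. by rewrite normC_nc ltcR. Qed.

End modulus.

Lemma normr_normD (R : realType) (a b : R) : `| `|a| + `|b| | = `|a| + `|b|.
Proof. by rewrite ger0_norm // addr_ge0. Qed.

Lemma cvg0_seqP (R : realType) (u : nat -> R) :
  u n @[n --> \oo] --> (0 : R) <->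
  forall e, 0 < e -> exists N, forall n, (N <= n)%N -> `|u n| < e.
Proof.
split=> [/cvgrPdist_lt h e e0|h].
  have [N _ hN] := h _ e0; exists N => n Nn.
  by have := hN n Nn; rewrite sub0r normrN.
apply/cvgrPdist_lt => e e0; have [N hN] := h e e0.
by exists N => // n Nn; rewrite sub0r normrN; exact: hN.
Qed.

Section measurability.
Context d (T : measurableType d) (R : realType).
Implicit Types f g : T -> R[i].

Lemma L0_real (u : T -> R) :
  measurable_fun setT u -> @L0 d T R (fun x => (u x)%:C%C).
Proof. by move=> mu; split => //=; exact: measurable_cst. Qed.

Lemma measurable_nc f : @L0 d T R f -> measurable_fun setT (fun x => nc (f x)).
Proof.
move=> [mr mi].
have -> : (fun x => nc (f x)) =
   (fun x => Num.sqrt (complex.Re (f x) ^+ 2 + complex.Im (f x) ^+ 2)).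
  by apply/funext => x; case: (f x).
apply: measurableT_comp.
  by apply: continuous_measurable_fun; exact: sqrt_continuous.
by apply: measurable_funD; apply: measurable_funX.
Qed.

Lemma L0D f g : @L0 d T R f -> @L0 d T R g -> @L0 d T R (fun x => f x + g x).
Proof.
move=> [fr fi] [gr gi]; split.
  rewrite (_ : (fun x => _) = (fun x => complex.Re (f x) + complex.Re (g x))).
    exact: measurable_funD.
  by apply/funext => x; case: (f x) => a b; case: (g x).
rewrite (_ : (fun x => _) = (fun x => complex.Im (f x) + complex.Im (g x))).
  exact: measurable_funD.
by apply/funext => x; case: (f x) => a b; case: (g x).
Qed.

Lemma L0M f g : @L0 d T R f -> @L0 d T R g -> @L0 d T R (fun x => f x * g x).
Proof.
move=> [fr fi] [gr gi]; split.
  rewrite (_ : (fun x => _) = (fun x => complex.Re (f x) * complex.Re (g x)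
       - complex.Im (f x) * complex.Im (g x))).
    by apply: measurable_funB; apply: measurable_funM.
  by apply/funext => x; case: (f x) => a b; case: (g x).
rewrite (_ : (fun x => _) = (fun x => complex.Re (f x) * complex.Im (g x)
     + complex.Im (f x) * complex.Re (g x))).
  by apply: measurable_funD; apply: measurable_funM.
by apply/funext => x; case: (f x) => a b; case: (g x).
Qed.

Lemma L0_cst (c : R[i]) : @L0 d T R (fun=> c).
Proof. by split; exact: measurable_cst. Qed.

Lemma L0N f : @L0 d T R f -> @L0 d T R (fun x => - f x).
Proof.
move=> hf; rewrite (_ : (fun x => _) = (fun x => (-1) * f x)).
  by apply: L0M => //; exact: L0_cst.
by apply/funext => x; rewrite mulN1r.
Qed.

Lemma L0B f g : @L0 d T R f -> @L0 d T R g -> @L0 d T R (fun x => f x - g x).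
Proof. by move=> hf hg; apply: L0D => //; exact: L0N. Qed.

Lemma L0_sum (I : Type) (s : seq I) (P : pred I) (F : I -> T -> R[i]) :
  (forall i, P i -> @L0 d T R (F i)) ->
  @L0 d T R (fun x => \sum_(i <- s | P i) F i x).
Proof.
move=> hF; elim: s => [|i s IH].
  by under eq_fun do rewrite big_nil; exact: L0_cst.
under eq_fun do rewrite big_cons.
by have [Pi|//] := boolP (P i); apply: L0D => //; exact: hF.
Qed.

Lemma measurable_powRfun (u : T -> R) (p : R) :
  measurable_fun setT u -> measurable_fun setT (fun x => u x `^ p).
Proof. by move=> mu; exact: (measurableT_comp (@measurable_powR R p) mu). Qed.

Lemma measurable_mem (A : set T) : measurable A ->
  measurable_fun setT (fun x => x \in A).
Proof.
move=> mA; apply: (measurable_fun_bool true).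
rewrite setTI (_ : _ @^-1` _ = A) //.
by apply/seteqP; split => x /=; [move/set_mem|move=> Ax; apply/mem_set].
Qed.

Lemma L0_if (A : set T) f g : measurable A -> @L0 d T R f -> @L0 d T R g ->
  @L0 d T R (fun x => if x \in A then f x else g x).
Proof.
move=> mA [fr fi] [gr gi]; split.
- rewrite (_ : (fun x => _) = (fun x => if x \in A then complex.Re (f x) else complex.Re (g x))).
    by apply: measurable_fun_ifT => //; exact: measurable_mem.
  by apply/funext => x; case: ifP.
- rewrite (_ : (fun x => _) = (fun x => if x \in A then complex.Im (f x) else complex.Im (g x))).
    by apply: measurable_fun_ifT => //; exact: measurable_mem.
  by apply/funext => x; case: ifP.
Qed.

End measurability.

Section domination.
Context d (T : measurableType d) (R : realType).
Variable m : {measure set T -> \bar R}.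
Implicit Types (X : fspace T R) (f g : T -> R[i]) (u v w : T -> R).

(** The constant of the quasi-triangle inequality is made explicit; [qlat_mono] lets several spaces
    share one K. *)
Definition qlat X (K : R) : Prop :=
  [/\ qbfs m X, 1 <= K & forall f g, X f -> X g ->
      fs_norm X (f + g) <= K * (fs_norm X f + fs_norm X g)].

(* [u] is an arbitrary function: domination needs no measurability. *)
Definition dom X u (r : R) : Prop :=
  exists f, [/\ X f, fs_norm X f <= r & \forall x \ae m, `|u x| <= nc (f x)].

Lemma qbfs_qlat X : qbfs m X -> exists K, qlat X K.
Proof. by move=> hX; case: (hX) => [[[_ _ _ _ _ _ _ [K K1 hK]] _] _ _]; exists K. Qed.

Lemma qlat_mono X K K' : K <= K' -> qlat X K -> qlat X K'.
Proof.
move=> KK' [hX K1 hK]; split=> //; first exact: le_trans KK'.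
move=> f g Xf Xg; apply: (le_trans (hK _ _ Xf Xg)).
case: hX => [[[_ _ _ _ ge0 _ _ _] _] _ _].
by rewrite ler_wpM2r // addr_ge0 // ge0.
Qed.

Section one_space.
Variables (X : fspace T R) (K : R).
Hypothesis hX : qlat X K.

Let K1 : 1 <= K. Proof. by case: hX. Qed.
Let K0 : 0 <= K. Proof. exact: le_trans K1. Qed.

Lemma fs_mem_L0 f : X f -> @L0 d T R f.
Proof. by case: hX => [[[[h _ _ _ _ _ _ _] _] _ _] _ _] Xf; exact: h. Qed.

Lemma fs_norm_ge0 f : X f -> 0 <= fs_norm X f.
Proof. by case: hX => [[[[_ _ _ _ h _ _ _] _] _ _] _ _] ?; exact: h. Qed.

Lemma fs_memD f g : X f -> X g -> X (f + g).
Proof.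
case: hX => [[[[_ _ _ h _ _ _ _] _] _ _] _ _] Xf Xg.
by have := h 1 _ _ Xf Xg; rewrite scale1r.
Qed.

Lemma fs_mem0 : X 0.
Proof. by case: hX => [[[[]]]]. Qed.

Lemma fs_memZ (a : R[i]) f : X f -> X (a *: f).
Proof.
case: hX => [[[[_ _ h0 h _ _ _ _] _] _ _] _ _] Xf.
by have := h a _ _ Xf h0; rewrite addr0.
Qed.

Lemma fs_memB f g : X f -> X g -> X (f - g).
Proof.
by move=> Xf Xg; apply: fs_memD => //; rewrite -scaleN1r; exact: fs_memZ.
Qed.

Lemma fs_normZ (a : R[i]) f : X f -> fs_norm X (a *: f) = nc a * fs_norm X f.
Proof. by case: hX => [[[[_ _ _ _ _ _ h _] _] _ _] _ _]; exact: h. Qed.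

Lemma fs_norm0 : fs_norm X 0 = 0.
Proof. by rewrite -(scale0r 0) fs_normZ ?Normc.normc0 ?mul0r //; exact: fs_mem0. Qed.

Lemma fs_normD f g : X f -> X g ->
  fs_norm X (f + g) <= K * (fs_norm X f + fs_norm X g).
Proof. by case: hX => _ _; exact. Qed.

Lemma fs_normBC f g : X f -> X g -> fs_norm X (f - g) = fs_norm X (g - f).
Proof.
move=> Xf Xg; have -> : f - g = (-1) *: (g - f).
  by rewrite scaleN1r opprB.
rewrite fs_normZ; last exact: fs_memB.
have -> : nc (-1 : R[i]) = 1 by rewrite ncN Normc.normc1.
by rewrite mul1r.
Qed.

Lemma fs_norm_eq0 f : X f -> fs_norm X f = 0 -> \forall x \ae m, f x = 0.
Proof.
case: hX => [[[[_ _ _ _ _ h _ _] _] _ _] _ _] Xf nf.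
by have := h _ Xf nf; apply: filterS => x; apply.
Qed.

Lemma fs_lattice f g : X f -> @L0 d T R g -> (\forall x \ae m, nc (g x) <= nc (f x)) ->
  X g /\ fs_norm X g <= fs_norm X f.
Proof.
case: hX => [[_ _ h] _ _] Xf Lg gf; apply: h => //.
by apply: filterS gf => x; rewrite normC_nc le_nc_real.
Qed.

Lemma dom_mem u r f : dom X u r -> @L0 d T R f ->
  (\forall x \ae m, nc (f x) <= `|u x|) -> X f /\ fs_norm X f <= r.
Proof.
move=> [g [Xg gr ug]] Lf fu.
have [|Xf fg] := fs_lattice Xg Lf; last by split=> //; exact: le_trans gr.
by near=> x; apply: (@le_trans _ _ `|u x|); near: x.
Unshelve. all: by end_near.
Qed.

Lemma dom_fs f r : X f -> fs_norm X f <= r -> dom X (fun x => nc (f x)) r.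
Proof.
by move=> Xf fr; exists f; split=> //; apply: aeW => x; rewrite ger0_norm ?nc_ge0.
Qed.

Lemma dom_ge0 u r : dom X u r -> 0 <= r.
Proof. by move=> [f [Xf fr _]]; exact: le_trans (fs_norm_ge0 Xf) fr. Qed.

Lemma dom_le u v r r' : dom X v r -> r <= r' ->
  (\forall x \ae m, `|u x| <= `|v x|) -> dom X u r'.
Proof.
move=> [f [Xf fr vf]] rr' uv; exists f; split=> //; first exact: le_trans rr'.
by near=> x; apply: (@le_trans _ _ `|v x|); near: x.
Unshelve. all: by end_near.
Qed.

Lemma dom_ler u r r' : dom X u r -> r <= r' -> dom X u r'.
Proof. by move=> h rr'; apply: (dom_le h rr'); exact: aeW. Qed.

(** Restores measurability, which [dom] does not record. *)
Lemma dom_rep u r : dom X u r ->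
  exists w, [/\ forall x, 0 <= w x, measurable_fun setT w,
    X (fun x => (w x)%:C%C), fs_norm X (fun x => (w x)%:C%C) <= r &
    \forall x \ae m, `|u x| <= w x].
Proof.
move=> [f [Xf fr uf]]; exists (fun x => nc (f x)).
have mw := measurable_nc (fs_mem_L0 Xf).
have [|Xw wf] := fs_lattice Xf (L0_real mw).
  by apply: aeW => x; rewrite nc_real ger0_norm ?nc_ge0.
by split=> // [x|]; [exact: nc_ge0|exact: le_trans fr].
Qed.

Lemma rep_dom w r : X (fun x => (w x)%:C%C) -> fs_norm X (fun x => (w x)%:C%C) <= r ->
  dom X w r.
Proof. by move=> Xw wr; exists (fun x => (w x)%:C%C); split => //; apply: aeW => x; rewrite nc_real. Qed.

Lemma dom0 r : 0 <= r -> dom X (fun=> 0) r.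
Proof.
move=> r0; exists 0; split; [exact: fs_mem0|by rewrite fs_norm0|].
by apply: aeW => x; rewrite normr0 nc_ge0.
Qed.

Lemma dom_add u v r s : dom X u r -> dom X v s ->
  dom X (fun x => `|u x| + `|v x|) (K * (r + s)).
Proof.
move=> /dom_rep[a [a0 ma Xa ar ua]] /dom_rep[b [b0 mb Xb bs vb]].
exists ((fun x => (a x)%:C%C) + (fun x => (b x)%:C%C)); split.
- exact: fs_memD.
- by rewrite (le_trans (fs_normD Xa Xb)) // ler_wpM2l // lerD.
near=> x.
rewrite (_ : (_ + _) x = (a x + b x)%:C%C); last by rewrite rmorphD.
rewrite nc_real [leLHS]ger0_norm ?addr_ge0 // [leRHS]ger0_norm ?addr_ge0 //.
by apply: lerD; near: x.
Unshelve. all: by end_near.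
Qed.

Lemma dom_scale u r (c : R) : dom X u r -> dom X (fun x => c * u x) (`|c| * r).
Proof.
move=> [f [Xf fr uf]]; exists (c%:C%C *: f); split.
- exact: fs_memZ.
- by rewrite fs_normZ // nc_real ler_wpM2l.
by apply: filterS uf => x ux; rewrite Normc.normcM nc_real normrM ler_wpM2l.
Qed.

(** The sum is nested as u 0 + (u 1 + (u 2 + ...)): every level costs a factor K, which the ratio q
    absorbs, so the bound does not depend on n. *)
Lemma dom_sum_geo n : forall (u : nat -> T -> R) (M q : R), 0 <= q -> 2 * K * q <= 1 ->
  0 <= M -> (forall k, (k < n)%N -> dom X (u k) (M * q ^+ k)) ->
  dom X (fun x => \sum_(k < n) `|u k x|) (2 * K * M).
Proof.
elim: n => [|n IH] u M q q0 Kq M0 hu.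
  apply: (@dom_le _ (fun=> 0) 0); first exact: dom0.
    by rewrite !mulr_ge0.
  by apply: aeW => x; rewrite big_ord0.
have h0 := hu 0%N isT; rewrite expr0 mulr1 in h0.
have hS : dom X (fun x => \sum_(k < n) `|u k.+1 x|) (2 * K * (M * q)).
  apply: (IH (fun k => u k.+1) (M * q) q) => //; first by rewrite mulr_ge0.
  by move=> k kn; have := hu k.+1 kn; rewrite exprS mulrA.
apply: (dom_le (dom_add h0 hS)).
  rewrite [leRHS](_ : _ = K * (M + M)); last by ring.
  rewrite ler_wpM2l // lerD2l // mulrCA ler_piMr //.
apply: aeW => x; rewrite big_ord_recl /=.
by rewrite [X in _ <= `| _ + X|]ger0_norm ?sumr_ge0.
Qed.

(** The partial sums of measurable majorants are Cauchy by [dom_sum_geo]; the modulus of their limit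
    is the required pointwise majorant. *)
Lemma dom_series (u : nat -> T -> R) (M q : R) : 0 < q -> 2 * K * q <= 1 ->
  0 <= M -> (forall k, dom X (u k) (M * q ^+ k)) ->
  exists2 U : T -> R, dom X U (2 * K ^+ 2 * M) &
    \forall x \ae m, forall n, \sum_(k < n) `|u k x| <= U x.
Proof.
move=> q0 Kq M0 /(fun h k => dom_rep (h k)) /choice[w hw].
pose S n : T -> R[i] := fun x => (\sum_(k < n) w k x)%:C%C.
have tail n l : dom X (fun x => \sum_(k < l) `|w (n + k)%N x|) (2 * K * (M * q ^+ n)).
  apply: (@dom_sum_geo l (fun k => w (n + k)%N) (M * q ^+ n) q) => //.
  - exact: ltW.
  - by rewrite mulr_ge0 // exprn_ge0 // ltW.
  move=> k _; have [? ? Xw wr _] := hw (n + k)%N.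
  by apply: rep_dom => //; rewrite -mulrA -exprD.
have SE n l : S (n + l)%N = S n + (fun x => (\sum_(k < l) w (n + k)%N x)%:C%C).
  by apply/funext => x; rewrite /S big_split_ord rmorphD.
have LS n : @L0 d T R (S n).
  apply: L0_real; apply: measurable_sum => k; by case: (hw k).
have pos n l x : `|\sum_(k < l) w (n + k)%N x| = \sum_(k < l) w (n + k)%N x.
  by rewrite ger0_norm // sumr_ge0 // => k _; case: (hw (n + k)%N).
have tl n l : X (fun x => (\sum_(k < l) w (n + k)%N x)%:C%C) /\
   fs_norm X (fun x => (\sum_(k < l) w (n + k)%N x)%:C%C) <= 2 * K * (M * q ^+ n).
  apply: (dom_mem (tail n l)).
    by apply: L0_real; apply: measurable_sum => k; by case: (hw (n + k)%N).
  apply: aeW => x; rewrite nc_real pos ger0_norm ?sumr_ge0 //.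
  by apply: ler_sum => k _; exact: ler_norm.
have XS n : X (S n).
  by have [h _] := tl 0%N n; exact: h.
have nS n l : fs_norm X (S (n + l)%N - S n) <= 2 * K * (M * q ^+ n).
  by rewrite SE addrAC subrr add0r; case: (tl n l).
have q1 : `|q| < 1.
  rewrite gtr0_norm //; apply: (@le_lt_trans _ _ (2^-1)); last by lra.
  have : q * (2 * 1) <= q * (2 * K) by rewrite ler_pM2l // ler_pM2l.
  by rewrite [q * (2 * K)]mulrC; move: Kq; lra.
have cv0 (c : R) : (c * q ^+ n) @[n --> \oo] --> (0 : R).
  rewrite -[X in _ --> X](mulr0 c); apply: cvgMr; exact: cvg_expr.
have [f Xf Sf] : exists2 f, X f & qn_cvg X S f.
  case: hX => [[[_ h] _ _] _ _]; apply: h => // e e0.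
  have [N hN] := (cvg0_seqP _).1 (cv0 (2 * K * M)) _ e0.
  exists N; suff H k l : (N <= k)%N -> (k <= l)%N -> fs_norm X (S l - S k) < e.
    move=> k l Nk Nl; have [kl|/ltnW lk] := leqP k l; last exact: H.
    by rewrite fs_normBC //; exact: H.
  move=> Nk kl; rewrite -(subnKC kl) (le_lt_trans (nS _ _)) // mulrA.
  exact: le_lt_trans (ler_norm _) (hN k Nk).
(* The quasi-norm need not be continuous, so the norm of f is estimated through f = S N + (f - S N);
   this turns 2 K M into 2 K^2 M. *)
exists (fun x => nc (f x)).
  apply: dom_fs => //; apply/ler_addgt0Pr => e e0.
  have e'0 : 0 < e / K by rewrite divr_gt0 // (lt_le_trans _ K1).
  have [N hN] := (cvg0_seqP _).1 Sf _ e'0.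
  have := hN N (leqnn N); rewrite ger0_norm; last exact/fs_norm_ge0/fs_memB.
  move=> hNN.
  rewrite (_ : f = S N + (f - S N)); last by rewrite addrC subrK.
  apply: (le_trans (fs_normD _ _)) => //; first exact: fs_memB.
  rewrite mulrDr lerD //.
    rewrite (_ : 2 * K ^+ 2 * M = K * (2 * K * M)); last by ring.
    rewrite ler_wpM2l //.
    have := nS 0%N N; rewrite add0n expr0 mulr1 (_ : S 0%N = 0) ?subr0 //.
    by apply/funext => x; rewrite /S big_ord0.
  by rewrite fs_normBC // -ler_pdivlMl ?(lt_le_trans _ K1) // mulrC ltW.
have key n : \forall x \ae m, \sum_(k < n) w k x <= nc (f x).
  (* The excess of the partial sum over |f| is dominated by S l - f for every l >= n, hence has norm
     0. *)
  pose v x := Num.max 0 (\sum_(k < n) w k x - nc (f x)).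
  have mv : measurable_fun setT v.
    apply: (measurable_maxr (f := cst 0)); first exact: measurable_cst.
    apply: measurable_funB.
      by apply: measurable_sum => k; case: (hw k).
    exact/measurable_nc/fs_mem_L0.
  have hv l : (n <= l)%N -> X (fun x => (v x)%:C%C) /\
      fs_norm X (fun x => (v x)%:C%C) <= fs_norm X (S l - f).
    move=> nl; apply: fs_lattice; [exact: fs_memB|exact: L0_real|].
    apply: aeW => x; rewrite nc_real /v ger0_norm ?le_max ?lexx //.
    rewrite ge_max nc_ge0 /=; apply: le_trans (ler_ncB _ _); rewrite lerD2r.
    rewrite -(subnKC nl) SE.
    rewrite [(_ + _) x](_ : _ = (\sum_(k < n) w k x + \sum_(k < l - n) w (n + k)%N x)%:C%C).
      rewrite nc_real ger0_norm ?lerDl ?addr_ge0 ?sumr_ge0 // => k _.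
      - by case: (hw (n + k)%N).
      - by case: (hw k).
      - by case: (hw (n + k)%N).
    by rewrite rmorphD.
  have [Xv _] := hv n (leqnn n).
  have nv : fs_norm X (fun x => (v x)%:C%C) = 0.
    apply/eqP; rewrite eq_le (fs_norm_ge0 Xv) andbT.
    apply/ler_addgt0Pr => e e0; rewrite add0r.
    have [N hN] := (cvg0_seqP _).1 Sf _ e0.
    have [_ h] := hv (maxn N n) (leq_maxr _ _); apply: (le_trans h).
    exact: le_trans (ler_norm _) (ltW (hN (maxn N n) (leq_maxl _ _))).
  have := fs_norm_eq0 Xv nv; apply: filterS => x [] /eqP.
  rewrite /v /Num.max; case: ifPn => [/ltW ? /eqP|]; last by rewrite -leNgt subr_le0.
  by move/eqP/eqP => /eqP; rewrite subr_eq0 => /eqP ->.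
have key' := ae_foralln key.
have hww : \forall x \ae m, forall k, `|u k x| <= w k x.
  by apply: ae_foralln => k; case: (hw k).
near=> x => n.
apply: (@le_trans _ _ (\sum_(k < n) w k x)).
  apply: ler_sum => k _; have : forall k, `|u k x| <= w k x by near: x.
  exact.
have : forall n, \sum_(k < n) w k x <= nc (f x) by near: x.
exact.
Unshelve. all: by end_near.
Qed.

(** Decay of norms becomes pointwise decay: [dom_series] applies to 2^k u k, because 4 K q <= 1
    leaves room for the factor 2. *)
Lemma dom_geo (u : nat -> T -> R) (M q : R) : 0 < q -> 4 * K * q <= 1 ->
  0 <= M -> (forall k, dom X (u k) (M * q ^+ k)) ->
  exists2 U : T -> R, dom X U (2 * K ^+ 2 * M) &
    \forall x \ae m, forall k, 2 ^+ k * `|u k x| <= U x.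
Proof.
move=> q0 Kq M0 hu.
have [||k|U hU uU] := @dom_series (fun k x => 2 ^+ k * u k x) M (2 * q) _ _ M0.
- by rewrite mulr_gt0.
- by rewrite (le_trans _ Kq) // (_ : 2 * K * (2 * q) = 4 * K * q) //; ring.
- have := dom_scale (2 ^+ k) (hu k); rewrite ger0_norm ?exprn_ge0 //.
  by move=> /dom_ler; apply; rewrite mulrCA -exprMn.
exists U => //; apply: filterS uU => x uU k.
apply: le_trans (uU k.+1); rewrite big_ord_recr /= normrM.
by rewrite [`|2 ^+ k|]ger0_norm ?exprn_ge0 // lerDr sumr_ge0.
Qed.

End one_space.

Section sum_of_spaces.
Variables (Y0 Y1 : fspace T R) (K : R).
Hypothesis hY0 : qlat Y0 K.
Hypothesis hY1 : qlat Y1 K.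

(** The counterpart of [dom] for the sum of the spaces, kept as two separate dominations so that the
    estimates of each space apply to its own part. *)
Definition domS (u : T -> R) (e : R) : Prop :=
  exists u0 u1, [/\ dom Y0 u0 e, dom Y1 u1 e &
    \forall x \ae m, `|u x| <= `|u0 x| + `|u1 x|].

Lemma sum_space_lb f :
  has_lbound [set r | exists f0 f1, [/\ Y0 f0, Y1 f1, f = f0 + f1 %[ae m] &
       r = fs_norm Y0 f0 + fs_norm Y1 f1]].
Proof.
exists 0 => _ [f0 [f1 [Y0f0 Y1f1 _ ->]]].
by rewrite addr_ge0 // (fs_norm_ge0 hY0, fs_norm_ge0 hY1).
Qed.

(** f is split in the proportions w0 / (w0 + w1) and w1 / (w0 + w1). Where the denominator vanishes,
    so does f, and the convention 1 / 0 = 0 gives the right value. *)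
Lemma sum_space_mem f u0 u1 r0 r1 : @L0 d T R f -> dom Y0 u0 r0 -> dom Y1 u1 r1 ->
  (\forall x \ae m, nc (f x) <= `|u0 x| + `|u1 x|) ->
  sum_space m Y0 Y1 f /\ fs_norm (sum_space m Y0 Y1) f <= r0 + r1.
Proof.
move=> Lf /dom_rep-/(_ _ hY0)[w0 [w00 mw0 Yw0 w0r uw0]].
move=> /dom_rep-/(_ _ hY1)[w1 [w10 mw1 Yw1 w1r uw1]] fu.
pose p w x : T -> R := fun x => w x / (w0 x + w1 x).
pose g w : T -> R[i] := fun x => (w x / (w0 x + w1 x))%:C%C * f x.
have ms : measurable_fun setT (fun x => (w0 x + w1 x)^-1).
  rewrite (_ : (fun x => _) = (fun x => (w0 x + w1 x) `^ (-1))).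
    by apply: measurable_powRfun; exact: measurable_funD.
  by apply/funext => x; rewrite powR_inv1 ?addr_ge0.
have Lg w : measurable_fun setT w -> @L0 d T R (g w).
  by move=> mw; apply: L0M => //; apply: L0_real; apply: measurable_funM.
have fw : \forall x \ae m, nc (f x) <= w0 x + w1 x.
  near=> x; apply: (@le_trans _ _ (`|u0 x| + `|u1 x|)); first by near: x.
  by apply: lerD; near: x.
have gw w : (forall x, 0 <= w x) -> \forall x \ae m, nc (g w x) <= `|w x|.
  move=> w_ge0; apply: filterS fw => x fx.
  rewrite /g Normc.normcM nc_real normrM (ger0_norm (w_ge0 x)) -mulrA ler_piMr //.
  have := addr_ge0 (w00 x) (w10 x); rewrite le_eqVlt => /orP[/eqP <-|s0].
    by rewrite invr0 normr0 mul0r.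
  have i0 : 0 <= (w0 x + w1 x)^-1 by rewrite invr_ge0 ltW.
  by rewrite (ger0_norm i0) ler_pdivrMl // mulr1.
have [Y0g g0r] := dom_mem hY0 (rep_dom Yw0 w0r) (Lg _ mw0) (gw _ w00).
have [Y1g g1r] := dom_mem hY1 (rep_dom Yw1 w1r) (Lg _ mw1) (gw _ w10).
have fE : f = g w0 + g w1 %[ae m].
  apply: filterS fw => x fx _; rewrite [RHS](_ : _ = g w0 x + g w1 x) //.
  rewrite /g -mulrDl -rmorphD -mulrDl.
  have := addr_ge0 (w00 x) (w10 x); rewrite le_eqVlt => /orP[/eqP s0|s0].
    move: fx; rewrite -s0 => fx.
    have /eqP : nc (f x) = 0 by apply/eqP; rewrite eq_le fx nc_ge0.
    by rewrite nc_eq0 => /eqP ->; rewrite mulr0.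
  by rewrite divff ?gt_eqF // rmorph1 mul1r.
split; first by split=> //; exists (g w0), (g w1).
apply: (@le_trans _ _ (fs_norm Y0 (g w0) + fs_norm Y1 (g w1))); last exact: lerD.
apply: ge_inf; first exact: sum_space_lb.
by exists (g w0), (g w1).
Unshelve. all: by end_near.
Qed.

Lemma sum_space_dom f e : sum_space m Y0 Y1 f -> fs_norm (sum_space m Y0 Y1) f < e ->
  domS (fun x => nc (f x)) e.
Proof.
move=> [Lf [g0 [g1 [Yg0 Yg1 fg]]]] /inf_lt[|r [f0 [f1 [Y0f0 Y1f1 fE ->]]] re].
  by exists (fs_norm Y0 g0 + fs_norm Y1 g1), g0, g1.
exists (fun x => nc (f0 x)), (fun x => nc (f1 x)); split.
- apply: dom_fs => //; rewrite (le_trans _ (ltW re)) // lerDl; exact: (fs_norm_ge0 hY1).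
- apply: dom_fs => //; rewrite (le_trans _ (ltW re)) // lerDr; exact: (fs_norm_ge0 hY0).
apply: filterS fE => x /(_ I) ->.
by rewrite !ger0_norm ?nc_ge0 // ler_ncD.
Qed.

Lemma domS_le (u v : T -> R) r r' : domS v r -> r <= r' ->
  (\forall x \ae m, `|u x| <= `|v x|) -> domS u r'.
Proof.
move=> [v0 [v1 [h0 h1 hv]]] rr' uv; exists v0, v1; split.
- exact: dom_ler h0 rr'.
- exact: dom_ler h1 rr'.
by near=> x; apply: (@le_trans _ _ `|v x|); near: x.
Unshelve. all: by end_near.
Qed.

Lemma domS_add (u v : T -> R) r s : domS u r -> domS v s ->
  domS (fun x => `|u x| + `|v x|) (K * (r + s)).
Proof.
move=> [u0 [u1 [hu0 hu1 hu]]] [v0 [v1 [hv0 hv1 hv]]].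
exists (fun x => `|u0 x| + `|v0 x|), (fun x => `|u1 x| + `|v1 x|); split.
- exact: (dom_add hY0).
- exact: (dom_add hY1).
near=> x; rewrite !normr_normD addrACA.
by apply: lerD; near: x.
Unshelve. all: by end_near.
Qed.

Lemma domS_scale (u : T -> R) r (c : R) : domS u r -> domS (fun x => c * u x) (`|c| * r).
Proof.
move=> [u0 [u1 [h0 h1 hu]]]; exists (fun x => c * u0 x), (fun x => c * u1 x); split.
- exact: (dom_scale hY0).
- exact: (dom_scale hY1).
by apply: filterS hu => x ux; rewrite !normrM -mulrDr ler_wpM2l.
Qed.

Lemma domS_l (u : T -> R) r : dom Y0 u r -> domS u r.
Proof.
move=> h; exists u, (fun=> 0); split => //.
- apply: (dom0 hY1); exact: (dom_ge0 hY0 h).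
- by apply: aeW => x; rewrite normr0 addr0.
Qed.

(** The decomposition changes with e. Taking the levels q^k, [dom_geo] bounds both parts pointwise,
    and 2^k |u| <= U0 + U1 for all k forces u = 0. *)
Lemma domS_eq0 (u : T -> R) : (forall e, 0 < e -> domS u e) -> \forall x \ae m, u x = 0.
Proof.
move=> hu.
have K1 : 1 <= K by case: hY0.
have K0 : 0 < K by exact: lt_le_trans K1.
pose q := (4 * K)^-1.
have q0 : 0 < q by rewrite invr_gt0 mulr_gt0.
have /choice[v0 /choice[v1 hv]] k : exists v0 v1, [/\ dom Y0 v0 (1 * q ^+ k),
    dom Y1 v1 (1 * q ^+ k) & \forall x \ae m, `|u x| <= `|v0 x| + `|v1 x|].
  by apply: hu; rewrite mul1r exprn_gt0.
have Kq : 4 * K * q <= 1 by rewrite divff // mulf_neq0 // gt_eqF.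
have [|U0 _ h0] := dom_geo hY0 q0 Kq ler01 (u := v0); first by move=> k; case: (hv k).
have [|U1 _ h1] := dom_geo hY1 q0 Kq ler01 (u := v1); first by move=> k; case: (hv k).
have h : \forall x \ae m, forall k, `|u x| <= `|v0 k x| + `|v1 k x|.
  by apply: ae_foralln => k; case: (hv k).
near=> x.
have A k : 2 ^+ k * `|u x| <= U0 x + U1 x.
  apply: (@le_trans _ _ (2 ^+ k * `|v0 k x| + 2 ^+ k * `|v1 k x|)).
    rewrite -mulrDr ler_wpM2l ?exprn_ge0 //.
    have : forall k, `|u x| <= `|v0 k x| + `|v1 k x| by near: x.
    exact.
  apply: lerD; last first.
    have : forall k, 2 ^+ k * `|v1 k x| <= U1 x by near: x.
    exact.
  have : forall k, 2 ^+ k * `|v0 k x| <= U0 x by near: x.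
  exact.
apply/eqP; rewrite -normr_eq0; apply/negPn/negP => ux.
have u0 : 0 < `|u x| by rewrite lt_neqAle eq_sym ux /=.
have := A (Num.Def.truncn ((U0 x + U1 x) / `|u x|)).+1.
rewrite leNgt => /negP; apply.
rewrite -ltr_pdivrMr // (lt_le_trans (truncnS_gt _)) //.
by rewrite -natrX ler_nat ltnW // ltn_expl.
Unshelve. all: by end_near.
Qed.

End sum_of_spaces.
End domination.

(** * Order continuity and Calderon products *)

Section cutting.
Context d (T : measurableType d) (R : realType).
Variable m : {measure set T -> \bar R}.
Implicit Types (X : fspace T R) (f g : T -> R[i]) (u v w : T -> R) (E : set T).

Definition cut E u : T -> R := fun x => if x \in E then u x else 0.

Lemma cutT E u x : E x -> cut E u x = u x.
Proof. by move=> Ex; rewrite /cut mem_set. Qed.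

Lemma cutF E u x : ~ E x -> cut E u x = 0.
Proof. by move=> Ex; rewrite /cut memNset. Qed.

Lemma cut_le E u x : `|cut E u x| <= `|u x|.
Proof. by rewrite /cut; case: ifP => // _; rewrite normr0. Qed.

Lemma cut_ge0 E u x : (forall x, 0 <= u x) -> 0 <= cut E u x.
Proof. by move=> u0; rewrite /cut; case: ifP. Qed.

Lemma measurable_cut E u : measurable E -> measurable_fun setT u ->
  measurable_fun setT (cut E u).
Proof.
move=> mE mu; apply: measurable_fun_ifT => //; first exact: measurable_mem.
Qed.

Lemma dom_cut X u r E : dom m X u r -> dom m X (cut E u) r.
Proof. by move=> h; apply: (dom_le h) => //; apply: aeW => x; exact: cut_le. Qed.

Lemma dom_cutS X u r E F : E `<=` F -> dom m X (cut F u) r -> dom m X (cut E u) r.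
Proof.
move=> EF h; apply: (dom_le h) => //; apply: aeW => x.
have [Ex|Ex] := pselect (E x); first by rewrite !cutT //; exact: EF.
by rewrite cutF // normr0.
Qed.

(** Only restrictions of a fixed element to sets that decrease to a null set are tested; this is the
    form that the splitting arguments use. *)
Definition order_cont X : Prop :=
  forall f, X f -> forall E : nat -> set T, (forall n, measurable (E n)) ->
  (forall n, E n.+1 `<=` E n) -> (\forall x \ae m, exists n, ~ E n x) ->
  forall e, 0 < e -> exists n, dom m X (cut (E n) (fun x => nc (f x))) e.

Lemma decr_sub (E : nat -> set T) : (forall n, E n.+1 `<=` E n) ->
  forall k n, (k <= n)%N -> E n `<=` E k.
Proof.
move=> hE k n /subnKC <-; elim: (n - k)%N => [|j IH]; first by rewrite addn0.
by rewrite addnS => x /hE /IH.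
Qed.

Lemma incr_seq (n_ : nat -> nat) : (forall i, (n_ i < n_ i.+1)%N) ->
  forall i j, (i <= j)%N -> (n_ i <= n_ j)%N.
Proof.
move=> h i j /subnKC <-; elim: (j - i)%N => [|k IH]; first by rewrite addn0.
by rewrite addnS (leq_trans IH) // ltnW.
Qed.

Lemma incr_seq_ge (n_ : nat -> nat) : (forall i, (n_ i < n_ i.+1)%N) ->
  forall i, (i <= n_ i)%N.
Proof. by move=> h; elim => // i IH; exact: leq_ltn_trans IH (h i). Qed.

Lemma decr_jump (E : nat -> set T) (n_ : nat -> nat) x :
  (forall n, E n.+1 `<=` E n) -> (forall i, (n_ i < n_ i.+1)%N) ->
  E (n_ 0%N) x -> (exists n, ~ E n x) -> exists j, E (n_ j) x /\ ~ E (n_ j.+1) x.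
Proof.
move=> hE hn E0 [n En].
have ex : exists j, x \notin E (n_ j).
  by exists n; apply/negP => /set_mem /(decr_sub hE (incr_seq_ge hn n)).
case: (ex_minnP ex) => -[|j] jP jmin; first by move: jP; rewrite mem_set.
exists j; split; last by move=> /mem_set Ej; rewrite Ej in jP.
by apply/set_mem/negPn/negP => /jmin; rewrite ltnn.
Qed.

Variables (X : fspace T R) (K : R).
Hypothesis hX : qlat m X K.
Let K1 : 1 <= K. Proof. by case: hX. Qed.
Let K0 : 0 < K. Proof. exact: lt_le_trans K1. Qed.

Lemma order_cont_dom u r (E : nat -> set T) : order_cont X -> dom m X u r ->
  (forall n, measurable (E n)) ->
  (forall n, E n.+1 `<=` E n) -> (\forall x \ae m, exists n, ~ E n x) ->
  forall e, 0 < e -> exists n, dom m X (cut (E n) u) e.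
Proof.
move=> oX [f [Xf _ uf]] mE hE h0 e e0.
have [n hn] := oX f Xf E mE hE h0 e e0; exists n; apply: (dom_le hn) => //.
apply: filterS uf => x ux; rewrite /cut; case: ifP => _ //.
by rewrite (ger0_norm (nc_ge0 _)).
Qed.

(* If the tails do not tend to [0] they are not Cauchy, which yields
   disjoint pieces of norm bounded below. *)
Lemma not_order_cont : ~ order_cont X ->
  exists (u : T -> R) (D : nat -> set T) (e : R), [/\ 0 < e,
    forall n, measurable (D n), forall j k, (j < k)%N -> D j `&` D k = set0,
    X (fun x => (u x)%:C%C) &
    (forall x, 0 <= u x) /\ measurable_fun setT u /\
    forall n, ~ dom m X (cut (D n) u) e].
Proof.
move=> /existsNP[f /not_implyP[Xf /existsNP[E /not_implyP[mE]]]].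
move=> /not_implyP[hE /not_implyP[h0 /existsNP[e /not_implyP[e0 nE]]]].
pose u x := nc (f x).
have [w [w0 mw Xw _ uw]] := dom_rep hX (dom_fs m Xf (lexx _)).
have nEw n : ~ dom m X (cut (E n) w) e.
  move=> h; apply: nE; exists n; apply: (dom_le h) => //.
  apply: filterS uw => x ux; rewrite /cut; case: ifP => _ //.
  by rewrite (ger0_norm (w0 x)).
(* Either pieces of norm more than some [de] start beyond every n, or at each level all pieces from
   some index on are small. In the second case telescoping with [dom_series] makes a whole tail of
   norm at most e, a contradiction. *)
have [[de [de0 hd]]|H] := pselect (exists de : R, 0 < de /\
    forall n, exists k, (n < k)%N /\ ~ dom m X (cut (E n `\` E k) w) de); last first.
  exfalso; pose q := (2 * K)^-1.
  have q0 : 0 < q by rewrite invr_gt0 mulr_gt0.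
  have Kq : 2 * K * q <= 1 by rewrite divff // mulf_neq0 // gt_eqF.
  pose c := e / (2 * K ^+ 2).
  have c0 : 0 < c by rewrite divr_gt0 // mulr_gt0 // exprn_gt0.
  have /choice[N hN] i : exists n, forall k, (n < k)%N ->
      dom m X (cut (E n `\` E k) w) (c * q ^+ i).
    apply: contrapT => hi; apply: H; exists (c * q ^+ i); split.
      by rewrite mulr_gt0 // exprn_gt0.
    move=> n; apply: contrapT => hk; apply: hi; exists n => k nk.
    by apply: contrapT => hh; apply: hk; exists k.
  pose n_ i := (\sum_(j < i.+1) (N j).+1)%N.
  have n_lt i : (n_ i < n_ i.+1)%N.
    by rewrite /n_ [X in (_ < X)%N]big_ord_recr /= addnS ltnS leq_addr.
  have Nn i : (N i <= n_ i)%N.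
    by rewrite /n_ big_ord_recr /= addnS ltnW // ltnS leq_addl.
  have hD k : dom m X (cut (E (n_ k) `\` E (n_ k.+1)) w) (c * q ^+ k).
    apply: (@dom_cutS _ _ _ _ (E (N k) `\` E (n_ k.+1))).
      by move=> x [Ex nEx]; split => //; exact: (decr_sub hE (Nn k)).
    by apply: hN; exact: leq_ltn_trans (Nn k) (n_lt k).
  have [U hU uU] := dom_series hX q0 Kq (ltW c0) hD.
  apply: (nEw (n_ 0%N)); apply: (dom_le hU).
    by rewrite mulrC divfK // gt_eqF // mulr_gt0 // exprn_gt0.
  near=> x.
  have Ux : forall n, \sum_(k < n) `|cut (E (n_ k) `\` E (n_ k.+1)) w x| <= U x by near: x.
  have [Ex|Ex] := pselect (E (n_ 0%N) x); last by rewrite cutF // normr0.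
  rewrite cutT // (le_trans _ (ler_norm (U x))) //.
  have [|j [Ej Ejn]] := decr_jump hE n_lt Ex; first by near: x.
  apply: le_trans (Ux j.+1); rewrite big_ord_recr /= cutT //.
  by rewrite lerDr sumr_ge0.
have /choice[kk hk] := hd.
pose n_ i := iter i kk 0%N.
have n_lt i : (n_ i < n_ i.+1)%N by rewrite /n_ iterS; case: (hk (iter i kk 0%N)).
exists w, (fun i => E (n_ i) `\` E (n_ i.+1)), de; split => //.
- by move=> n; apply: measurableD.
- move=> j k jk; apply/seteqP; split => // x [[Ejx nEjx] [Ekx _]]; apply: nEjx.
  exact: (decr_sub hE (incr_seq n_lt jk)).
by split=> //; split => // n; case: (hk (n_ n)).
Unshelve. all: by end_near.
Qed.

(* Diagonal argument: the union of the pieces D_k on which the k-th element of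
   a dense sequence is small stays away from the whole sequence. *)
Lemma separable_order_cont : qn_separable X -> order_cont X.
Proof.
move=> [DD /pcard_injP[g ginj] [DX Ddense]]; apply: contrapT.
move=> /not_order_cont[u [D [e [e0 mD trD Xu [u0 [mu hu]]]]]].
pose ds k := xget (0 : T -> R[i]) [set f | DD f /\ g f = k].
have dsg f : DD f -> ds (g f) = f.
  move=> Df; rewrite /ds; case: xgetP => [h -> [Dh gh]|/(_ f)]; last by case.
  by apply: ginj; rewrite ?inE.
pose c := e / (2 * K).
have c0 : 0 < c by rewrite divr_gt0 // mulr_gt0.
pose S := [set k | dom m X (cut (D k) (fun x => nc (ds k x))) c].
pose G := \bigcup_(k in S) D k.
have mG : measurable G by apply: bigcup_measurable.
have Xh : X (fun x => (cut G u x)%:C%C).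
  have [] // := fs_lattice hX Xu (L0_real (measurable_cut mG mu)).
  by apply: aeW => x; rewrite !nc_real cut_le.
have [f Df hf] := Ddense _ Xh c c0.
pose k := g f; have dk : ds k = f by exact: dsg.
have hdom : dom m X (fun x => nc ((cut G u x)%:C%C - f x)) c.
  by have := dom_fs m (fs_memB hX Xh (DX _ Df)) (ltW hf).
(* On D k, the function [cut G u] is u if k is in S and 0 otherwise. In the first case f is small
   there and u is not, in the second f is not small there; either way f is too far from
   [cut G u]. *)
have [Sk|nSk] := pselect (S k).
  apply: (hu k); have := dom_add hX (dom_cut (D k) hdom) Sk.
  move=> /dom_le; apply.
    by rewrite -mulr2n mulrnAr -mulr_natl mulrA mulrC divfK // gt_eqF // mulr_gt0.
  apply: aeW => x; have [Dx|nDx] := pselect (D k x); last by rewrite cutF // normr0.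
  rewrite !cutT //; last by exists k.
  rewrite dk !normr_normD !(ger0_norm (nc_ge0 _)) (ger0_norm (u0 x)).
  rewrite -[leLHS](ger0_norm (u0 x)) -nc_real.
  by apply: le_trans (ler_ncD _ _); rewrite subrK.
apply: (nSk); rewrite /S /= dk; apply: (dom_le hdom) => //.
apply: aeW => x; have [Dx|nDx] := pselect (D k x); last by rewrite cutF // normr0.
rewrite cutT // cutF; last first.
  move=> [j Sj Dj]; have [jk|jk|jk] := ltngtP j k.
  - by have := trD _ _ jk; rewrite -subset0 => /(_ x); apply.
  - by have := trD _ _ jk; rewrite -subset0 => /(_ x); apply.
  - by apply: nSk; rewrite -jk.
by rewrite sub0r ncN.
Qed.

End cutting.

Section calderon.
Context d (T : measurableType d) (R : realType).
Variable m : {measure set T -> \bar R}.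
Implicit Types (X : fspace T R) (f g : T -> R[i]) (u v w : T -> R) (E : set T).

(* Membership in the ball of radius r of the Calderon product Y0^(1-th) Y1^th. *)
Definition calderon (Y0 Y1 : fspace T R) (th : R) u r : Prop :=
  exists a b, [/\ dom m Y0 a r, dom m Y1 b r &
    \forall x \ae m, `|u x| <= `|a x| `^ (1 - th) * `|b x| `^ th].

Variables (Y0 Y1 : fspace T R) (K : R).
Hypothesis hY0 : qlat m Y0 K.
Hypothesis hY1 : qlat m Y1 K.
Let K1 : 1 <= K. Proof. by case: hY0. Qed.
Let K0 : 0 < K. Proof. exact: lt_le_trans K1. Qed.

(** The sums of the |a i| and of the |b i| dominate each of their terms, so one pair of factors
    serves every point, whichever i it needs. *)
Lemma calderon_glue th u (a b : nat -> T -> R) M q : 0 <= th <= 1 -> 0 < q ->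
  2 * K * q <= 1 -> 0 <= M ->
  (forall i, dom m Y0 (a i) (M * q ^+ i)) -> (forall i, dom m Y1 (b i) (M * q ^+ i)) ->
  (\forall x \ae m, exists i, `|u x| <= `|a i x| `^ (1 - th) * `|b i x| `^ th) ->
  calderon Y0 Y1 th u (2 * K ^+ 2 * M).
Proof.
move=> /andP[th0 th1] q0 Kq M0 ha hb hu.
have [A hA aA] := dom_series hY0 q0 Kq M0 ha.
have [B hB bB] := dom_series hY1 q0 Kq M0 hb.
exists A, B; split => //; near=> x.
have [i /le_trans] : exists i, `|u x| <= `|a i x| `^ (1 - th) * `|b i x| `^ th by near: x.
apply.
have le_last (c : nat -> T -> R) (C : T -> R) :
    (forall n, \sum_(k < n) `|c k x| <= C x) -> `|c i x| <= `|C x|.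
  move=> h; rewrite (le_trans _ (ler_norm _)) // (le_trans _ (h i.+1)) //.
  by rewrite big_ord_recr /= lerDr sumr_ge0.
apply: ler_pM; rewrite ?powR_ge0 //; apply: ge0_ler_powR; rewrite ?nnegrE ?subr_ge0 //.
  by apply: le_last; near: x.
by apply: le_last; near: x.
Unshelve. all: by end_near.
Qed.

(** The glued function is a pointwise limit of finite sums of cut-offs, which are eventually
    constant at each point. *)
Lemma measurable_glue (D : nat -> set T) (v : nat -> T -> R) :
  (forall n, measurable (D n)) -> (forall j k, (j < k)%N -> D j `&` D k = set0) ->
  (forall n, measurable_fun setT (v n)) ->
  exists w : T -> R, [/\ measurable_fun setT w,
    forall i x, D i x -> w x = v i x & forall x, (forall i, ~ D i x) -> w x = 0].
Proof.
move=> mD trD mv.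
have tr x i j : D i x -> D j x -> i = j.
  move=> Di Dj; have [ij|ij|//] := ltngtP i j.
  - by have := trD _ _ ij; rewrite -subset0 => /(_ x); case.
  - by have := trD _ _ ij; rewrite -subset0 => /(_ x); case.
have /choice[w hw] (x : T) : exists y : R, (forall i, D i x -> y = v i x) /\
    ((forall i, ~ D i x) -> y = 0).
  have [[i Di]|H] := pselect (exists i, D i x).
    exists (v i x); split => [j Dj|/(_ i)//]; by rewrite (tr _ _ _ Di Dj).
  by exists 0; split => // i Di; case: H; exists i.
exists w; split => [|i x Di|x Dx]; last by case: (hw x) => _ ->.
  apply: (measurable_fun_cvg (h := fun n x => \sum_(k < n) cut (D k) (v k) x)).
    by move=> n; apply: measurable_sum => k; apply: measurable_cut.
  move=> x _; have [[i Di]|H] := pselect (exists i, D i x).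
    rewrite ((hw x).1 _ Di).
    apply: cvg_near_cst; exists i.+1 => // n /= ni.
    rewrite (bigD1 (Ordinal ni)) //= cutT // big1 ?addr0 // => j /eqP ji.
    rewrite cutF // => Dj; apply: ji; apply/val_inj; exact: (tr _ _ _ Dj Di).
  have [_ ->] := hw x; last by move=> i Di; apply: H; exists i.
  apply: cvg_near_cst; exists 0%N => // n _.
  by rewrite big1 // => j _; rewrite cutF // => Dj; apply: H; exists (nat_of_ord j).
exact: (hw x).1.
Qed.

(* Order continuity of Y0 makes the norms of the pieces of the first factor
   decay; rescaling by c_i^(-th), c_i^(1-th) shares the decay between
   both factors. *)
Lemma calderon_split_l (th : R) (u : T -> R) (r q : R) : 0 < th < 1 -> 0 < q < 1 -> 0 < r ->
  order_cont m Y0 -> calderon Y0 Y1 th u r ->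
  exists (g0 g1 : T -> R) (D : nat -> set T) (L : nat -> R),
  [/\ [/\ measurable_fun setT g0, measurable_fun setT g1, forall x, 0 <= g0 x
        & forall x, 0 <= g1 x],
      (forall n, measurable (D n)) /\ (forall j k, (j < k)%N -> D j `&` D k = set0),
      (forall i x, D i x -> [/\ 0 < g0 x, 0 < g1 x, g0 x <= L i * g1 x & g1 x <= L i * g0 x])
        /\ (forall x, (forall i, ~ D i x) -> g0 x = 0 /\ g1 x = 0),
      forall i, dom m Y0 (cut (D i) g0) (r * q ^+ i) /\ dom m Y1 (cut (D i) g1) (r * q ^+ i)
    & \forall x \ae m, `|u x| <= g0 x `^ (1 - th) * g1 x `^ th].
Proof.
move=> /andP[th0 th1] /andP[q0 q1] r0 oc [a [b [ha hb hu]]].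
have [f0 [f00 mf0 Yf0 f0r af0]] := dom_rep hY0 ha.
have [f1 [f10 mf1 Yf1 f1r bf1]] := dom_rep hY1 hb.
(* The sets E N increase to the set P where both factors are positive, so order continuity applies
   to f0 on P minus E N, and on each E N the two factors are comparable. *)
pose E N := [set x | [&& 0 < f0 x, 0 < f1 x, f0 x <= 2 ^+ N * f1 x & f1 x <= 2 ^+ N * f0 x]].
pose P := [set x | (0 < f0 x) && (0 < f1 x)].
have mE N : measurable (E N).
  have mb : measurable_fun setT (fun x => [&& 0 < f0 x, 0 < f1 x, f0 x <= 2 ^+ N * f1 x & f1 x <= 2 ^+ N * f0 x]).
    apply: measurable_and; first exact: measurable_fun_ltr.
    apply: measurable_and; first exact: measurable_fun_ltr.
    apply: measurable_and; apply: measurable_fun_ler => //; exact: measurable_funM.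
  rewrite (_ : E N = setT `&` (fun x => [&& 0 < f0 x, 0 < f1 x, f0 x <= 2 ^+ N * f1 x & f1 x <= 2 ^+ N * f0 x]) @^-1` [set true]).
    exact: mb.
  by rewrite setTI.
have mP : measurable P.
  have mb : measurable_fun setT (fun x => (0 < f0 x) && (0 < f1 x)).
    by apply: measurable_and; exact: measurable_fun_ltr.
  rewrite (_ : P = setT `&` (fun x => (0 < f0 x) && (0 < f1 x)) @^-1` [set true]).
    exact: mb.
  by rewrite setTI.
have incrE N : E N `<=` E N.+1.
  move=> x /= /and4P[p0 p1 h0 h1]; apply/and4P; split => //.
    by rewrite (le_trans h0) // ler_pM2r // ler_eXn2l // ltr1n.
  by rewrite (le_trans h1) // ler_pM2r // ler_eXn2l // ltr1n.
have coverE x : P x -> exists N, E N x.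
  move=> /= /andP[p0 p1].
  pose N := Num.Def.truncn (f0 x / f1 x + f1 x / f0 x).
  have hN : f0 x / f1 x + f1 x / f0 x <= 2 ^+ N.+1.
    rewrite (le_trans (ltW (truncnS_gt _))) // -natrX ler_nat ltnW //.
    exact: ltn_expl.
  exists N.+1 => /=; apply/and4P; split => //.
    rewrite -ler_pdivrMr // (le_trans _ hN) // lerDl divr_ge0 //.
  by rewrite -ler_pdivrMr // (le_trans _ hN) // lerDr divr_ge0.
(* With c = (q^(i+1))^(1/(1-th)), the rescaling multiplies the second factor by c^(1-th) = q^(i+1)
   and the first by c^(-th); the factor c^th in [tol] pays for the latter. The index is shifted
   because the piece D (i+1) lies outside E (n_ i). *)
pose tol i := q ^+ i.+1 * ((q ^+ i.+1) `^ ((1 - th)^-1)) `^ th.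
have tol0 i : 0 < tol i by rewrite mulr_gt0 ?powR_gt0 // ?powR_gt0 // exprn_gt0.
have /choice[N hN] i : exists n, dom m Y0 (cut (P `\` E n) f0) (r * tol i).
  have [|n x [Px nE]|||n hn] := order_cont_dom oc (rep_dom m Yf0 f0r)
    (E := fun n => P `\` E n) _ _ _ (e := r * tol i).
  - by move=> n; apply: measurableD.
  - by split => //; apply: contra_not nE => /incrE.
  - apply: aeW => x; have [Px|nPx] := pselect (P x); last by exists 0%N => -[].
    by have [n En] := coverE x Px; exists n => -[].
  - by rewrite mulr_gt0.
  by exists n.
pose n_ i := (\sum_(j < i.+1) (N j).+1)%N.
have n_lt i : (n_ i < n_ i.+1)%N.
  by rewrite /n_ [X in (_ < X)%N]big_ord_recr /= addnS ltnS leq_addr.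
have Nn i : (N i <= n_ i)%N.
  by rewrite /n_ big_ord_recr /= addnS ltnW // ltnS leq_addl.
have subE k n : (k <= n)%N -> E k `<=` E n.
  move=> /subnKC <-; elim: (n - k)%N => [|j IH]; first by rewrite addn0.
  by rewrite addnS => x /IH /incrE.
pose D i := if i is j.+1 then E (n_ j.+1) `\` E (n_ j) else E (n_ 0%N).
have DE i : D i `<=` E (n_ i) by case: i => [|i] x //; case.
have mD i : measurable (D i) by case: i => [|i] //=; apply: measurableD.
have trD j k : (j < k)%N -> D j `&` D k = set0.
  move=> jk; apply/seteqP; split => // x [/DE Ej]; case: k jk => // k; rewrite ltnS => jk [_]; apply.
  exact: (subE _ _ (incr_seq n_lt jk)).
pose c i : R := if i is j.+1 then (q ^+ j.+1) `^ ((1 - th)^-1) else 1.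
have c0 i : 0 < c i by case: i => [|i] //=; rewrite powR_gt0 // exprn_gt0.
have [w [mw wD w0]] := @measurable_glue D (fun i => cst (c i)) mD trD
   (fun i => measurable_cst _).
pose W := \bigcup_i D i.
have mW : measurable W by exact: bigcup_measurable.
pose g0 := cut W (fun x => w x `^ (- th) * f0 x).
pose g1 := cut W (fun x => w x `^ (1 - th) * f1 x).
have inW i x : D i x -> W x by move=> Dx; exists i.
have g0D i x : D i x -> g0 x = c i `^ (- th) * f0 x.
  by move=> Dx; rewrite /g0 cutT ?(wD i) //; exact: inW Dx.
have g1D i x : D i x -> g1 x = c i `^ (1 - th) * f1 x.
  by move=> Dx; rewrite /g1 cutT ?(wD i) //; exact: inW Dx.
have g00 x : 0 <= g0 x by apply: cut_ge0 => y; rewrite mulr_ge0 // powR_ge0.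
have g10 x : 0 <= g1 x by apply: cut_ge0 => y; rewrite mulr_ge0 // powR_ge0.
have DP i x : D i x -> 0 < f0 x /\ 0 < f1 x by move=> /DE /= /and4P[].
exists g0, g1, D, (fun i => 2 ^+ n_ i * (c i + (c i)^-1)); split.
- split => //; apply: measurable_cut => //; apply: measurable_funM => //;
    exact: measurable_powRfun.
- by [].
- split => [i x Dx|x nD]; last first.
    have nW : ~ W x by move=> [i _ Di]; exact: (nD i).
    by rewrite /g0 /g1 !cutF.
  rewrite (g0D _ _ Dx) (g1D _ _ Dx); have [p0 p1] := DP _ _ Dx.
  have /and4P[_ _ h0 h1] := DE _ _ Dx.
  have cE : c i `^ (1 - th) = c i * c i `^ (- th).
    rewrite powRD; last by rewrite (gt_eqF (c0 i)) implybT.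
    by rewrite powRr1 // ltW.
  have ct : 0 < c i `^ (- th) by rewrite powR_gt0.
  split; rewrite ?mulr_gt0 ?powR_gt0 // cE.
    rewrite (_ : _ * (_ * f1 x) = (c i `^ (- th)) * (c i * (c i + (c i)^-1) * (2 ^+ n_ i * f1 x))); last by ring.
    rewrite ler_pM2l // (le_trans h0) // ler_peMl ?mulr_ge0 ?exprn_ge0 //.
    by rewrite mulrDr divff ?gt_eqF // lerDr mulr_ge0 // ltW.
  rewrite (_ : _ * (_ * f0 x) = (c i `^ (- th)) * ((c i + (c i)^-1) * (2 ^+ n_ i * f0 x))); last by ring.
  rewrite [c i * _]mulrC -mulrA ler_pM2l //; apply: ler_pM => //; first exact: ltW.
  by rewrite lerDl invr_ge0 ltW.
- move=> i; have hb1 : dom m Y1 f1 r by exact: rep_dom.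
  have ha1 : dom m Y0 f0 r by exact: rep_dom.
  have hcut (v f : T -> R) (cc : R) : (forall x, D i x -> v x = cc * f x) -> cut (D i) v = fun x => cc * cut (D i) f x.
    move=> hv; apply/funext => x; have [Dx|nDx] := pselect (D i x).
      by rewrite !cutT // hv.
    by rewrite !cutF // mulr0.
  rewrite (hcut _ f0 _ (fun x => @g0D i x)) (hcut _ f1 _ (fun x => @g1D i x)).
  case: i g0D g1D hcut => [|i] g0D g1D hcut.
    rewrite !powR1 expr0 mulr1; split.
      by have := dom_scale hY0 1 (dom_cut (D 0%N) ha1); rewrite normr1 mul1r.
    by have := dom_scale hY1 1 (dom_cut (D 0%N) hb1); rewrite normr1 mul1r.
  split.
    have h : dom m Y0 (cut (D i.+1) f0) (r * tol i).
      apply: dom_cutS (hN i) => x [Ex nEx]; split.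
        by move: Ex; rewrite /E /P /= => /and4P[-> ->].
      by apply: contra_not nEx => /(subE _ _ (Nn i)).
    have := dom_scale hY0 (c i.+1 `^ (- th)) h; rewrite ger0_norm ?powR_ge0 //.
    move=> /dom_ler; apply.
    rewrite /tol /c mulrCA ler_pM2l // mulrCA powRN mulVf ?mulr1 //.
    by rewrite gt_eqF // powR_gt0 // powR_gt0 // exprn_gt0.
  have := dom_scale hY1 (c i.+1 `^ (1 - th)) (dom_cut (D i.+1) hb1).
  rewrite ger0_norm ?powR_ge0 // => /dom_ler; apply.
  rewrite /c -powRrM mulVf; last by rewrite gt_eqF // subr_gt0.
  by rewrite powRr1 ?exprn_ge0 ?(ltW q0) // mulrC.
near=> x.
have ux : `|u x| <= f0 x `^ (1 - th) * f1 x `^ th.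
  have /le_trans -> // : `|u x| <= `|a x| `^ (1 - th) * `|b x| `^ th by near: x.
  apply: ler_pM; rewrite ?powR_ge0 //; apply: ge0_ler_powR; rewrite ?nnegrE ?subr_ge0 ?(ltW th0) ?(ltW th1) //.
    by near: x.
  by near: x.
have [Px|nPx] := pselect (P x).
  have [j Dj] : exists j, D j x.
    have [n En] := coverE x Px.
    have ex : exists j, x \in E (n_ j).
      by exists n; apply/mem_set/(subE _ _ (incr_seq_ge n_lt n)).
    case: (ex_minnP ex) => -[|j] /set_mem Ej jmin; first by exists 0%N.
    exists j.+1; split => //; move=> /mem_set /jmin; by rewrite ltnn.
  rewrite (g0D _ _ Dj) (g1D _ _ Dj); apply: (le_trans ux).
  rewrite !powRM ?powR_ge0 // mulrACA -!powRrM -powRD; last first.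
    by rewrite (gt_eqF (c0 j)) implybT.
  by rewrite (_ : - th * (1 - th) + (1 - th) * th = 0) ?powRr0 ?mul1r //; ring.
have fz : f0 x = 0 \/ f1 x = 0.
  have [f0p|f0n] := ltP 0 (f0 x); last by left; apply/eqP; rewrite eq_le f0n f00.
  right; apply/eqP; rewrite eq_le f10 andbT leNgt; apply/negP => f1p.
  by apply: nPx; rewrite /P /= f0p f1p.
apply: (le_trans ux); apply: (@le_trans _ _ 0); last by rewrite mulr_ge0 ?powR_ge0.
case: fz => ->; rewrite powR0 ?mul0r ?mulr0 //.
  by rewrite gt_eqF // subr_gt0.
by rewrite gt_eqF.
Unshelve. all: by end_near.
Qed.

End calderon.

Lemma calderonC d (T : measurableType d) (R : realType) (m : {measure set T -> \bar R})
    (Y0 Y1 : fspace T R) th u r :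
  calderon m Y0 Y1 th u r -> calderon m Y1 Y0 (1 - th) u r.
Proof.
move=> [a [b [ha hb h]]]; exists b, a; split => //.
by apply: filterS h => x; rewrite mulrC subKr.
Qed.

Lemma calderon_split d (T : measurableType d) (R : realType)
    (m : {measure set T -> \bar R}) (Y0 Y1 : fspace T R) (K : R)
    (hY0 : qlat m Y0 K) (hY1 : qlat m Y1 K) (th : R) (u : T -> R) (r q : R) :
  0 < th < 1 -> 0 < q < 1 -> 0 < r ->
  order_cont m Y0 \/ order_cont m Y1 -> calderon m Y0 Y1 th u r ->
  exists (g0 g1 : T -> R) (D : nat -> set T) (L : nat -> R),
  [/\ [/\ measurable_fun setT g0, measurable_fun setT g1, forall x, 0 <= g0 x
        & forall x, 0 <= g1 x],
      (forall n, measurable (D n)) /\ (forall j k, (j < k)%N -> D j `&` D k = set0),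
      (forall i x, D i x -> [/\ 0 < g0 x, 0 < g1 x, g0 x <= L i * g1 x & g1 x <= L i * g0 x])
        /\ (forall x, (forall i, ~ D i x) -> g0 x = 0 /\ g1 x = 0),
      forall i, dom m Y0 (cut (D i) g0) (r * q ^+ i) /\ dom m Y1 (cut (D i) g1) (r * q ^+ i)
    & \forall x \ae m, `|u x| <= g0 x `^ (1 - th) * g1 x `^ th].
Proof.
move=> th01 q01 r0 [oc|oc] hu; first exact: (calderon_split_l hY0 hY1).
have th01' : 0 < 1 - th < 1.
  by move: th01 => /andP[? ?]; rewrite subr_gt0 ltrBlDr ltrDl; apply/andP.
have [g1 [g0 [D [L [[mg1 mg0 g10 g00] mD [hD h0] hdom hle]]]]] :=
  calderon_split_l hY1 hY0 th01' q01 r0 oc (calderonC hu).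
exists g0, g1, D, L; split => //.
- split=> [i x /hD[]//|x /h0[]//].
- by move=> i; case: (hdom i).
- by apply: filterS hle => x; rewrite subKr mulrC.
Qed.

(** * A-convexity and p-means *)

Section circle.
Variable R : realType.
Implicit Types (t s : R) (z w : R[i]).

Definition expi t : R[i] := (cos t +i* sin t)%C.

Lemma expiD t s : expi (t + s) = expi t * expi s.
Proof.
by apply/eqP; rewrite eq_complex /= cosD sinD eqxx /= [cos t * sin s + _]addrC.
Qed.

Lemma expi0 : expi 0 = 1.
Proof. by rewrite /expi cos0 sin0. Qed.

Lemma nc_expi t : nc (expi t) = 1.
Proof. by rewrite /= cos2Dsin2 sqrtr1. Qed.

Lemma expiX t n : expi t ^+ n = expi (n%:R * t).
Proof.
elim: n => [|n IH]; first by rewrite mul0r expi0.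
by rewrite exprS IH -expiD -natr1 mulrDl mul1r addrC.
Qed.

Lemma cos_lip t s : `|cos t - cos s| <= `|t - s|.
Proof.
wlog st : t s / s <= t.
  move=> H; have [|/ltW] := leP s t; first exact: H.
  by move=> /H; rewrite distrC [leRHS]distrC.
have [|c _ ->] := @MVT_segment R cos (fun x => - sin x) s t st.
  by apply: continuous_subspaceT => x; exact: continuous_cos.
by rewrite normrM normrN ler_piMl // sin_max.
Qed.

Lemma sin_lip t s : `|sin t - sin s| <= `|t - s|.
Proof.
wlog st : t s / s <= t.
  move=> H; have [|/ltW] := leP s t; first exact: H.
  by move=> /H; rewrite distrC [leRHS]distrC.
have [|c _ ->] := @MVT_segment R sin (fun x => cos x) s t st.
  by apply: continuous_subspaceT => x; exact: continuous_sin.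
by rewrite normrM ler_piMl // cos_max.
Qed.

Lemma expi_lip t s : nc (expi t - expi s) <= 2 * `|t - s|.
Proof.
apply: (le_trans (nc_leD _)); rewrite mulr_natl mulr2n.
by apply: lerD; [exact: cos_lip|exact: sin_lip].
Qed.

Lemma expi_surj z : nc z = 1 -> exists2 t, 0 <= t < pi *+ 2 & z = expi t.
Proof.
case: z => a b /= h.
have ab : a ^+ 2 + b ^+ 2 = 1.
  rewrite -[LHS]sqr_sqrtr ?addr_ge0 ?sqr_ge0 // h expr1n //.
have a1 : -1 <= a <= 1.
  rewrite -ler_norml -[leRHS]normr1 -ler_sqr ?nnegrE // !real_normK ?num_real//.
  by rewrite expr1n -ab lerDl sqr_ge0.
have b2 : 1 - a ^+ 2 = b ^+ 2 by rewrite -ab addrAC subrr add0r.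
have [b0|b0] := leP 0 b.
  exists (acos a).
    by rewrite acos_ge0 //= (le_lt_trans (acos_lepi a1)) // mulr2n ltrDl pi_gt0.
  by rewrite /expi acosK ?in_itv //= sin_acos // b2 sqrtr_sqr ger0_norm.
exists (pi *+ 2 - acos a).
  rewrite subr_ge0 (le_trans (acos_lepi a1)) ?mulr2n ?lerDl ?pi_ge0 //=.
  rewrite ltrBlDr ltrDl acos_gt0 //; case/andP: a1 => -> /=.
  rewrite le_eqVlt => /orP[/eqP a1|//]; move: b2; rewrite a1 expr1n subrr => /esym/eqP.
  by rewrite sqrf_eq0 => /eqP b00; rewrite b00 ltxx in b0.
rewrite /expi addrC cosD2pi sinD2pi cosN sinN acosK ?in_itv //= sin_acos // b2.
by rewrite sqrtr_sqr ltr0_norm // opprK.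
Qed.

Definition node n j : R[i] := expi (j%:R * (pi *+ 2 / n%:R)).

Lemma nc_node n j : nc (node n j) = 1.
Proof. exact: nc_expi. Qed.

(** The bound is written as a multiple of (2 n)^-1 because this is the value of 1 - r in
    [quantile_bound]. *)
Lemma node_near n z : (0 < n)%N -> nc z = 1 ->
  exists2 j, (j < n)%N & nc (z - node n j) <= 8 * pi * (2 * n%:R)^-1.
Proof.
move=> n0 /expi_surj[t /andP[t0 t2] ->].
have nR : (0 : R) < n%:R by rewrite ltr0n.
have h0 : 0 < pi *+ 2 / n%:R :> R by rewrite divr_gt0 // pmulrn_lgt0 // pi_gt0.
set h := pi *+ 2 / n%:R in h0 *.
exists (Num.Def.truncn (t / h)).
  rewrite -(ltr_nat R) (@le_lt_trans _ _ (t / h)) //.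
    by rewrite truncn_le divr_ge0 // ltW.
  by rewrite ltr_pdivrMr // /h mulrC divfK // gt_eqF.
apply: (le_trans (expi_lip _ _)).
have lo : (Num.Def.truncn (t / h))%:R * h <= t.
  by rewrite -ler_pdivlMr // truncn_le divr_ge0 // ltW.
have hi : t < (Num.Def.truncn (t / h))%:R * h + h.
  by rewrite -[X in _ + X]mul1r -mulrDl natr1 -ltr_pdivrMr // truncnS_gt.
rewrite ger0_norm ?subr_ge0 //.
have -> : 8 * pi * (2 * n%:R)^-1 = 2 * h.
  by rewrite /h -mulr_natl invfM; field; rewrite gt_eqF.
by rewrite ler_pM2l // lerBlDl ltW.
Qed.

(* [bump r N] is a polynomial approximation of r(1-z)/(1-rz), which maps the unit
   disc into itself, is [r] at [0], and is bounded away from [1] in modulus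
   on an arc of length of order [1 - r] around [1]. *)
Definition bump (r : R) N : {poly R[i]} :=
  (r%:C%C *: (1 - 'X)) * \sum_(k < N) (r%:C%C ^+ k *: 'X^k).

Lemma bump0 r N : (0 < N)%N -> (bump r N).[0] = r%:C%C.
Proof.
case: N => // N _; rewrite /bump !hornerE /= horner_sum big_ord_recl /=.
rewrite hornerZ hornerXn !expr0 !mulr1 big1 ?addr0 ?subr0 ?mulr1 // => k _.
by rewrite hornerZ hornerXn /bump /= expr0n /= mulr0.
Qed.

(** Multiplication by 1 - r z sums the geometric series; 1 + r^N is the price of its truncation. *)
Lemma nc_bump r N z : 0 <= r -> nc z = 1 ->
  nc (bump r N).[z] * nc (1 - r%:C%C * z) <= (1 + r ^+ N) * (r * nc (1 - z)).
Proof.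
move=> r0 z1; have -> : nc (bump r N).[z] * nc (1 - r%:C%C * z) =
    r * nc (1 - z) * nc (1 - (r%:C%C * z) ^+ N).
  rewrite /bump hornerM hornerZ !hornerE horner_sum.
  under eq_bigr do rewrite hornerZ hornerXn -exprMn.
  have g (u : R[i]) : (1 - u) * \sum_(k < N) u ^+ k = 1 - u ^+ N.
    by rewrite -[1 - u]opprB mulNr -subrX1 opprB.
  by rewrite 2!Normc.normcM nc_real (ger0_norm r0) -mulrA -Normc.normcM [_ * (1 - _)]mulrC g.
have -> : (1 + r ^+ N) * (r * nc (1 - z)) = r * nc (1 - z) * (1 + r ^+ N) by ring.
rewrite ler_wpM2l ?mulr_ge0 ?nc_ge0 //.
rewrite (le_trans (ler_ncD _ _)) // ncN Normc.normc1 ncX Normc.normcM z1 mulr1.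
by rewrite nc_real ger0_norm.
Qed.

(** For 0 <= r <= 1 this gap is nonnegative, which bounds the bump by about 1, and even at least (1
    - r)^2, which is the gain exploited in [bump_arc]. *)
Lemma sqr_bump_gap r z : nc z = 1 ->
  nc (1 - r%:C%C * z) ^+ 2 - (r * nc (1 - z)) ^+ 2 =
  (1 - r) * (1 + r - 2 * r * complex.Re z).
Proof.
case: z => a b /= h.
have ab : a ^+ 2 + b ^+ 2 = 1 by rewrite -[LHS]sqr_sqrtr ?addr_ge0 ?sqr_ge0 // h expr1n.
rewrite exprMn !sqr_sqrtr ?addr_ge0 ?sqr_ge0 //.
have bE : b ^+ 2 = 1 - a ^+ 2 by rewrite -ab addrAC subrr add0r.
rewrite !mul0r sub0r addr0 subr0 sqrrN exprMn sub0r sqrrN bE; ring.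
Qed.

Lemma bump_le1 r N z : 0 <= r <= 1 -> nc z = 1 -> (0 < nc (1 - r%:C%C * z)) ->
  nc (bump r N).[z] <= 1 + r ^+ N.
Proof.
move=> /andP[r0 r1] z1 p0; rewrite -(ler_pM2r p0) (le_trans (nc_bump N r0 z1)) //.
rewrite ler_wpM2l ?addr_ge0 ?exprn_ge0 //.
rewrite -ler_sqr ?nnegrE ?mulr_ge0 ?nc_ge0 // -subr_ge0 sqr_bump_gap //.
rewrite mulr_ge0 ?subr_ge0 //.
have : complex.Re z <= 1 by rewrite (le_trans (ler_norm _)) // (le_trans (nc_Re z)) ?z1.
nra.
Qed.

(** On the arc, |1 - r z| <= (1 + c)(1 - r), so the gap (1 - r)^2 is at least the fraction (1 +
    c)^-2 of |1 - r z|^2. *)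
Lemma bump_arc (r c : R) N z : 0 <= r < 1 -> 0 <= c -> nc z = 1 ->
  nc (1 - z) <= c * (1 - r) ->
  nc (bump r N).[z] <= (1 + r ^+ N) * Num.sqrt (1 - (1 + c) ^- 2).
Proof.
move=> /andP[r0 r1] c0 z1 hz.
have d0 : 0 < 1 - r by rewrite subr_gt0.
have c1 : 0 < 1 + c by rewrite ltr_wpDr.
set D := nc (1 - r%:C%C * z).
have Dlow : 1 - r <= D.
  rewrite (le_trans _ (ler_ncB _ _)) // Normc.normc1 Normc.normcM z1 mulr1.
  by rewrite nc_real ger0_norm.
have p0 : 0 < D by exact: lt_le_trans Dlow.
have Dhi : D <= (1 + c) * (1 - r).
  rewrite /D (_ : 1 - _ = (1 - r)%:C%C + r%:C%C * (1 - z)); last by rewrite rmorphB rmorph1; ring.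
  apply: (le_trans (ler_ncD _ _)); rewrite nc_real (ger0_norm (ltW d0)) mulrDl mul1r lerD2l.
  rewrite Normc.normcM nc_real ger0_norm // (le_trans _ hz) // ler_piMl ?nc_ge0 //.
  exact: ltW.
rewrite -(ler_pM2r p0) (le_trans (nc_bump N r0 z1)) // -[leRHS]mulrA.
rewrite ler_wpM2l ?addr_ge0 ?exprn_ge0 //.
have u1 : (1 + c) ^- 2 <= 1.
  by rewrite invf_le1 ?exprn_gt0 // exprn_ege1 // lerDl.
rewrite -ler_sqr ?nnegrE ?mulr_ge0 ?nc_ge0 ?sqrtr_ge0 // [leRHS]exprMn.
rewrite sqr_sqrtr ?subr_ge0 // mulrBl mul1r.
have e := sqr_bump_gap r z1; rewrite -/D in e.
have -> : (r * nc (1 - z)) ^+ 2 = D ^+ 2 - (1 - r) * (1 + r - 2 * r * complex.Re z).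
  by rewrite -e; ring.
rewrite lerD2l lerN2.
have h1 : (1 + c) ^- 2 * D ^+ 2 <= (1 - r) ^+ 2.
  by rewrite ler_pdivrMl ?exprn_gt0 // -exprMn ler_sqr ?nnegrE ?mulr_ge0 // ltW.
apply: (le_trans h1); rewrite expr2 ler_pM2l //.
have /(ler_wpM2l r0) : complex.Re z <= 1.
  by rewrite (le_trans (ler_norm _)) // (le_trans (nc_Re z)) ?z1.
lra.
Qed.

(** The product with (1 - tau)^k is at most 1, and (1 - tau)^k >= 1/2 by Bernoulli. *)
Lemma pow1D_le2 (tau : R) k : 0 <= tau -> k%:R * tau <= 2^-1 -> (1 + tau) ^+ k <= 2.
Proof.
move=> t0 kt.
have bern j : 1 - j%:R * tau <= (1 - tau) ^+ j \/ 1 < tau.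
  have [t1|] := leP tau 1; last by right.
  left; elim: j => [|j IH]; first by rewrite mul0r subr0.
  have s0 : 0 <= 1 - tau by rewrite subr_ge0.
  rewrite exprS (le_trans _ (ler_wpM2l s0 IH)) //.
  rewrite -natr1; have : 0 <= j%:R * tau * tau by rewrite !mulr_ge0.
  lra.
case: k kt => [|k] kt; first by rewrite expr0 ler1n.
have [b|t1] := bern k.+1; last first.
  move: kt; have : 1 <= k.+1%:R :> R by rewrite ler1n.
  nra.
have h : (1 + tau) ^+ k.+1 * (1 - tau) ^+ k.+1 <= 1.
  rewrite -exprMn exprn_ile1 //; last by rewrite -subr_ge0; have := sqr_ge0 tau; lra.
  have : tau <= 2^-1.
    by rewrite (le_trans _ kt) // ler_peMl // ler1n.
  by move: t0; nra.
have p0 : 0 <= (1 + tau) ^+ k.+1 by rewrite exprn_ge0 // addr_ge0.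
nra.
Qed.

Lemma powM_small (c rho : R) : 0 <= c -> 0 <= rho < 1 -> exists L, c * rho ^+ L.+1 <= 2^-1.
Proof.
move=> c0 /andP[r0 r1].
have cv : (c * rho ^+ n) @[n --> \oo] --> (0 : R).
  rewrite -[X in _ --> X](mulr0 c); apply: cvgMr; apply: cvg_expr.
  by rewrite ger0_norm.
have h2 : 0 < 2^-1 :> R by rewrite invr_gt0.
have [N hN] := (cvg0_seqP _).1 cv _ h2.
exists N; apply: le_trans (ler_norm _) _; exact/ltW/hN.
Qed.

End circle.

(** The point is that C does not depend on n: the walk below has exponentially many endpoints. *)
Definition pmean_bounded d (T : measurableType d) (R : realType) (m : {measure set T -> \bar R})
    (X : fspace T R) (p C : R) : Prop :=
  forall (n : nat) (g : nat -> T -> R), (0 < n)%N -> (forall i, (i < n)%N -> dom m X (g i) 1) ->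
  dom m X (fun x => ((\sum_(i < n) `|g i x| `^ p) / n%:R) `^ p^-1) C.

Section analytic_convexity.
Context d (T : measurableType d) (R : realType).
Variable m : {measure set T -> \bar R}.
Variables (X : fspace T R) (K C : R).
Hypothesis hX : qlat m X K.
Hypothesis C1 : 1 <= C.
Hypothesis hC : forall (n : nat) (a : nat -> T -> R[i]), (forall k, X (a k)) ->
      let P := fun z : R[i] => \sum_(k < n) z ^+ k *: a k in
      fs_norm X (P 0) <= C * sup [set fs_norm X (P z) | z in [set z | `|z| = 1]].
Let K1 : 1 <= K. Proof. by case: hX. Qed.
Let K0 : 0 < K. Proof. exact: lt_le_trans K1. Qed.
Let C0 : 0 < C. Proof. exact: lt_le_trans C1. Qed.

(** Purely qualitative: s is never estimated, it only certifies that a norm may be absorbed in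
    [quantile_bound]. *)
Lemma dom_sum_fin (I : finType) (u : I -> T -> R) (r : R) : 0 <= r ->
  (forall i, dom m X (u i) r) -> exists s, dom m X (fun x => \sum_i `|u i x|) s.
Proof.
move=> r0 hu; suff [s hs] : exists s, dom m X (fun x => \sum_(i <- index_enum I) `|u i x|) s.
  by exists s.
elim: (index_enum I) => [|i l [s IH]].
  exists 0; apply: (dom_le (dom0 hX (lexx 0))) => //.
  by apply: aeW => x; rewrite big_nil.
exists (K * (r + s)); apply: (dom_le (dom_add hX (hu i) IH)) => //.
by apply: aeW => x; rewrite big_cons [X in _ <= `| _ + X|]ger0_norm // sumr_ge0.
Qed.

Lemma maximum_principle (n : nat) (a : nat -> T -> R[i]) (M : R) :
  (forall k, X (a k)) ->
  (forall z, nc z = 1 -> dom m X (fun x => nc (\sum_(k < n) z ^+ k * a k x)) M) ->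
  dom m X (fun x => nc (\sum_(k < n) 0 ^+ k * a k x)) (C * M).
Proof.
move=> Xa hM.
pose P := fun z : R[i] => \sum_(k < n) z ^+ k *: a k.
have PE z x : P z x = \sum_(k < n) z ^+ k * a k x.
  by rewrite /P fct_sumE.
have XP z : X (P z).
  rewrite /P; elim/big_ind: _ => [||k _]; first exact: (fs_mem0 hX).
    by move=> f g; exact: (fs_memD hX).
  exact: (fs_memZ hX).
rewrite (_ : (fun x => _) = (fun x => nc (P 0 x))); last first.
  by apply/funext => x; rewrite PE.
apply: dom_fs => //; apply: (le_trans (hC n Xa)); rewrite ler_wpM2l ?(ltW C0) //.
apply: ge_sup; first by exists (fs_norm X (P 1)), 1 => //=; rewrite normr1.
move=> _ [z /= z1 <-].
have z1' : nc z = 1 by apply: complexI; rewrite -normC_nc.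
have [|_ ->] // := dom_mem hX (hM z z1') (fs_mem_L0 hX (XP z)).
by apply: aeW => x; rewrite PE ger0_norm ?nc_ge0.
Qed.

Definition L0poly (p : T -> {poly R[i]}) := forall k, @L0 d T R (fun x => (p x)`_k).

Lemma L0polyM p q : L0poly p -> L0poly q -> L0poly (fun x => p x * q x).
Proof.
move=> hp hq k; under eq_fun do rewrite coefM.
by apply: L0_sum => i _; apply: L0M.
Qed.

Lemma L0poly_cst p : L0poly (fun=> p).
Proof. by move=> k; exact: L0_cst. Qed.

Lemma L0poly_prod (I : Type) (s : seq I) (p : I -> T -> {poly R[i]}) :
  (forall i, L0poly (p i)) -> L0poly (fun x => \prod_(i <- s) p i x).
Proof.
move=> hp; elim: s => [|i s IH].
  by under eq_fun do rewrite big_nil; exact: L0poly_cst.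
by under eq_fun do rewrite big_cons; exact: L0polyM.
Qed.

Lemma L0poly_if (b : T -> bool) p q : measurable_fun setT b ->
  L0poly p -> L0poly q -> L0poly (fun x => if b x then p x else q x).
Proof.
move=> mb hp hq k.
rewrite (_ : (fun x => _) = (fun x => if x \in [set x | b x] then (p x)`_k else (q x)`_k)).
  apply: L0_if => //.
  by rewrite -[X in measurable X]setTI; have := mb measurableT [set true] I.
apply/funext => x; case: (boolP (b x)) => bx; first by rewrite mem_set.
by rewrite memNset //=; apply/negP.
Qed.

(* The functions h 1_(|G_i| < h) are small, on the i-th arc of the circle, against the
   polynomial h prod bump; A-convexity then bounds h. *)
Lemma quantile_bound : exists2 L : nat, (0 < L)%N &
  forall (I : finType) (G : I -> T -> R[i]) (h : T -> R), (0 < #|I|)%N ->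
    (forall i, X (G i)) -> (forall i, fs_norm X (G i) <= 1) ->
    measurable_fun setT h -> (forall x, 0 <= h x) ->
    (forall x, (#|[set i | (nc (G i x) < h x)%R]%SET| * L <= #|I|)%N) ->
    dom m X h (8 * C * K).
Proof.
pose c : R := 8 * pi.
have c0 : 0 <= c by rewrite mulr_ge0 // pi_ge0.
pose rho := Num.sqrt (1 - (1 + c) ^- 2).
have rho01 : 0 <= rho < 1.
  rewrite sqrtr_ge0 /= -[ltRHS]sqrtr1 ltr_sqrt // ltrBlDr ltrDl.
  by rewrite invr_gt0 exprn_gt0 // ltr_wpDr.
have CK0 : 0 <= 4 * C * K by rewrite !mulr_ge0 // ltW.
(* rho^L is the gain near the node of a bad index when bumps are raised to the power L; this choice
   allows the norm of h to be absorbed at the end. *)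
have [L L2 hL] : exists2 L, (1 < L)%N & 4 * C * K * rho ^+ L <= 2^-1.
  have [L' hL'] := powM_small CK0 rho01; exists L'.+2 => //.
  apply: le_trans hL'; rewrite ler_wpM2l // [leLHS]exprS ler_piMl //.
    by rewrite exprn_ge0 //; case/andP: rho01.
  by case/andP: rho01 => _ /ltW.
exists L; first exact: ltnW.
move=> I G h n0 XG nG mh h0 hcard.
pose n := #|I|.
have nR : (0 : R) < (2 * n%:R)^-1 by rewrite invr_gt0 mulr_gt0 // ltr0n.
(* With 1 - r of the order of the spacing of the nodes, each bump is effective on the arc around its
   node, while a product of at most n bumps is still at least 1 - n / (2 n) = 1/2 at 0. *)
pose r : R := 1 - (2 * n%:R)^-1.
have n2 : (2 * n%:R)^-1 <= 2^-1 :> R.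
  rewrite invfM ler_piMr ?invr_ge0 // invf_le1 ?ltr0n // ler1n //.
have r01 : 0 <= r < 1 by rewrite /r; move: n2 nR; lra.
have r1E : 1 - r = (2 * n%:R)^-1 by rewrite /r; ring.
have [r0 r1] := andP r01.
(* At most L n bumps are multiplied, each of modulus at most 1 + tau on the circle, so the product
   stays below 2. *)
have [N hN] : exists N, (L * n)%:R * r ^+ N.+1 <= 2^-1 by apply: powM_small.
pose tau := r ^+ N.+1.
have tau0 : 0 <= tau by rewrite exprn_ge0.
pose B (i : I) : {poly R[i]} := bump r N.+1 \Po ((node R n (enum_rank i))^-1 *: 'X).
have BE i z : (B i).[z] = (bump r N.+1).[(node R n (enum_rank i))^-1 * z].
  by rewrite /B horner_comp hornerZ hornerX.
have nodeV j : nc (node R n j)^-1 = 1 by rewrite Normc.normcV nc_node invr1.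
have B1 i z : nc z = 1 -> nc (B i).[z] <= 1 + tau.
  move=> z1; rewrite BE; apply: bump_le1; rewrite ?r0 ?(ltW r1) //.
    by rewrite Normc.normcM nodeV z1 mulr1.
  rewrite (lt_le_trans _ (ler_ncB _ _)) // Normc.normc1 !Normc.normcM nodeV z1.
  by rewrite !mulr1 nc_real ger0_norm // subr_gt0.
have B0 i : (B i).[0] = r%:C%C by rewrite BE mulr0 bump0.
have Bsmall i z : nc z = 1 -> nc (z - node R n (enum_rank i)) <= c * (2 * n%:R)^-1 ->
    nc (B i).[z] <= (1 + tau) * rho.
  move=> z1 hz; rewrite BE; apply: bump_arc => //.
    by rewrite Normc.normcM nodeV z1 mulr1.
  have nn0 : node R n (enum_rank i) != 0.
    by rewrite -nc_eq0 nc_node oner_eq0.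
  rewrite r1E -[X in X - _](mulVf nn0) -mulrBr Normc.normcM nodeV mul1r ncB //.
pose b i x : bool := nc (G i x) < h x.
pose Q (S : {set I}) : {poly R[i]} := \prod_i (if i \in S then B i ^+ L else 1).
pose S x : {set I} := [set i | b i x]%SET.
have QE S' z : nc (Q S').[z] = \prod_(i in S') nc (B i).[z] ^+ L.
  rewrite /Q horner_prod nc_prod [RHS]big_mkcond; apply: eq_bigr => i _.
  by case: ifP => _; rewrite ?horner_exp ?ncX // hornerC Normc.normc1.
have tau2 k : (k <= L * n)%N -> (1 + tau) ^+ k <= 2.
  move=> kn; apply: pow1D_le2 => //; apply: le_trans hN.
  by rewrite ler_wpM2r // ler_nat.
have cardn (S' : {set I}) : (#|S'| <= n)%N by rewrite /n max_card.
have Qle2 S' z : nc z = 1 -> nc (Q S').[z] <= 2.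
  move=> z1; rewrite QE.
  apply: (@le_trans _ _ (\prod_(i in S') (1 + tau) ^+ L)).
    apply: ler_prod => i _; rewrite exprn_ge0 ?nc_ge0 //=.
    by rewrite lerXn2r ?nnegrE ?nc_ge0 ?addr_ge0 // B1.
  rewrite prodr_const -exprM; apply: tau2; exact: leq_mul.
have Qsmall (S' : {set I}) (z : R[i]) (i : I) : nc z = 1 -> (i \in S') ->
    nc (z - node R n (enum_rank i)) <= c * (2 * n%:R)^-1 ->
    nc (Q S').[z] <= 2 * rho ^+ L.
  move=> z1 iS hz; rewrite QE (bigD1 i) //=.
  have rL : 0 <= rho ^+ L by rewrite exprn_ge0 // sqrtr_ge0.
  apply: (@le_trans _ _ ((1 + tau) ^+ L * rho ^+ L * \prod_(j in S' | j != i) (1 + tau) ^+ L)).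
    apply: ler_pM => //.
    - by rewrite exprn_ge0 // nc_ge0.
    - by apply: prodr_ge0 => j _; rewrite exprn_ge0 // nc_ge0.
    - rewrite -exprMn lerXn2r ?nnegrE ?nc_ge0 ?mulr_ge0 ?sqrtr_ge0 ?addr_ge0 //.
      exact: Bsmall.
    apply: ler_prod => j _; rewrite exprn_ge0 ?nc_ge0 //=.
    by rewrite lerXn2r ?nnegrE ?nc_ge0 ?addr_ge0 // B1.
  have -> : (1 + tau) ^+ L * rho ^+ L * \prod_(j in S' | j != i) (1 + tau) ^+ L =
     \prod_(j in S') (1 + tau) ^+ L * rho ^+ L.
    by rewrite [in RHS](bigD1 i) //= mulrAC.
  rewrite ler_wpM2r // prodr_const -exprM; apply: tau2; exact: leq_mul.
have Q0 x : 2^-1 <= nc (Q (S x)).[0].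
  rewrite QE; under eq_bigr do rewrite B0 nc_real (ger0_norm r0).
  rewrite prodr_const -exprM.
  have bern k : 1 - k%:R * (2 * n%:R)^-1 <= r ^+ k.
    elim: k => [|k IH]; first by rewrite mul0r subr0.
    rewrite exprS (le_trans _ (ler_wpM2l r0 IH)) // /r -natr1.
    have : 0 <= k%:R * (2 * n%:R)^-1 * (2 * n%:R)^-1 :> R by rewrite !mulr_ge0 ?(ltW nR).
    lra.
  apply: le_trans (bern _); rewrite lerBrDl -lerBrDr.
  rewrite (_ : 1 - 2^-1 = n%:R * (2 * n%:R)^-1); last first.
    by field; rewrite pnatr_eq0 -lt0n.
  rewrite ler_wpM2r ?(ltW nR) // ler_nat mulnC; exact: hcard.
have mb i : measurable_fun setT (b i).
  by apply: measurable_fun_ltr => //; exact/measurable_nc/(fs_mem_L0 hX).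
(* Since L > 1, not all indices are bad at x, so h is below the sum of the |G i|. This finiteness
   makes the final absorption legitimate. *)
have hdom : exists s, dom m X h s.
  have [s hs] := dom_sum_fin ler01 (fun i => dom_fs m (XG i) (nG i)).
  exists s; apply: (dom_le hs) => //; apply: aeW => x.
  rewrite (ger0_norm (h0 x)) ger0_norm; last by apply: sumr_ge0.
  have [i iS] : exists i, i \notin S x.
    apply/existsP; rewrite -negb_forall; apply/negP => /forallP hS.
    have SE : S x = [set: I]%SET by apply/setP => i; rewrite hS inE.
    have := hcard x; rewrite -/(S x) SE cardsT leqNgt => /negP; apply.
    by rewrite -[X in (X < _)%N]muln1 ltn_pmul2l.
  rewrite (bigD1 i) //= (le_trans _ (_ : `|nc (G i x)| <= _)) ?lerDl ?sumr_ge0 //.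
  by move: iS; rewrite inE -leNgt ger0_norm ?nc_ge0.
have [s hs] := hdom.
have Xh : X (fun x => (h x)%:C%C) /\ fs_norm X (fun x => (h x)%:C%C) <= s.
  apply: (dom_mem hX hs); first exact: L0_real.
  by apply: aeW => x; rewrite nc_real.
set H := fs_norm X (fun x => (h x)%:C%C) in Xh.
have hH : dom m X h H by apply: rep_dom; case: Xh.
have H0 : 0 <= H by exact: dom_ge0 hX _ _ hH.
(* The polynomial varies with x only through the set S x, which has finitely many values; hence its
   coefficients are measurable and bounded. *)
pose a k x : R[i] := (h x)%:C%C * (Q (S x))`_k.
have La k : @L0 d T R (a k).
  apply: L0M; first exact: L0_real.
  have : L0poly (fun x => Q (S x)).
    rewrite /Q /S; apply: L0poly_prod => i.
    under eq_fun do rewrite inE.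
    by apply: L0poly_if => //; exact: L0poly_cst.
  exact.
have Xa k : X (a k).
  have [] // := dom_mem hX (dom_scale hX (\sum_(S' : {set I}) nc (Q S')`_k) hH) (La k).
  apply: aeW => x; rewrite Normc.normcM nc_real normrM mulrC ler_wpM2r //.
  rewrite ger0_norm ?sumr_ge0 //; last by move=> *; exact: nc_ge0.
  by rewrite (bigD1 (S x)) //= lerDl sumr_ge0 // => *; exact: nc_ge0.
pose deg := \max_(S' : {set I}) size (Q S').
have PE z x : \sum_(k < deg) z ^+ k * a k x = (h x)%:C%C * (Q (S x)).[z].
  rewrite (@horner_coef_wide _ deg); last exact: (leq_bigmax (S x)).
  rewrite mulr_sumr; apply: eq_bigr => k _; rewrite /a; ring.
have hM z : nc z = 1 -> dom m X (fun x => nc (\sum_(k < deg) z ^+ k * a k x))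
    (K * (2 + 2 * rho ^+ L * H)).
  move=> z1; have [j jn hj] := node_near (n0 : (0 < n)%N) z1.
  pose i := enum_val (Ordinal jn).
  have hz : nc (z - node R n (enum_rank i)) <= c * (2 * n%:R)^-1.
    by rewrite /i enum_valK.
  have d1 := dom_scale hX 2 (dom_fs m (XG i) (nG i)).
  have d2 := dom_scale hX (2 * rho ^+ L) hH.
  apply: (dom_le (dom_add hX d1 d2)).
    rewrite ler_wpM2l ?(ltW K0) // lerD //; first by rewrite mulr1 ger0_norm.
    by rewrite ger0_norm // mulr_ge0 // exprn_ge0 // sqrtr_ge0.
  apply: aeW => x; rewrite PE normr_normD ger0_norm ?nc_ge0 //.
  rewrite Normc.normcM nc_real ger0_norm //.
  rewrite [X in _ <= X + _]ger0_norm ?mulr_ge0 ?nc_ge0 //.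
  rewrite [X in _ <= _ + X]ger0_norm ?mulr_ge0 ?exprn_ge0 ?sqrtr_ge0 //.
  have [bx|bx] := boolP (b i x).
    rewrite (@le_trans _ _ (2 * rho ^+ L * h x)) ?lerDr ?mulr_ge0 ?nc_ge0 //.
    by rewrite mulrC ler_wpM2r // (Qsmall _ _ i) // inE.
  rewrite (@le_trans _ _ (2 * nc (G i x))) ?lerDl ?mulr_ge0 ?exprn_ge0 ?sqrtr_ge0 //.
  rewrite mulrC; apply: ler_pM; rewrite ?nc_ge0 ?Qle2 //.
  by rewrite leNgt.
have := maximum_principle Xa hM => hP.
have hh : dom m X h (2 * (C * (K * (2 + 2 * rho ^+ L * H)))).
  apply: (dom_le (dom_scale hX 2 hP)); first by rewrite ger0_norm.
  apply: aeW => x; rewrite PE Normc.normcM nc_real normrM (ger0_norm (_ : 0 <= 2)) //.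
  rewrite [`|_ * nc _|]ger0_norm ?mulr_ge0 ?nc_ge0 //.
  by rewrite mulrCA ler_peMr //; have := Q0 x; lra.
apply: (dom_ler hH).
(* By the choice of L this yields H <= 4 C K + H / 2. *)
have : H <= 2 * (C * (K * (2 + 2 * rho ^+ L * H))).
  by have [|_] := dom_mem hX hh (L0_real mh); first by apply: aeW => x; rewrite nc_real.
rewrite (_ : 2 * _ = 4 * C * K + (4 * C * K * rho ^+ L) * H); last by ring.
have := ler_wpM2r H0 hL; lra.
Qed.

(** Summation along a balanced binary tree of depth l costs K^l only, instead of a power K^(2^l). *)
Lemma dom_pow2 l : forall u : nat -> T -> R,
  (forall j, (j < 2 ^ l)%N -> dom m X (u j) 1) ->
  dom m X (fun x => \sum_(j < 2 ^ l) `|u j x|) ((2 * K) ^+ l).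
Proof.
elim: l => [|l IH] u hu.
  apply: (dom_le (hu 0%N isT)) => //; apply: aeW => x.
  by rewrite big_ord1 normr_id.
have h1 : dom m X (fun x => \sum_(j < 2 ^ l) `|u j x|) ((2 * K) ^+ l).
  by apply: IH => j jl; apply: hu; rewrite expnS mul2n -addnn ltn_addr.
have h2 : dom m X (fun x => \sum_(j < 2 ^ l) `|u (2 ^ l + j)%N x|) ((2 * K) ^+ l).
  apply: (IH (fun j => u (2 ^ l + j)%N)) => j jl; apply: hu.
  by rewrite expnS mul2n -addnn ltn_add2l.
apply: (dom_le (dom_add hX h1 h2)).
  by rewrite exprS le_eqVlt; apply/orP; left; apply/eqP; ring.
apply: aeW => x; rewrite expnS mul2n -addnn big_split_ord /=.
rewrite [X in _ <= `|X + _|]ger0_norm ?sumr_ge0 //.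
by rewrite [X in _ <= `|_ + X|]ger0_norm ?sumr_ge0.
Qed.

(** A truncated layer-cake bound: passing to the integer part of Y loses at most 1. *)
Lemma count_below (Y : R) M : 0 <= Y ->
  Num.min Y M%:R - 1 <= \sum_(k < M) ((0 < k)%N && (k%:R <= Y))%:R :> R.
Proof.
move=> Y0; elim: M => [|M IH].
  by rewrite big_ord0 subr_le0 ge_min ler01 orbT.
rewrite big_ord_recr /=; case: M IH => [|M] IH.
  by rewrite big_ord0 /= addr0 subr_le0 ge_min lexx orbT.
set s := \sum_(_ < _) _ in IH *; have [MY|MY] := leP M.+1%:R Y.
  move: IH; rewrite (min_idPr MY) /= => IH.
  have : Num.min Y M.+2%:R <= M.+2%:R :> R by rewrite ge_min lexx orbT.
  by rewrite -[M.+2]addn1 natrD; lra.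
rewrite /= addr0; apply: le_trans IH; rewrite lerD2r.
by rewrite le_min !ge_min lexx (ltW MY).
Qed.

Lemma powR_expr (x a : R) l : 0 <= x -> (x ^+ l) `^ a = (x `^ a) ^+ l.
Proof.
move=> x0; elim: l => [|l IH]; first by rewrite !expr0 powR1.
by rewrite !exprS powRM ?exprn_ge0 // IH.
Qed.

(** For independent events of probabilities P k, the probability that none occurs is small once the
    expected number of occurrences is large. *)
Lemma prod_onem_le (M : nat) (P : 'I_M -> R) : (forall k, 0 <= P k <= 1) ->
  \prod_k (1 - P k) * (1 + \sum_k P k) <= 1.
Proof.
elim: M P => [|M IH] P hP; first by rewrite !big_ord0 addr0 mulr1.
rewrite !big_ord_recl /=.
have h := IH (fun k => P (lift ord0 k)) (fun k => hP _).
have p0 : 0 <= \prod_i (1 - P (lift ord0 i)).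
  by apply: prodr_ge0 => i _; rewrite subr_ge0; case/andP: (hP (lift ord0 i)).
have s0 : 0 <= \sum_i P (lift ord0 i).
  by apply: sumr_ge0 => i _; case/andP: (hP (lift ord0 i)).
have /andP[q0 q1] := hP ord0.
move: h p0 s0 q0 q1; set p := \prod_i _; set s := \sum_i _; set q := P ord0.
move=> h p0 s0 q0 q1.
have ps : 0 <= p * s by rewrite mulr_ge0.
have pq : 0 <= p * q * q by rewrite !mulr_ge0.
have psq : 0 <= p * s * q by rewrite !mulr_ge0.
have -> : (1 - q) * p * (1 + (q + s)) = p * (1 + s) - p * q * q - p * s * q by ring.
by lra.
Qed.

(* The quantile bound is applied to the n^M functions sup_k k^(-1/p) g_(s k): for
   each x all but a small proportion of the maps s satisfy
   sup_k k^(-1/p) g_(s k)(x) >= c (mean of g_i(x)^p)^(1/p). *)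
Lemma power_mean_bound : exists2 p0 : R, 0 < p0 <= 1 & forall p, 0 < p <= p0 ->
  exists2 Cp : R, 0 < Cp & pmean_bounded m X p Cp.
Proof.
have [L L0 hL] := quantile_bound.
(* For p <= 1 / s one has 2^(1/p) >= 4 K^2. A dyadic block of 2^l functions costs (2 K)^l and gains
   2^(-l/p), which leaves a ratio of at most 1 / (2 K). *)
have [s s0 hs] : exists2 s : nat, (0 < s)%N & 4 * K ^+ 2 <= 2 ^+ s.
  exists (Num.Def.truncn (4 * K ^+ 2)).+1 => //.
  rewrite (le_trans (ltW (truncnS_gt _))) // -natrX ler_nat ltnW //.
  exact: ltn_expl.
have sR : (0 : R) < s%:R by rewrite ltr0n.
exists (s%:R^-1); first by rewrite invr_gt0 sR /= invf_le1 // ler1n.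
move=> p /andP[p_gt0 ps].
have p0 : 0 <= p by exact: ltW.
have pn0 : p != 0 by rewrite gt_eqF.
have ip0 : 0 <= p^-1 by rewrite invr_ge0.
pose beta : R := 1 + L%:R.
have beta0 : 0 < beta by rewrite /beta ltr_wpDr.
exists (beta `^ p^-1 * (2 * K) * (8 * C * K)).
  by rewrite !mulr_gt0 // powR_gt0.
move=> n g n0 hg.
have hg' (i : 'I_n) : dom m X (g i) 1 by exact: hg.
have /choice[y hy] : forall i : 'I_n, exists w : T -> R, [/\ forall x, 0 <= w x, measurable_fun setT w,
    X (fun x => (w x)%:C%C), fs_norm X (fun x => (w x)%:C%C) <= 1 &
    \forall x \ae m, `|g i x| <= w x] by move=> i; exact: (dom_rep hX (hg' i)).
have y0 i x : 0 <= y i x by case: (hy i).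
have my i : measurable_fun setT (y i) by case: (hy i).
have dy i : dom m X (y i) 1 by case: (hy i) => *; exact: rep_dom.
have nR : (0 : R) < n%:R by rewrite ltr0n.
pose S x : R := (\sum_i y i x `^ p) / n%:R.
have S0 x : 0 <= S x by rewrite divr_ge0 // sumr_ge0 // => i _; exact: powR_ge0.
have mS : measurable_fun setT S.
  apply: measurable_funM => //; apply: measurable_sum => i; exact: measurable_powRfun.
(* One value is at most n times the mean, so M = 2^N is at least every Y i and the truncation at M
   in [count_below] has no effect. *)
have [N hN] : exists N : nat, beta * n%:R <= (2 ^ N)%:R.
  exists (Num.Def.truncn (beta * n%:R)).+1.
  rewrite (le_trans (ltW (truncnS_gt _))) // ler_nat ltnW //.
  exact: ltn_expl.
pose M := (2 ^ N)%N; have M0 : (0 < M)%N by rewrite /M expn_gt0.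
have oM k : (k < M)%N -> exists i : 'I_M, val i = k by move=> kM; exists (Ordinal kM).
pose idx k : 'I_M := insubd (Ordinal M0) k.
have idxE (k : 'I_M) : idx k = k.
  by apply/val_inj; rewrite /idx insubdK //=; exact: ltn_ord.
(* The weight k^(-1/p) is replaced by its value at the largest power of 2 not above k, and the
   supremum over k by a sum over dyadic blocks. *)
pose wt l : R := (2 ^+ l) `^ (- p^-1).
pose F (sg : {ffun 'I_M -> 'I_n}) x : R :=
  \sum_(l < N) wt l * \sum_(j < 2 ^ l) y (sg (idx (2 ^ l + j)%N)) x.
have wt0 l : 0 <= wt l by exact: powR_ge0.
have F0 sg x : 0 <= F sg x.
  by apply: sumr_ge0 => l _; rewrite mulr_ge0 // sumr_ge0.
have mF sg : measurable_fun setT (F sg).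
  apply: measurable_sum => l; apply: measurable_funM => //; exact: measurable_sum.
have dF sg : dom m X (F sg) (2 * K).
  pose q : R := 2 * K * 2 `^ (- p^-1).
  have q0 : 0 <= q by rewrite !mulr_ge0 ?powR_ge0 // ltW.
  have Kq : 2 * K * q <= 1.
    have -> : 2 * K * q = 4 * K ^+ 2 * 2 `^ (- p^-1) by rewrite /q; ring.
    rewrite powRN ler_pdivrMr ?powR_gt0 // mul1r (le_trans hs) //.
    rewrite -powR_mulrn // ler_powR ?ler1n //.
    by rewrite -[s%:R]invrK lef_pV2 ?posrE // invr_gt0.
  have := @dom_sum_geo _ _ _ m X K hX N
     (fun l x => wt l * \sum_(j < 2 ^ l) y (sg (idx (2 ^ l + j)%N)) x) 1 q q0 Kq ler01 _.
  rewrite mulr1 => h; apply: (dom_le (h _)) => // [l lN|].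
    have := dom_scale hX (wt l) (@dom_pow2 l (fun j => y (sg (idx (2 ^ l + j)%N))) (fun j _ => dy _)).
    move=> h'; apply: (dom_le h').
      have -> : wt l = (2 `^ (- p^-1)) ^+ l.
        exact: powR_expr.
      by rewrite (ger0_norm (exprn_ge0 l (powR_ge0 2 (- p^-1)))) mul1r -exprMn mulrC.
    apply: aeW => x; rewrite !normrM ler_wpM2l // [X in X <= _]ger0_norm ?sumr_ge0 //.
    by rewrite [X in _ <= X]ger0_norm ?sumr_ge0 // ler_sum // => j _; exact: ler_norm.
  apply: aeW => x; rewrite ger0_norm // ger0_norm ?sumr_ge0 //.
  by apply: ler_sum => l _; exact: ler_norm.
have K2 : 0 < 2 * K by rewrite mulr_gt0.
pose G sg x : R[i] := (F sg x / (2 * K))%:C%C.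
have mG sg : measurable_fun setT (fun x => F sg x / (2 * K)).
  by apply: measurable_funM.
have GX sg : X (G sg) /\ fs_norm X (G sg) <= 1.
  have := dom_scale hX (2 * K)^-1 (dF sg).
  rewrite ger0_norm ?invr_ge0 ?(ltW K2) // mulVf ?gt_eqF // => h.
  apply: (dom_mem hX h); first exact: L0_real.
  by apply: aeW => x; rewrite nc_real mulrC.
pose h x := (S x / beta) `^ p^-1 / (2 * K).
have h0 x : 0 <= h x by rewrite divr_ge0 ?powR_ge0 // ltW.
have mh : measurable_fun setT h.
  by apply: measurable_funM => //; apply: measurable_powRfun; apply: measurable_funM.
have In0 : (0 < #|{ffun 'I_M -> 'I_n}|)%N.
  by rewrite card_ffun !card_ord expn_gt0 n0.
have hcard x : (#|[set sg | (nc (G sg x) < h x)%R]%SET| * L <= #|{ffun 'I_M -> 'I_n}|)%N.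
  have [Sx|Sx] := eqVneq (S x) 0.
    rewrite (_ : [set sg | _]%SET = finset.set0) ?cards0 ?mul0n //.
    apply/setP => sg; rewrite !inE; apply/negbTE; rewrite -leNgt /h Sx mul0r.
    by rewrite powR0 ?mul0r ?nc_ge0 // invr_eq0.
  have Spos : 0 < S x by rewrite lt_neqAle eq_sym Sx S0.
  pose Y i : R := beta * y i x `^ p / S x.
  have Y0 i : 0 <= Y i.
    by rewrite /Y divr_ge0 // mulr_ge0 ?powR_ge0 // ltW.
  (* Indicator that coordinate k with value i gives no lower bound (S x / beta)^(1/p) for F sg x.
     The index 0 lies in no dyadic block and never gives one. *)
  pose A (k : 'I_M) (i : 'I_n) : R := ((k == 0 :> nat) || (Y i < k%:R))%:R.
  have A0 k i : 0 <= A k i by rewrite /A ler0n.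
  have failA sg : nc (G sg x) < h x -> \prod_k A k (sg k) = 1.
    move=> fail; apply: big1 => k _; rewrite /A; case: eqVneq => //= k0.
    have kpos : (0 < k)%N by rewrite lt0n.
    have kR : (0 : R) < k%:R by rewrite ltr0n.
    suff -> : Y (sg k) < k%:R by [].
    have Fh : F sg x < (S x / beta) `^ p^-1.
      move: fail; rewrite /G nc_real ger0_norm ?divr_ge0 ?(ltW K2) //.
      by rewrite /h ltr_pM2r // invr_gt0.
    have [l lN [j jl kE]] : exists2 l, (l < N)%N & exists2 j, (j < 2 ^ l)%N & k = (2 ^ l + j)%N :> nat.
      have /andP[lo hi] := trunc_log_bounds (isT : (1 < 2)%N) kpos.
      exists (trunc_log 2 k).
        rewrite -(ltn_exp2l _ _ (isT : (1 < 2)%N)); exact: leq_ltn_trans lo (ltn_ord k).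
      exists (k - 2 ^ trunc_log 2 k)%N; last by rewrite subnKC.
      by rewrite ltn_subLR // addnn -mul2n -expnS.
    have yF : wt l * y (sg k) x <= F sg x.
      rewrite /F (bigD1 (Ordinal lN)) //= -[leLHS]addr0 lerD //; last first.
        by apply: sumr_ge0 => i _; rewrite mulr_ge0 // sumr_ge0.
      rewrite ler_wpM2l // (bigD1 (Ordinal jl)) //= -kE idxE lerDl sumr_ge0 //.
    have kwt : k%:R `^ (- p^-1) * y (sg k) x < (S x / beta) `^ p^-1.
      apply: le_lt_trans Fh; apply: le_trans yF; rewrite ler_wpM2r //.
      rewrite /wt !powRN lef_pV2 ?posrE ?powR_gt0 // ?exprn_gt0 //.
      apply: ge0_ler_powR; rewrite ?nnegrE ?exprn_ge0 ?ler0n //.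
      by rewrite -natrX ler_nat kE leq_addr.
    have SB : 0 <= S x / beta by rewrite divr_ge0 // ltW.
    have n1 : k%:R `^ (- p^-1) * y (sg k) x \in Num.nneg.
      by rewrite nnegrE mulr_ge0 ?powR_ge0.
    have n2 : (S x / beta) `^ p^-1 \in Num.nneg by rewrite nnegrE powR_ge0.
    have := gt0_ltr_powR p_gt0 n1 n2 kwt; rewrite powRM ?powR_ge0 // -!powRrM mulNr mulVf //.
    rewrite powRr1 // powRN powRr1 ?ler0n // ltr_pdivrMl // => hh.
    rewrite /Y ltr_pdivrMr // -ltr_pdivlMl // mulrC -mulrA //.
  (* The coordinates of sg are independent: a failing map fails in every coordinate, and products
     distribute over sums. *)
  have cardE : #|[set sg | (nc (G sg x) < h x)%R]%SET|%:R <= \prod_k \sum_i A k i.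
    rewrite bigA_distr_bigA /= -sum1_card natr_sum big_mkcond /=.
    apply: ler_sum => sg _; rewrite inE; case: ifP => hf; first by rewrite failA.
    exact: prodr_ge0.
  pose P (k : 'I_M) : R := (\sum_i ((0 < k)%N && (k%:R <= Y i))%:R) / n%:R.
  have AP k : \sum_i A k i = n%:R * (1 - P k).
    rewrite mulrBr mulr1 /P mulrCA divff ?gt_eqF // mulr1.
    rewrite -[n in n%:R]card_ord -sum1_card natr_sum -sumrB; apply: eq_bigr => i _.
    rewrite /A lt0n; case: eqVneq => _ /=; rewrite ?subr0 // ltNge.
    by case: (k%:R <= Y i); rewrite /= ?subr0 ?subrr.
  have P01 k : 0 <= P k <= 1.
    rewrite /P divr_ge0 ?sumr_ge0 //=.
    rewrite ler_pdivrMr // mul1r (@le_trans _ _ (\sum_(i < n) 1)) //.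
      by apply: ler_sum => i _; case: (_ && _).
    by rewrite sumr_const card_ord.
  have YM i : Y i <= M%:R.
    apply: le_trans hN; rewrite /Y -mulrA ler_pM2l // ler_pdivrMr //.
    rewrite /S mulrCA divff ?gt_eqF // mulr1 (bigD1 i) //= lerDl sumr_ge0 //.
    by move=> *; exact: powR_ge0.
  have sumP : L%:R <= \sum_k P k.
    rewrite /P -mulr_suml exchange_big /= ler_pdivlMr //.
    apply: (@le_trans _ _ (\sum_i (Y i - 1))); last first.
      apply: ler_sum => i _; have := count_below M (Y0 i).
      by rewrite (min_idPl (YM i)).
    rewrite sumrB /= sumr_const card_ord -/(_%:R) /Y -mulr_suml -mulr_sumr.
    have -> : \sum_i y i x `^ p = S x * n%:R by rewrite /S divfK // gt_eqF.
    by rewrite mulrA mulrAC mulfK // /beta mulrDl mul1r addrAC subrr add0r.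
  have := prod_onem_le P01 => hP.
  have pr0 : 0 <= \prod_k (1 - P k).
    by apply: prodr_ge0 => k _; rewrite subr_ge0; case/andP: (P01 k).
  rewrite -(ler_nat R) natrM card_ffun !card_ord.
  apply: (le_trans (ler_wpM2r (ler0n _ _) cardE)).
  under eq_bigr do rewrite AP.
  rewrite big_split /= prodr_const card_ord natrX -mulrA ler_piMr ?exprn_ge0 //.
  apply: le_trans hP; rewrite ler_wpM2l //; apply: (le_trans sumP); rewrite lerDr //.
have := hL _ G h In0 (fun sg => (GX sg).1) (fun sg => (GX sg).2) mh h0 hcard => hh.
have hfin := dom_scale hX (beta `^ p^-1 * (2 * K)) hh.
apply: (dom_le hfin).
  by rewrite ger0_norm // !mulr_ge0 ?powR_ge0 // ltW.
have hall : \forall x \ae m, forall i : 'I_n, `|g i x| <= y i x.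
  have : \forall x \ae m, forall k : nat, forall i : 'I_n, nat_of_ord i = k -> `|g i x| <= y i x.
    apply: ae_foralln => k.
    have [kn|kn] := ltnP k n; last first.
      by apply: aeW => x i ik; have := ltn_ord i; rewrite ik ltnNge kn.
    have [_ _ _ _] := hy (Ordinal kn); apply: filterS => x h' i ik.
    by have -> : i = Ordinal kn by exact/val_inj.
  by apply: filterS => x h' i; exact: (h' i).
apply: filterS hall => x gy.
have -> : beta `^ p^-1 * (2 * K) * h x = S x `^ p^-1.
  have -> : S x `^ p^-1 = beta `^ p^-1 * (S x / beta) `^ p^-1.
    have e : S x = beta * (S x / beta) by rewrite mulrC divfK // gt_eqF.
    have sb : 0 <= S x / beta by apply: divr_ge0; [exact: S0|exact: ltW].
    by rewrite [in LHS]e (powRM _ (ltW beta0) sb).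
  by rewrite /h -mulrA [2 * K * _]mulrC divfK // gt_eqF.
apply: le_trans (ler_norm _); rewrite [leLHS]ger0_norm; last exact: powR_ge0.
apply: ge0_ler_powR; rewrite ?nnegrE //.
  by rewrite divr_ge0 // sumr_ge0 // => i _; exact: powR_ge0.
rewrite /S ler_wpM2r ?invr_ge0 //; apply: ler_sum => i _.
by apply: ge0_ler_powR; rewrite ?nnegrE.
Qed.

End analytic_convexity.

(** * Jensen's inequality at roots of unity *)

Section roots_of_unity.
Variable R : realType.
Implicit Types (t s : R) (z w : R[i]).

Lemma powR_subadd (a b p : R) : 0 <= a -> 0 <= b -> 0 < p <= 1 ->
  (a + b) `^ p <= a `^ p + b `^ p.
Proof.
move=> a0 b0 /andP[p0 p1].
have pn0 : p != 0 by rewrite gt_eqF.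
have [ab0|ab] := eqVneq (a + b) 0.
  by rewrite ab0 powR0 // addr_ge0 // powR_ge0.
have ab1 : 0 < a + b by rewrite lt_neqAle eq_sym ab addr_ge0.
have h c : 0 <= c -> c <= a + b -> (a + b) `^ p * (c / (a + b)) <= c `^ p.
  move=> c0 cab; have [->|cn0] := eqVneq c 0; first by rewrite mul0r mulr0 powR_ge0.
  have cp : 0 < c by rewrite lt_neqAle eq_sym cn0.
  rewrite -[in leRHS](divfK ab c) mulrC [leRHS]powRM ?divr_ge0 ?(ltW ab1) //.
  rewrite ler_wpM2r ?powR_ge0 // ger1_powR // divr_gt0 //=.
  by rewrite ler_pdivrMr // mul1r.
have ha := h a a0 _; have hb := h b b0 _.
rewrite (le_trans _ (lerD (ha _) (hb _))) ?lerDl ?lerDr //.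
by rewrite -mulrDr -mulrDl divff // mulr1.
Qed.

Lemma powR_le_add (a b c p : R) : 0 <= a -> 0 <= b -> 0 <= c -> 0 < p <= 1 ->
  a <= b + c -> a `^ p <= b `^ p + c `^ p.
Proof.
move=> a0 b0 c0 p01 abc; apply: (le_trans _ (powR_subadd b0 c0 p01)).
by apply: ge0_ler_powR; rewrite ?nnegrE ?addr_ge0 //; case/andP: p01 => /ltW.
Qed.

Lemma powR_prod (I : Type) (s : seq I) (f : I -> R) (p : R) :
  (forall i, 0 <= f i) -> \prod_(i <- s) (f i `^ p) = (\prod_(i <- s) f i) `^ p.
Proof.
move=> f0; elim: s => [|i s IH]; first by rewrite !big_nil powR1.
by rewrite !big_cons IH powRM // prodr_ge0.
Qed.

Lemma expi_eq1 t : 0 < t < pi *+ 2 -> expi t != 1.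
Proof.
move=> /andP[t0 t2]; rewrite eq_complex /= negb_and; apply/orP; left.
have : 0 < sin (t / 2).
  apply: sin_gt0_pi; rewrite divr_gt0 //= ltr_pdivrMr // mulr_natr //.
have -> : cos t = 1 - (sin (t / 2)) ^+ 2 *+ 2.
  rewrite [in LHS](_ : t = (t / 2) *+ 2); last by rewrite -mulr_natr divfK.
  rewrite cos_mulr2n cos2sin2; ring.
move=> s0; rewrite lt_eqF // ltrBlDr ltrDl mulrn_wgt0 // exprn_gt0 //.
Qed.

Lemma node_exp n j : node R n j = (node R n 1) ^+ j.
Proof. by rewrite /node expiX mul1r. Qed.

Lemma node_prim n : (0 < n)%N -> n.-primitive_root (node R n 1).
Proof.
move=> n0; have nR : (0 : R) < n%:R by rewrite ltr0n.
apply/andP; split => //; apply/forallP => i; rewrite unity_rootE.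
have h : (node R n 1) ^+ i.+1 = expi (i.+1%:R * (pi *+ 2 / n%:R)).
  by rewrite /node mul1r expiX.
rewrite h; have [-> |ni] := eqVneq i.+1 n.
  have -> : n%:R * (pi *+ 2 / n%:R) = pi *+ 2 :> R by rewrite mulrC divfK // gt_eqF.
  by rewrite /expi cos2pi sin2pi eqxx.
have p0 : 0 < pi *+ 2 :> R by rewrite mulr2n addr_gt0 // pi_gt0.
apply/eqP/negbTE/expi_eq1; rewrite mulr_gt0 ?divr_gt0 //=.
rewrite mulrC -mulrA gtr_pMr //.
by rewrite mulrC ltr_pdivrMr // mul1r ltr_nat ltn_neqAle ni ltn_ord.
Qed.

Lemma node_sum_pow n k : (0 < k < n)%N -> \sum_(j < n) (node R n j) ^+ k = 0.
Proof.
move=> /andP[k0 kn]; have n0 : (0 < n)%N by exact: leq_trans kn.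
under eq_bigr do rewrite node_exp exprAC.
set z := node R n 1 ^+ k.
have z1 : z != 1.
  rewrite /z; apply/negP => /eqP zk.
  have := prim_order_dvd (node_prim n0) k; rewrite zk eqxx => /(dvdn_leq k0).
  by rewrite leqNgt kn.
have : (z - 1) * \sum_(j < n) z ^+ j = 0.
  by rewrite -subrX1 /z exprAC (prim_expr_order (node_prim n0)) expr1n subrr.
by move=> /eqP; rewrite mulf_eq0 subr_eq0 (negbTE z1) /= => /eqP.
Qed.

Lemma node_prod n (x : R[i]) (rho : R) : (0 < n)%N -> 0 < rho ->
  \prod_(j < n) (rho%:C%C * node R n j - x) = (- 1) ^+ n * (x ^+ n - rho%:C%C ^+ n).
Proof.
move=> n0 r0.
have rn0 : rho%:C%C != 0 :> R[i] by rewrite -nc_eq0 nc_real gtr0_norm // gt_eqF.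
have XnE (y : R[i]) : ('X^n - 1 : {poly R[i]}).[y] = y ^+ n - 1.
  by rewrite hornerD hornerN hornerXn hornerC.
have h (y : R[i]) : \prod_(j < n) (y - node R n 1 ^+ j) = y ^+ n - 1.
  transitivity (\prod_(j < n) ('X - (node R n 1 ^+ j)%:P)).[y].
    by rewrite horner_prod; apply: eq_bigr => j _; rewrite hornerXsubC.
  by rewrite -XnE -(factor_Xn_sub_1 (node_prim n0)) big_mkord.
have -> : x ^+ n - rho%:C%C ^+ n = rho%:C%C ^+ n * ((x / rho%:C%C) ^+ n - 1).
  by rewrite mulrBr mulr1 -exprMn mulrC divfK.
rewrite -h mulrA -exprMn -[n in _ ^+ n]card_ord -prodr_const -big_split /=.
apply: eq_bigr => j _; rewrite -node_exp.
rewrite -[X in _ - X = _](divfK rn0); set y := x / _; ring.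
Qed.

Lemma sum_divn (G : nat -> R) m n : (0 < m)%N ->
  \sum_(j < n * m) G (j %/ m)%N = m%:R * \sum_(q < n) G q.
Proof.
move=> m0; elim: n G => [|n IH] G; first by rewrite !big_ord0 mulr0.
rewrite mulSn big_split_ord big_ord_recl mulrDr /=; congr (_ + _).
  rewrite (eq_bigr (fun=> G 0%N)); last by move=> j _; rewrite divn_small.
  by rewrite sumr_const card_ord mulr_natl.
rewrite -(IH (fun q => G q.+1)); apply: eq_bigr => j _; congr G.
by rewrite divnDl ?dvdnn // divnn m0.
Qed.

(** In [jensen_poly], 4 pi / n bounds the distance from a fine node to the coarse node before it,
    and 1 / n bounds 1 - rho. *)
Definition cJ : R := 4 * pi + 1.

Lemma cJ_ge0 : 0 <= cJ.
Proof. by rewrite addr_ge0 // mulr_ge0 // pi_ge0. Qed.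

(* For the (nm)-th roots zeta of
   unity, prod_zeta (xi - rho zeta) = xi^(nm) - rho^(nm), so the geometric mean
   of |Q(rho zeta)| is asymptotically at least |Q(0)| as m tends to infinity,
   provided that no root of Q has modulus rho; AM-GM then gives the p-mean. *)
Lemma jensen_poly (Q : {poly R[i]}) (kap A p : R) n : 0 < p <= 1 -> (1 < n)%N -> 0 <= A ->
  (forall u v, nc u <= 1 -> nc v <= 1 ->
     expR (kap * complex.Re u) * nc Q.[u] <=
     expR (kap * complex.Re v) * nc Q.[v] + A * nc (u - v)) ->
  nc Q.[0] `^ p <= (\sum_(j < n) (expR (kap * complex.Re (node R n j)) * nc Q.[node R n j]) `^ p) / n%:R
    + (A * cJ / n%:R) `^ p.
Proof.
move=> p01 n1 A0 lip; have [p0 p1] := andP p01.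
have n0 : (0 < n)%N by exact: ltnW.
have nR : (0 : R) < n%:R by rewrite ltr0n.
set mn := _ / n%:R; set er := (_ / n%:R) `^ p.
have mn0 : 0 <= mn by rewrite divr_ge0 // sumr_ge0 // => *; exact: powR_ge0.
have er0 : 0 <= er by exact: powR_ge0.
set mu := mn + er; have mu0 : 0 <= mu by exact: addr_ge0.
have [Q0|Q0] := eqVneq Q.[0] 0.
  by rewrite Q0 Normc.normc0 powR0 // gt_eqF.
have [rs Qrs] := closed_field_poly_normal Q.
have Qn0 : Q != 0 by apply: contraNneq Q0 => ->; rewrite horner0.
have lead0 : lead_coef Q != 0 by rewrite lead_coef_eq0.
have xi0 x : x \in rs -> x != 0.
  move=> xr; apply: contraNneq Q0 => x0; rewrite Qrs hornerZ horner_prod.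
  by rewrite (big_rem x) //= hornerXsubC x0 subrr mul0r mulr0.
(* Infinitely many radii are on offer and only finitely many are moduli of roots. Being within 1 / n
   of 1 keeps the Lipschitz error of order A / n. *)
have [rho [rho1 rholt rhon]] : exists rho : R, [/\ 1 - n%:R^-1 < rho, rho < 1 &
    forall x, x \in rs -> nc x != rho].
  pose f (k : nat) : R := 1 - (n%:R + 1 + k%:R)^-1.
  have den0 (k : nat) : 0 < n%:R + 1 + k%:R :> R by rewrite ltr_wpDr // addr_gt0.
  have finj : injective f.
    move=> k k' /addrI /oppr_inj /invr_inj /addrI /eqP; rewrite eqr_nat => /eqP //.
  have [k kn] : exists k : nat, f k \notin [seq nc x | x <- rs].
    apply: contrapT => /forallNP H.
    have Hk k : f k \in [seq nc x | x <- rs] by apply/negPn/negP; exact: H.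
    have := @uniq_leq_size _ [seq f k | k <- iota 0 (size rs).+1] [seq nc x | x <- rs] _ _.
    rewrite !size_map size_iota ltnn => h; suff : false by []; apply: h.
      by rewrite map_inj_uniq // iota_uniq.
    by move=> y /mapP[k _ ->].
  exists (f k); split.
  - rewrite /f ltrD2l ltrN2 ltf_pV2 ?posrE //.
    by rewrite -addrA ltrDl ltr_wpDr.
  - by rewrite /f ltrBlDr ltrDl invr_gt0.
  - by move=> x xr; apply: contra kn => /eqP <-; apply: map_f.
have rho0 : 0 < rho.
  by apply: le_lt_trans rho1; rewrite subr_ge0 invf_le1 // ler1n.
pose E N j : R := (expR (kap * complex.Re (rho%:C%C * node R N j)) *
   nc Q.[rho%:C%C * node R N j]) `^ p.
have E0 N j : 0 <= E N j by exact: powR_ge0.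
have rnode N j : nc (rho%:C%C * node R N j) <= 1.
  by rewrite Normc.normcM nc_node nc_real gtr0_norm // mulr1 ltW.
(* Each of the n m fine nodes is compared with the coarse node of index [j %/ m], so refining raises
   the mean by at most [er], uniformly in m. *)
have Emean m : (0 < m)%N -> (\sum_(j < n * m) E (n * m)%N j) / (n * m)%:R <= mu.
  move=> m0; have mR : (0 : R) < m%:R by rewrite ltr0n.
  have nm0 : (0 : R) < (n * m)%:R by rewrite ltr0n muln_gt0 n0.
  rewrite ler_pdivrMr //.
  pose G q : R := (expR (kap * complex.Re (node R n q)) * nc Q.[node R n q]) `^ p.
  apply: (@le_trans _ _ (\sum_(j < n * m) (G (j %/ m)%N + er))).
    apply: ler_sum => j _; apply: powR_le_add => //.
    - by rewrite mulr_ge0 ?expR_ge0 ?nc_ge0.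
    - by rewrite mulr_ge0 ?expR_ge0 ?nc_ge0.
    - by rewrite divr_ge0 // mulr_ge0 // cJ_ge0.
    apply: le_trans (lip _ (node R n (j %/ m)) (rnode _ _) _) _; first by rewrite nc_node.
    rewrite lerD2l -mulrA ler_wpM2l //.
    set w := node R _ j; set w' := node R _ _.
    have -> : rho%:C%C * w - w' = (w - w') - (1 - rho)%:C%C * w.
      by rewrite rmorphB rmorph1; ring.
    apply: le_trans (ler_ncD _ _) _; rewrite ncN Normc.normcM nc_node mulr1 nc_real.
    rewrite gtr0_norm ?subr_gt0 // /cJ mulrDl mul1r lerD //; last first.
      by rewrite lerBlDr -lerBlDl ltW.
    apply: le_trans (expi_lip _ _) _.
    have -> : (j %/ m)%:R * (pi *+ 2 / n%:R) = ((j %/ m) * m)%:R * (pi *+ 2 / (n * m)%:R) :> R.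
      by rewrite !natrM; field; rewrite !gt_eqF.
    have h0 : 0 <= pi *+ 2 / (n * m)%:R :> R.
      by apply: divr_ge0 => //; apply: mulrn_wge0; exact: pi_ge0.
    rewrite -mulrBl normrM.
    have -> : `|pi *+ 2 / (n * m)%:R| = pi *+ 2 / (n * m)%:R :> R.
      by rewrite ger0_norm // h0.
    rewrite {1}(divn_eq j m) natrD addrAC subrr add0r ger0_norm //.
    apply: (@le_trans _ _ (2 * (m%:R * (pi *+ 2 / (n * m)%:R)))).
      rewrite ler_pM2l // ler_wpM2r ?h0 //.
      by rewrite ler_nat ltnW // ltn_mod.
    rewrite natrM le_eqVlt; apply/orP; left; apply/eqP.
    by rewrite -[pi *+ 2]mulr_natl -mulr_natl; field; rewrite !gt_eqF.
  rewrite big_split /= sum_divn // sumr_const card_ord.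
  rewrite /mu mulrDl -[er *+ _]mulr_natr lerD //.
  rewrite /mn natrM [n%:R * m%:R]mulrC mulrA mulrAC divfK ?gt_eqF // mulrC //.
(* For N > 1 the real parts of the nodes sum to 0, so the exponential weights cancel in the
   product. *)
have prodE N : (0 < N)%N -> \prod_(j < N) E N j =
   (nc (lead_coef Q) ^+ N * \prod_(x <- rs) nc (x ^+ N - rho%:C%C ^+ N)) `^ p \/ (N <= 1)%N.
  move=> N0; have [N1|] := ltnP 1 N; last by right.
  left; rewrite powR_prod; last first.
    by move=> j; rewrite mulr_ge0 ?expR_ge0 ?nc_ge0.
  congr (_ `^ p); rewrite big_split /= -expR_sum -mulr_sumr.
  have -> : \sum_(j < N) complex.Re (rho%:C%C * node R N j) = 0.
    have h := @node_sum_pow N 1 N1.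
    under eq_bigr do rewrite [complex.Re _]/= mul0r subr0.
    rewrite -mulr_sumr (_ : \sum_(j < N) _ = complex.Re (\sum_(j < N) node R N j ^+ 1)).
      by rewrite h mulr0.
    by rewrite (@raddf_sum (Rcomplex R) R (@complex.Re R)).
  rewrite mulr0 expR0 mul1r -nc_prod {1}Qrs.
  under eq_bigr do rewrite hornerZ horner_prod.
  rewrite big_split /= prodr_const card_ord exchange_big /= Normc.normcM ncX; congr (_ * _).
  rewrite nc_prod; apply: eq_bigr => x _.
  under eq_bigr do rewrite !hornerE.
  by rewrite node_prod // Normc.normcM ncX ncN Normc.normc1 expr1n mul1r.
have [N0 hN0] : exists N0, forall N, (N0 <= N)%N -> forall x, x \in rs ->
    nc x ^+ N <= 2 * nc (x ^+ N - rho%:C%C ^+ N).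
  have one x : x \in rs -> exists N0, forall N, (N0 <= N)%N ->
      nc x ^+ N <= 2 * nc (x ^+ N - rho%:C%C ^+ N).
    move=> xr; have x0 : 0 < nc x.
      by rewrite lt_neqAle nc_ge0 andbT eq_sym nc_eq0 xi0.
    have low N : `|nc x ^+ N - rho ^+ N| <= nc (x ^+ N - rho%:C%C ^+ N).
      have rE : nc (rho%:C%C ^+ N : R[i]) = rho ^+ N by rewrite ncX nc_real gtr0_norm.
      rewrite ler_norml -rE -ncX ler_ncB andbT lerNl opprB.
      by rewrite ncB ler_ncB.
    have lim0 (a b : R) : 0 < a -> a < b -> exists N0, forall N, (N0 <= N)%N -> a ^+ N <= 2^-1 * b ^+ N.
      move=> a0 ab; have b0 : 0 < b by exact: lt_trans ab.
      have ab1 : 0 <= a / b < 1 by rewrite divr_ge0 ?ltW // ltr_pdivrMr ?mul1r.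
      have h2 : 0 < 2^-1 :> R by rewrite invr_gt0.
      have cv : (a / b) ^+ N @[N --> \oo] --> (0 : R).
        by apply: cvg_expr; rewrite ger0_norm; case/andP: ab1.
      have [N1 hN1] := (cvg0_seqP _).1 cv _ h2; exists N1 => N NN.
      have := ltW (le_lt_trans (ler_norm _) (hN1 N NN)).
      by rewrite exprMn exprVn ler_pdivrMr // exprn_gt0.
    have := rhon x xr; rewrite neq_lt => /orP[xlt|xgt].
      have [N1 hN1] := lim0 _ _ x0 xlt; exists N1 => N NN.
      have := hN1 N NN; have := low N; have := ler_norm (rho ^+ N - nc x ^+ N).
      rewrite distrC; have : 0 <= nc x ^+ N by rewrite exprn_ge0 // ltW.
      by move: (nc x ^+ N) (rho ^+ N) => a b; lra.
    have [N1 hN1] := lim0 _ _ rho0 xgt; exists N1 => N NN.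
    have := hN1 N NN; have := low N; have := ler_norm (nc x ^+ N - rho ^+ N).
    by move: (nc x ^+ N) (rho ^+ N) => a b; lra.
  elim: (rs) one => [|y l IH] one; first by exists 0%N.
  have [N1 hN1] := one y (mem_head _ _).
  have [|N2 hN2] := IH; first by move=> x xl; apply: one; rewrite inE xl orbT.
  exists (maxn N1 N2) => N NN x; rewrite inE => /orP[/eqP ->|xl].
    by apply: hN1; exact: leq_trans (leq_maxl _ _) NN.
  by apply: hN2 => //; exact: leq_trans (leq_maxr _ _) NN.
pose a := nc Q.[0] `^ p.
have a0 : 0 < a by rewrite powR_gt0 // lt_neqAle nc_ge0 andbT eq_sym nc_eq0.
(* Each root costs a factor 2 in [hN0], independently of N; comparing N-th powers for large N makes
   B harmless. *)
pose B : R := (2 ^+ size rs) `^ p.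
have B0 : 0 < B by rewrite powR_gt0 // exprn_gt0.
have main m : (N0 <= n * m.+1)%N -> a ^+ (n * m.+1) <= B * mu ^+ (n * m.+1).
  move=> Nm; set N := (n * m.+1)%N.
  have N1 : (1 < N)%N by rewrite (leq_trans n1) // leq_pmulr.
  have hAGM := leif_AGM (A := predT) (E := fun j : 'I_N => E N j) (fun j _ => E0 N j).
  have : \prod_(j < N) E N j <= mu ^+ N.
    apply: (le_trans hAGM.1); rewrite card_ord lerXn2r ?nnegrE //.
      by rewrite divr_ge0 // sumr_ge0.
    exact: Emean.
  move=> hp; rewrite -ler_pdivrMl // (le_trans _ hp) //.
  have [->|] := prodE N (ltnW N1); last by rewrite leqNgt N1.
  rewrite ler_pdivrMl // /a /B -powR_expr ?nc_ge0 // -powRM ?exprn_ge0 //; last first.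
    by rewrite mulr_ge0 ?exprn_ge0 ?nc_ge0 // prodr_ge0 // => *; exact: nc_ge0.
  apply: ge0_ler_powR; rewrite ?nnegrE ?(ltW p0) ?exprn_ge0 ?nc_ge0 //.
    by rewrite !mulr_ge0 ?exprn_ge0 ?nc_ge0 // prodr_ge0 // => *; exact: nc_ge0.
  rewrite {1}Qrs hornerZ horner_prod Normc.normcM nc_prod exprMn mulrCA.
  rewrite ler_wpM2l ?exprn_ge0 ?nc_ge0 //.
  have : forall x, x \in rs -> nc x ^+ N <= 2 * nc (x ^+ N - rho%:C%C ^+ N).
    exact: hN0.
  elim: (rs) => [|y l IH] hl; first by rewrite !big_nil expr1n expr0 mulr1.
  rewrite !big_cons exprMn /= exprS mulrACA.
  apply: ler_pM; rewrite ?exprn_ge0 ?nc_ge0 ?prodr_ge0 //.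
  - by move=> *; exact: nc_ge0.
  - rewrite hornerXsubC sub0r ncN; apply: hl; exact: mem_head.
  - by apply: IH => x xl; apply: hl; rewrite inE xl orbT.
(* If mu < a, then B (mu / a)^N tends to 0, against the lower bound 1 along multiples N of n. *)
rewrite -/a leNgt; apply/negP => mua.
have q01 : 0 <= mu / a < 1 by rewrite divr_ge0 ?(ltW a0) // ltr_pdivrMr // mul1r.
have [L hL] := powM_small (ltW B0) q01.
have hb m : (N0 <= n * m.+1)%N -> 1 <= B * (mu / a) ^+ (n * m.+1).
  move=> hm; rewrite exprMn exprVn mulrA ler_pdivlMr ?exprn_gt0 // mul1r; exact: main.
have big : (maxn N0 L.+1 <= n * (maxn N0 L.+1).+1)%N.
  by rewrite (leq_trans (leqnSn _)) // leq_pmull.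
have := hb (maxn N0 L.+1) (leq_trans (leq_maxl _ _) big).
have : B * (mu / a) ^+ (n * (maxn N0 L.+1).+1) <= B * (mu / a) ^+ L.+1.
  rewrite ler_wpM2l ?(ltW B0) //; case/andP: q01 => q0 q1; apply: ler_wiXn2l => //.
    exact: ltW.
  exact: leq_trans (leq_maxr _ _) big.
by move: hL; lra.
Qed.

Lemma ler_nc_powB (a b : R[i]) (s : R) k : nc a <= s -> nc b <= s ->
  nc (a ^+ k - b ^+ k) <= k%:R * s ^+ k.-1 * nc (a - b).
Proof.
move=> ha hb; have s0 : 0 <= s by exact: le_trans (nc_ge0 _) ha.
rewrite subrXX Normc.normcM mulrC ler_wpM2r ?nc_ge0 //.
apply: le_trans (ler_nc_sum _ _ _) _.
apply: (@le_trans _ _ (\sum_(i < k) s ^+ k.-1)); last by rewrite sumr_const card_ord mulr_natl.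
apply: ler_sum => i _; rewrite Normc.normcM !ncX.
have -> : s ^+ k.-1 = s ^+ (k.-1 - i) * s ^+ i.
  by rewrite -exprD subnK // -ltnS (leq_trans (ltn_ord i)) // leqSpred.
by apply: ler_pM; rewrite ?exprn_ge0 ?nc_ge0 // lerXn2r ?nnegrE ?nc_ge0.
Qed.

Lemma expR_subr_le (a b : R) : expR a - expR b <= expR a * (a - b).
Proof.
have -> : expR b = expR a * expR (b - a) by rewrite -expRD addrC subrK.
rewrite -[X in X - _]mulr1 -mulrBr ler_wpM2l ?expR_ge0 //.
by have := expR_ge1Dx (b - a); lra.
Qed.

(** [jensen_poly] is applied to the partial sums of the power series, as polynomials in the position
    on the circle around z. The sums bounded by D control the size and the Lipschitz constant of all
    partial sums on the disc of radius s, so the error does not depend on the order of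
    truncation. *)
Lemma local_jensen (al : nat -> R[i]) (z0 z : R[i]) (r s D kap p : R) n
    (ph : R[i] -> R[i]) :
  0 < p <= 1 -> (1 < n)%N -> 0 < r <= 1 -> s <= 1 -> nc (z - z0) + r <= s ->
  `|complex.Re z| <= 1 ->
  (forall N, \sum_(k < N) k.+1%:R * s ^+ k.-1 * nc (al k) <= D) ->
  (forall e, 0 < e -> exists N,
     nc (ph z - \sum_(k < N) al k * (z - z0) ^+ k) <= e /\
     forall j, (j < n)%N -> nc (ph (z + r%:C%C * node R n j) -
       \sum_(k < N) al k * (z + r%:C%C * node R n j - z0) ^+ k) <= e) ->
  (expR (kap * complex.Re z) * nc (ph z)) `^ p <=
   (\sum_(j < n) (expR (kap * complex.Re (z + r%:C%C * node R n j)) *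
      nc (ph (z + r%:C%C * node R n j))) `^ p) / n%:R +
   ((1 + `|kap|) * expR (3 * `|kap|) * D * cJ / n%:R) `^ p.
Proof.
move=> p01 n1 /andP[r0 r1] s1 hs Rez hD hap; have [p0 p1] := andP p01.
have n0 : (0 < n)%N by exact: ltnW.
have nR : (0 : R) < n%:R by rewrite ltr0n.
have D0 : 0 <= D by have := hD 0%N; rewrite big_ord0.
have s0 : 0 <= s by apply: le_trans hs; rewrite addr_ge0 ?nc_ge0 // ltW.
pose W (w : R[i]) := expR (kap * complex.Re w).
pose pt j : R[i] := z + r%:C%C * node R n j.
have ReD (u : R[i]) : complex.Re (z + r%:C%C * u) = complex.Re z + r * complex.Re u.
  by case: z {hs Rez hap pt} => a b; case: u => c d /=; rewrite mul0r subr0.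
have Wle w : `|complex.Re w| <= 2 -> W w <= expR (2 * `|kap|).
  move=> hw; rewrite ler_expR (le_trans (ler_norm _)) // normrM mulrC ler_wpM2r //.
have Rept j : `|complex.Re (pt j)| <= 2.
  rewrite ReD (le_trans (ler_normD _ _)) // (_ : 2 = 1 + 1) // lerD //.
  rewrite normrM gtr0_norm // (le_trans (ler_wpM2l (ltW r0) (_ : _ <= 1))) ?mulr1 //.
  by rewrite (le_trans (nc_Re _)) // nc_node.
set mn := _ / n%:R; set er := (_ / n%:R) `^ p.
apply/ler_addgt0Pr => e' e'0.
pose Bk := expR (2 * `|kap|).
have Bk0 : 0 < Bk by exact: expR_gt0.
(* ph is replaced by a polynomial once at z and once at the nodes; since (Bk e)^p = e' / 2, this
   costs e' in total. *)
pose e := (e' / 2) `^ p^-1 / Bk.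
have e0 : 0 < e by rewrite divr_gt0 // powR_gt0 // divr_gt0.
have eE : (Bk * e) `^ p = e' / 2.
  by rewrite /e mulrC divfK ?gt_eqF // -powRrM mulVf ?gt_eqF // powRr1 // divr_ge0 // ltW.
clearbody e; have [N [hz hj]] := hap e e0.
pose Q : {poly R[i]} := \sum_(k < N) al k *: ((z - z0)%:P + r%:C%C *: 'X) ^+ k.
have QE u : Q.[u] = \sum_(k < N) al k * (z + r%:C%C * u - z0) ^+ k.
  rewrite /Q horner_sum; apply: eq_bigr => k _.
  by rewrite hornerZ horner_exp hornerD hornerC hornerZ hornerX addrAC.
have inS u : nc u <= 1 -> nc (z + r%:C%C * u - z0) <= s.
  move=> u1; rewrite addrAC (le_trans (ler_ncD _ _)) // (le_trans _ hs) // lerD2l.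
  by rewrite Normc.normcM nc_real gtr0_norm // ler_piMr // ltW.
have Qle u : nc u <= 1 -> nc Q.[u] <= D.
  move=> u1; rewrite QE (le_trans (ler_nc_sum _ _ _)) // (le_trans _ (hD N)) //.
  apply: ler_sum => k _; rewrite Normc.normcM mulrC ler_wpM2r ?nc_ge0 // ncX.
  apply: (@le_trans _ _ (s ^+ k.-1)).
    apply: (@le_trans _ _ (s ^+ k)); first by rewrite lerXn2r ?nnegrE ?nc_ge0 // inS.
    by rewrite ler_wiXn2l // leq_pred.
  by rewrite ler_peMl ?exprn_ge0 // ler1n.
have Qlip u v : nc u <= 1 -> nc v <= 1 -> nc (Q.[u] - Q.[v]) <= D * nc (u - v).
  move=> u1 v1; rewrite !QE -sumrB (le_trans (ler_nc_sum _ _ _)) //.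
  rewrite (le_trans _ (ler_wpM2r (nc_ge0 _) (hD N))) // mulr_suml.
  apply: ler_sum => k _; rewrite -mulrBr Normc.normcM mulrC mulrAC ler_wpM2r ?nc_ge0 //.
  apply: (le_trans (ler_nc_powB _ (inS _ u1) (inS _ v1))).
  have -> : z + r%:C%C * u - z0 - (z + r%:C%C * v - z0) = r%:C%C * (u - v) by ring.
  rewrite Normc.normcM nc_real gtr0_norm //.
  apply: ler_pM; rewrite ?mulr_ge0 ?exprn_ge0 ?nc_ge0 ?(ltW r0) //.
    by rewrite ler_wpM2r ?exprn_ge0 // ler_nat.
  by rewrite ler_piMl ?nc_ge0.
have Eu u : nc u <= 1 -> expR (kap * r * complex.Re u) <= expR `|kap|.
  move=> u1; rewrite ler_expR (le_trans (ler_norm _)) // !normrM -mulrA ler_piMr //.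
  rewrite gtr0_norm // mulr_ile1 ?(ltW r0) // (le_trans (nc_Re _)) //.
pose A := (1 + `|kap|) * expR `|kap| * D.
have A0 : 0 <= A by rewrite !mulr_ge0 ?expR_ge0 ?addr_ge0.
have lip u v : nc u <= 1 -> nc v <= 1 ->
     expR (kap * r * complex.Re u) * nc Q.[u] <=
     expR (kap * r * complex.Re v) * nc Q.[v] + A * nc (u - v).
  move=> u1 v1; rewrite -lerBlDl.
  have -> : expR (kap * r * complex.Re u) * nc Q.[u] - expR (kap * r * complex.Re v) * nc Q.[v]
    = expR (kap * r * complex.Re u) * (nc Q.[u] - nc Q.[v]) +
      (expR (kap * r * complex.Re u) - expR (kap * r * complex.Re v)) * nc Q.[v] by ring.
  have -> : A * nc (u - v) = expR `|kap| * (D * nc (u - v)) +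
     (expR `|kap| * (`|kap| * nc (u - v))) * D by rewrite /A; ring.
  have h1 : nc Q.[u] - nc Q.[v] <= D * nc (u - v).
    by apply: le_trans (Qlip _ _ u1 v1); exact: ler_ncB.
  apply: lerD.
    apply: (@le_trans _ _ (expR (kap * r * complex.Re u) * (D * nc (u - v)))).
      by rewrite ler_wpM2l ?expR_ge0.
    by rewrite ler_wpM2r ?Eu // mulr_ge0 ?nc_ge0.
  have h2 : expR (kap * r * complex.Re u) - expR (kap * r * complex.Re v) <=
      expR `|kap| * (`|kap| * nc (u - v)).
    apply: (le_trans (expR_subr_le _ _)).
    rewrite -mulrBr (le_trans (ler_norm _)) // normrM ger0_norm ?expR_ge0 //.
    apply: ler_pM; rewrite ?expR_ge0 ?Eu //.
    rewrite !normrM -mulrA ler_wpM2l // gtr0_norm //.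
    apply: (@le_trans _ _ `|complex.Re u - complex.Re v|).
      by rewrite ler_piMl.
    have -> : complex.Re u - complex.Re v = complex.Re (u - v) by case: (u); case: (v).
    exact: nc_Re.
  apply: (@le_trans _ _ ((expR `|kap| * (`|kap| * nc (u - v))) * nc Q.[v])).
    by rewrite ler_wpM2r ?nc_ge0.
  by rewrite ler_wpM2l ?Qle // !mulr_ge0 ?expR_ge0 ?nc_ge0.
have J := jensen_poly p01 n1 A0 lip.
have W0 w : 0 <= W w by exact: expR_ge0.
have Wz : W z <= expR `|kap|.
  by rewrite ler_expR (le_trans (ler_norm _)) // normrM ler_piMr.
have Wpow (w : R[i]) (x : R) : 0 <= x -> (W w * x) `^ p = W w `^ p * x `^ p.
  by move=> x0; rewrite powRM.
have step1 : (W z * nc (ph z)) `^ p <= (W z * nc Q.[0]) `^ p + e' / 2.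
  rewrite -eE; apply: powR_le_add => //; rewrite ?mulr_ge0 ?nc_ge0 ?(ltW Bk0) ?(ltW e0) //.
  have : nc (ph z) <= nc Q.[0] + e.
    rewrite -lerBlDl (le_trans (ler_ncB _ _)) // QE mulr0 addr0 //.
  move=> /(ler_wpM2l (W0 z)) /le_trans; apply; rewrite mulrDr lerD2l ler_wpM2r ?(ltW e0) //.
  by apply: Wle; apply: (le_trans Rez); rewrite ler1n.
have step2 : (W z * nc Q.[0]) `^ p <= mn + e' / 2 + er.
  have nn0 : n%:R != 0 :> R by rewrite gt_eqF.
  rewrite (Wpow z (nc Q.[0]) (nc_ge0 _)).
  apply: (le_trans (ler_wpM2l (powR_ge0 _ _) J)); rewrite mulrDr.
  apply: lerD; last first.
    rewrite /er -powRM //; last by rewrite divr_ge0 // mulr_ge0 // cJ_ge0.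
    apply: ge0_ler_powR; rewrite ?nnegrE ?(ltW p0) //.
    - by rewrite mulr_ge0 // divr_ge0 // mulr_ge0 // cJ_ge0.
    - by rewrite divr_ge0 // !mulr_ge0 ?cJ_ge0 ?expR_ge0 // addr_ge0.
    rewrite !mulrA ler_wpM2r ?invr_ge0 // ler_wpM2r ?cJ_ge0 //.
    rewrite /A ?mulrA ler_wpM2r //.
    rewrite [_ * (1 + _)]mulrC -!mulrA ler_wpM2l ?addr_ge0 //.
    apply: (@le_trans _ _ (expR `|kap| * expR `|kap|)); first by rewrite ler_wpM2r ?expR_ge0.
    by rewrite -expRD ler_expR; have := normr_ge0 kap; lra.
  rewrite mulrA /mn mulr_sumr -[e' / 2](mulfK nn0) -mulrDl ler_wpM2r ?invr_ge0 //.
  have -> : e' / 2 * n%:R = \sum_(j < n) e' / 2 by rewrite sumr_const card_ord mulr_natr.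
  rewrite -big_split /=.
  apply: ler_sum => j _; rewrite -Wpow ?mulr_ge0 ?expR_ge0 ?nc_ge0 // -eE.
  have -> : W z * (expR (kap * r * complex.Re (node R n j)) * nc Q.[node R n j]) =
      W (pt j) * nc Q.[node R n j].
    by rewrite mulrA /W -expRD ReD mulrDr mulrA.
  apply: powR_le_add => //; rewrite ?mulr_ge0 ?nc_ge0 ?(ltW Bk0) ?(ltW e0) //.
  have : nc Q.[node R n j] <= nc (ph (pt j)) + e.
    rewrite -lerBlDl (le_trans (ler_ncB _ _)) // QE ncB hj //.
  move=> /(ler_wpM2l (W0 (pt j))) /le_trans; apply; rewrite mulrDr lerD2l ler_wpM2r ?(ltW e0) //.
  exact: Wle.
move: step1 step2; rewrite -/(W z).
by move: (W z * _) => x1; lra.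
Qed.

(** For n > 2 the squares of the nodes also sum to 0; together with Re^2 + Im^2 = 1 this determines
    both second moments. *)
Lemma node_sum_ReIm n : (2 < n)%N ->
  [/\ \sum_(j < n) complex.Re (node R n j) = 0, \sum_(j < n) complex.Im (node R n j) = 0,
      \sum_(j < n) complex.Re (node R n j) ^+ 2 = n%:R / 2 &
      \sum_(j < n) complex.Im (node R n j) ^+ 2 = n%:R / 2].
Proof.
move=> n2; have n1 : (0 < 1 < n)%N by rewrite (ltn_trans _ n2).
have h1 := node_sum_pow n1; have h2 := @node_sum_pow n 2 n2.
have ReS (f : 'I_n -> R[i]) : complex.Re (\sum_j f j) = \sum_j complex.Re (f j).
  exact: (@raddf_sum (Rcomplex R) R (@complex.Re R)).
have ImS (f : 'I_n -> R[i]) : complex.Im (\sum_j f j) = \sum_j complex.Im (f j).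
  exact: (@raddf_sum (Rcomplex R) R (@complex.Im R)).
have d : \sum_(j < n) complex.Re (node R n j) ^+ 2 - \sum_(j < n) complex.Im (node R n j) ^+ 2 = 0.
  rewrite -sumrB; move: (congr1 (@complex.Re R) h2); rewrite ReS => e; rewrite -[RHS]e.
  by apply: eq_bigr => j _.
have sm : \sum_(j < n) complex.Re (node R n j) ^+ 2 + \sum_(j < n) complex.Im (node R n j) ^+ 2 = n%:R.
  rewrite -big_split /= (eq_bigr (fun=> 1)) ?sumr_const ?card_ord // => j _.
  by rewrite cos2Dsin2.
split.
- by move: (congr1 (@complex.Re R) h1); rewrite ReS.
- by move: (congr1 (@complex.Im R) h1); rewrite ImS.
- by move: d sm; move: (\sum_(j < n) _) (\sum_(j < n) _) => a b; lra.
- by move: d sm; move: (\sum_(j < n) _) (\sum_(j < n) _) => a b; lra.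
Qed.

End roots_of_unity.

(** * The complex exponential *)

Section complex_exponential.
Variable R : realType.
Implicit Types (t s : R) (z w : R[i]).

Definition cexp z : R[i] := (expR (complex.Re z))%:C%C * expi (complex.Im z).

Lemma cexpD z w : cexp (z + w) = cexp z * cexp w.
Proof.
rewrite /cexp; case: z => a b; case: w => a' b' /=.
by rewrite expRD expiD rmorphM /= mulrACA.
Qed.

Lemma cexp0 : cexp 0 = 1.
Proof. by rewrite /cexp /= expR0 expi0 mulr1. Qed.

Lemma nc_cexp z : nc (cexp z) = expR (complex.Re z).
Proof. by rewrite /cexp Normc.normcM nc_expi nc_real mulr1 ger0_norm // expR_ge0. Qed.

(** Componentwise, so that the real mean value theorem applies. *)
Definition cderiv (f : R -> R[i]) (df : R[i]) (t : R) : Prop :=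
  is_derive t 1 (fun s => complex.Re (f s)) (complex.Re df) /\
  is_derive t 1 (fun s => complex.Im (f s)) (complex.Im df).

Lemma ReD z w : complex.Re (z + w) = complex.Re z + complex.Re w.
Proof. by case: z => ? ?; case: w. Qed.

Lemma ImD z w : complex.Im (z + w) = complex.Im z + complex.Im w.
Proof. by case: z => ? ?; case: w. Qed.

Lemma ReM z w : complex.Re (z * w) = complex.Re z * complex.Re w - complex.Im z * complex.Im w.
Proof. by case: z => ? ?; case: w. Qed.

Lemma ImM z w : complex.Im (z * w) = complex.Re z * complex.Im w + complex.Im z * complex.Re w.
Proof. by case: z => ? ?; case: w. Qed.

Lemma cderivD f g df dg t : cderiv f df t -> cderiv g dg t ->
  cderiv (fun s => f s + g s) (df + dg) t.
Proof.
move=> [f1 f2] [g1 g2]; split.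
  rewrite ReD (_ : (fun _ => _) = (fun s => complex.Re (f s)) + (fun s => complex.Re (g s))).
    exact: is_deriveD.
  by apply/funext => s; exact: ReD.
rewrite ImD (_ : (fun _ => _) = (fun s => complex.Im (f s)) + (fun s => complex.Im (g s))).
  exact: is_deriveD.
by apply/funext => s; exact: ImD.
Qed.

Lemma cderivM f g df dg t : cderiv f df t -> cderiv g dg t ->
  cderiv (fun s => f s * g s) (df * g t + f t * dg) t.
Proof.
move=> [f1 f2] [g1 g2]; split.
  rewrite (_ : (fun _ => _) = (fun s => complex.Re (f s)) * (fun s => complex.Re (g s)) -
     (fun s => complex.Im (f s)) * (fun s => complex.Im (g s))).
    by apply: is_derive_eq; rewrite /GRing.scale /= ReD !ReM; ring.
  by apply/funext => s; exact: ReM.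
rewrite (_ : (fun _ => _) = (fun s => complex.Re (f s)) * (fun s => complex.Im (g s)) +
     (fun s => complex.Im (f s)) * (fun s => complex.Re (g s))).
  by apply: is_derive_eq; rewrite /GRing.scale /= ImD !ImM; ring.
by apply/funext => s; exact: ImM.
Qed.

Lemma cderiv_cst c t : cderiv (fun=> c) 0 t.
Proof. by split; exact: is_derive_cst. Qed.

Lemma cderiv_linear c t : cderiv (fun s => s%:C%C * c) c t.
Proof.
case: c => a b; split.
  rewrite (_ : (fun _ => _) = a *: id).
    by apply: is_derive_eq; rewrite /GRing.scale /= mulr1.
  by apply/funext => s /=; rewrite mul0r subr0 mulrC.
rewrite (_ : (fun _ => _) = b *: id).
  by apply: is_derive_eq; rewrite /GRing.scale /= mulr1.
by apply/funext => s /=; rewrite mul0r addr0 mulrC.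
Qed.

Lemma cderivX c n t : cderiv (fun s => (s%:C%C * c) ^+ n) (n%:R * c * (t%:C%C * c) ^+ n.-1) t.
Proof.
elim: n => [|n IH].
  by rewrite !mul0r; exact: cderiv_cst.
have := cderivM (cderiv_linear c t) IH.
rewrite (_ : (fun s => _) = (fun s => (s%:C%C * c) ^+ n.+1)); last first.
  by apply/funext => s; rewrite exprS.
rewrite (_ : _ + _ = n.+1%:R * c * (t%:C%C * c) ^+ n.+1.-1) //=.
case: n {IH} => [|n] /=; first by rewrite !mul0r mulr0 addr0 mul1r.
rewrite [in LHS]exprS exprS -(natr1 n.+1); ring.
Qed.

Lemma is_derive_dilation (f : R -> R) a t df : is_derive (a * t) 1 f df ->
  is_derive t 1 (fun s => f (a * s)) (a * df).
Proof.
move=> hf; rewrite mulrC; apply: (@is_derive1_comp R f ( *%R a)).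
rewrite (_ : *%R a = a *: id); last by apply/funext.
by apply: is_derive_eq; rewrite /GRing.scale /= mulr1.
Qed.

Lemma cderiv_cexp c t : cderiv (fun s => cexp (s%:C%C * c)) (c * cexp (t%:C%C * c)) t.
Proof.
case: c => a b.
have e s : cexp (s%:C%C * (a +i* b)%C) = (expR (a * s) * cos (b * s) +i* (expR (a * s) * sin (b * s)))%C.
  by rewrite /cexp /= !mul0r subr0 addr0 ![s * _]mulrC; congr (_ +i* _)%C; ring.
split.
  rewrite (_ : (fun _ => _) = (fun s => expR (a * s)) * (fun s => cos (b * s))); last first.
    by apply/funext => s; rewrite e.
  have h1 : is_derive t 1 (fun s => expR (a * s)) (a * expR (a * t)).
    exact: is_derive_dilation.
  have h2 : is_derive t 1 (fun s => cos (b * s)) (b * - sin (b * t)).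
    exact: is_derive_dilation.
  apply: is_derive_eq; rewrite e /GRing.scale /=; ring.
rewrite (_ : (fun _ => _) = (fun s => expR (a * s)) * (fun s => sin (b * s))); last first.
  by apply/funext => s; rewrite e.
have h1 : is_derive t 1 (fun s => expR (a * s)) (a * expR (a * t)).
  exact: is_derive_dilation.
have h2 : is_derive t 1 (fun s => sin (b * s)) (b * cos (b * t)).
  exact: is_derive_dilation.
apply: is_derive_eq; rewrite e /GRing.scale /=; ring.
Qed.

(** The mean value theorem is used on the real and the imaginary part separately; hence the factor
    2. *)
Lemma cderiv_bound (f df : R -> R[i]) (B : R) : (forall t, cderiv f (df t) t) ->
  (forall t, 0 <= t <= 1 -> nc (df t) <= B) -> nc (f 1 - f 0) <= 2 * B.
Proof.
move=> hf hB.
have dc (g : R -> R) (dg : R -> R) : (forall t, is_derive t 1 g (dg t)) ->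
   (forall t, 0 <= t <= 1 -> `|dg t| <= B) -> `|g 1 - g 0| <= B.
  move=> hg hb.
  have [|c /andP[c0 c1] ->] := @MVT_segment R g dg 0 1 ler01 (fun t _ => hg t).
  - apply: continuous_subspaceT => x; apply: differentiable_continuous.
    by apply/derivable1_diffP; case: (hg x).
  - by rewrite subr0 mulr1; apply: hb; move: c0 c1; rewrite !bnd_simp => -> ->.
apply: (le_trans (nc_leD _)); rewrite mulr_natl mulr2n; apply: lerD.
  rewrite (_ : complex.Re _ = complex.Re (f 1) - complex.Re (f 0)).
    apply: (dc (fun t => complex.Re (f t)) (fun t => complex.Re (df t))); first by move=> t; case: (hf t).
    by move=> t t01; apply: (le_trans (nc_Re _)); exact: hB.
  by case: (f 1) => ? ?; case: (f 0).
rewrite (_ : complex.Im _ = complex.Im (f 1) - complex.Im (f 0)).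
  apply: (dc (fun t => complex.Im (f t)) (fun t => complex.Im (df t))); first by move=> t; case: (hf t).
  by move=> t t01; apply: (le_trans (nc_Im _)); exact: hB.
by case: (f 1) => ? ?; case: (f 0).
Qed.

Lemma cexp_taylor_deriv w n t :
  cderiv (fun s => cexp (s%:C%C * (- w)) * \sum_(k < n.+1) (s%:C%C * w) ^+ k / (k`!)%:R)
    (cexp (t%:C%C * (- w)) * (- w) * ((t%:C%C * w) ^+ n / (n`!)%:R)) t.
Proof.
pose S n s := \sum_(k < n) (s%:C%C * w) ^+ k / (k`!)%:R.
have hS k : cderiv (S k.+1) (w * S k t) t.
  elim: k => [|k IH].
    rewrite (_ : S 1%N = fun=> 1) ?{1}/S ?big_ord0 ?mulr0; first exact: cderiv_cst.
    by apply/funext => s; rewrite /S big_ord1 expr0 fact0 divr1.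
  rewrite (_ : S k.+2 = fun s => S k.+1 s + (s%:C%C * w) ^+ k.+1 * (k.+1`!)%:R^-1); last first.
    by apply/funext => s; rewrite /S big_ord_recr.
  have := cderivD IH (cderivM (cderivX w k.+1 t) (cderiv_cst ((k.+1`!)%:R^-1) t)).
  rewrite (_ : w * S k t + _ = w * S k.+1 t) // mulr0 addr0 /S big_ord_recr /= mulrDr; congr (_ + _).
  rewrite factS natrM invfM; have : k.+1%:R != 0 :> R[i] by rewrite pnatr_eq0.
  by move=> k0; rewrite mulrCA !mulrA; congr (_ * _); field.
have := cderivM (cderiv_cexp (- w) t) (hS n).
rewrite (_ : _ + _ = cexp (t%:C%C * (- w)) * (- w) * ((t%:C%C * w) ^+ n / (n`!)%:R)) //.
rewrite /S big_ord_recr /=; ring.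
Qed.

(* Differentiating exp(-tw) times the Taylor polynomial telescopes, so one mean
   value estimate replaces an induction on the order of the remainder. *)
Lemma cexp_remainder w (c : R) n : nc w <= c ->
  nc (cexp w - \sum_(k < n) w ^+ k / (k`!)%:R) <= 2 * 2 ^- n * expR (6 * c).
Proof.
move=> wc; have c0 : 0 <= c := le_trans (nc_ge0 _) wc.
have ec : expR (complex.Re w) <= expR c.
  by rewrite ler_expR (le_trans (ler_norm _)) // (le_trans (nc_Re _)).
case: n => [|n].
  rewrite big_ord0 subr0 nc_cexp expr0 invr1 mulr1 (le_trans ec) //.
  apply: (@le_trans _ _ (expR (6 * c))); first by rewrite ler_expR; lra.
  by rewrite ler_peMl ?expR_ge0 // ler1n.
have fact0 k : (0 : R) < (k`!)%:R by rewrite ltr0n fact_gt0.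
(* The left side is (n+1) 4^(-n-1) times a term of the series of exp(4 c), and n + 1 <= 2^(n+1)
   takes one of the two factors 2^(-n-1). *)
have key : c ^+ n.+1 / (n`!)%:R <= 2 ^- n.+1 * expR (4 * c).
  have : (4 * c) ^+ n.+1 / (n.+1`!)%:R <= expR (4 * c).
    have h : 0 <= 4 * c by rewrite mulr_ge0.
    by apply: le_trans (expR_ge1Dxn n h); rewrite lerDr.
  move=> h.
  have -> : c ^+ n.+1 / (n`!)%:R = n.+1%:R * (2 ^- n.+1 * 2 ^- n.+1) * ((4 * c) ^+ n.+1 / (n.+1`!)%:R).
    rewrite exprMn (_ : 4 = 2 * 2 :> R); last by rewrite -natrM.
    rewrite exprMn factS natrM; field.
    by rewrite nat1r !pnatr_eq0 -lt0n fact_gt0 /= expf_neq0 // pnatr_eq0.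
  apply: ler_pM => //; rewrite ?mulr_ge0 ?invr_ge0 ?exprn_ge0 ?mulr_ge0 //.
  rewrite mulrA ler_piMl ?invr_ge0 ?exprn_ge0 // ler_pdivrMr ?exprn_gt0 // mul1r.
  by rewrite -natrX ler_nat ltnW // ltn_expl.
pose f t := cexp (t%:C%C * (- w)) * \sum_(k < n.+1) (t%:C%C * w) ^+ k / (k`!)%:R.
have hb := @cderiv_bound f _ (expR c * (2 ^- n.+1 * expR (4 * c))) (cexp_taylor_deriv w n).
have {hb} : nc (f 1 - f 0) <= 2 * (expR c * (2 ^- n.+1 * expR (4 * c))).
  apply: hb => t /andP[t0 t1].
  have tw : nc (t%:C%C * w) <= c.
    by rewrite Normc.normcM nc_real ger0_norm // (le_trans _ wc) // ler_piMl // nc_ge0.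
  rewrite Normc.normcM [nc (_ * - w)]Normc.normcM nc_cexp ncN -mulrA; apply: ler_pM; rewrite ?expR_ge0 ?mulr_ge0 ?nc_ge0 //.
    rewrite ler_expR (le_trans (ler_norm _)) // (le_trans (nc_Re _)) //.
    by rewrite mulrN ncN.
  apply: (le_trans _ key); rewrite exprS -mulrA.
  apply: ler_pM; rewrite ?mulr_ge0 ?nc_ge0 //.
  rewrite Normc.normcM; have -> : nc ((n`!)%:R^-1) = (n`!)%:R^-1 :> R.
    by rewrite -(rmorph_nat (real_complex R)) -fmorphV nc_real ger0_norm // invr_ge0 ler0n.
  rewrite ncX ler_wpM2r ?invr_ge0 ?ler0n //.
  by apply: lerXn2r; rewrite ?nnegrE ?nc_ge0.
have -> : f 0 = 1.
  rewrite /f rmorph0 !mul0r cexp0 mul1r big_ord_recl /= expr0 divr1 big1 ?addr0 //.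
  by move=> i _; rewrite expr0n /= mul0r.
have -> : cexp w - \sum_(k < n.+1) w ^+ k / (k`!)%:R = - cexp w * (f 1 - 1).
  rewrite /f rmorph1 !mul1r mulrBr mulrA mulNr -cexpD subrr cexp0 mulNr mul1r mulr1.
  by rewrite opprK addrC.
move=> h; rewrite Normc.normcM ncN nc_cexp.
apply: (@le_trans _ _ (expR c * (2 * (expR c * (2 ^- n.+1 * expR (4 * c)))))).
  by apply: ler_pM; rewrite ?expR_ge0 ?nc_ge0.
rewrite (_ : 6 * c = c + (c + 4 * c)); last by ring.
rewrite !expRD; by rewrite (_ : expR c * _ = 2 * 2 ^- n.+1 * (expR c * (expR c * expR (4 * c)))) //; ring.
Qed.

End complex_exponential.

(** * Complex powers are admissible *)

Lemma cvg_within0P (R : realType) (A : set R[i]) (N : R[i] -> R) (z0 : R[i]) :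
  (N z @[z --> within A (nbhs (z0 : R[i]^o))] --> (0 : R)) <->
  forall e, 0 < e -> exists2 del, 0 < del & forall z, A z -> nc (z - z0) < del -> `|N z| < e.
Proof.
split=> [/cvgrPdist_lt H e e0|H].
  have := H e e0; rewrite near_withinE => /nbhs_ballP[[a b] /= ab0 hab].
  (* The radius of a ball in R[i] is itself complex; its positivity makes it real. *)
  move: ab0; rewrite ltcE /= => /andP[/eqP b0 a0].
  exists a => // z Az zz; have := hab z; rewrite sub0r normrN; apply => //.
  rewrite -ball_normE /= distrC normC_nc b0.
  by rewrite (lt_nc_real _ a).
apply/cvgrPdist_lt => e e0; have [del d0 hd] := H e e0.
rewrite near_withinE; apply/nbhs_ballP; exists (del%:C%C) => /=; first by rewrite ltcR.
move=> z; rewrite -ball_normE /= distrC lt_nc_real => zz Az.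
by rewrite sub0r normrN; exact: hd.
Qed.

Lemma cvg_at0P (R : realType) (N : R -> R) (t0 : R) :
  (N t @[t --> t0] --> (0 : R)) <->
  forall e, 0 < e -> exists2 del, 0 < del & forall t, `|t - t0| < del -> `|N t| < e.
Proof.
split=> [/cvgrPdist_lt H e e0|H].
  have /nbhs_ballP[a /= a0 ha] := H e e0.
  by exists a => // t tt; have := ha t; rewrite sub0r normrN; apply; rewrite -ball_normE /= distrC.
apply/cvgrPdist_lt => e e0; have [del d0 hd] := H e e0.
apply/nbhs_ballP; exists del => //= t /=; rewrite distrC => tt.
by rewrite sub0r normrN; exact: hd.
Qed.

Lemma exp2_small (R : realType) (e C : R) : 0 < e -> 0 <= C -> exists N, 2 ^- N * C < e.
Proof.
move=> e0 C0; exists (Num.Def.truncn (C / e)).+1; rewrite mulrC ltr_pdivrMr ?exprn_gt0 //.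
rewrite mulrC -ltr_pdivrMr //; apply: (lt_le_trans (truncnS_gt _)).
by rewrite -natrX ler_nat ltnW // ltn_expl.
Qed.

Section powers_interpolation.
Context d (T : measurableType d) (R : realType).
Variable m : {measure set T -> \bar R}.
Variables (Y0 Y1 : fspace T R) (K : R).
Hypothesis hY0 : qlat m Y0 K.
Hypothesis hY1 : qlat m Y1 K.
Let K1 : 1 <= K. Proof. by case: hY0. Qed.
Let K0 : 0 < K. Proof. exact: lt_le_trans K1. Qed.

Variables (ph : T -> R[i]) (g0 g1 Lam : T -> R) (r : R).
Hypothesis Lph : @L0 d T R ph.
Hypothesis ph1 : forall x, nc (ph x) <= 1.
Hypothesis mg0 : measurable_fun setT g0.
Hypothesis mLam : measurable_fun setT Lam.
Hypothesis g00 : forall x, 0 <= g0 x.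
Hypothesis g1E : forall x, g1 x = g0 x * expR (Lam x).
Hypothesis Yg0 : dom m Y0 g0 r.
Hypothesis Yg1 : dom m Y1 g1 r.
(** A substitute for boundedness of Lam: discarding the points where |Lam| is large costs little in
    both spaces. *)
Hypothesis tails : forall e, 0 < e -> exists L : R,
  dom m Y0 (cut [set x | L < `|Lam x|] g0) e /\ dom m Y1 (cut [set x | L < `|Lam x|] g1) e.

(** This is ph g0^(1-z) g1^z, as g1 = g0 exp(Lam); the form with Lam avoids complex powers of 0. *)
Definition power_fun (z : R[i]) (x : T) : R[i] := ph x * (g0 x)%:C%C * cexp (z * (Lam x)%:C%C).
Notation F := power_fun.

Let g10 x : 0 <= g1 x. Proof. by rewrite g1E mulr_ge0 ?expR_ge0. Qed.

Lemma Re_mul_real z (t : R) : complex.Re (z * t%:C%C) = complex.Re z * t.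
Proof. by case: z => a b /=; rewrite mulr0 subr0. Qed.

Lemma measurable_expR_comp (u : T -> R) : measurable_fun setT u ->
  measurable_fun setT (fun x => expR (u x)).
Proof. by move=> mu; apply: (measurableT_comp _ mu); apply: continuous_measurable_fun; exact: continuous_expR. Qed.

Lemma L0_power_fun z : @L0 d T R (F z).
Proof.
case: z => a b; apply: L0M; first by apply: L0M => //; exact: L0_real.
have mRe (c : R) : measurable_fun setT (fun x => c * Lam x) by exact: measurable_funM.
rewrite (_ : (fun x => _) = fun x => (expR (a * Lam x))%:C%C * expi (b * Lam x)).
  apply: L0M; first by apply: L0_real; exact: measurable_expR_comp.
  split=> /=; apply: (measurableT_comp _ (mRe b)); apply: continuous_measurable_fun.
    exact: continuous_cos.
  exact: continuous_sin.
by apply/funext => x; rewrite /cexp /= !mulr0 subr0 add0r.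
Qed.

Lemma nc_power_fun z x : nc (F z x) <= g0 x * expR (complex.Re z * Lam x).
Proof.
rewrite /power_fun Normc.normcM [nc (ph x * _)]Normc.normcM nc_cexp nc_real ger0_norm //.
rewrite Re_mul_real ler_wpM2r ?expR_ge0 // ler_piMl //.
Qed.

Lemma expR_interp (a l : R) : 0 <= a <= 1 -> expR (a * l) <= 1 + expR l.
Proof.
move=> /andP[a0 a1]; have [l0|l0] := leP 0 l.
  apply: (@le_trans _ _ (expR l)); first by rewrite ler_expR ler_piMl.
  by rewrite lerDr.
apply: (@le_trans _ _ 1); last by rewrite lerDl expR_ge0.
by rewrite -expR0 ler_expR mulr_ge0_le0 // ltW.
Qed.

Lemma power_fun_strip z x : closed_strip z -> nc (F z x) <= g0 x + g1 x.
Proof.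
move=> hz; apply: (le_trans (nc_power_fun _ _)).
rewrite g1E -{2}[g0 x]mulr1 -mulrDr ler_wpM2l //; exact: expR_interp.
Qed.

Lemma power_fun_sum z : closed_strip z ->
  sum_space m Y0 Y1 (F z) /\ fs_norm (sum_space m Y0 Y1) (F z) <= r + r.
Proof.
move=> hz; apply: (sum_space_mem hY0 hY1 (L0_power_fun z) Yg0 Yg1).
by apply: aeW => x; rewrite !ger0_norm //; exact: power_fun_strip.
Qed.

Lemma cexp_sub1 w (c : R) : nc w <= c -> nc (cexp w - 1) <= 2 * c * expR c.
Proof.
move=> wc; have c0 : 0 <= c := le_trans (nc_ge0 _) wc.
have := @cderiv_bound R (fun t => cexp (t%:C%C * w)) (fun t => w * cexp (t%:C%C * w)) (c * expR c)
  (cderiv_cexp w).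
rewrite rmorph0 rmorph1 mul0r mul1r cexp0 mulrA; apply => t /andP[t0 t1].
rewrite Normc.normcM nc_cexp ler_pM ?nc_ge0 ?expR_ge0 // ler_expR.
apply: (le_trans (ler_norm _)); apply: (le_trans (nc_Re _)).
by rewrite Normc.normcM nc_real ger0_norm // (le_trans _ wc) // ler_piMl // nc_ge0.
Qed.

(** Where |Lam| <= L, the function is Lipschitz in z with a constant depending on L; elsewhere the
    crude bound 2 G is used. *)
Lemma power_fun_diff z z' (L del G : R) x : 0 <= L -> 0 <= del -> nc (z' - z) <= del ->
  nc (F z x) <= G -> nc (F z' x) <= G ->
  nc (F z' x - F z x) <= 2 * (del * L) * expR (del * L) * G + 2 * cut [set x | L < `|Lam x|] (fun=> G) x.
Proof.
move=> L0 d0 zz Fz Fz'; have G0 : 0 <= G := le_trans (nc_ge0 _) Fz.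
have [LL|LL] := ltP L `|Lam x|.
  rewrite cutT //; apply: (le_trans (ler_ncD _ _)); rewrite ncN.
  apply: (@le_trans _ _ (2 * G)); first by rewrite mulr_natl mulr2n lerD.
  by rewrite lerDr mulr_ge0 ?mulr_ge0 ?expR_ge0.
rewrite cutF; last by rewrite /=; move: LL; rewrite leNgt => /negP.
rewrite mulr0 addr0.
have -> : F z' x - F z x = (cexp ((z' - z) * (Lam x)%:C%C) - 1) * F z x.
  rewrite /power_fun -{1}(subrK z z') mulrDl cexpD; ring.
rewrite Normc.normcM ler_pM ?nc_ge0 //; apply: cexp_sub1.
by rewrite Normc.normcM nc_real ler_pM ?nc_ge0.
Qed.

(** One pair of majorants works for all nearby z and z', and serves both the continuity on the
    closed strip and the two traces, each of which must be estimated in a single space. *)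
Lemma power_fun_modulus e : 0 < e -> exists2 del, 0 < del & exists H0 H1 : T -> R,
  [/\ dom m Y0 H0 e, dom m Y1 H1 e, forall x, 0 <= H0 x, forall x, 0 <= H1 x &
   forall z z' x, nc (z' - z) < del ->
    [/\ closed_strip z -> closed_strip z' -> nc (F z' x - F z x) <= H0 x + H1 x,
       complex.Re z = 0 -> complex.Re z' = 0 -> nc (F z' x - F z x) <= H0 x &
       complex.Re z = 1 -> complex.Re z' = 1 -> nc (F z' x - F z x) <= H1 x]].
Proof.
move=> e0; have r0 : 0 <= r := dom_ge0 hY0 Yg0.
pose e' := e / (4 * K).
have e'0 : 0 < e' by rewrite divr_gt0 // mulr_gt0.
have [L' [t0 t1]] := tails e'0.
pose L := Num.max L' 1.
have L1 : 1 <= L by rewrite le_max lexx orbT.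
have L0 : 0 < L by exact: lt_le_trans L1.
have LL : [set x | L < `|Lam x|] `<=` [set x | L' < `|Lam x|].
  by move=> x /=; apply: le_lt_trans; rewrite le_max lexx.
have {}t0 := dom_cutS LL t0; have {}t1 := dom_cutS LL t1.
have e1 : 0 < expR 1 :> R by exact: expR_gt0.
(* del L <= 1 bounds the exponential in [power_fun_diff] by exp 1, and the second term makes the
   Lipschitz part at most e'. *)
pose del := Num.min L^-1 (e' / (2 * L * expR 1 * (r + 1))).
have r1 : 0 < r + 1 by lra.
have D0 : 0 < 2 * L * expR 1 * (r + 1) by rewrite !mulr_gt0.
have d0 : 0 < del by rewrite lt_min invr_gt0 L0 divr_gt0.
have dL : del * L <= 1.
  by rewrite -ler_pdivlMr // mul1r ge_min lexx.
pose c := 2 * (del * L) * expR (del * L).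
have c0 : 0 <= c by rewrite !mulr_ge0 ?expR_ge0 // ltW.
have cr : c * r <= e'.
  apply: (@le_trans _ _ (del * (2 * L * expR 1 * (r + 1)))).
    rewrite /c (_ : 2 * (del * L) * expR (del * L) * r = del * (2 * L * (expR (del * L) * r))); last by ring.
    rewrite ler_wpM2l ?(ltW d0) // -(mulrA (2 * L)) ler_wpM2l ?mulr_ge0 ?(ltW L0) //.
    by apply: ler_pM; rewrite ?expR_ge0 ?ler_expR //; lra.
  by rewrite -ler_pdivlMr // ge_min lexx orbT.
pose E := [set x | L < `|Lam x|].
pose H (g : T -> R) x := `|c * g x| + `|2 * cut E g x|.
have hH Y (hY : qlat m Y K) g : dom m Y g r -> dom m Y (cut E g) e' -> dom m Y (H g) e.
  move=> h1 h2; have := dom_add hY (dom_scale hY c h1) (dom_scale hY 2 h2).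
  move/dom_ler; apply; rewrite !ger0_norm //.
  apply: (@le_trans _ _ (K * (e' + 2 * e'))); first by rewrite ler_pM2l // lerD2r.
  have -> : e = K * (4 * e') by rewrite /e'; field; rewrite gt_eqF.
  rewrite ler_pM2l //; lra.
have HE g x : (forall x, 0 <= g x) -> H g x = c * g x + 2 * cut E g x.
  move=> g_0; have cg := @cut_ge0 _ _ _ E g x g_0.
  by rewrite /H (ger0_norm (mulr_ge0 c0 (g_0 x))) ger0_norm // mulr_ge0.
exists del => //; exists (H g0), (H g1); split.
- exact: hH.
- exact: hH.
- by move=> x; rewrite addr_ge0.
- by move=> x; rewrite addr_ge0.
move=> z z' x /ltW zz; rewrite (HE g0) // (HE g1) //.
have key (g : T -> R) : nc (F z x) <= g x -> nc (F z' x) <= g x ->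
   nc (F z' x - F z x) <= c * g x + 2 * cut E g x.
  move=> h1 h2; apply: (le_trans (power_fun_diff (ltW L0) (ltW d0) zz h1 h2)).
  by rewrite /cut.
split=> hz hz'.
- have := key (fun x => g0 x + g1 x) (power_fun_strip x hz) (power_fun_strip x hz').
  move=> /le_trans; apply; rewrite mulrDr /cut; case: ifP => _; lra.
- by apply: key; apply: (le_trans (nc_power_fun _ _)); rewrite ?hz ?hz' mul0r expR0 mulr1.
- by apply: key; apply: (le_trans (nc_power_fun _ _)); rewrite ?hz ?hz' mul1r -g1E.
Qed.

Lemma sum_space_ge0 f : sum_space m Y0 Y1 f -> 0 <= fs_norm (sum_space m Y0 Y1) f.
Proof.
move=> [Lf [f0 [f1 [Yf0 Yf1 fE]]]]; apply: lb_le_inf; first by exists (fs_norm Y0 f0 + fs_norm Y1 f1), f0, f1.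
move=> _ [h0 [h1 [Yh0 Yh1 _ ->]]].
by rewrite addr_ge0 // (fs_norm_ge0 hY0, fs_norm_ge0 hY1).
Qed.

Lemma power_fun_analytic : analytic_on_strip (sum_space m Y0 Y1) F.
Proof.
have r0 : 0 <= r := dom_ge0 hY0 Yg0.
split=> [z hz|z0 /andP[a0 a1]].
  by case: (@power_fun_sum z); rewrite // /closed_strip /=; move/andP: hz => [? ?]; rewrite !ltW.
set a := complex.Re z0 in a0 a1 *.
(* Both a + rho and a - rho lie in [0, 1], so F z0 times exp(rho |Lam|) is still dominated by g0 +
   g1. *)
pose rho := Num.min a (1 - a).
have rho0 : 0 < rho by rewrite lt_min a0 subr_gt0.
have bnd l : expR (a * l + rho * `|l|) <= 1 + expR l.
  have ra : rho <= a by rewrite ge_min lexx.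
  have r1a : rho <= 1 - a by rewrite ge_min lexx orbT.
  have [l0|l0] := leP 0 l; first by rewrite (ger0_norm l0) -mulrDl expR_interp //; apply/andP; split; lra.
  by rewrite (ltr0_norm l0) mulrN -mulNr -mulrDl expR_interp //; apply/andP; split; lra.
have hb x c : c <= rho * `|Lam x| -> nc (F z0 x) * expR c <= g0 x + g1 x.
  move=> hc; apply: (@le_trans _ _ (g0 x * expR (a * Lam x) * expR (rho * `|Lam x|))).
    by apply: ler_pM; rewrite ?nc_ge0 ?expR_ge0 ?nc_power_fun ?ler_expR.
  rewrite -mulrA -expRD g1E -[X in _ <= X + _]mulr1 -mulrDr ler_wpM2l //.
(* [cexp_remainder] carries exp(6 c), here with c = (rho / 6) |Lam|: exactly the exponential that
   [hb] can afford. *)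
exists (rho / 6); split; first by rewrite divr_gt0 //= ltr_pdivrMr // ltr_pMr // ltr1n.
pose al k (x : T) : R[i] := F z0 x * ((Lam x)%:C%C ^+ k / (k`!)%:R).
have pe (y : R) k : 0 <= y -> y ^+ k / (k`!)%:R <= expR y.
  move=> y0; case: k => [|k].
    by rewrite expr0 fact0 divr1 (le_trans _ (expR_ge1Dx _)) // lerDl.
  by apply: le_trans (expR_ge1Dxn k y0); rewrite lerDr.
have nck k x : nc ((Lam x)%:C%C ^+ k / (k`!)%:R : R[i]) = `|Lam x| ^+ k / (k`!)%:R.
  rewrite Normc.normcM ncX nc_real -(rmorph_nat (real_complex R)) -fmorphV nc_real [`|_^-1|]ger0_norm //.
have Lal k : @L0 d T R (al k).
  apply: L0M; first exact: L0_power_fun.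
  rewrite (_ : (fun x => _) = (fun x => (Lam x ^+ k / (k`!)%:R)%:C%C)).
    by apply: L0_real; apply: measurable_funM => //; exact: measurable_funX.
  by apply/funext => x; rewrite rmorphM rmorphXn /= fmorphV /= rmorph_nat.
exists al.
  move=> k; have rk : 0 <= rho ^- k by rewrite invr_ge0 exprn_ge0 // ltW.
  have [] // := sum_space_mem hY0 hY1 (Lal k) (dom_scale hY0 (rho ^- k) Yg0) (dom_scale hY1 (rho ^- k) Yg1).
  apply: aeW => x; rewrite !ger0_norm ?mulr_ge0 // -mulrDr Normc.normcM nck.
  rewrite ler_pdivlMl ?exprn_gt0 // (_ : rho ^+ k * (nc (F z0 x) * (`|Lam x| ^+ k / (k`!)%:R)) = nc (F z0 x) * ((rho * `|Lam x|) ^+ k / (k`!)%:R)); last first.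
    by rewrite exprMn; ring.
  apply: le_trans (hb x (rho * `|Lam x|) _) => //.
  by rewrite ler_wpM2l ?nc_ge0 // pe // mulr_ge0 // ltW.
move=> z; rewrite lt_nc_real => zz.
have hz : closed_strip z.
  have := le_lt_trans (nc_Re (z - z0)) zz; rewrite (_ : complex.Re _ = complex.Re z - a); last first.
    by rewrite /a; case: (z) => ? ?; case: (z0).
  rewrite ltr_norml /closed_strip /=; have : rho <= a by rewrite ge_min lexx.
  have : rho <= 1 - a by rewrite ge_min lexx orbT.
  by move=> ? ? /andP[? ?]; apply/andP; split; lra.
apply/cvg0_seqP => e e0.
have [N hN] : exists N, 2 ^- N * (4 * (r + 1)) < e.
  by apply: exp2_small; rewrite // mulr_ge0 // addr_ge0.
exists N => n Nn.
have p0 : 0 <= 2 * 2 ^- n :> R by rewrite mulr_ge0 // invr_ge0 exprn_ge0.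
have Ls : @L0 d T R (\sum_(k < n) (z - z0) ^+ k *: al k - F z).
  rewrite fct_sumE; apply: (@L0B _ _ _ (fun x => \sum_(k < n) (z - z0) ^+ k * al k x)); last exact: L0_power_fun.
  by apply: L0_sum => k _; apply: L0M => //; exact: L0_cst.
have [|Sm Sn] := sum_space_mem hY0 hY1 Ls (dom_scale hY0 (2 * 2 ^- n) Yg0) (dom_scale hY1 (2 * 2 ^- n) Yg1).
  apply: aeW => x; rewrite !ger0_norm ?mulr_ge0 // -mulrDr.
  have -> : (\sum_(k < n) (z - z0) ^+ k *: al k - F z) x =
     - (F z0 x * (cexp ((z - z0) * (Lam x)%:C%C) - \sum_(k < n) ((z - z0) * (Lam x)%:C%C) ^+ k / (k`!)%:R)).
    rewrite fct_sumE mulrBr opprB; congr (_ - _).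
      rewrite mulr_sumr; apply: eq_bigr => k _.
      rewrite exprMn [LHS](_ : _ = (z - z0) ^+ k * (F z0 x * ((Lam x)%:C%C ^+ k / (k`!)%:R))) //.
      by rewrite mulrCA !mulrA.
    by rewrite /power_fun -[in LHS](subrK z0 z) mulrDl cexpD; ring.
  rewrite ncN Normc.normcM.
  have hc : nc ((z - z0) * (Lam x)%:C%C) <= rho / 6 * `|Lam x|.
    by rewrite Normc.normcM nc_real ler_wpM2r // ltW.
  apply: (le_trans (ler_wpM2l (nc_ge0 _) (cexp_remainder n hc))).
  rewrite mulrCA ler_wpM2l //; apply: hb.
  by rewrite mulrA mulrCA divff ?mulr1 // pnatr_eq0.
rewrite ger0_norm; last exact: sum_space_ge0.
apply: (le_lt_trans Sn); rewrite !ger0_norm //; apply: le_lt_trans hN.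
have h2 : 2 ^- n <= 2 ^- N :> R.
  by rewrite lef_pV2 ?posrE ?exprn_gt0 // ler_eXn2l // ltr1n.
apply: (@le_trans _ _ (2 ^- n * (4 * (r + 1)))); last by rewrite ler_wpM2r //; lra.
have : 0 <= 2 ^- n :> R by rewrite invr_ge0 exprn_ge0.
by nra.
Qed.

Lemma power_fun_admissible : admissible m Y0 Y1 F /\ admissible_norm m Y0 Y1 F <= r + r.
Proof.
have r0 : 0 <= r := dom_ge0 hY0 Yg0.
have cl z : strip z -> closed_strip z by move=> /andP[? ?]; apply/andP; split; exact: ltW.
have Y0F t : Y0 (F (0 +i* t)%C) /\ fs_norm Y0 (F (0 +i* t)%C) <= r.
  apply: (dom_mem hY0 Yg0 (L0_power_fun _)); apply: aeW => x.
  by apply: (le_trans (nc_power_fun _ _)); rewrite /= mul0r expR0 mulr1 ler_norm.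
have Y1F t : Y1 (F (1 +i* t)%C) /\ fs_norm Y1 (F (1 +i* t)%C) <= r.
  apply: (dom_mem hY1 Yg1 (L0_power_fun _)); apply: aeW => x.
  by apply: (le_trans (nc_power_fun _ _)); rewrite /= mul1r -g1E ler_norm.
split; first split.
- exact: power_fun_analytic.
- by exists (r + r) => z /cl/power_fun_sum[].
- split=> [z /power_fun_sum[]//|z0 hz0]; apply/cvg_within0P => e e0.
  have e4 : 0 < e / 4 by rewrite divr_gt0.
  have [del d0 [H0 [H1 [YH0 YH1 H00 H10 hH]]]] := power_fun_modulus e4.
  exists del => // z hz zz.
  have [|Sm Sn] := sum_space_mem hY0 hY1 (L0B (L0_power_fun z) (L0_power_fun z0)) YH0 YH1.
    apply: aeW => x; rewrite !ger0_norm //.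
    by have [h _ _] := hH z0 z x zz; exact: h.
  rewrite ger0_norm; last exact: sum_space_ge0.
  by apply: (le_lt_trans Sn); lra.
- split; first by move=> t; case: (Y0F t).
    move=> t0; apply/cvg_at0P => e e0.
    have e2 : 0 < e / 2 by rewrite divr_gt0.
    have [del d0 [H0 [H1 [YH0 YH1 H00 H10 hH]]]] := power_fun_modulus e2.
    exists del => // t tt.
    have [|Sm Sn] := dom_mem hY0 YH0 (L0B (L0_power_fun (0 +i* t)%C) (L0_power_fun (0 +i* t0)%C)).
      apply: aeW => x; rewrite ger0_norm //.
      have [|_ h _] := hH (0 +i* t0)%C (0 +i* t)%C x; last exact: h.
      by rewrite /= oppr0 addr0 expr0n /= add0r sqrtr_sqr.
    rewrite ger0_norm; last exact: (fs_norm_ge0 hY0).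
    by apply: (le_lt_trans Sn); lra.
  by exists r => t; case: (Y0F t).
- split; first by move=> t; case: (Y1F t).
    move=> t0; apply/cvg_at0P => e e0.
    have e2 : 0 < e / 2 by rewrite divr_gt0.
    have [del d0 [H0 [H1 [YH0 YH1 H00 H10 hH]]]] := power_fun_modulus e2.
    exists del => // t tt.
    have [|Sm Sn] := dom_mem hY1 YH1 (L0B (L0_power_fun (1 +i* t)%C) (L0_power_fun (1 +i* t0)%C)).
      apply: aeW => x; rewrite ger0_norm //.
      have [|_ _ h] := hH (1 +i* t0)%C (1 +i* t)%C x; last exact: h.
      by rewrite /= subrr expr0n /= add0r sqrtr_sqr.
    rewrite ger0_norm; last exact: (fs_norm_ge0 hY1).
    by apply: (le_lt_trans Sn); lra.
  by exists r => t; case: (Y1F t).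
rewrite /admissible_norm !ge_max -andbA; apply/and3P; split.
- apply: ge_sup; first by exists (fs_norm Y0 (F (0 +i* 0)%C)), 0.
  by move=> _ [t _ <-]; case: (Y0F t) => _ h; lra.
- apply: ge_sup; first by exists (fs_norm Y1 (F (1 +i* 0)%C)), 0.
  by move=> _ [t _ <-]; case: (Y1F t) => _ h; lra.
- apply: ge_sup.
    exists (fs_norm (sum_space m Y0 Y1) (F (2^-1 +i* 0)%C)), (2^-1 +i* 0)%C => //.
    by rewrite /strip /=; apply/andP; split; lra.
  by move=> _ [z /cl/power_fun_sum[_ h] <-].
Qed.

End powers_interpolation.

Section interpolation_of_products.
Context d (T : measurableType d) (R : realType).
Variable m : {measure set T -> \bar R}.
Variables (Y0 Y1 : fspace T R) (K : R).
Hypothesis hY0 : qlat m Y0 K.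
Hypothesis hY1 : qlat m Y1 K.
Let K1 : 1 <= K. Proof. by case: hY0. Qed.
Let K0 : 0 < K. Proof. exact: lt_le_trans K1. Qed.

Lemma admissible_norm_ge0 F : admissible m Y0 Y1 F -> 0 <= admissible_norm m Y0 Y1 F.
Proof.
move=> [_ _ _ [h0 _ [M hM]] _]; rewrite /admissible_norm le_max; apply/orP; left.
rewrite le_max; apply/orP; left.
apply: (@le_trans _ _ (fs_norm Y0 (F (0 +i* 0)%C))); first exact: (fs_norm_ge0 hY0).
by apply: ub_le_sup; [exists M => _ [t _ <-]|exists 0].
Qed.

Lemma interp_norm_le th f F : admissible m Y0 Y1 F -> F th%:C%C = f %[ae m] ->
  fs_norm (interp m Y0 Y1 th) f <= admissible_norm m Y0 Y1 F.
Proof.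
move=> aF Ff; apply: ge_inf; last by exists F.
by exists 0 => _ [G [aG _] <-]; exact: admissible_norm_ge0.
Qed.

(** The quotient of f by g0 exp(th Lam) has modulus at most 1 a.e. and is put into [ph], so that the
    admissible function takes the value f at th. *)
Lemma power_interp (g0 g1 Lam : T -> R) (r th : R) f :
  measurable_fun setT g0 -> measurable_fun setT Lam -> (forall x, 0 <= g0 x) ->
  (forall x, g1 x = g0 x * expR (Lam x)) -> dom m Y0 g0 r -> dom m Y1 g1 r ->
  (forall e, 0 < e -> exists L : R,
    dom m Y0 (cut [set x | L < `|Lam x|] g0) e /\ dom m Y1 (cut [set x | L < `|Lam x|] g1) e) ->
  @L0 d T R f -> (\forall x \ae m, nc (f x) <= g0 x * expR (th * Lam x)) ->
  interp m Y0 Y1 th f /\ fs_norm (interp m Y0 Y1 th) f <= r + r.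
Proof.
move=> mg0 mLam g00 g1E Yg0 Yg1 tl Lf hf.
pose w x := g0 x * expR (th * Lam x).
have w0 x : 0 <= w x by rewrite mulr_ge0 ?expR_ge0.
have mw : measurable_fun setT w.
  by apply: measurable_funM => //; apply: measurable_expR_comp; exact: measurable_funM.
pose P := [set x | nc (f x) <= w x].
have mP : measurable P.
  rewrite (_ : P = setT `&` (fun x => nc (f x) <= w x) @^-1` [set true]); last by rewrite setTI.
  by apply: measurable_fun_ler => //; exact: measurable_nc.
pose ph x : R[i] := if x \in P then ((w x)^-1)%:C%C * f x else 0.
have Lph : @L0 d T R ph.
  apply: L0_if => //.
  apply: L0M => //; apply: L0_real.
  rewrite (_ : (fun x => _) = (fun x => w x `^ (-1))); first exact: measurable_powRfun.
  by apply/funext => x; rewrite powR_inv1.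
have ph1 x : nc (ph x) <= 1.
  rewrite /ph; case: ifPn => [/set_mem Px|_]; last by rewrite Normc.normc0.
  rewrite Normc.normcM nc_real ger0_norm ?invr_ge0 //.
  have := w0 x; rewrite le_eqVlt => /orP[/eqP <-|w_gt]; first by rewrite invr0 mul0r.
  by rewrite ler_pdivrMl // mulr1.
have [aF Fn] := power_fun_admissible hY0 hY1 Lph ph1 mg0 mLam g00 g1E Yg0 Yg1 tl.
have FE : power_fun ph g0 Lam th%:C%C = f %[ae m].
  apply: filterS hf => x fx _; rewrite /power_fun -mulrA.
  have -> : (g0 x)%:C%C * cexp (th%:C%C * (Lam x)%:C%C) = (w x)%:C%C.
    by rewrite /cexp /w /= !mul0r subr0 mulr0 addr0 expi0 mulr1 -rmorphM.
  rewrite /ph mem_set //; have := w0 x; rewrite le_eqVlt => /orP[/eqP we|w_gt].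
    move: fx; rewrite /= -/(w x) -we mulr0 => fx.
    by apply/esym/eqP; rewrite -nc_eq0 eq_le fx nc_ge0.
  by rewrite mulrAC -rmorphM mulVf ?gt_eqF // rmorph1 mul1r.
split; first by split=> //; exists (power_fun ph g0 Lam).
exact: le_trans (interp_norm_le aF FE) Fn.
Qed.

End interpolation_of_products.

(** * From Calderon products to interpolation spaces *)

Section calderon_to_interp.
Context d (T : measurableType d) (R : realType).
Variable m : {measure set T -> \bar R}.

Lemma ln_ratio_bound (a b L : R) : 0 < a -> 0 < b -> a <= L * b -> b <= L * a ->
  `|ln b - ln a| <= ln L.
Proof.
move=> a0 b0 ab ba.
have L0 : 0 < L by rewrite -(pmulr_lgt0 _ b0); exact: lt_le_trans ab.
rewrite ler_norml; apply/andP; split.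
  have := ab; rewrite -ler_ln ?posrE ?mulr_gt0 // lnM ?posrE //; lra.
have := ba; rewrite -ler_ln ?posrE ?mulr_gt0 // lnM ?posrE //; lra.
Qed.

Lemma expR_ln_ratio (a b : R) : 0 <= a -> 0 <= b -> (a = 0 <-> b = 0) ->
  b = a * expR (ln b - ln a).
Proof.
move=> a0 b0 ab; move: a0; rewrite le_eqVlt => /orP[/eqP ae|a_gt].
  by rewrite -ae mul0r; apply/ab.
have b_gt : 0 < b by rewrite lt_neqAle b0 andbT; apply/eqP => /esym/ab ae; rewrite ae ltxx in a_gt.
by rewrite expRD expRN !lnK ?posrE // mulrCA divff ?mulr1 // gt_eqF.
Qed.

Lemma powR_ln_ratio (a b th : R) : 0 < th < 1 -> 0 <= a -> 0 <= b -> (a = 0 <-> b = 0) ->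
  a `^ (1 - th) * b `^ th = a * expR (th * (ln b - ln a)).
Proof.
move=> /andP[th0 th1] a0 b0 ab.
have [ae|a_ne] := eqVneq a 0.
  by rewrite ae mul0r powR0 ?mul0r // subr_eq0 gt_eqF.
rewrite {1}(expR_ln_ratio a0 b0 ab) powRM ?expR_ge0 // -expRM mulrA -powRD.
  by rewrite subrK powRr1 // [th * _]mulrC.
by apply/implyP => _.
Qed.

(** Multiplying factors of norms r0 and r1 by r / r0 and r / r1 gives both the norm r without
    changing the product of powers. *)
Lemma rescale_weights (r0 r1 th : R) : 0 < r0 -> 0 < r1 -> let r := r0 `^ (1 - th) * r1 `^ th in
  (r / r0) `^ (1 - th) * (r / r1) `^ th = 1.
Proof.
move=> r00 r10 r; have r_gt : 0 < r by rewrite mulr_gt0 ?powR_gt0.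
have i0 : 0 <= r0^-1 by rewrite invr_ge0 ltW.
have i1 : 0 <= r1^-1 by rewrite invr_ge0 ltW.
rewrite (powRM _ (ltW r_gt) i0) (powRM _ (ltW r_gt) i1) mulrACA -powRD; last first.
  by rewrite (gt_eqF r_gt) implybT.
rewrite subrK (powRr1 (ltW r_gt)) -(powR_inv1 (ltW r00)) -(powR_inv1 (ltW r10)).
by rewrite -!powRrM !mulN1r !powRN -invfM divff // gt_eqF.
Qed.

Lemma measurable_ln_comp (u : T -> R) : measurable_fun setT u ->
  measurable_fun setT (fun x => ln (u x)).
Proof. by move=> mu; exact: (measurableT_comp (@measurable_ln R) mu). Qed.

Lemma dom_pieces (Y : fspace T R) (K : R) (hY : qlat m Y K) (g : T -> R) (D : nat -> set T)
    (M q : R) : 0 < q -> 2 * K * q <= 1 -> 0 <= M ->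
  (forall i, dom m Y (cut (D i) g) (M * q ^+ i)) ->
  (forall x, (forall i, ~ D i x) -> g x = 0) -> dom m Y g (2 * K ^+ 2 * M).
Proof.
move=> q0 Kq M0 hD h0; have [U hU sU] := dom_series hY q0 Kq M0 hD.
apply: (dom_le hU) => //; apply: filterS sU => x sx.
have [[i Dx]|nD] := pselect (exists i, D i x).
  apply: le_trans (ler_norm _); apply: le_trans (sx i.+1).
  by rewrite big_ord_recr /= cutT // lerDr sumr_ge0.
by rewrite h0 ?normr0 // => i Di; apply: nD; exists i.
Qed.

Variables (Y0 Y1 : fspace T R) (K : R).
Hypothesis hY0 : qlat m Y0 K.
Hypothesis hY1 : qlat m Y1 K.
Let K1 : 1 <= K. Proof. by case: hY0. Qed.
Let K0 : 0 < K. Proof. exact: lt_le_trans K1. Qed.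

Lemma pow_small (q e C : R) : 0 < q -> q <= 2^-1 -> 0 < e -> 0 <= C -> exists N, C * q ^+ N <= e.
Proof.
move=> q0 q2 e0 C0; have [N hN] := exp2_small e0 C0; exists N.
apply: le_trans (ltW hN); rewrite mulrC ler_wpM2r // -exprVn.
by apply: lerXn2r; rewrite ?nnegrE ?invr_ge0 // ltW.
Qed.

Lemma calderon_interp (th : R) u (r : R) f : 0 < th < 1 -> 0 < r ->
  order_cont m Y0 \/ order_cont m Y1 -> calderon m Y0 Y1 th u r ->
  @L0 d T R f -> (\forall x \ae m, nc (f x) <= `|u x|) ->
  interp m Y0 Y1 th f /\ fs_norm (interp m Y0 Y1 th) f <= 4 * K ^+ 2 * r.
Proof.
move=> th01 r0 oc hu Lf fu; pose q := (4 * K)^-1.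
have q0 : 0 < q by rewrite invr_gt0 mulr_gt0.
have q2 : q <= 2^-1 by rewrite /q lef_pV2 ?posrE ?mulr_gt0 //; have := K1; lra.
have q1 : 0 < q < 1 by rewrite q0; lra.
have Kq : 2 * K * q <= 1.
  by rewrite ler_pdivrMr ?mulr_gt0 // mul1r ler_pM2r // ler_nat.
have [g0 [g1 [D [L [[mg0 mg1 g00 g10] [mD tD] [hD h0] hdom hle]]]]] :=
  calderon_split hY0 hY1 th01 q1 r0 oc hu.
have z01 x : g0 x = 0 <-> g1 x = 0.
  have [[i Dx]|nD] := pselect (exists i, D i x).
    by have [a b _ _] := hD i x Dx; split=> e; rewrite e ltxx in a b.
  by have [|-> ->] := h0 x => // i Di; apply: nD; exists i.
have g0Z x : (forall i, ~ D i x) -> g0 x = 0 by move=> /h0[].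
have g1Z x : (forall i, ~ D i x) -> g1 x = 0 by move=> /h0[].
pose Lam x := ln (g1 x) - ln (g0 x).
have tail N e Y g : qlat m Y K -> (forall i, dom m Y (cut (D i) g) (r * q ^+ i)) ->
    2 * K ^+ 2 * (r * q ^+ N) <= e -> (forall x, (forall i, ~ D i x) -> g x = 0) ->
    dom m Y (cut [set x | exists2 i, (N <= i)%N & D i x] g) e.
  move=> hY hg Ne gZ; apply: dom_ler Ne.
  apply: (dom_pieces hY (D := fun i => D (N + i)%N) q0 Kq).
  - by rewrite mulr_ge0 ?exprn_ge0 ?(ltW q0) // ltW.
  - move=> i; rewrite -mulrA -exprD; apply: (dom_le (hg (N + i)%N)) => //.
    apply: aeW => x; rewrite /cut; case: ifP => _; rewrite ?normr0 //.
    by case: ifP => _; rewrite ?normr0.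
  - move=> x nD; apply: cutF => -[i Ni Di]; apply: (nD (i - N)%N).
    by rewrite subnKC.
rewrite (_ : 4 * K ^+ 2 * r = 2 * K ^+ 2 * r + 2 * K ^+ 2 * r); last by ring.
apply: (@power_interp _ _ _ _ _ _ K hY0 hY1 g0 g1 Lam) => //.
- by apply: measurable_funB; exact: measurable_ln_comp.
- by move=> x; exact: expR_ln_ratio.
- apply: (dom_pieces hY0 q0 Kq (ltW r0)); last exact: g0Z.
  by move=> i; case: (hdom i).
- apply: (dom_pieces hY1 q0 Kq (ltW r0)); last exact: g1Z.
  by move=> i; case: (hdom i).
- move=> e e0.
  have [|N hN] := @pow_small q e (2 * K ^+ 2 * r) q0 q2 e0.
    by rewrite !mulr_ge0 // ?exprn_ge0 // ltW.
  rewrite -mulrA in hN.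
  (* On the piece D i one has |Lam| <= ln (L i), so |Lam| > L' excludes the first N pieces, and the
     remaining ones have small norm. *)
  pose L' := \sum_(i < N) `|ln (L i)|; exists L'.
  have sub : [set x | L' < `|Lam x|] `<=` [set x | exists2 i, (N <= i)%N & D i x] `|` [set x | forall i, ~ D i x].
    move=> x /= Lx; have [[i Dx]|nD] := pselect (exists i, D i x); last first.
      by right=> i Di; apply: nD; exists i.
    left; exists i => //; rewrite leqNgt; apply/negP => iN.
    have [a b c e'] := hD i x Dx.
    have := ln_ratio_bound a b c e'; apply/negP; rewrite -ltNge; apply: le_lt_trans Lx.
    apply: (le_trans (ler_norm _)); rewrite /L' (bigD1 (Ordinal iN)) //= lerDl sumr_ge0 //.
  have cutle g : (forall x, (forall i, ~ D i x) -> g x = 0) -> forall x,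
      `|cut [set x | L' < `|Lam x|] g x| <= `|cut [set x | exists2 i, (N <= i)%N & D i x] g x|.
    move=> gZ x; have [Lx|Lx] := pselect (L' < `|Lam x|); last by rewrite cutF // normr0.
    rewrite cutT //; case: (sub x Lx) => h; first by rewrite cutT.
    by rewrite gZ ?normr0.
  split.
    apply: (dom_le (tail N e _ g0 hY0 _ hN g0Z)) => //; first by move=> i; case: (hdom i).
    by apply: aeW; exact: cutle.
  apply: (dom_le (tail N e _ g1 hY1 _ hN g1Z)) => //; first by move=> i; case: (hdom i).
  by apply: aeW; exact: cutle.
near=> x; rewrite -powR_ln_ratio //; apply: (@le_trans _ _ `|u x|); near: x => //.
Unshelve. all: by end_near.
Qed.

(** Comparability makes Lam bounded, so that its tails are empty. The bound is multiplicative in r0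
    and r1 and free of L; [interp_order_cont] and [gmean_bound] rest on this. *)
Lemma interp_comparable (th : R) (a b : T -> R) (r0 r1 L : R) f : 0 < th < 1 ->
  0 < r0 -> 0 < r1 ->
  measurable_fun setT a -> measurable_fun setT b -> (forall x, 0 <= a x) -> (forall x, 0 <= b x) ->
  dom m Y0 a r0 -> dom m Y1 b r1 ->
  (forall x, a x <= L * b x) -> (forall x, b x <= L * a x) ->
  @L0 d T R f -> (\forall x \ae m, nc (f x) <= a x `^ (1 - th) * b x `^ th) ->
  interp m Y0 Y1 th f /\
  fs_norm (interp m Y0 Y1 th) f <= 2 * (r0 `^ (1 - th) * r1 `^ th).
Proof.
move=> th01 r00 r10 ma mb a0 b0 ha hb ab ba Lf hf.
pose r := r0 `^ (1 - th) * r1 `^ th.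
have r_gt : 0 < r by rewrite mulr_gt0 ?powR_gt0.
pose c0 := r / r0; pose c1 := r / r1.
have c00 : 0 < c0 by rewrite divr_gt0.
have c10 : 0 < c1 by rewrite divr_gt0.
pose g0 x := c0 * a x; pose g1 x := c1 * b x.
have g00 x : 0 <= g0 x by rewrite mulr_ge0 // ltW.
have g10 x : 0 <= g1 x by rewrite mulr_ge0 // ltW.
have z01 x : g0 x = 0 <-> g1 x = 0.
  split=> [/eqP|/eqP]; rewrite mulf_eq0 gt_eqF //= => /eqP e; rewrite /g0 /g1.
    have := ba x; rewrite e mulr0 => h; rewrite (_ : b x = 0) ?mulr0 //.
    by apply/eqP; rewrite eq_le h b0.
  have := ab x; rewrite e mulr0 => h; rewrite (_ : a x = 0) ?mulr0 //.
  by apply/eqP; rewrite eq_le h a0.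
have [th0 th1] := andP th01.
pose L' := Num.max (L * c0 / c1) (L * c1 / c0).
have gL x : g0 x <= L' * g1 x.
  apply: (@le_trans _ _ (L * c0 / c1 * g1 x)); last by rewrite ler_wpM2r // le_max lexx.
  rewrite /g1 /g0 (_ : _ / c1 * _ = c0 * (L * b x)) ?ler_pM2l //.
  by field; rewrite gt_eqF.
have gL' x : g1 x <= L' * g0 x.
  apply: (@le_trans _ _ (L * c1 / c0 * g0 x)); last by rewrite ler_wpM2r // le_max lexx orbT.
  rewrite /g1 /g0 (_ : _ / c0 * _ = c1 * (L * a x)) ?ler_pM2l //.
  by field; rewrite gt_eqF.
pose Lam x := ln (g1 x) - ln (g0 x).
have LamL x : `|Lam x| <= `|ln L'|.
  have := g00 x; rewrite le_eqVlt => /orP[/eqP e|g0x].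
    by have /(z01 x) e' := esym e; rewrite /Lam -e e' subrr normr0.
  have g1x : 0 < g1 x by rewrite lt_neqAle g10 andbT; apply/eqP => /esym/z01 e; rewrite e ltxx in g0x.
  by apply: (le_trans (ln_ratio_bound g0x g1x _ _) (ler_norm _)).
rewrite (_ : 2 * (r0 `^ (1 - th) * r1 `^ th) = r + r); last by rewrite /r; ring.
apply: (@power_interp _ _ _ _ _ _ K hY0 hY1 g0 g1 Lam) => //.
- exact: measurable_funM.
- by apply: measurable_funB; apply: measurable_ln_comp; exact: measurable_funM.
- by move=> x; exact: expR_ln_ratio.
- have := dom_scale hY0 c0 ha; rewrite ger0_norm ?(ltW c00) // /c0 divfK // gt_eqF //.
- have := dom_scale hY1 c1 hb; rewrite ger0_norm ?(ltW c10) // /c1 divfK // gt_eqF //.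
- move=> e e0; exists `|ln L'|.
  have c g x : cut [set x | `|ln L'| < `|Lam x|] g x = 0.
    by apply: cutF; rewrite /= ltNge LamL.
  split.
    by apply: (dom_le (dom0 hY0 (ltW e0))) => //; apply: aeW => x; rewrite c.
  by apply: (dom_le (dom0 hY1 (ltW e0))) => //; apply: aeW => x; rewrite c.
apply: filterS hf => x hx; rewrite -powR_ln_ratio //; apply: (le_trans hx).
rewrite /g0 /g1 (powRM _ (ltW c00) (a0 x)) (powRM _ (ltW c10) (b0 x)).
by rewrite mulrACA rescale_weights // mul1r.
Qed.

End calderon_to_interp.

(** * Local power series of admissible functions *)

(** If Q A failed, the complements in A of the sets with Q would generate a proper filter, whose
    cluster point in A contradicts the local hypothesis. *)
Lemma compact_local_global (X : topologicalType) (A : set X) (Q : set X -> Prop) :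
  compact A -> Q set0 -> (forall S S', Q S -> Q S' -> Q (S `|` S')) ->
  (forall S S', S `<=` S' -> Q S' -> Q S) ->
  (forall x, A x -> exists2 U, nbhs x U & Q U) -> Q A.
Proof.
move=> cA Q0 QU Qs loc; apply: contrapT => nQ.
pose F : set_system X := [set B | exists2 S, Q S & A `\` S `<=` B].
have FF : ProperFilter F.
  apply: Build_ProperFilter_ex.
    move=> B [S QS SB]; apply: contrapT => nB; apply: nQ; apply: (Qs _ S) QS => x Ax.
    by apply: contrapT => nS; apply: nB; exists x; apply: SB.
  split.
  - by exists set0.
  - move=> B B' [S QS SB] [S' QS' SB']; exists (S `|` S'); first exact: QU.
    by move=> x [Ax /not_orP[nS nS']]; split; [apply: SB|apply: SB'].
  - by move=> B B' BB' [S QS SB]; exists S => // x /SB /BB'.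
have [|x [Ax cx]] := cA F FF; first by exists set0 => // x [].
have [U nU QU'] := loc x Ax.
have [|y [[_ nUy] Uy]] := cx (A `\` U) U _ nU; first by exists U.
exact: nUy.
Qed.

Lemma ballR_lt (R : realType) (a e b : R) : ball a e b -> `|b - a| < e.
Proof. by rewrite -ball_normE /= distrC. Qed.

Section local_analysis.
Context d (T : measurableType d) (R : realType).
Variable m : {measure set T -> \bar R}.
Variables (Y0 Y1 : fspace T R) (K : R).
Hypothesis hY0 : qlat m Y0 K.
Hypothesis hY1 : qlat m Y1 K.
Let K1 : 1 <= K. Proof. by case: hY0. Qed.
Let K0 : 0 < K. Proof. exact: lt_le_trans K1. Qed.
Notation domS := (domS m Y0 Y1).

Lemma domS_series (u : nat -> T -> R) (M q : R) : 0 < q -> 2 * K * q <= 1 -> 0 <= M ->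
  (forall k, domS (u k) (M * q ^+ k)) ->
  exists2 U : T -> R, domS U (2 * K ^+ 2 * M) & (forall x, 0 <= U x) /\
    \forall x \ae m, forall n, \sum_(k < n) `|u k x| <= U x.
Proof.
move=> q0 Kq M0 /choice[u0 /choice[u1 hu]].
have [|U0 hU0 s0] := dom_series hY0 q0 Kq M0 (u := u0); first by move=> k; case: (hu k).
have [|U1 hU1 s1] := dom_series hY1 q0 Kq M0 (u := u1); first by move=> k; case: (hu k).
exists (fun x => `|U0 x| + `|U1 x|).
  exists U0, U1; split => //; apply: aeW => x; by rewrite normr_normD.
split=> [x|]; first by rewrite addr_ge0.
have h : \forall x \ae m, forall k, `|u k x| <= `|u0 k x| + `|u1 k x|.
  by apply: ae_foralln => k; case: (hu k).
near=> x => n; apply: (@le_trans _ _ (\sum_(k < n) (`|u0 k x| + `|u1 k x|))).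
  by apply: ler_sum => k _; move: (k : nat); near: x.
rewrite big_split /=; apply: lerD; apply: le_trans (ler_norm _).
  by move: n; near: x.
by move: n; near: x.
Unshelve. all: by end_near.
Qed.

Lemma domS_ge0 u r : domS u r -> 0 <= r.
Proof. by move=> [u0 [u1 [/(dom_ge0 hY0)]]]. Qed.

Variable F : R[i] -> T -> R[i].
Hypothesis aF : analytic_on_strip (sum_space m Y0 Y1) F.

Lemma domS_sum_space f : sum_space m Y0 Y1 f ->
  exists r, 0 < r /\ domS (fun x => nc (f x)) r.
Proof.
move=> hf; exists (fs_norm (sum_space m Y0 Y1) f + 1); split.
  by rewrite ltr_wpDl // (sum_space_ge0 hY0 hY1).
by apply: (sum_space_dom hY0 hY1) => //; rewrite ltrDl.
Qed.

Lemma domS_mem f r : @L0 d T R f -> domS (fun x => nc (f x)) r ->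
  sum_space m Y0 Y1 f /\ fs_norm (sum_space m Y0 Y1) f <= r + r.
Proof.
move=> Lf [u0 [u1 [h0 h1 hu]]]; apply: (sum_space_mem hY0 hY1 Lf h0 h1).
by apply: filterS hu => x; rewrite ger0_norm // nc_ge0.
Qed.

Lemma sum_space_lin f g (c : R[i]) : sum_space m Y0 Y1 f -> sum_space m Y0 Y1 g ->
  sum_space m Y0 Y1 (c *: f + g).
Proof.
move=> hf hg; have [r [r0 dr]] := domS_sum_space hf; have [s [s0 ds]] := domS_sum_space hg.
have Lcf : @L0 d T R (c *: f + g).
  by apply: L0D; [apply: L0M; [exact: L0_cst|case: hf]|case: hg].
have [] // := domS_mem (r := K * (`|nc c| * r + s)) Lcf.
apply: (domS_le (domS_add hY0 hY1 (domS_scale hY0 hY1 (nc c) dr) ds)) => //.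
apply: aeW => x; rewrite normr_normD !ger0_norm ?mulr_ge0 ?nc_ge0 //.
by rewrite -Normc.normcM; exact: ler_ncD.
Qed.

(** Cauchy estimates without contour integrals: al k rho^k is the difference of two consecutive
    errors at the point z0 + rho, and these are eventually in the unit ball. *)
Lemma coef_bound z0 : strip z0 -> exists rho B (al : nat -> T -> R[i]),
  [/\ 0 < rho, 0 < B, forall z, nc (z - z0) <= rho -> strip z,
    forall k, domS (fun x => nc (al k x)) (B * rho ^- k) &
    forall z e, nc (z - z0) <= rho -> 0 < e -> exists N, forall n, (N <= n)%N ->
      domS (fun x => nc (F z x - \sum_(k < n) al k x * (z - z0) ^+ k)) e].
Proof.
move=> hz0; have [FS /(_ z0 hz0)[r [/andP[r0 rm] [al Yal hal]]]] := aF.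
pose rho := r / 2.
have rho0 : 0 < rho by rewrite divr_gt0.
have rhor : rho < r by rewrite /rho; lra.
have inS z : nc (z - z0) <= rho -> strip z.
  move=> zz; have := le_lt_trans (le_trans (nc_Re (z - z0)) zz) rhor.
  rewrite (_ : complex.Re _ = complex.Re z - complex.Re z0); last first.
    by case: (z) => ? ?; case: (z0).
  move: rm; rewrite lt_min => /andP[r1 r2]; rewrite ltr_norml /strip /= => /andP[? ?].
  by apply/andP; split; lra.
have cv z e : nc (z - z0) <= rho -> 0 < e -> exists N, forall n, (N <= n)%N ->
      domS (fun x => nc (F z x - \sum_(k < n) al k x * (z - z0) ^+ k)) e.
  move=> zz e0; have [|N hN] := (cvg0_seqP _).1 (hal z _) _ e0.
    by rewrite lt_nc_real (le_lt_trans zz).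
  exists N => n /hN Nn.
  have Sn : sum_space m Y0 Y1 (\sum_(k < n) (z - z0) ^+ k *: al k).
    elim: (n) => [|j IH].
      rewrite big_ord0; have [] // := @domS_mem (0 : T -> R[i]) 0.
      apply: (domS_l hY0 hY1); apply: (dom_le (dom0 hY0 (lexx 0))) => //.
      by apply: aeW => x; rewrite [nc _](_ : _ = 0) //; exact: Normc.normc0.
    by rewrite big_ord_recr /= addrC; exact: sum_space_lin.
  have FSz : sum_space m Y0 Y1 (F z).
    apply: FS; exact: inS.
  have SF : sum_space m Y0 Y1 (\sum_(k < n) (z - z0) ^+ k *: al k - F z).
    by rewrite addrC -scaleN1r; exact: sum_space_lin.
  rewrite (ger0_norm (sum_space_ge0 hY0 hY1 SF)) in Nn.
  apply: (domS_le (sum_space_dom hY0 hY1 SF Nn)) => //.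
  apply: aeW => x; rewrite !(ger0_norm (nc_ge0 _)) ncB.
  rewrite (_ : (_ - F z) x = \sum_(k < n) al k x * (z - z0) ^+ k - F z x) //.
  rewrite fct_sumE; congr (_ - _); apply: eq_bigr => k _; exact: mulrC.
have [N hN] : exists N, forall n, (N <= n)%N ->
    domS (fun x => nc (F (z0 + rho%:C%C) x - \sum_(k < n) al k x * rho%:C%C ^+ k)) 1.
  have [|N hN] := cv (z0 + rho%:C%C) 1 _ ltr01.
    by rewrite addrAC subrr add0r nc_real ger0_norm // ltW.
  by exists N => n /hN; rewrite addrAC subrr add0r.
have /choice[b hb] : forall k, exists r, 0 < r /\ domS (fun x => nc (al k x)) r.
  by move=> k; exact: domS_sum_space.
pose B := 2 * K + \sum_(k < N) b k * rho ^+ k.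
have sb : 0 <= \sum_(k < N) b k * rho ^+ k.
  by apply: sumr_ge0 => k _; case: (hb k) => b0 _; rewrite mulr_ge0 ?exprn_ge0 // ltW.
have B0 : 0 < B by rewrite ltr_pwDl // mulr_gt0.
exists rho, B, al; split => //.
move=> k; have [kN|Nk] := ltnP k N.
  have [b0 hbk] := hb k; apply: (domS_le hbk); last exact: aeW.
  rewrite ler_pdivlMr ?exprn_gt0 //.
  rewrite /B (bigD1 (Ordinal kN)) //= addrCA lerDl addr_ge0 ?mulr_ge0 ?(ltW K0) //.
  by apply: sumr_ge0 => j _; case: (hb j) => bj _; rewrite mulr_ge0 ?exprn_ge0 // ltW.
have h1 := hN k Nk; have h2 := hN k.+1 (leqW Nk).
have h3 := domS_scale hY0 hY1 (rho ^- k) (domS_add hY0 hY1 h1 h2).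
have rk : 0 <= rho ^- k by rewrite invr_ge0 exprn_ge0 // ltW.
apply: (domS_le h3).
  rewrite ger0_norm // mulrC ler_wpM2r // /B mulrC; lra.
apply: aeW => x; rewrite normrM (ger0_norm rk) ler_pdivlMl ?exprn_gt0 //.
rewrite !ger0_norm ?addr_ge0 ?nc_ge0 //.
rewrite -[X in X * _](ger0_norm (exprn_ge0 k (ltW rho0))) -nc_real rmorphXn -Normc.normcM.
set S := \sum_(j < k) _; set G := F _ x.
have -> : rho%:C%C ^+ k * al k x = (G - S) - (G - (S + al k x * rho%:C%C ^+ k)) by ring.
have -> : \sum_(j < k.+1) al j x * rho%:C%C ^+ j = S + al k x * rho%:C%C ^+ k.
  by rewrite big_ord_recr.
by apply: (le_trans (ler_ncD _ _)); rewrite ncN.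
Qed.

(** Convergence in quasi-norm becomes convergence a.e. with a single majorant D: on the smaller
    radius s <= rho / (4 K) the functions 2^k s^k |al k| are summable in the sum space. *)
Lemma local_series z0 : strip z0 -> exists s B (al : nat -> T -> R[i]) (D : T -> R),
  [/\ 0 < s <= 1, domS D B, forall x, 0 <= D x,
    \forall x \ae m, forall N, \sum_(k < N) k.+1%:R * s ^+ k.-1 * nc (al k x) <= D x &
    forall z, nc (z - z0) <= s -> strip z /\ \forall x \ae m, forall n,
      nc (F z x - \sum_(k < n) al k x * (z - z0) ^+ k) <= 2 ^- n * D x].
Proof.
move=> /coef_bound[rho [B [al [rho0 B0 inS hal cv]]]].
pose s := Num.min 1 (rho / (4 * K)).
have K40 : 0 < 4 * K by rewrite mulr_gt0.
have s0 : 0 < s by rewrite lt_min ltr01 divr_gt0.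
have s1 : s <= 1 by rewrite ge_min lexx.
have sK : s <= rho / (4 * K) by rewrite ge_min lexx orbT.
have srho : s <= rho.
  by apply: (le_trans sK); rewrite ler_pdivrMr // ler_peMr ?(ltW rho0) //; have := K1; lra.
pose q := 2 * s / rho.
have q0 : 0 < q by rewrite divr_gt0 ?mulr_gt0.
have Kq : 2 * K * q <= 1.
  rewrite /q mulrA ler_pdivrMr // mul1r; move: sK; rewrite ler_pdivlMr //; lra.
(* The factor 2^k covers k + 1 in the Lipschitz sums and yields 2^-n in the remainders; s^-1
   accounts for the exponent k - 1. *)
pose u k x := s^-1 * (2 ^+ k * s ^+ k) * nc (al k x).
have u0 k x : 0 <= u k x by rewrite !mulr_ge0 ?invr_ge0 ?exprn_ge0 ?nc_ge0 // ltW.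
have M0 : 0 <= s^-1 * B by rewrite mulr_ge0 ?invr_ge0 // ltW.
have [|D0 hD0 [D00 sD0]] := @domS_series u (s^-1 * B) q q0 Kq M0.
  move=> k; apply: (domS_le (domS_scale hY0 hY1 (s^-1 * (2 ^+ k * s ^+ k)) (hal k))).
    rewrite ger0_norm ?mulr_ge0 ?invr_ge0 ?exprn_ge0 // ?(ltW s0) //.
    rewrite (_ : _ * (B / rho ^+ k) = s^-1 * B * q ^+ k) // /q !exprMn exprVn; ring.
  by apply: aeW => x; rewrite lexx.
have sm x k : k.+1%:R * s ^+ k.-1 * nc (al k x) <= u k x.
  rewrite /u ler_wpM2r ?nc_ge0 // mulrA [s^-1 * _]mulrC -mulrA; apply: ler_pM => //.
  - by rewrite exprn_ge0 // ltW.
  - by rewrite -natrX ler_nat ltn_expl.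
  - case: k => [|k] /=; first by rewrite expr0 mulr1 invf_ge1.
    by rewrite exprS mulrA mulVf ?gt_eqF // mul1r.
have smx x n : (forall n, \sum_(k < n) `|u k x| <= D0 x) ->
    forall z, nc (z - z0) <= s -> forall N, (n <= N)%N ->
    nc (\sum_(k < N) al k x * (z - z0) ^+ k - \sum_(k < n) al k x * (z - z0) ^+ k) <= 2 ^- n * D0 x.
  move=> hx z zz N nN.
  rewrite -(subnKC nN) big_split_ord /= addrAC subrr add0r.
  apply: (le_trans (ler_nc_sum _ _ _)).
  rewrite ler_pdivlMl ?exprn_gt0 // mulr_sumr.
  apply: le_trans (hx (n + (N - n))%N); rewrite big_split_ord /=.
  rewrite ler_wpDl ?sumr_ge0 //; apply: ler_sum => i _.
  rewrite ger0_norm // /u Normc.normcM ncX mulrCA [leRHS]mulrC ler_wpM2l ?nc_ge0 //.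
  apply: (@le_trans _ _ (2 ^+ n * s ^+ (n + i))).
    rewrite ler_wpM2l ?exprn_ge0 //; apply: lerXn2r; rewrite ?nnegrE ?nc_ge0 //; exact: ltW.
  rewrite mulrA ler_wpM2r ?exprn_ge0 ?(ltW s0) //.
  apply: (@le_trans _ _ (2 ^+ (n + i))).
    by rewrite ler_eXn2l ?leq_addr // ltr1n.
  by rewrite ler_peMl ?exprn_ge0 // invf_ge1.
exists s, (2 * K ^+ 2 * (s^-1 * B)), al, D0; split => //.
- by rewrite s0.
- apply: filterS sD0 => x hx N; apply: le_trans (hx N); apply: ler_sum => k _.
  by rewrite ger0_norm.
move=> z zz; have zr := le_trans zz srho; split; first exact: inS.
apply: ae_foralln => n.
(* For fixed z, the excess is at most the error of every later partial sum, hence 0 a.e. by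
   [domS_eq0]; the null set depends on z. *)
pose v x := Num.max 0 (nc (F z x - \sum_(k < n) al k x * (z - z0) ^+ k) - 2 ^- n * D0 x).
have v0 x : 0 <= v x by rewrite le_max lexx.
have hv : \forall x \ae m, v x = 0.
  apply: (domS_eq0 hY0 hY1) => e e0; have [N hN] := cv z e zr e0.
  have := hN (maxn N n) (leq_maxl _ _); move/domS_le; apply => //.
  apply: filterS sD0 => x hx; rewrite !ger0_norm ?nc_ge0 // /v ge_max nc_ge0 /=.
  rewrite lerBlDr; apply: (le_trans _ (lerD (lexx _) (smx x n hx z zz _ (leq_maxr N n)))).
  by apply: le_trans (ler_ncD _ _); rewrite addrA subrK.
apply: filterS hv => x /eqP; rewrite eq_le => /andP[+ _].
by rewrite ge_max subr_le0 => /andP[].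
Qed.

Definition rect (del M : R) (z : R[i]) : bool :=
  [&& del <= complex.Re z, complex.Re z <= 1 - del & `|complex.Im z| <= M].

Definition jensen_at p z r n (x : T) (kap Dx : R) : Prop :=
  (expR (kap * complex.Re z) * nc (F z x)) `^ p <=
   (\sum_(j < n) (expR (kap * complex.Re (z + r%:C%C * node R n j)) *
      nc (F (z + r%:C%C * node R n j) x)) `^ p) / n%:R +
   ((1 + `|kap|) * expR (3 * `|kap|) * Dx * cJ R / n%:R) `^ p.

(** Radii and majorants from [local_series] are made uniform by compactness of the rectangle. The
    exceptional set may depend on z, r' and n, but not on kap. *)
Lemma jensen_rect p (del M : R) : 0 < p <= 1 -> 0 < del ->
  exists r B (D : T -> R), [/\ 0 < r, domS D B, forall x, 0 <= D x &
   forall r' z n, 0 < r' <= r -> rect del M z -> (1 < n)%N ->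
     \forall x \ae m, forall kap, jensen_at p z r' n x kap (D x)].
Proof.
move=> p01 del0.
pose P (S : set (R * R)%type) := exists r B (D : T -> R), [/\ 0 < r, domS D B, forall x, 0 <= D x &
   forall r' (z : R[i]) n, 0 < r' <= r -> S (complex.Re z, complex.Im z) -> (1 < n)%N ->
     \forall x \ae m, forall kap, jensen_at p z r' n x kap (D x)].
have [] : P ([set t | del <= t <= 1 - del] `*` [set t | - M <= t <= M]).
- apply: compact_local_global.
  + apply: compact_setX.
      rewrite (_ : [set t | _] = `[del, 1 - del]%classic); first exact: segment_compact.
      by apply/seteqP; split=> t; rewrite /= in_itv.
    rewrite (_ : [set t | _] = `[- M, M]%classic); first exact: segment_compact.
    by apply/seteqP; split=> t; rewrite /= in_itv.
  + exists 1, 0, (fun=> 0); split => //; first exact: (domS_l hY0 hY1 (dom0 hY0 (lexx 0))).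
  + move=> S S' [r [B [D [r0 hD D0 hS]]]] [r' [B' [D' [r'0 hD' D'0 hS']]]].
    exists (Num.min r r'), (K * (B + B')), (fun x => `|D x| + `|D' x|); split.
    * by rewrite lt_min r0.
    * exact: domS_add.
    * by move=> x; rewrite addr_ge0.
    have mono x z s n kap Dx Dx' : 0 <= Dx -> Dx <= Dx' -> jensen_at p z s n x kap Dx ->
        jensen_at p z s n x kap Dx'.
      move=> Dx0 DD /le_trans; apply; rewrite lerD2l; case/andP: p01 => p0 p1.
      have c0 : 0 <= (1 + `|kap|) * expR (3 * `|kap|) by rewrite mulr_ge0 ?expR_ge0 ?addr_ge0.
      have cJn : 0 <= cJ R / n%:R by rewrite divr_ge0 // cJ_ge0.
      have e t : (1 + `|kap|) * expR (3 * `|kap|) * t * cJ R / n%:R =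
         (1 + `|kap|) * expR (3 * `|kap|) * t * (cJ R / n%:R) by rewrite -mulrA.
      rewrite !e; apply: ge0_ler_powR; rewrite ?nnegrE ?(ltW p0) //.
      * exact: (mulr_ge0 (mulr_ge0 c0 Dx0) cJn).
      * exact: (mulr_ge0 (mulr_ge0 c0 (le_trans Dx0 DD)) cJn).
      * by rewrite ler_wpM2r // ler_wpM2l.
    move=> s z n /andP[s0 sm] [Sz|Sz] n1.
      have {}hS := hS s z n _ Sz n1; rewrite s0 (le_trans sm) ?ge_min ?lexx // in hS.
      apply: filterS (hS isT) => x hx kap; apply: mono (hx kap) => //.
      by rewrite (ger0_norm (D0 x)) lerDl.
    have {}hS' := hS' s z n _ Sz n1; rewrite s0 (le_trans sm) ?ge_min ?lexx ?orbT // in hS'.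
    apply: filterS (hS' isT) => x hx kap; apply: mono (hx kap) => //.
    by rewrite (ger0_norm (D'0 x)) lerDr.
  + move=> S S' SS' [r [B [D [r0 hD D0 hS]]]]; exists r, B, D; split=> // r' z n hr Sz n1.
    by apply: hS => //; exact: SS'.
  move=> [a b] [/= /andP[a1 a2] _].
  have [|s [B [al [D [/andP[s0 s1] hD D0 sD sF]]]]] := @local_series (a +i* b)%C.
    by apply/andP; split => /=; lra.
  pose e := s / 4; have e0 : 0 < e by rewrite divr_gt0.
  exists (ball (a, b) e); first exact: nbhsx_ballx.
  exists e, B, D; split => // r' z n /andP[r'0 r'e] [/= za zb] n1.
  have zz : nc (z - (a +i* b)%C) <= s / 2.
    apply: (le_trans (nc_leD _)); case: (z) za zb => u v /=.
    move=> /ballR_lt/ltW h1 /ballR_lt/ltW h2.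
    by have := lerD h1 h2; rewrite /e; lra.
  have zj j : nc (z + r'%:C%C * node R n j - (a +i* b)%C) <= s.
    rewrite addrAC; apply: (le_trans (ler_ncD _ _)).
    rewrite Normc.normcM nc_node nc_real mulr1 ger0_norm ?(ltW r'0) //.
    by have := lerD zz r'e; rewrite /e; lra.
  have zs : nc (z - (a +i* b)%C) <= s by lra.
  have Fz := (sF _ zs).2.
  have Fj : \forall x \ae m, forall j N, nc (F (z + r'%:C%C * node R n j) x -
       \sum_(k < N) al k x * (z + r'%:C%C * node R n j - (a +i* b)%C) ^+ k) <= 2 ^- N * D x.
    by apply: ae_foralln => j; exact: (sF _ (zj j)).2.
  near=> x => kap.
  apply: (@local_jensen R (fun k => al k x) (a +i* b)%C z r' s (D x) kap p n (fun w => F w x)) => //.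
  - by rewrite r'0 /=; rewrite /e in r'e; lra.
  - by rewrite /e in r'e; lra.
  - have [h _] := sF z zs; case/andP: h => h1 h2; rewrite ger0_norm; exact: ltW.
  - by near: x.
  move=> ep ep0; have [N hN] := exp2_small ep0 (D0 x); exists N; split.
    apply: le_trans (ltW hN); move: N {hN}; near: x; exact: Fz.
  move=> j _; apply: le_trans (ltW hN); move: j N {hN}; near: x; exact: Fj.
move=> r [B [D [r0 hD D0 h]]]; exists r, B, D; split => // r' z n hr /and3P[z1 z2 z3] n1.
by apply: h => //; split => /=; [apply/andP|rewrite -ler_norml].
Unshelve. all: by end_near.
Qed.

(** Continuity up to the boundary is uniform on compact segments only; this is why endpoints of the
    walk with |Im w| > M will count as bad. *)
Lemma boundary_uniform (j e M : R) : (j = 0) \/ (j = 1) ->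
  continuous_on_closed_strip (sum_space m Y0 Y1) F -> 0 < e ->
  exists2 del, 0 < del & forall z : R[i], closed_strip z -> `|complex.Re z - j| < del ->
    `|complex.Im z| <= M -> domS (fun x => nc (F z x - F (j +i* complex.Im z)%C x)) e.
Proof.
move=> hj [FS cF] e0.
have js t : closed_strip (j +i* t)%C by case: hj => ->; apply/andP => /=; split.
pose P (S : set R) := exists2 del, 0 < del & forall z : R[i], closed_strip z ->
   `|complex.Re z - j| < del -> S (complex.Im z) -> domS (fun x => nc (F z x - F (j +i* complex.Im z)%C x)) e.
have : P [set t | - M <= t <= M].
  apply: compact_local_global.
  - rewrite (_ : [set t | _] = `[- M, M]%classic); first exact: segment_compact.
    by apply/seteqP; split=> t; rewrite /= in_itv.
  - by exists 1.
  - move=> S S' [r r0 h] [r' r'0 h']; exists (Num.min r r'); first by rewrite lt_min r0.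
    by move=> z hz; rewrite lt_min => /andP[? ?] [?|?]; [apply: h|apply: h'].
  - by move=> S S' SS' [r r0 h]; exists r => // z hz hr /SS'; exact: h.
  move=> t _.
  pose e' := e / (3 * K); have e'0 : 0 < e' by rewrite divr_gt0 // mulr_gt0.
  have [r r0 hr] := (cvg_within0P _ _ _).1 (cF _ (js t)) e' e'0.
  have {}hr z : closed_strip z -> nc (z - (j +i* t)%C) < r ->
      domS (fun x => nc (F z x - F (j +i* t)%C x)) e'.
    move=> hz zr; have := hr z hz zr.
    have Sz : sum_space m Y0 Y1 (F z - F (j +i* t)%C).
      by rewrite addrC -scaleN1r; apply: sum_space_lin; exact: FS.
    rewrite (ger0_norm (sum_space_ge0 hY0 hY1 Sz)); exact: (sum_space_dom hY0 hY1 Sz).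
  exists (ball t (r / 2)); first by apply: nbhsx_ballx; rewrite divr_gt0.
  exists (r / 2); first by rewrite divr_gt0.
  move=> [a b] hz /= za /ballR_lt zb.
  have h1 : nc ((a +i* b)%C - (j +i* t)%C) < r.
    apply: (le_lt_trans (nc_leD _)) => /=; lra.
  have h2 : nc ((j +i* b)%C - (j +i* t)%C) < r.
    apply: (le_lt_trans (nc_leD _)) => /=; rewrite subrr normr0 add0r; lra.
  apply: (domS_le (domS_add hY0 hY1 (hr _ hz h1) (hr _ (js b) h2))).
    rewrite /e' (_ : K * _ = 2 / 3 * e); first lra.
    by field; rewrite gt_eqF.
  apply: aeW => x; rewrite normr_normD !(ger0_norm (nc_ge0 _)).
  rewrite (ncB (F (j +i* b)%C x)); apply: le_trans (ler_ncD _ _).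
  by rewrite addrA subrK.
move=> [del d0 h]; exists del => // z hz zd zM; apply: h => //.
by rewrite /= -ler_norml.
Qed.

End local_analysis.

(** * A stopped walk in the strip *)

Section stopped_walk.
Variable R : realType.
Variables (n : nat) (r : R) (inK : pred R[i]).
Hypothesis n2 : (2 < n)%N.

(** A stopped point is repeated n times, so that after N steps all n^N endpoints have equal weight
    and expectations are plain averages. *)
Definition step (z : R[i]) : seq R[i] :=
  if inK z then [seq z + r%:C%C * node R n j | j <- iota 0 n] else nseq n z.

Definition walk (z : R[i]) N : seq R[i] := iter N (fun L => flatten (map step L)) [:: z].

Lemma size_step z : size (step z) = n.
Proof. by rewrite /step; case: ifP => _; rewrite ?size_map ?size_iota ?size_nseq. Qed.

Lemma walkP (P : R[i] -> Prop) z : P z -> (forall w, P w -> forall v, v \in step w -> P v) ->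
  forall N v, v \in walk z N -> P v.
Proof.
move=> Pz hP; elim=> [v|N IH v]; first by rewrite inE => /eqP ->.
by move=> /flattenP[L /mapP[w /IH Pw ->]]; exact: hP.
Qed.

Definition avg (phi : R[i] -> R) (z : R[i]) : R := (\sum_(w <- step z) phi w) / n%:R.

Definition mean (L : seq R[i]) (phi : R[i] -> R) : R := (\sum_(w <- L) phi w) / (size L)%:R.

Let n0 : (0 : R) < n%:R.
Proof. by rewrite ltr0n (leq_trans _ n2). Qed.

Lemma size_walk z N : size (walk z N) = (n ^ N)%N.
Proof.
elim: N => [|N IH] //; rewrite expnS -IH /= size_flatten /shape -map_comp.
rewrite (eq_map (g := fun=> n)); last by move=> w /=; exact: size_step.
by elim: (walk z N) => [|w L IHL] /=; rewrite ?muln0 // IHL mulnS.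
Qed.

Lemma size_walk_gt0 z N : (0 < size (walk z N))%N.
Proof. by rewrite size_walk expn_gt0 (leq_trans _ n2). Qed.

Lemma mean_walkS z N phi : mean (walk z N.+1) phi = mean (walk z N) (avg phi).
Proof.
rewrite /mean !size_walk /= big_flatten big_map /avg -big_distrl /= expnS natrM invfM.
by rewrite -!mulrA.
Qed.

Lemma mean_le L phi psi : (forall w, w \in L -> phi w <= psi w) -> mean L phi <= mean L psi.
Proof.
move=> h; rewrite /mean ler_wpM2r ?invr_ge0 // big_seq [leRHS]big_seq; exact: ler_sum.
Qed.

Lemma mean_ge0 L phi : (forall w, 0 <= phi w) -> 0 <= mean L phi.
Proof. by move=> h; rewrite divr_ge0 // sumr_ge0. Qed.

Lemma meanD L phi psi : mean L (fun w => phi w + psi w) = mean L phi + mean L psi.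
Proof. by rewrite /mean big_split /= mulrDl. Qed.

Lemma meanZ L c phi : mean L (fun w => c * phi w) = c * mean L phi.
Proof. by rewrite /mean -mulr_sumr mulrA. Qed.

Lemma mean_cst L c : (0 < size L)%N -> mean L (fun=> c) = c.
Proof.
move=> L0; rewrite /mean big_const_seq count_predT iter_addr_0 -(mulr_natr c) mulfK //.
by rewrite pnatr_eq0 -lt0n.
Qed.

Lemma avg_nseq phi z : ~~ inK z -> avg phi z = phi z.
Proof.
move=> /negbTE Kz; rewrite /avg /step Kz big_nseq iter_addr_0 -(mulr_natr (phi z)) mulfK //.
by rewrite gt_eqF.
Qed.

Lemma avgE phi z : inK z -> avg phi z = (\sum_(j < n) phi (z + r%:C%C * node R n j)) / n%:R.
Proof. by move=> Kz; rewrite /avg /step Kz big_map -[n in iota 0 n]subn0 big_mkord. Qed.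

Lemma avg_Re2 z : avg (fun w => complex.Re w ^+ 2) z =
  complex.Re z ^+ 2 + r ^+ 2 / 2 * (inK z)%:R.
Proof.
have [Kz|Kz] := boolP (inK z); last by rewrite avg_nseq // mulr0 addr0.
have [h1 _ h2 _] := node_sum_ReIm R n2.
rewrite avgE //.
rewrite (eq_bigr (fun j : 'I_n => complex.Re z ^+ 2 + (2 * r * complex.Re z) * complex.Re (node R n j)
   + r ^+ 2 * complex.Re (node R n j) ^+ 2)); last first.
  by move=> j _; rewrite ReD ReM /= mul0r subr0; ring.
rewrite 2!big_split /= -!mulr_sumr h1 h2 big_const_ord iter_addr_0 -mulr_natr.
by field; rewrite gt_eqF.
Qed.

Lemma avg_Im2 z : avg (fun w => complex.Im w ^+ 2) z =
  complex.Im z ^+ 2 + r ^+ 2 / 2 * (inK z)%:R.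
Proof.
have [Kz|Kz] := boolP (inK z); last by rewrite avg_nseq // mulr0 addr0.
have [_ h1 _ h2] := node_sum_ReIm R n2.
rewrite avgE //.
rewrite (eq_bigr (fun j : 'I_n => complex.Im z ^+ 2 + (2 * r * complex.Im z) * complex.Im (node R n j)
   + r ^+ 2 * complex.Im (node R n j) ^+ 2)); last first.
  by move=> j _; rewrite ImD ImM /= mul0r addr0; ring.
rewrite 2!big_split /= -!mulr_sumr h1 h2 big_const_ord iter_addr_0 -mulr_natr.
by field; rewrite gt_eqF.
Qed.

(** A stopped point stays stopped, so the mass inside never increases. *)
Lemma avg_inK z : avg (fun w => (inK w)%:R) z <= (inK z)%:R.
Proof.
rewrite /avg ler_pdivrMr // /step; case: ifP => Kz.
  rewrite mul1r big_map -[X in _ <= X%:R](size_iota 0 n) -sum1_size natr_sum.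
  by apply: ler_sum => j _; rewrite lern1 leq_b1.
by rewrite big_nseq Kz mul0r iter_addr_0 mul0rn.
Qed.

(* The mean of Re^2 grows by r^2/2 per unit of mass still in K, yet stays below 1. *)
Lemma mean_inK z N : (forall v, v \in walk z N -> 0 <= complex.Re v <= 1) ->
  N%:R * (r ^+ 2 / 2) * mean (walk z N) (fun w => (inK w)%:R) <= 1.
Proof.
move=> h01; pose c k := mean (walk z k) (fun w => (inK w)%:R).
have c_dec k : c k.+1 <= c k.
  by rewrite /c mean_walkS; apply: mean_le => w _; exact: avg_inK.
have Re2 k : k%:R * (r ^+ 2 / 2) * c k <= mean (walk z k) (fun w => complex.Re w ^+ 2).
  elim: k => [|k IH]; first by rewrite !mul0r mean_ge0 // => w; exact: sqr_ge0.
  rewrite mean_walkS (_ : avg _ = fun w => complex.Re w ^+ 2 + r ^+ 2 / 2 * (inK w)%:R); last first.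
    by apply/funext => w; exact: avg_Re2.
  rewrite meanD meanZ -/(c k).
  apply: (@le_trans _ _ (k.+1%:R * (r ^+ 2 / 2) * c k)).
    by rewrite ler_wpM2l // mulr_ge0 // divr_ge0 // sqr_ge0.
  by rewrite -natr1 !mulrDl mul1r lerD2r.
apply: (le_trans (Re2 N)); rewrite -[leRHS](mean_cst 1 (size_walk_gt0 z N)).
apply: mean_le => v /h01/andP[v0 v1]; by rewrite expr_le1.
Qed.

(* The mean of Im^2 - Re^2 is invariant. *)
Lemma mean_Im2 (th : R) N : (forall v, v \in walk th%:C%C N -> 0 <= complex.Re v <= 1) ->
  mean (walk th%:C%C N) (fun w => complex.Im w ^+ 2) <= 1.
Proof.
move=> h01; pose z := th%:C%C : R[i].
have e k : mean (walk z k) (fun w => complex.Im w ^+ 2) + th ^+ 2 =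
    mean (walk z k) (fun w => complex.Re w ^+ 2).
  elim: k => [|k IH].
    by rewrite /mean /walk /= !big_seq1 expr0n /= mul0r add0r divr1.
  rewrite !mean_walkS (_ : avg _ = fun w => complex.Im w ^+ 2 + r ^+ 2 / 2 * (inK w)%:R); last first.
    by apply/funext => w; exact: avg_Im2.
  rewrite (_ : avg (fun w => complex.Re w ^+ 2) = fun w => complex.Re w ^+ 2 + r ^+ 2 / 2 * (inK w)%:R); last first.
    by apply/funext => w; exact: avg_Re2.
  by rewrite !meanD -IH addrAC.
apply: (@le_trans _ _ (mean (walk z N) (fun w => complex.Re w ^+ 2))).
  by rewrite -e lerDl sqr_ge0.
rewrite -[leRHS](mean_cst 1 (size_walk_gt0 z N)).
apply: mean_le => v /h01/andP[v0 v1]; by rewrite expr_le1.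
Qed.

(** Chebyshev's inequality, with the second moment from [mean_Im2]. *)
Lemma mean_far (th M : R) N : (forall v, v \in walk th%:C%C N -> 0 <= complex.Re v <= 1) ->
  0 < M -> mean (walk th%:C%C N) (fun w => ((M < `|complex.Im w|)%R : nat)%:R) <= M ^- 2.
Proof.
move=> h01 M0; rewrite -[leRHS]mul1r ler_pdivlMr ?exprn_gt0 // mulrC -meanZ.
apply: le_trans (mean_Im2 h01); apply: mean_le => w _.
case: ltP => [Mw|_]; last by rewrite mulr0 sqr_ge0.
by rewrite mulr1 -[leRHS]real_normK ?num_real // lerXn2r ?nnegrE ?(ltW M0) // ltW.
Qed.

Lemma mean_submean z N phi (e : R) :
  (forall k w, (k < N)%N -> w \in walk z k -> inK w -> phi w <= avg phi w + e) -> 0 <= e ->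
  phi z <= mean (walk z N) phi + N%:R * e.
Proof.
move=> h e0.
have : forall k, (k <= N)%N -> phi z <= mean (walk z k) phi + k%:R * e.
  elim=> [_|k IH kN]; first by rewrite /mean /walk /= big_seq1 divr1 mul0r addr0.
  apply: (le_trans (IH (ltnW kN))); rewrite mean_walkS -natr1 mulrDl mul1r.
  rewrite [k%:R * e + e]addrC addrA lerD2r -(mean_cst e (size_walk_gt0 z k)) -meanD.
  apply: mean_le => w wk; have [Kw|Kw] := boolP (inK w); first exact: (h k).
  by rewrite avg_nseq // lerDl.
exact.
Qed.

End stopped_walk.

Lemma ae_seq d (T : measurableType d) (R : realType) (m : {measure set T -> \bar R})
    (I : eqType) (s : seq I) (P : I -> T -> Prop) :
  (forall w, w \in s -> \forall x \ae m, P w x) -> \forall x \ae m, forall w, w \in s -> P w x.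
Proof.
elim: s => [|w s IH] h; first exact: aeW.
have h1 := h w (mem_head _ _).
have h2 := IH (fun v vs => h v (@mem_behead _ (w :: s) _ vs)).
near=> x => v; rewrite inE => /orP[/eqP ->|vs]; first by near: x.
by move: v vs; near: x.
Unshelve. all: by end_near.
Qed.

(** * Norms of p-means over a list of points *)

Section power_means.
Context d (T : measurableType d) (R : realType).
Variable m : {measure set T -> \bar R}.

Lemma powR_inv_add (p s t : R) : 0 < p -> 0 <= s -> 0 <= t ->
  (s + t) `^ p^-1 <= 2 `^ p^-1 * (s `^ p^-1 + t `^ p^-1).
Proof.
move=> p0 s0 t0; have ip : 0 <= p^-1 by rewrite invr_ge0 ltW.
wlog st : s t s0 t0 / s <= t.
  move=> H; have [st|/ltW ts] := leP s t; first exact: H.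
  by rewrite addrC [X in _ * X]addrC; exact: H.
apply: (@le_trans _ _ ((2 * t) `^ p^-1)).
  by apply: ge0_ler_powR; rewrite ?nnegrE ?addr_ge0 ?mulr_ge0 //; lra.
by rewrite powRM // ler_wpM2l ?powR_ge0 // lerDr powR_ge0.
Qed.

Lemma powRK (p s : R) : 0 < p -> 0 <= s -> (s `^ p^-1) `^ p = s.
Proof. by move=> p0 s0; rewrite -powRrM mulVf ?gt_eqF // powRr1. Qed.

Lemma powRKV (p s : R) : 0 < p -> 0 <= s -> (s `^ p) `^ p^-1 = s.
Proof. by move=> p0 s0; rewrite -powRrM mulfV ?gt_eqF // powRr1. Qed.

Definition pm (p : R) (L : seq R[i]) (u : R[i] -> T -> R) (x : T) : R :=
  mean L (fun w => `|u w x| `^ p) `^ p^-1.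

Lemma pmX p L u x : 0 < p -> pm p L u x `^ p = mean L (fun w => `|u w x| `^ p).
Proof. by move=> p0; rewrite /pm powRK // mean_ge0 // => w; exact: powR_ge0. Qed.

Lemma pm_ge0 p L u x : 0 <= pm p L u x.
Proof. exact: powR_ge0. Qed.

Lemma pm_sum p L u u0 u1 x : 0 < p <= 1 ->
  (forall w, w \in L -> `|u w x| <= `|u0 w x| + `|u1 w x|) ->
  pm p L u x <= 2 `^ p^-1 * (pm p L u0 x + pm p L u1 x).
Proof.
move=> /andP[p0 p1] h; have pg (v : R[i] -> T -> R) : 0 <= mean L (fun w => `|v w x| `^ p).
  by apply: mean_ge0 => w; exact: powR_ge0.
apply: le_trans (powR_inv_add p0 (pg u0) (pg u1)).
apply: ge0_ler_powR; rewrite ?nnegrE ?addr_ge0 ?invr_ge0 ?(ltW p0) //.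
rewrite -meanD; apply: mean_le => w wL.
apply: le_trans (powR_subadd _ _ _) => //; last by rewrite p0.
by apply: ge0_ler_powR; rewrite ?nnegrE ?addr_ge0 ?(ltW p0) //; exact: h.
Qed.

Variables (Y : fspace T R) (K p Cp : R).
Hypothesis hY : qlat m Y K.
Hypothesis p01 : 0 < p <= 1.
Hypothesis Cp0 : 0 < Cp.
Hypothesis PM : pmean_bounded m Y p Cp.
Let p0 : 0 < p. Proof. by case/andP: p01. Qed.
Let K1 : 1 <= K. Proof. by case: hY. Qed.

Lemma pm_dom L u (rho : R) : (0 < size L)%N -> 0 < rho ->
  (forall w, w \in L -> dom m Y (u w) rho) -> dom m Y (pm p L u) (Cp * rho).
Proof.
move=> L0 rho0 hu.
have h : dom m Y (fun x => ((\sum_(i < size L) `|rho^-1 * u (nth 0 L i) x| `^ p) / (size L)%:R) `^ p^-1) Cp.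
  apply: (@PM _ (fun i x => rho^-1 * u (nth 0 L i) x) L0) => i iL.
  have := dom_scale hY rho^-1 (hu _ (mem_nth 0 iL)).
  by rewrite ger0_norm ?invr_ge0 ?(ltW rho0) // mulVf // gt_eqF.
have := dom_scale hY rho h; rewrite ger0_norm ?(ltW rho0) // mulrC => {}h.
apply: (dom_le h) => //; apply: aeW => x; rewrite le_eqVlt; apply/orP; left; apply/eqP.
congr `|_|; rewrite /pm /mean.
rewrite (big_nth 0) big_mkord.
rewrite [X in _ = rho * ((X / _) `^ _)](_ : _ = rho^-1 `^ p * \sum_(i < size L) `|u (nth 0 L i) x| `^ p).
  have S0 : 0 <= (\sum_(i < size L) `|u (nth 0 L i) x| `^ p) / (size L)%:R.
    by rewrite divr_ge0 // sumr_ge0 // => i _; exact: powR_ge0.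
  rewrite -mulrA (powRM _ (powR_ge0 _ _) S0).
  by rewrite powRKV ?invr_ge0 ?(ltW rho0) // mulrA divff ?mul1r // gt_eqF.
rewrite mulr_sumr; apply: eq_bigr => i _.
by rewrite normrM powRM // ger0_norm // invr_ge0 ltW.
Qed.

(** The bad entries are averaged among themselves, in the list L'. Their share of the full mean is
    at most kap, so their norm bound rho enters with the small factor kap^(1/p). *)
Lemma pm_split L u (bad : pred R[i]) (kap rho e : R) : (0 < size L)%N -> 0 < rho -> 0 < e ->
  0 <= kap -> mean L (fun w => (bad w)%:R) <= kap ->
  (forall w, w \in L -> bad w -> dom m Y (u w) rho) ->
  (forall w, w \in L -> ~~ bad w -> dom m Y (u w) e) ->
  dom m Y (pm p L u) (K * (2 `^ p^-1 * Cp * (e + kap `^ p^-1 * rho))).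
Proof.
move=> L0 rho0 e0 kap0 hk hbad hgood.
have ip : 0 <= p^-1 by rewrite invr_ge0 ltW.
pose ug w x := if bad w then 0 else u w x.
have dg : dom m Y (pm p L ug) (Cp * e).
  apply: pm_dom => // w wL; rewrite /ug; have [bw|bw] := boolP (bad w); last exact: hgood.
  exact: (dom0 hY (ltW e0)).
pose L' := [seq w <- L | bad w].
have db : dom m Y (fun x => kap `^ p^-1 * pm p L' u x) (kap `^ p^-1 * (Cp * rho)).
  have [L'0|L'0] := posnP (size L').
    have -> : (fun x => kap `^ p^-1 * pm p L' u x) = fun=> 0.
      apply/funext => x; rewrite /pm /mean (size0nil L'0) big_nil mul0r powR0 ?mulr0 //.
      by rewrite invr_eq0 gt_eqF.
    apply: (dom0 hY); rewrite mulr_ge0 ?powR_ge0 // mulr_ge0 //; exact: ltW.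
  have h : dom m Y (pm p L' u) (Cp * rho).
    by apply: pm_dom => // w; rewrite mem_filter => /andP[bw wL]; exact: hbad.
  by have := dom_scale hY (kap `^ p^-1) h; rewrite ger0_norm ?powR_ge0.
have h2 : 0 <= 2 `^ p^-1 :> R by exact: powR_ge0.
have := dom_scale hY (2 `^ p^-1) (dom_add hY dg db); rewrite (ger0_norm h2) => h.
apply: (dom_le h).
  by rewrite mulrCA ler_wpM2l ?(le_trans ler01 K1) // -mulrA ler_wpM2l //; lra.
apply: aeW => x; apply: (le_trans _ (ler_norm _)).
apply: (le_trans _ (ler_wpM2l h2 (lerD (ler_norm _) (ler_norm _)))).
apply: (@le_trans _ _ (pm p L u x)); first by rewrite (ger0_norm (pm_ge0 p L u x)).
have m0 (M : seq R[i]) (v : R[i] -> T -> R) : 0 <= mean M (fun w => `|v w x| `^ p).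
  by apply: mean_ge0 => w; exact: powR_ge0.
rewrite /pm -powRM //.
apply: le_trans (powR_inv_add p0 _ _) => //; last by rewrite mulr_ge0.
have m1 := addr_ge0 (m0 L ug) (mulr_ge0 kap0 (m0 L' u)).
apply: (ge0_ler_powR ip (m0 L u) m1).
have sL : (0 : R) < (size L)%:R by rewrite ltr0n.
rewrite /mean; apply: (@le_trans _ _
   (((\sum_(w <- L) `|ug w x| `^ p) + \sum_(w <- L') `|u w x| `^ p) / (size L)%:R)).
  rewrite ler_wpM2r ?invr_ge0 // /L' big_filter [X in _ <= _ + X]big_mkcond -big_split /=.
  apply: ler_sum => w _; rewrite /ug; case: (bad w); last by rewrite addr0.
  by rewrite lerDr powR_ge0.
rewrite mulrDl lerD2l.
have [L'0|L'0] := posnP (size L').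
  by rewrite (size0nil L'0) big_nil !mul0r mulr0.
set S := \sum_(w <- L') _.
have S0 : 0 <= S by apply: sumr_ge0 => w _; exact: powR_ge0.
rewrite mulrCA ler_wpM2l // ler_pdivlMr ?ltr0n // mulrC.
move: hk; rewrite /mean; apply: le_trans; rewrite ler_pM2r ?invr_gt0 //.
rewrite /L' size_filter -sum1_count natr_sum big_mkcond /=.
by apply: ler_sum => w _; case: (bad w).
Qed.

End power_means.

(** * Boundary control of interior values *)

Lemma shifted_in_strip (R : realType) (del r t u : R) : 0 < del -> r <= del / 2 ->
  del <= t -> t <= 1 - del -> - r <= u -> u <= r -> 0 < t + u < 1.
Proof. by move=> *; apply/andP; split; lra. Qed.

Section stage_inequality.
Context d (T : measurableType d) (R : realType).
Variable m : {measure set T -> \bar R}.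
Variables (Y0 Y1 : fspace T R) (K p Cp : R).
Hypothesis hY0 : qlat m Y0 K.
Hypothesis hY1 : qlat m Y1 K.
Hypothesis p01 : 0 < p <= 1.
Hypothesis Cp0 : 0 < Cp.
Hypothesis PM0 : pmean_bounded m Y0 p Cp.
Hypothesis PM1 : pmean_bounded m Y1 p Cp.
Let p0 : 0 < p. Proof. by case/andP: p01. Qed.
Let K1 : 1 <= K. Proof. by case: hY0. Qed.
Let K0 : 0 < K. Proof. exact: lt_le_trans K1. Qed.

Variable F : R[i] -> T -> R[i].
Variable MF : R.
Hypothesis aF : admissible m Y0 Y1 F.
Hypothesis MF0 : 0 < MF.
Hypothesis hMS : forall z, strip z -> fs_norm (sum_space m Y0 Y1) (F z) <= MF.

(** The boundary value at the horizontal projection of w, charged to the nearer side of the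
    strip. *)
Definition left_trace (w : R[i]) (x : T) : R :=
  if complex.Re w < 2^-1 then nc (F (0 +i* complex.Im w)%C x) else 0.
Definition right_trace (w : R[i]) (x : T) : R :=
  if complex.Re w < 2^-1 then 0 else nc (F (1 +i* complex.Im w)%C x).

Lemma powR_add_le (a b : R) : 0 <= a -> 0 <= b ->
  a `^ p + b `^ p <= (2 `^ p^-1 * (a + b)) `^ p.
Proof.
move=> a0 b0; rewrite powRM ?powR_ge0 ?addr_ge0 // powRK // mulr_natl mulr2n.
by apply: lerD; apply: ge0_ler_powR; rewrite ?nnegrE ?addr_ge0 ?(ltW p0) // ?lerDl ?lerDr.
Qed.

(** Decompositions are chosen entry by entry and their p-means estimated in each space; recombining
    them costs 2^(1/p). *)
Lemma domS_pm L (E : R[i] -> T -> R) (bad : pred R[i]) (kap rho e : R) :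
  (0 < size L)%N -> 0 < rho -> 0 < e ->
  0 <= kap -> mean L (fun w => (bad w)%:R) <= kap ->
  (forall w, w \in L -> domS m Y0 Y1 (E w) (if bad w then rho else e)) ->
  domS m Y0 Y1 (pm p L E) (2 `^ p^-1 * (K * (2 `^ p^-1 * Cp * (e + kap `^ p^-1 * rho)))).
Proof.
move=> L0 rho0 e0 k0 hk hE.
have /choice[u0 /choice[u1 hu]] w : exists u0 u1, w \in L ->
    [/\ dom m Y0 u0 (if bad w then rho else e), dom m Y1 u1 (if bad w then rho else e) &
     \forall x \ae m, `|E w x| <= `|u0 x| + `|u1 x|].
  have [wL|wL] := boolP (w \in L); last by exists (fun=> 0), (fun=> 0).
  by have [v0 [v1 h]] := hE w wL; exists v0, v1.
have h2 : 0 <= 2 `^ p^-1 :> R by exact: powR_ge0.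
have h0 : dom m Y0 (pm p L u0) (K * (2 `^ p^-1 * Cp * (e + kap `^ p^-1 * rho))).
  apply: (pm_split hY0 p01 Cp0 PM0 (bad := bad)) => // w wL bw; have [] := hu w wL.
    by rewrite bw.
  by rewrite (negbTE bw).
have h1 : dom m Y1 (pm p L u1) (K * (2 `^ p^-1 * Cp * (e + kap `^ p^-1 * rho))).
  apply: (pm_split hY1 p01 Cp0 PM1 (bad := bad)) => // w wL bw; have [] := hu w wL.
    by rewrite bw.
  by rewrite (negbTE bw).
have := dom_scale hY0 (2 `^ p^-1) h0; have := dom_scale hY1 (2 `^ p^-1) h1.
rewrite (ger0_norm h2) => d1 d0.
exists (fun x => 2 `^ p^-1 * pm p L u0 x), (fun x => 2 `^ p^-1 * pm p L u1 x).
split; [exact: d0|exact: d1|].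
have h : \forall x \ae m, forall w, w \in L -> `|E w x| <= `|u0 w x| + `|u1 w x|.
  by apply: ae_seq => w wL; case: (hu w wL).
apply: filterS h => x hx.
apply: (le_trans _ (lerD (ler_norm _) (ler_norm _))).
rewrite -mulrDr (ger0_norm (pm_ge0 p L E x)).
exact: pm_sum.
Qed.

(* The null set does not depend on [kap], which may thus be optimized at each point. *)
Lemma interior_bound (th e0 kb : R) : 0 < th < 1 -> 0 < e0 -> 0 <= kb ->
  exists (L : seq R[i]) (e : T -> R), [/\ (0 < size L)%N,
    forall M, 0 < M -> mean L (fun w => ((M < `|complex.Im w|)%R : nat)%:R) <= M ^- 2,
    domS m Y0 Y1 e e0, forall x, 0 <= e x &
    \forall x \ae m, forall kap, `|kap| <= kb ->
      nc (F th%:C%C x) `^ p <= expR 1 * (expR (- (kap * th * p)) * pm p L left_trace x `^ p +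
         expR (kap * (1 - th) * p) * pm p L right_trace x `^ p) + e x `^ p].
Proof.
move=> th01 e00 kb0; have [th0 th1] := andP th01; have [_ p1] := andP p01.
have [aFa _ aFc _ _] := aF.
pose W := expR kb; have W0 : 0 < W by exact: expR_gt0.
have W1 : 1 <= W by rewrite /W -expR0 ler_expR.
pose q2 : R := 2 `^ p^-1; have q20 : 0 < q2 by exact: powR_gt0.
(* The budget e0 is shared in three: e1 for the endpoints near the boundary, kf for the few bad
   endpoints, n for the errors in Jensen's inequality. *)
pose G := q2 * K * W ^+ 2 * q2 * K * q2 * Cp.
have G0 : 0 < G by rewrite /G !mulr_gt0 // exprn_gt0.
pose rho := 2 * MF; have rho0 : 0 < rho by rewrite mulr_gt0.
pose e1 := e0 / (3 * G); have e10 : 0 < e1 by rewrite divr_gt0 ?mulr_gt0.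
pose kf := (e0 / (3 * G * rho)) `^ p.
have kf0 : 0 < kf by rewrite powR_gt0 // divr_gt0 ?mulr_gt0.
have kfE : kf `^ p^-1 = e0 / (3 * G * rho).
  by rewrite /kf powRKV // divr_ge0 ?(ltW e00) // ltW // !mulr_gt0.
pose M := 1 + 2 / kf.
have M1 : 1 <= M by rewrite lerDl divr_ge0 // ltW.
have M0 : 0 < M by exact: lt_le_trans M1.
have M2 : M ^- 2 <= kf / 2.
  rewrite -[leRHS]invrK lef_pV2 ?posrE ?exprn_gt0 ?invr_gt0 ?divr_gt0 //.
  rewrite invf_div; apply: (@le_trans _ _ M); first by rewrite lerDr.
  by rewrite expr2 ler_peMr // ltW.
clearbody M.
have [d0 d00 hd0] := boundary_uniform hY0 hY1 M (or_introl erefl) aFc e10.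
have [d1 d10 hd1] := boundary_uniform hY0 hY1 M (or_intror erefl) aFc e10.
(* The bound (kb + 1)^-1 keeps |kap| del <= 1, so replacing Re w by 0 or 1 in the weight costs at
   most the factor exp 1 of the statement. *)
pose del := Num.min (Num.min d0 d1) (Num.min (1 / 4) (kb + 1)^-1).
have kb1 : 0 < kb + 1 by lra.
have del0 : 0 < del by rewrite !lt_min d00 d10 invr_gt0 kb1 divr_gt0.
have [dd0 dd1 d4 dk] : [/\ del <= d0, del <= d1, del <= 1 / 4 & del <= (kb + 1)^-1].
  by split; rewrite !ge_min lexx ?orbT.
have kdel : kb * del <= 1.
  apply: (@le_trans _ _ (kb * (kb + 1)^-1)); first by rewrite ler_wpM2l.
  by rewrite ler_pdivrMr //; lra.
have dl2 : del < 2^-1 by lra.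
have dr2 : 2^-1 <= 1 - del by lra.
clearbody del.
have [rj [B [D [rj0 hD D0 hJ]]]] := jensen_rect hY0 hY1 aFa M p01 del0.
pose r := Num.min rj (del / 2).
have r0 : 0 < r by rewrite lt_min rj0 divr_gt0.
have rrj : r <= rj by rewrite ge_min lexx.
have rdel : r <= del / 2 by rewrite ge_min lexx orbT.
clearbody r.
(* By [mean_inK] the mass still inside after N steps is at most kf / 2; [mean_far] gives the other
   half. *)
pose N := (Num.Def.truncn (4 / (kf * r ^+ 2))).+1.
have hN : 2 / kf <= N%:R * (r ^+ 2 / 2).
  have := ltW (truncnS_gt (4 / (kf * r ^+ 2))); rewrite -/N => h.
  apply: le_trans (ler_wpM2r _ h); last by rewrite divr_ge0 ?exprn_ge0 // ltW.
  rewrite le_eqVlt; apply/orP; left; apply/eqP; field.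
  by rewrite !gt_eqF.
clearbody N.
pose E0 := (1 + kb) * expR (3 * kb) * cJ R.
have E00 : 0 <= E0.
  by rewrite /E0 mulr_ge0 ?cJ_ge0 // mulr_ge0 ?expR_ge0 // addr_ge0.
have B0 : 0 <= B := domS_ge0 hY0 hD.
pose c3 := W * N%:R `^ p^-1 * E0 * B.
have WN : 0 <= W * N%:R `^ p^-1 by rewrite mulr_ge0 ?powR_ge0 // ltW.
have c30 : 0 <= c3 := mulr_ge0 (mulr_ge0 WN E00) B0.
(* n is chosen last: r and N do not depend on it, and the error accumulated over N steps decreases
   like 1 / n. *)
pose n := (Num.Def.truncn (3 * q2 * K * c3 / e0)).+3.
have n2 : (2 < n)%N by [].
have nR : (0 : R) < n%:R by rewrite ltr0n.
have hn : q2 * K * (c3 / n%:R) <= e0 / 3.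
  have h : 3 * q2 * K * c3 / e0 <= n%:R.
    by apply: (le_trans (ltW (truncnS_gt _))); rewrite ler_nat /n !ltnS leqW.
  rewrite mulrA ler_pdivrMr // mulrC.
  by move: h; rewrite ler_pdivrMr //; lra.
clearbody n.
pose inK : pred R[i] := rect del M.
pose L := walk n r inK th%:C%C N.
have L0 : (0 < size L)%N by exact: size_walk_gt0.
have stay k v : v \in walk n r inK th%:C%C k -> 0 < complex.Re v < 1.
  move: k v; apply: walkP => [|w /andP[w0 w1] v]; first by rewrite /= th0.
  rewrite /step; case: ifP => [/and3P[wd w1d _]|_]; last by move=> /nseqP[-> _]; rewrite w0.
  move=> /mapP[j _ ->].
  have -> : complex.Re (w + r%:C%C * node R n j) = complex.Re w + r * complex.Re (node R n j).
    by rewrite ReD ReM /= mul0r subr0.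
  have := nc_Re (node R n j); rewrite nc_node ler_norml => /andP[c1 c2].
  set c := complex.Re (node R n j) in c1 c2 *.
  have h1 : r * c <= r by rewrite ler_piMr // ltW.
  have h2 : - r <= r * c by rewrite -mulrN1 ler_wpM2l // ltW.
  exact: shifted_in_strip del0 rdel wd w1d h2 h1.
have stay' k v : v \in walk n r inK th%:C%C k -> 0 <= complex.Re v <= 1.
  by move=> /stay/andP[/ltW-> /ltW->].
pose bad (w : R[i]) := inK w || (M < `|complex.Im w|).
have hbad : mean L (fun w => (bad w)%:R) <= kf.
  have h1 : mean L (fun w => (inK w)%:R) <= kf / 2.
    have := mean_inK n2 (stay' N).
    rewrite -/L => h.
    have : 2 / kf * mean L (fun w => (inK w)%:R) <= 1.
      by apply: le_trans h; rewrite ler_wpM2r // mean_ge0.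
    by rewrite mulrAC ler_pdivrMr // mul1r; lra.
  have h2 := le_trans (mean_far n2 (stay' N) M0) M2.
  apply: (@le_trans _ _ (kf / 2 + kf / 2)); last by lra.
  apply: (le_trans _ (lerD h1 h2)); rewrite -meanD; apply: mean_le => w _.
  by rewrite /bad; case: (inK w); case: (_ < _); rewrite //= ?addr0 ?add0r // lerDl.
pose js (w : R[i]) : R := if complex.Re w < 2^-1 then 0 else 1.
(* At a bad endpoint the whole value of F counts as error, at the others only its distance to the
   boundary value. *)
pose E w x := if bad w then nc (F w x) else nc (F w x - F (js w +i* complex.Im w)%C x).
have good w : 0 < complex.Re w < 1 -> ~~ bad w ->
    `|complex.Im w| <= M /\ (complex.Re w < del \/ 1 - del < complex.Re w).
  move=> _; rewrite /bad negb_or -leNgt => /andP[nK wM]; split => //.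
  move: nK; rewrite /inK /rect wM andbT negb_and -!ltNge => /orP[]; by [left|right].
have hE w : w \in L -> domS m Y0 Y1 (E w) (if bad w then rho else e1).
  move=> /stay w01; rewrite /E; case: ifPn => [_|gw].
    apply: (sum_space_dom hY0 hY1); first by apply: aFa.1.
    by apply: (le_lt_trans (hMS w01)); rewrite /rho mulr_natl mulr2n ltrDl.
  have cw : closed_strip w by case/andP: w01 => /ltW ? /ltW ?; apply/andP.
  have [wM [wl|wr]] := good w w01 gw; case/andP: w01 => w0 w1.
    have -> : js w = 0 by rewrite /js ifT // (lt_trans wl dl2).
    by apply: hd0; rewrite // subr0 gtr0_norm // (lt_le_trans wl dd0).
  have -> : js w = 1 by rewrite /js ifF // ltNge (le_trans dr2 (ltW wr)).
  apply: hd1 => //; rewrite distrC gtr0_norm ?subr_gt0 // ltrBlDr addrC -ltrBlDr.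
  by apply: le_lt_trans wr; rewrite lerD2l lerN2.
have hpm := domS_pm L0 rho0 e10 (ltW kf0) hbad hE.
pose c := W * N%:R `^ p^-1 * (E0 / n%:R).
have c0 : 0 <= c := mulr_ge0 WN (divr_ge0 E00 (ltW nR)).
have W20 : 0 <= W ^+ 2 by rewrite exprn_ge0 // ltW.
pose a x := W ^+ 2 * pm p L E x; pose b x := c * D x.
have a0 x : 0 <= a x by rewrite mulr_ge0 ?pm_ge0.
have b0 x : 0 <= b x by rewrite mulr_ge0.
exists L, (fun x => q2 * (a x + b x)); split => //.
- by move=> M' M'0; exact: (mean_far n2 (stay' N)).
- have := domS_scale hY0 hY1 q2 (domS_add hY0 hY1 (domS_scale hY0 hY1 (W ^+ 2) hpm) (domS_scale hY0 hY1 c hD)).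
  rewrite (ger0_norm (ltW q20)) (ger0_norm W20) (ger0_norm c0) => h.
  apply: (domS_le h).
    rewrite -/q2 kfE.
    have -> : q2 * (K * (W ^+ 2 * (q2 * (K * (q2 * Cp * (e1 + e0 / (3 * G * rho) * rho)))) + c * B)) =
       G * e1 + G * (e0 / (3 * G * rho)) * rho + q2 * K * (c3 / n%:R).
      by rewrite /G /c /c3; ring.
    have -> : G * e1 = e0 / 3 by rewrite /e1; field; rewrite gt_eqF.
    have -> : G * (e0 / (3 * G * rho)) * rho = e0 / 3 by field; rewrite !gt_eqF.
    lra.
  apply: aeW => x.
  by rewrite (ger0_norm (a0 x)) (ger0_norm (b0 x)).
- by move=> x; rewrite mulr_ge0 ?addr_ge0 // ltW.
have J : \forall x \ae m, forall k, forall w, w \in walk n r inK th%:C%C k ->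
    inK w -> forall kap, jensen_at F p w r n x kap (D x).
  apply: ae_foralln => k; apply: ae_seq => w _.
  have [Kw|Kw] := boolP (inK w); last by apply: aeW.
  have : 0 < r <= rj by rewrite r0.
  move=> /hJ/(_ Kw (ltnW n2)); by apply: filterS.
apply: filterS J => x hx kap kapb.
pose err := (E0 * D x / n%:R) `^ p.
pose phi w := (expR (kap * complex.Re w) * nc (F w x)) `^ p.
have sub : phi th%:C%C <= mean L phi + N%:R * err.
  apply: (mean_submean n2) => [k w kN wk Kw|]; last exact: powR_ge0.
  have := hx k w wk Kw kap; rewrite /jensen_at => /le_trans; apply; apply: lerD.
    by rewrite avgE.
  have m1 : (1 + `|kap|) * expR (3 * `|kap|) <= (1 + kb) * expR (3 * kb).
    by apply: ler_pM; rewrite ?expR_ge0 ?addr_ge0 ?lerD2l // ler_expR ler_pM2l.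
  have i1 : 0 <= (1 + `|kap|) * expR (3 * `|kap|) by rewrite mulr_ge0 ?expR_ge0 ?addr_ge0.
  have i2 : 0 <= D x * cJ R / n%:R := divr_ge0 (mulr_ge0 (D0 x) (cJ_ge0 R)) (ltW nR).
  have f t : t * D x * cJ R / n%:R = t * (D x * cJ R / n%:R) by ring.
  have g : E0 * D x / n%:R = (1 + kb) * expR (3 * kb) * (D x * cJ R / n%:R) by rewrite /E0; ring.
  rewrite /err f g; apply: (ge0_ler_powR (ltW p0)).
  - exact: mulr_ge0.
  - exact: mulr_ge0 (le_trans i1 m1) i2.
  - exact: ler_wpM2r.
pose Wp := W `^ p.
have Wp0 : 0 <= Wp by exact: powR_ge0.
have expRp t : expR t `^ p = expR (t * p) by rewrite expRM.
have WpE t : t <= kb -> expR t `^ p <= Wp.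
  move=> tk; rewrite /Wp /W; apply: (ge0_ler_powR (ltW p0)); rewrite ?nnegrE ?expR_ge0 //.
  by rewrite ler_expR.
have kapw w : 0 < complex.Re w < 1 -> kap * complex.Re w <= kb.
  move=> /andP[w0 w1]; apply: le_trans kapb; apply: (le_trans (ler_norm _)).
  by rewrite normrM ler_piMr // gtr0_norm // ltW.
have E_ge0 w : 0 <= E w x by rewrite /E; case: ifP => _; exact: nc_ge0.
have lp t : 0 <= t `^ p by exact: powR_ge0.
have key w : w \in L -> phi w <= Wp * `|E w x| `^ p +
    expR 1 * (`|left_trace w x| `^ p + expR (kap * p) * `|right_trace w x| `^ p).
  move=> /stay w01; rewrite (ger0_norm (E_ge0 w)) /phi (powRM _ (expR_ge0 _) (nc_ge0 _)).
  have rest : 0 <= expR 1 * (`|left_trace w x| `^ p + expR (kap * p) * `|right_trace w x| `^ p).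
    by rewrite mulr_ge0 ?expR_ge0 // addr_ge0 ?lp // mulr_ge0 ?expR_ge0 ?lp.
  have ew := WpE _ (kapw w w01).
  rewrite /E; case: ifPn => [_|gw].
    by rewrite -[X in X <= _]addr0; apply: lerD rest; rewrite ler_wpM2r.
  have tri : nc (F w x) `^ p <= nc (F w x - F (js w +i* complex.Im w)%C x) `^ p +
      nc (F (js w +i* complex.Im w)%C x) `^ p.
    apply: powR_le_add => //; rewrite ?nc_ge0 //.
    by apply: le_trans (ler_ncD _ _); rewrite subrK.
  apply: (le_trans (ler_wpM2l (lp _) tri)); rewrite mulrDr; apply: lerD.
    by rewrite ler_wpM2r.
  have [_ [wl|wr]] := good w w01 gw; case/andP: w01 => w0 w1.
    have wh : complex.Re w < 2^-1 := lt_trans wl dl2.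
    rewrite /js /left_trace /right_trace wh normr0 powR0 ?gt_eqF // mulr0 addr0.
    rewrite (ger0_norm (nc_ge0 _)) ler_wpM2r // expRp ler_expR.
    have : `|kap * complex.Re w| <= 1.
      rewrite normrM (gtr0_norm w0) (le_trans _ kdel) //; apply: ler_pM => //; exact: ltW.
    by move=> /(le_trans (ler_norm _))/(ler_wpM2r (ltW p0)); rewrite mul1r => /le_trans; apply.
  have wh : complex.Re w < 2^-1 = false by rewrite ltNge (le_trans dr2 (ltW wr)).
  rewrite /js /left_trace /right_trace wh normr0 powR0 ?gt_eqF // add0r.
  rewrite (ger0_norm (nc_ge0 _)) mulrA ler_wpM2r // expRp -expRD ler_expR.
  have : `|kap * (complex.Re w - 1)| <= 1.
    rewrite normrM (le_trans _ kdel) //; apply: ler_pM => //.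
    rewrite distrC gtr0_norm ?subr_gt0 // lerBlDr addrC -lerBlDr; exact: ltW.
  rewrite (_ : kap * complex.Re w * p = kap * (complex.Re w - 1) * p + kap * p); last by ring.
  rewrite lerD2r.
  by move=> /(le_trans (ler_norm _))/(ler_wpM2r (ltW p0)); rewrite mul1r => /le_trans; apply.
clearbody L.
pose A := pm p L left_trace x `^ p; pose Bt := pm p L right_trace x `^ p.
pose PE := pm p L E x `^ p.
suff: nc (F th%:C%C x) `^ p <= expR 1 * (expR (- (kap * th * p)) * A +
    expR (kap * (1 - th) * p) * Bt) + (q2 * (a x + b x)) `^ p by [].
have mphi : mean L phi <= Wp * PE + expR 1 * (A + expR (kap * p) * Bt).
  have -> : PE = mean L (fun w => `|E w x| `^ p) by exact: pmX.
  have -> : A = mean L (fun w => `|left_trace w x| `^ p) by exact: pmX.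
  have -> : Bt = mean L (fun w => `|right_trace w x| `^ p) by exact: pmX.
  rewrite -!meanZ -meanD -meanZ -meanD; exact: mean_le.
have phth : nc (F th%:C%C x) `^ p = expR (- (kap * th * p)) * phi th%:C%C.
  rewrite /phi (powRM _ (expR_ge0 _) (nc_ge0 _)) expRp mulrA -expRD /=.
  by rewrite addNr expR0 mul1r.
have aE : a x `^ p = Wp ^+ 2 * PE.
  by rewrite /a (powRM _ W20 (pm_ge0 _ _ _ _)) expr2 (powRM _ (ltW W0) (ltW W0)) -expr2.
have bE : b x `^ p = Wp * N%:R * err.
  have cD : 0 <= E0 / n%:R * D x := mulr_ge0 (divr_ge0 E00 (ltW nR)) (D0 x).
  rewrite /b /c -mulrA (powRM _ WN cD).
  rewrite (powRM _ (ltW W0) (powR_ge0 _ _)) powRK // /err; congr (_ * _ `^ _); ring.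
rewrite phth; have ab := powR_add_le (a0 x) (b0 x); rewrite aE bE in ab.
have et : expR (- (kap * th * p)) <= Wp.
  rewrite /Wp /W expRp ler_expR -mulNr ler_wpM2r ?(ltW p0) //.
  apply: (le_trans (ler_norm _)); rewrite normrN normrM (gtr0_norm th0).
  by apply: le_trans kapb; rewrite ler_piMr // ltW.
have et0 := expR_ge0 (- (kap * th * p)).
apply: (le_trans (ler_wpM2l et0 (le_trans sub (lerD mphi (lexx (N%:R * err)))))).
apply: (le_trans _ (lerD (lexx _) ab)).
have -> : kap * (1 - th) * p = - (kap * th * p) + kap * p by ring.
rewrite expRD; set t := expR (- (kap * th * p)) in et et0 *.
have PE0 : 0 <= PE by exact: lp.
have err0 : 0 <= N%:R * err by rewrite mulr_ge0 // /err lp.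
have h1 : t * (Wp * PE) <= Wp ^+ 2 * PE.
  by rewrite mulrA expr2 ler_wpM2r // ler_wpM2r.
have h2 : t * (N%:R * err) <= Wp * N%:R * err by rewrite -[leRHS]mulrA ler_wpM2r.
set u := expR (kap * p); set v := expR 1.
have -> : t * (Wp * PE + v * (A + u * Bt) + N%:R * err) = v * (t * A + t * u * Bt) + (t * (Wp * PE) + t * (N%:R * err)).
  by ring.
by rewrite lerD2l lerD.
Qed.

End stage_inequality.

(** * From interpolation spaces to Calderon products *)

Section trace_tails.
Context d (T : measurableType d) (R : realType).
Variable m : {measure set T -> \bar R}.
Variables (Y : fspace T R) (K p Cp : R).
Hypothesis hY : qlat m Y K.
Hypothesis p01 : 0 < p <= 1.
Hypothesis Cp0 : 0 < Cp.
Hypothesis PM : pmean_bounded m Y p Cp.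
Let p0 : 0 < p. Proof. by case/andP: p01. Qed.
Let K1 : 1 <= K. Proof. by case: hY. Qed.
Let K0 : 0 < K. Proof. exact: lt_le_trans K1. Qed.

Variables (h : R -> T -> R[i]) (MF : R) (G : nat -> set T).
Hypothesis Yh : forall t, Y (h t).
Hypothesis ch : forall t0 : R, fs_norm Y (h t - h t0) @[t --> t0] --> (0 : R).
Hypothesis MF0 : 0 < MF.
Hypothesis hM : forall t, fs_norm Y (h t) <= MF.
Hypothesis mG : forall n, measurable (G n).
Hypothesis dG : forall n, G n.+1 `<=` G n.
Hypothesis G0 : \forall x \ae m, exists n, ~ G n x.
Hypothesis oc : order_cont m Y.

(** The index that order continuity gives for one t0 also serves the nearby t by continuity of h,
    and compactness leaves finitely many. *)
Lemma tail_compact (M e : R) : 0 < e ->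
  exists n, forall t, `|t| <= M -> dom m Y (cut (G n) (fun x => nc (h t x))) e.
Proof.
move=> e0; pose Q (S : set R) := exists n, forall t, S t -> dom m Y (cut (G n) (fun x => nc (h t x))) e.
have : Q [set t | - M <= t <= M].
  apply: compact_local_global.
  - rewrite (_ : [set t | _] = `[- M, M]%classic); first exact: segment_compact.
    by apply/seteqP; split=> t; rewrite /= in_itv.
  - by exists 0%N.
  - move=> S S' [n hn] [n' hn']; exists (maxn n n') => t [/hn|/hn']; apply: dom_cutS.
      by apply: decr_sub => //; exact: leq_maxl.
    by apply: decr_sub => //; exact: leq_maxr.
  - by move=> S S' SS' [n hn]; exists n => t /SS'; exact: hn.
  move=> t0 _; pose e' := e / (2 * K); have e'0 : 0 < e' by rewrite divr_gt0 // mulr_gt0.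
  have [del d0 hd] := (cvg_at0P _ _).1 (ch t0) e' e'0.
  have [n hn] := oc (Yh t0) mG dG G0 e'0.
  exists (ball t0 del); first exact: nbhsx_ballx.
  exists n => t /ballR_lt/hd; have Yd := fs_memB hY (Yh t) (Yh t0).
  rewrite (ger0_norm (fs_norm_ge0 hY Yd)) => /ltW/(dom_fs m Yd) ht.
  apply: (dom_le (dom_add hY (dom_cut (G n) ht) hn)).
    by rewrite /e' (_ : K * _ = e) //; field; rewrite gt_eqF.
  apply: aeW => x; rewrite normr_normD /cut; case: ifP => _; last by rewrite !normr0 addr0.
  rewrite !(ger0_norm (nc_ge0 _)).
  have -> : h t x = (h t - h t0) x + h t0 x by rewrite [X in X + _](_ : _ = h t x - h t0 x) ?subrK.
  exact: ler_ncD.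
by move=> [n hn]; exists n => t tM; apply: hn; rewrite /= -ler_norml.
Qed.

Definition trace_mean (sel : pred R[i]) (L : seq R[i]) : T -> R :=
  pm p L (fun w x => if sel w then nc (h (complex.Im w) x) else 0).

Lemma trace_mean_dom sel L : (0 < size L)%N -> dom m Y (trace_mean sel L) (Cp * MF).
Proof.
move=> L0; apply: (pm_dom hY p01 PM) => // w wL; case: (sel w).
  exact: (dom_fs m (Yh _) (hM _)).
exact: (dom0 hY (ltW MF0)).
Qed.

Lemma measurable_trace_mean sel L : measurable_fun setT (trace_mean sel L).
Proof.
apply: measurable_powRfun; apply: measurable_funM => //.
elim: L => [|w L IH].
  by rewrite (_ : (fun x => _) = fun=> 0) //; apply/funext => x; rewrite big_nil.
rewrite (_ : (fun x => _) = fun x => `|if sel w then nc (h (complex.Im w) x) else 0| `^ p +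
    \sum_(w0 <- L) `|if sel w0 then nc (h (complex.Im w0) x) else 0| `^ p).
  apply: measurable_funD => //; apply: measurable_powRfun.
  apply: measurableT_comp => //; case: (sel w) => //.
  by apply: measurable_nc; exact: (fs_mem_L0 hY (Yh _)).
by apply/funext => x; rewrite big_cons.
Qed.

(** The index n must not depend on the list. Entries with |Im w| <= M are handled by [tail_compact];
    the others form a fraction of at most M^-2, which [pm_split] makes small. *)
Lemma tail_pm (e : R) : 0 < e -> exists n, forall sel L, (0 < size L)%N ->
  (forall M, 0 < M -> mean L (fun w => ((M < `|complex.Im w|)%R : nat)%:R) <= M ^- 2) ->
  dom m Y (cut (G n) (trace_mean sel L)) e.
Proof.
move=> e0; pose q2 : R := 2 `^ p^-1.
have q20 : 0 < q2 by exact: powR_gt0.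
pose c := K * (q2 * Cp); have c0 : 0 < c by rewrite !mulr_gt0.
pose e' := e / (2 * c); have e'0 : 0 < e' by rewrite divr_gt0 // mulr_gt0.
pose kf := (e / (2 * c * MF)) `^ p.
have kf0 : 0 < kf by rewrite powR_gt0 // divr_gt0 // !mulr_gt0.
have kfE : kf `^ p^-1 = e / (2 * c * MF).
  by rewrite /kf powRKV // divr_ge0 ?(ltW e0) // ltW // !mulr_gt0.
pose M := 1 + kf^-1.
have M1 : 1 <= M by rewrite lerDl invr_ge0 ltW.
have M0 : 0 < M by exact: lt_le_trans M1.
have M2 : M ^- 2 <= kf.
  rewrite -[leRHS]invrK lef_pV2 ?posrE ?exprn_gt0 ?invr_gt0 //.
  apply: (@le_trans _ _ M); first by rewrite lerDr.
  by rewrite expr2 ler_peMr // ltW.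
have [n hn] := tail_compact M e'0; exists n => sel L L0 hL.
have cutE : cut (G n) (trace_mean sel L) =
    pm p L (fun w => cut (G n) (fun x => if sel w then nc (h (complex.Im w) x) else 0)).
  apply/funext => x; rewrite /cut /trace_mean /pm; case: ifP => // _.
  rewrite /mean big1 ?mul0r ?powR0 ?invr_eq0 ?gt_eqF // => w _.
  by rewrite normr0 powR0 // gt_eqF.
rewrite cutE; have hk := le_trans (hL M M0) M2.
have hz (r : R) : 0 < r -> dom m Y (cut (G n) (fun=> 0)) r.
  by move=> r0; apply: dom_cut; apply: (dom0 hY); exact: ltW.
apply: (dom_ler (pm_split hY p01 Cp0 PM L0 MF0 e'0 (ltW kf0) hk _ _)).
- move=> w wL _; case: (sel w); last exact: hz.
  apply: dom_cut; exact: (dom_fs m (Yh _) (hM _)).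
- move=> w wL; rewrite -leNgt => wM; case: (sel w); last exact: hz.
  exact: hn.
rewrite kfE -/q2 (_ : K * _ = c * e' + c * (e / (2 * c * MF)) * MF); last by rewrite /c; ring.
rewrite (_ : c * e' = e / 2); last by rewrite /e'; field; rewrite gt_eqF.
rewrite (_ : c * _ * MF = e / 2); last by field; rewrite !gt_eqF.
lra.
Qed.

End trace_tails.

(** The choice kap = ln (A + a0) - ln (B + a1) makes both weighted terms equal to the geometric
    mean. The positive a0 and a1 keep kap finite, within ln Q, and dominate the error e. *)
Lemma optimal_weight_bound (R : realType) (p th f A B e a0 a1 Q : R) : 0 < p <= 1 -> 0 < th < 1 ->
  0 <= f -> 0 <= A -> 0 <= B -> 0 <= e -> 0 < a0 -> 0 < a1 -> e <= a0 -> e <= a1 ->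
  A + a0 <= Q * a1 -> B + a1 <= Q * a0 ->
  (forall kap, `|kap| <= ln Q -> f `^ p <= expR 1 * (expR (- (kap * th * p)) * A `^ p +
     expR (kap * (1 - th) * p) * B `^ p) + e `^ p) ->
  f <= (2 * expR 1 + 1) `^ p^-1 * ((A + a0) `^ (1 - th) * (B + a1) `^ th).
Proof.
move=> /andP[p0 p1] /andP[th0 th1] f0 A0 B0 e0 a00 a10 ea0 ea1 AQ BQ h.
set A' := A + a0; set B' := B + a1.
have A'0 : 0 < A' by rewrite ltr_wpDl.
have B'0 : 0 < B' by rewrite ltr_wpDl.
have Q0 : 0 < Q by rewrite -(pmulr_lgt0 _ a10); exact: lt_le_trans AQ.
have kQ : `|ln A' - ln B'| <= ln Q.
  apply: ln_ratio_bound => //.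
    by apply: (le_trans BQ); rewrite ler_pM2l // lerDr.
  by apply: (le_trans AQ); rewrite ler_pM2l // lerDr.
have := h _ kQ; set kap := ln A' - ln B' => {}h.
set g := A' `^ (1 - th) * B' `^ th.
have pR (x y : R) : 0 < x -> x `^ y = expR (y * ln x) by move=> x0; rewrite /powR gt_eqF.
have gE : g = expR ((1 - th) * ln A' + th * ln B') by rewrite /g !pR // expRD.
have g0 : 0 < g by rewrite gE expR_gt0.
have g1 : expR (- (kap * th * p)) * A' `^ p = g `^ p.
  rewrite pR // gE -expRM -expRD; congr expR; rewrite /kap; ring.
have g2 : expR (kap * (1 - th) * p) * B' `^ p = g `^ p.
  rewrite pR // gE -expRM -expRD; congr expR; rewrite /kap; ring.
have mp (s t : R) : 0 <= s -> s <= t -> s `^ p <= t `^ p.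
  by move=> s0 st; apply: ge0_ler_powR; rewrite ?nnegrE ?(ltW p0) // (le_trans s0).
have eg : e <= g.
  have e1 : e = e `^ (1 - th) * e `^ th.
    rewrite -powRD ?subrK ?powRr1 //; by rewrite oner_eq0.
  rewrite e1; apply: ler_pM; rewrite ?powR_ge0 //.
    apply: ge0_ler_powR; rewrite ?nnegrE ?subr_ge0 ?(ltW th1) ?(ltW A'0) //.
    by apply: (le_trans ea0); rewrite lerDr.
  apply: ge0_ler_powR; rewrite ?nnegrE ?(ltW th0) ?(ltW B'0) //.
  by apply: (le_trans ea1); rewrite lerDr.
have fp : f `^ p <= (2 * expR 1 + 1) * g `^ p.
  apply: (le_trans h).
  have -> : (2 * expR 1 + 1) * g `^ p = expR 1 * (2 * g `^ p) + g `^ p by ring.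
  apply: lerD; last exact: mp.
  rewrite ler_wpM2l ?expR_ge0 // mulr_natl mulr2n; apply: lerD.
    rewrite -g1 ler_wpM2l ?expR_ge0 // mp // lerDl; exact: ltW.
  rewrite -g2 ler_wpM2l ?expR_ge0 // mp // lerDl; exact: ltW.
have c0 : 0 <= 2 * expR 1 + 1 :> R by rewrite addr_ge0 // mulr_ge0 // expR_ge0.
have ip : 0 <= p^-1 by rewrite invr_ge0 ltW.
rewrite -[X in X <= _](powRKV p0 f0) -[X in _ * X](powRKV p0 (ltW g0)) -(powRM _ c0 (powR_ge0 _ _)).
by apply: (ge0_ler_powR ip) => //; rewrite nnegrE ?powR_ge0 // mulr_ge0 // powR_ge0.
Qed.

Lemma small_terms (R : realType) (u0 u1 uA uB c0 c1 v0 v1 vA vB d0 d1 a0 a1 : R) :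
  u0 <= v0 -> u1 <= v1 -> uA <= vA -> uB <= vB -> c0 <= d0 -> c1 <= d1 ->
  0 <= v0 -> 0 <= v1 -> 0 <= vA -> 0 <= vB -> 0 <= d0 -> 0 <= d1 ->
  v0 + v1 + vA + vB + d0 + d1 < a0 -> v0 + v1 + vA + vB + d0 + d1 < a1 ->
  [/\ u0 + u1 <= a0, u0 + u1 <= a1, uA + c0 <= a1 & uB + c1 <= a0].
Proof. by move=> *; split; lra. Qed.

Section interp_to_calderon.
Context d (T : measurableType d) (R : realType).
Variable m : {measure set T -> \bar R}.

Lemma unit_dom (Y : fspace T R) (K r : R) : qlat m Y K -> 0 < r -> exists w : T -> R,
  [/\ measurable_fun setT w, forall x, 0 <= w x, dom m Y w r & \forall x \ae m, 0 < w x].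
Proof.
move=> hY r0; have [[_ [f Yf f0] _] _ _] := hY.
pose c := r / (fs_norm Y f + 1).
have n1 : 0 < fs_norm Y f + 1 by rewrite ltr_wpDl // (fs_norm_ge0 hY Yf).
have c0 : 0 < c by rewrite divr_gt0.
exists (fun x => c * nc (f x)); split.
- by apply: measurable_funM => //; apply: measurable_nc; exact: (fs_mem_L0 hY Yf).
- by move=> x; rewrite mulr_ge0 ?nc_ge0 // ltW.
- apply: (dom_ler (dom_scale hY c (dom_fs m Yf (lexx _)))).
  rewrite gtr0_norm // /c mulrAC ler_pdivrMr // ler_pM2l //; lra.
- apply: filterS f0 => x fx; rewrite mulr_gt0 // lt_neqAle nc_ge0 andbT eq_sym nc_eq0.
  by rewrite gt_eqF.
Qed.

Lemma dom_rescale (Y0 Y1 : fspace T R) (K th r0 r1 : R) (a b : T -> R) :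
  qlat m Y0 K -> qlat m Y1 K -> 0 < th < 1 -> 0 < r0 -> 0 < r1 ->
  dom m Y0 a r0 -> dom m Y1 b r1 -> exists a' b',
  [/\ dom m Y0 a' (r0 `^ (1 - th) * r1 `^ th), dom m Y1 b' (r0 `^ (1 - th) * r1 `^ th) &
   forall x, `|a' x| `^ (1 - th) * `|b' x| `^ th = `|a x| `^ (1 - th) * `|b x| `^ th].
Proof.
move=> hY0 hY1 th01 r00 r10 ha hb; have [th0 th1] := andP th01.
pose r := r0 `^ (1 - th) * r1 `^ th.
have r_gt : 0 < r by rewrite mulr_gt0 ?powR_gt0.
pose c0 := r / r0; pose c1 := r / r1.
have c00 : 0 < c0 by rewrite divr_gt0.
have c10 : 0 < c1 by rewrite divr_gt0.
exists (fun x => c0 * a x), (fun x => c1 * b x); split.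
- have := dom_scale hY0 c0 ha; rewrite ger0_norm ?(ltW c00) // /c0 divfK // gt_eqF //.
- have := dom_scale hY1 c1 hb; rewrite ger0_norm ?(ltW c10) // /c1 divfK // gt_eqF //.
move=> x; rewrite (normrM c0) (normrM c1) (gtr0_norm c00) (gtr0_norm c10).
rewrite (powRM _ (ltW c00) (normr_ge0 (a x))) (powRM _ (ltW c10) (normr_ge0 (b x))).
by rewrite mulrACA rescale_weights // mul1r.
Qed.

Variables (Y0 Y1 : fspace T R) (K p Cp : R).
Hypothesis hY0 : qlat m Y0 K.
Hypothesis hY1 : qlat m Y1 K.
Hypothesis p01 : 0 < p <= 1.
Hypothesis Cp0 : 0 < Cp.
Hypothesis PM0 : pmean_bounded m Y0 p Cp.
Hypothesis PM1 : pmean_bounded m Y1 p Cp.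
Let p0 : 0 < p. Proof. by case/andP: p01. Qed.
Let K1 : 1 <= K. Proof. by case: hY0. Qed.
Let K0 : 0 < K. Proof. exact: lt_le_trans K1. Qed.

(* The pieces A n, B n bound f off G n with norms independent of n, while one of the
   two families has uniformly small tails on the sets G n. *)
Lemma calderon_tails (th Rr c : R) (f : T -> R) (A B : nat -> T -> R) (G : nat -> set T) :
  0 < th < 1 -> 0 < Rr -> 0 < c -> (\forall x \ae m, exists n, ~ G n x) ->
  (forall n, G n.+1 `<=` G n) ->
  (forall n, dom m Y0 (A n) Rr) -> (forall n, dom m Y1 (B n) Rr) ->
  (\forall x \ae m, forall n, ~ G n x -> `|f x| <= c * (`|A n x| `^ (1 - th) * `|B n x| `^ th)) ->
  (forall e, 0 < e -> exists n, forall l, dom m Y0 (cut (G n) (A l)) e) \/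
  (forall e, 0 < e -> exists n, forall l, dom m Y1 (cut (G n) (B l)) e) ->
  calderon m Y0 Y1 th f (2 * K ^+ 2 * (c * Rr)).
Proof.
move=> th01 Rr0 c0 G0 dG hA hB hf tl; have [th0 th1] := andP th01.
pose q := (4 * K)^-1.
have q0 : 0 < q by rewrite invr_gt0 mulr_gt0.
have Kq : 2 * K * q <= 1.
  by rewrite ler_pdivrMr ?mulr_gt0 // mul1r ler_pM2r // ler_nat.
(* Only one family is known to be small on the tails; it is made small enough, according to its
   exponent, for the product of powers to decay like q^i. Uniformity in l allows l = n_ (i+1)
   afterwards. *)
have [n_ hn] : exists n_ : nat -> nat, forall i, (i <= n_ i)%N /\ forall l, exists r0 r1,
    [/\ 0 < r0, 0 < r1, dom m Y0 (cut (G (n_ i)) (A l)) r0, dom m Y1 (cut (G (n_ i)) (B l)) r1 &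
     r0 `^ (1 - th) * r1 `^ th = Rr * q ^+ i.+1].
  have RE : Rr = Rr `^ (1 - th) * Rr `^ th.
    by rewrite -powRD ?subrK ?(powRr1 (ltW Rr0)) // (gt_eqF Rr0) implybT.
  suff /choice[n_ h] : forall i, exists n, (i <= n)%N /\ forall l, exists r0 r1,
    [/\ 0 < r0, 0 < r1, dom m Y0 (cut (G n) (A l)) r0, dom m Y1 (cut (G n) (B l)) r1 &
     r0 `^ (1 - th) * r1 `^ th = Rr * q ^+ i.+1] by exists n_.
  move=> i; have qi0 : 0 < q ^+ i.+1 by exact: exprn_gt0.
  case: tl => tl.
    have e0 : 0 < Rr * (q ^+ i.+1) `^ (1 - th)^-1 by rewrite mulr_gt0 ?powR_gt0.
    have [n hn] := tl _ e0; exists (maxn n i); split; first exact: leq_maxr.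
    move=> l; exists (Rr * (q ^+ i.+1) `^ (1 - th)^-1), Rr; split => //.
    - by apply: dom_cutS (hn l); apply: decr_sub => //; exact: leq_maxl.
    - exact: dom_cut.
    have thn : 1 - th != 0 by rewrite gt_eqF // subr_gt0.
    rewrite (powRM _ (ltW Rr0) (powR_ge0 _ _)) -powRrM mulVf // (powRr1 (ltW qi0)).
    by rewrite mulrAC -RE.
  have e0 : 0 < Rr * (q ^+ i.+1) `^ th^-1 by rewrite mulr_gt0 ?powR_gt0.
  have [n hn] := tl _ e0; exists (maxn n i); split; first exact: leq_maxr.
  move=> l; exists Rr, (Rr * (q ^+ i.+1) `^ th^-1); split => //.
  - exact: dom_cut.
  - by apply: dom_cutS (hn l); apply: decr_sub => //; exact: leq_maxl.
  have thn : th != 0 by rewrite gt_eqF.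
  rewrite (powRM _ (ltW Rr0) (powR_ge0 _ _)) -powRrM mulVf // (powRr1 (ltW qi0)).
  by rewrite mulrA -RE.
have hp i : exists ab : (T -> R) * (T -> R), [/\ dom m Y0 ab.1 (Rr * q ^+ i.+1), dom m Y1 ab.2 (Rr * q ^+ i.+1) &
    forall x, `|ab.1 x| `^ (1 - th) * `|ab.2 x| `^ th =
      `|cut (G (n_ i)) (A (n_ i.+1)) x| `^ (1 - th) * `|cut (G (n_ i)) (B (n_ i.+1)) x| `^ th].
  have [_ /(_ (n_ i.+1))[r0 [r1 [r00 r10 h0 h1 rE]]]] := hn i.
  have [a [b [ha hb hab]]] := dom_rescale hY0 hY1 th01 r00 r10 h0 h1.
  by exists (a, b); rewrite -rE.
have [ab {}hp] := choice hp.
(* Piece i + 1 serves the points of G (n_ i) outside G (n_ (i+1)), where the bound of index n_ (i+1)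
   holds; piece 0 serves the points outside G (n_ 0). *)
pose a i x := c * (if i is j.+1 then (ab j).1 x else A (n_ 0%N) x).
pose b i x := c * (if i is j.+1 then (ab j).2 x else B (n_ 0%N) x).
apply: (calderon_glue hY0 hY1 (a := a) (b := b) _ q0 Kq).
- by rewrite !ltW.
- by rewrite mulr_ge0 // ltW.
- move=> i; rewrite -mulrA -{1}(gtr0_norm c0); apply: (dom_scale hY0).
  by case: i => [|i]; [rewrite expr0 mulr1|case: (hp i)].
- move=> i; rewrite -mulrA -{1}(gtr0_norm c0); apply: (dom_scale hY1).
  by case: i => [|i]; [rewrite expr0 mulr1|case: (hp i)].
have cE (s t : R) : `|c * s| `^ (1 - th) * `|c * t| `^ th = c * (`|s| `^ (1 - th) * `|t| `^ th).
  rewrite !normrM (gtr0_norm c0) (powRM _ (ltW c0) (normr_ge0 s)) (powRM _ (ltW c0) (normr_ge0 t)).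
  by rewrite mulrACA -powRD ?subrK ?(powRr1 (ltW c0)) // (gt_eqF c0) implybT.
near=> x.
have fx : forall n, ~ G n x -> `|f x| <= c * (`|A n x| `^ (1 - th) * `|B n x| `^ th) by near: x.
have [n nG] : exists n, ~ G n x by near: x.
have hex : exists i, `[< ~ G (n_ i) x >].
  exists n; apply/asboolP => Gx; apply: nG; apply: decr_sub Gx => //.
  by case: (hn n).
case: (ex_minnP hex) => -[|i] /asboolP nGi mi.
  by exists 0%N; rewrite /a /b cE; exact: fx.
exists i.+1; rewrite /a /b cE; have [_ _ ->] := hp i.
have Gi : G (n_ i) x.
  by apply: contrapT => nGi'; have := mi i (asboolT nGi'); rewrite ltnn.
by rewrite !cutT //; exact: fx.
Unshelve. all: by end_near.
Qed.

Definition calderon_cst : R := (2 * expR 1 + 1) `^ p^-1.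

Lemma admissible_bounds (F : R[i] -> T -> R[i]) : admissible m Y0 Y1 F ->
  [/\ forall t, fs_norm Y0 (F (0 +i* t)%C) <= admissible_norm m Y0 Y1 F,
      forall t, fs_norm Y1 (F (1 +i* t)%C) <= admissible_norm m Y0 Y1 F &
      forall z, strip z -> fs_norm (sum_space m Y0 Y1) (F z) <= admissible_norm m Y0 Y1 F].
Proof.
move=> [_ [MS hMS] _ [_ _ [M0 hM0]] [_ _ [M1 hM1]]]; rewrite /admissible_norm; split.
- move=> t; rewrite !le_max; apply/orP; left; apply/orP; left.
  by apply: ub_le_sup; [exists M0 => _ [s _ <-]|exists t].
- move=> t; rewrite !le_max; apply/orP; left; apply/orP; right.
  by apply: ub_le_sup; [exists M1 => _ [s _ <-]|exists t].
- move=> z hz; rewrite !le_max; apply/orP; right.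
  by apply: ub_le_sup; [exists MS => _ [s hs <-]; exact: hMS|exists z].
Qed.

Lemma interp_calderon (th r : R) f : 0 < th < 1 -> 0 < r ->
  order_cont m Y0 \/ order_cont m Y1 -> interp m Y0 Y1 th f ->
  fs_norm (interp m Y0 Y1 th) f < r ->
  calderon m Y0 Y1 th (fun x => nc (f x)) (2 * K ^+ 2 * (calderon_cst * (K * (Cp * r + r)))).
Proof.
move=> th01 r0 oc [Lf [F1 aF1 F1f]] /inf_lt[|_ [F [aF Ff] <-] Fr].
  by exists (admissible_norm m Y0 Y1 F1), F1.
have [b0 b1 bS] := admissible_bounds aF.
have {}b0 t : fs_norm Y0 (F (0 +i* t)%C) <= r := le_trans (b0 t) (ltW Fr).
have {}b1 t : fs_norm Y1 (F (1 +i* t)%C) <= r := le_trans (b1 t) (ltW Fr).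
have {}bS z : strip z -> fs_norm (sum_space m Y0 Y1) (F z) <= r.
  by move=> /bS h; exact: le_trans h (ltW Fr).
have [_ _ _ [YF0 cF0 _] [YF1 cF1 _]] := aF.
pose q := (4 * K)^-1.
have q0 : 0 < q by rewrite invr_gt0 mulr_gt0.
have q2 : q <= 2^-1 by rewrite /q lef_pV2 ?posrE ?mulr_gt0 //; have := K1; lra.
have Kq : 4 * K * q <= 1 by rewrite divff // gt_eqF // mulr_gt0.
have q1 : q <= 1 by apply: (le_trans q2); lra.
have qi k : 1 <= q ^- k by rewrite invf_ge1 ?exprn_gt0 // exprn_ile1 // ltW.
clearbody q.
have [al0 [mal0 al00 Yal0 al0p]] := unit_dom hY0 r0.
have [al1 [mal1 al10 Yal1 al1p]] := unit_dom hY1 r0.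
(* At stage k the error decays like q^k, while the admissible weights cover ratios of the two
   factors up to q^-k. *)
have : forall k, exists Le : seq R[i] * (T -> R), [/\ (0 < size Le.1)%N,
    forall M, 0 < M -> mean Le.1 (fun w => ((M < `|complex.Im w|)%R : nat)%:R) <= M ^- 2,
    domS m Y0 Y1 Le.2 (r * q ^+ k), forall x, 0 <= Le.2 x &
    \forall x \ae m, forall kap, `|kap| <= ln (q ^- k) ->
      nc (F th%:C%C x) `^ p <= expR 1 * (expR (- (kap * th * p)) * pm p Le.1 (left_trace F) x `^ p +
         expR (kap * (1 - th) * p) * pm p Le.1 (right_trace F) x `^ p) + Le.2 x `^ p].
  move=> k; have rk : 0 < r * q ^+ k by rewrite mulr_gt0 // exprn_gt0.
  have [L [e h]] := interior_bound hY0 hY1 p01 Cp0 PM0 PM1 aF r0 bS th01 rk (ln_ge0 (qi k)).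
  by exists (L, e).
move=> /choice[Le hLe].
pose h0 t := F (0 +i* t)%C; pose h1 t := F (1 +i* t)%C.
pose sel : pred R[i] := fun w => complex.Re w < 2^-1.
pose A k := trace_mean p h0 sel (Le k).1.
pose B k := trace_mean p h1 (fun w => ~~ sel w) (Le k).1.
have AE k x : pm p (Le k).1 (left_trace F) x = A k x by [].
have BE k x : pm p (Le k).1 (right_trace F) x = B k x.
  rewrite /B /trace_mean /pm; congr (_ `^ _); congr (mean _ _); apply/funext => w.
  by rewrite /right_trace /sel; case: ifP.
have L0 k : (0 < size (Le k).1)%N by case: (hLe k).
have hA k : dom m Y0 (A k) (Cp * r) by exact: (trace_mean_dom hY0 p01 PM0 YF0 r0 b0).
have hB k : dom m Y1 (B k) (Cp * r) by exact: (trace_mean_dom hY1 p01 PM1 YF1 r0 b1).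
have mA k : measurable_fun setT (A k) by exact: (measurable_trace_mean p hY0 YF0).
have mB k : measurable_fun setT (B k) by exact: (measurable_trace_mean p hY1 YF1).
have A0 k x : 0 <= A k x by exact: pm_ge0.
have B0 k x : 0 <= B k x by exact: pm_ge0.
have AT k : A k = trace_mean p h0 sel (Le k).1 := erefl.
have BT k : B k = trace_mean p h1 (fun w => ~~ sel w) (Le k).1 := erefl.
clearbody A B.
have : forall k, exists w : (T -> R) * (T -> R), [/\ [/\ forall x, 0 <= w.1 x, measurable_fun setT w.1 &
    dom m Y0 w.1 (r * q ^+ k)], [/\ forall x, 0 <= w.2 x, measurable_fun setT w.2 &
    dom m Y1 w.2 (r * q ^+ k)] & \forall x \ae m, (Le k).2 x <= w.1 x + w.2 x].
  move=> k; have [_ _ [v0 [v1 [hv0 hv1 hv]]] _ _] := hLe k.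
  have [w0 [w00 mw0 Yw0 w0r v0w]] := dom_rep hY0 hv0.
  have [w1 [w10 mw1 Yw1 w1r v1w]] := dom_rep hY1 hv1.
  exists (w0, w1); split; first by split=> //=; exact: rep_dom.
    by split=> //=; exact: rep_dom.
  near=> x; apply: (le_trans (ler_norm _)); apply: (@le_trans _ _ (`|v0 x| + `|v1 x|)).
    by near: x.
  by apply: lerD; near: x.
move=> /choice[w hw].
have w0_0 k x : 0 <= (w k).1 x by case: (hw k) => -[].
have w1_0 k x : 0 <= (w k).2 x by case: (hw k) => _ [].
have r0' := ltW r0; have Cr0 : 0 <= Cp * r by rewrite mulr_ge0 // ltW.
have [|U0 _ hU0] := dom_geo hY0 q0 Kq r0' (u := fun k => (w k).1); first by move=> k; case: (hw k) => -[].
have [|U1 _ hU1] := dom_geo hY1 q0 Kq r0' (u := fun k => (w k).2); first by move=> k; case: (hw k) => _ [].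
have qk0 k : 0 <= q ^+ k by rewrite exprn_ge0 // ltW.
have [|UA _ hUA] := dom_geo hY0 q0 Kq Cr0 (u := fun k x => q ^+ k * A k x).
  by move=> k; have := dom_scale hY0 (q ^+ k) (hA k); rewrite (ger0_norm (qk0 k)) mulrC.
have [|UB _ hUB] := dom_geo hY1 q0 Kq Cr0 (u := fun k x => q ^+ k * B k x).
  by move=> k; have := dom_scale hY1 (q ^+ k) (hB k); rewrite (ger0_norm (qk0 k)) mulrC.
(* These are the conditions of [optimal_weight_bound] with Q = q^-k. *)
pose tst k x := [&& (w k).1 x + (w k).2 x <= al0 x, (w k).1 x + (w k).2 x <= al1 x,
   q ^+ k * (A k x + al0 x) <= al1 x & q ^+ k * (B k x + al1 x) <= al0 x].
pose E k := [set x | tst k x].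
have mE k : measurable (E k).
  have mw : measurable_fun setT (fun x => (w k).1 x + (w k).2 x).
    by apply: measurable_funD; [case: (hw k) => -[]|case: (hw k) => _ []].
  have mb : measurable_fun setT (tst k).
    apply: measurable_and; first exact: measurable_fun_ler.
    apply: measurable_and; first exact: measurable_fun_ler.
    by apply: measurable_and; apply: measurable_fun_ler => //; apply: measurable_funM => //;
      exact: measurable_funD.
  rewrite (_ : E k = setT `&` (tst k) @^-1` [set true]); last by rewrite setTI.
  exact: mb.
pose G n := \bigcup_(k in [set k | (n <= k)%N]) ~` E k.
have mG n : measurable (G n).
  by apply: bigcup_measurable => k _; exact: measurableC.
have dG n : G n.+1 `<=` G n by move=> x [k /= nk Ek]; exists k => //=; exact: ltnW.
(* By [dom_geo] all quantities compared with al0 x > 0 and al1 x > 0 are at most 2^-k times a finite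
   number, so the tests hold for all large k. *)
have G0 : \forall x \ae m, exists n, ~ G n x.
  near=> x.
  have a0 : 0 < al0 x by near: x.
  have a1 : 0 < al1 x by near: x.
  have u0 : forall k, 2 ^+ k * `|(w k).1 x| <= U0 x by near: x.
  have u1 : forall k, 2 ^+ k * `|(w k).2 x| <= U1 x by near: x.
  have uA : forall k, 2 ^+ k * `|q ^+ k * A k x| <= UA x by near: x.
  have uB : forall k, 2 ^+ k * `|q ^+ k * B k x| <= UB x by near: x.
  have pos (g : nat -> R) U : (forall k, 2 ^+ k * `|g k| <= U) -> 0 <= U.
    by move=> /(_ 0%N); apply: le_trans; rewrite mulr_ge0 // exprn_ge0.
  have U00 := pos _ _ u0; have U10 := pos _ _ u1; have UA0 := pos _ _ uA; have UB0 := pos _ _ uB.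
  pose Cs := U0 x + U1 x + UA x + UB x + al0 x + al1 x.
  have Cs0 : 0 <= Cs by rewrite !addr_ge0.
  have mn : 0 < Num.min (al0 x) (al1 x) by rewrite lt_min a0.
  have [N hN] := exp2_small mn Cs0; exists N => -[k /= Nk]; apply.
  have h2 : 2 ^- k * Cs < Num.min (al0 x) (al1 x).
    apply: le_lt_trans hN; rewrite ler_wpM2r // lef_pV2 ?posrE ?exprn_gt0 //.
    by rewrite ler_eXn2l // ltr1n.
  have k2 : 0 < 2 ^- k :> R by rewrite invr_gt0 exprn_gt0.
  have t (g : nat -> R) U : (forall k, 2 ^+ k * `|g k| <= U) -> g k <= 2 ^- k * U.
    move=> /(_ k); rewrite mulrC -ler_pdivlMr ?exprn_gt0 // => /(le_trans (ler_norm _)).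
    by rewrite mulrC.
  have qk : q ^+ k <= 2 ^- k.
    by rewrite -exprVn; apply: lerXn2r; rewrite ?nnegrE ?invr_ge0 // ltW.
  have := t _ _ u0; have := t _ _ u1; have := t _ _ uA; have := t _ _ uB => tB tA t1 t0.
  have la0 : q ^+ k * al0 x <= 2 ^- k * al0 x by rewrite ler_wpM2r.
  have la1 : q ^+ k * al1 x <= 2 ^- k * al1 x by rewrite ler_wpM2r.
  move: h2; rewrite lt_min /Cs !mulrDr => /andP[m0 m1].
  have p0' := mulr_ge0 (ltW k2) U00; have p1' := mulr_ge0 (ltW k2) U10.
  have pA' := mulr_ge0 (ltW k2) UA0; have pB' := mulr_ge0 (ltW k2) UB0.
  have pa0 := mulr_ge0 (ltW k2) (ltW a0); have pa1 := mulr_ge0 (ltW k2) (ltW a1).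
  rewrite /E /tst /= !mulrDr; apply/and4P.
  exact: (small_terms t0 t1 tA tB la0 la1 p0' p1' pA' pB' pa0 pa1 m0 m1).
have fE : \forall x \ae m, forall n, ~ G n x -> `|nc (f x)| <=
     calderon_cst * (`|A n x + al0 x| `^ (1 - th) * `|B n x + al1 x| `^ th).
  have st : \forall x \ae m, forall k, forall kap, `|kap| <= ln (q ^- k) ->
      nc (F th%:C%C x) `^ p <= expR 1 * (expR (- (kap * th * p)) * A k x `^ p +
         expR (kap * (1 - th) * p) * B k x `^ p) + (Le k).2 x `^ p.
    apply: ae_foralln => k; have [_ _ _ _] := hLe k; apply: filterS => x hx kap /hx.
    by rewrite AE BE.
  have ew : \forall x \ae m, forall k, (Le k).2 x <= (w k).1 x + (w k).2 x.
    by apply: ae_foralln => k; case: (hw k).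
  near=> x => n nG.
  have /and4P[t1 t2 t3 t4] : E n x.
    by apply: contrapT => nE; apply: nG; exists n => /=.
  have <- : F th%:C%C x = f x by have : True -> F th%:C%C x = f x; [near: x|exact].
  have eq_ : (Le n).2 x <= (w n).1 x + (w n).2 x by move: n {nG t1 t2 t3 t4}; near: x.
  rewrite (ger0_norm (nc_ge0 _)) !ger0_norm ?addr_ge0 //.
  apply: (@optimal_weight_bound R p th _ _ _ ((Le n).2 x) _ _ (q ^- n)) => //.
  - exact: nc_ge0.
  - by case: (hLe n).
  - by near: x.
  - by near: x.
  - exact: le_trans t1.
  - exact: le_trans t2.
  - by rewrite ler_pdivlMl ?exprn_gt0.
  - by rewrite ler_pdivlMl ?exprn_gt0.
  - by move: n {nG t1 t2 t3 t4 eq_}; near: x.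
have Rr0 : 0 < K * (Cp * r + r) by rewrite mulr_gt0 // addr_gt0 // mulr_gt0.
have c0 : 0 < calderon_cst by rewrite powR_gt0 // addr_gt0 // mulr_gt0 // expR_gt0.
have sumE (Y : fspace T R) (u v : T -> R) s : (forall x, 0 <= u x) -> (forall x, 0 <= v x) ->
    dom m Y (fun x => `|u x| + `|v x|) s -> dom m Y (fun x => u x + v x) s.
  move=> u0 v0 h; apply: (dom_le h) => //; apply: aeW => x.
  by rewrite !ger0_norm ?addr_ge0.
apply: (@calderon_tails th _ calderon_cst _ (fun n x => A n x + al0 x) (fun n x => B n x + al1 x) G) => //.
- by move=> n; apply: sumE => //; exact: dom_add.
- by move=> n; apply: sumE => //; exact: dom_add.
have cutE (u v : T -> R) S : (forall x, 0 <= u x) -> (forall x, 0 <= v x) ->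
    forall x, `|cut S (fun x => u x + v x) x| <= `| `|cut S u x| + `|cut S v x| |.
  move=> u0 v0 x; rewrite /cut; case: ifP => _; last by rewrite normr0.
  by rewrite !ger0_norm ?addr_ge0.
case: oc => oc; [left|right] => e e0; pose e' := e / (2 * K);
    have e'0 : 0 < e' by rewrite divr_gt0 // mulr_gt0.
  have [n hn] := tail_pm hY0 p01 Cp0 PM0 YF0 cF0 r0 b0 mG dG G0 oc e'0.
  have [n' hn'] := order_cont_dom oc Yal0 mG dG G0 e'0.
  exists (maxn n n') => l; have [_ hm _ _ _] := hLe l.
  have h1' := dom_cutS (decr_sub dG (leq_maxl n n')) (hn sel _ (L0 l) hm).
  rewrite -AT in h1'.
  have h2' := dom_cutS (decr_sub dG (leq_maxr n n')) hn'.
  apply: (dom_le (dom_add hY0 h1' h2')).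
    by rewrite /e' (_ : K * _ = e) //; field; rewrite gt_eqF.
  by apply: aeW; exact: cutE.
have [n hn] := tail_pm hY1 p01 Cp0 PM1 YF1 cF1 r0 b1 mG dG G0 oc e'0.
have [n' hn'] := order_cont_dom oc Yal1 mG dG G0 e'0.
exists (maxn n n') => l; have [_ hm _ _ _] := hLe l.
have h1' := dom_cutS (decr_sub dG (leq_maxl n n')) (hn (fun w => ~~ sel w) _ (L0 l) hm).
rewrite -BT in h1'.
have h2' := dom_cutS (decr_sub dG (leq_maxr n n')) hn'.
apply: (dom_le (dom_add hY1 h1' h2')).
  by rewrite /e' (_ : K * _ = e) //; field; rewrite gt_eqF.
by apply: aeW; exact: cutE.
Unshelve. all: by end_near.
Qed.

End interp_to_calderon.

(** * Reiteration *)

(* Dividing x n by t n, the solution of t n = Q ^+ n * P * t n.+1 `^ rho, leaves a bounded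
   sequence with y n <= y n.+1 `^ rho, hence sup y <= (sup y) `^ rho. *)
Lemma iteration_bound (R : realType) (x : nat -> R) (Q P W rho : R) :
  1 <= Q -> 0 <= P -> 0 < rho < 1 -> (forall n, 0 <= x n) -> (forall n, x n <= Q ^+ n * W) ->
  (forall n, x n <= Q ^+ n * P * x n.+1 `^ rho) ->
  x 0%N <= ((Q `^ (1 - rho)^-1) `^ rho) `^ (1 - rho)^-1 * P `^ (1 - rho)^-1.
Proof.
move=> Q1 P0 /andP[rho0 rho1] x0 xW hx.
have Q0 : 0 < Q by exact: lt_le_trans Q1.
pose s := (1 - rho)^-1.
have r1 : 0 < 1 - rho by rewrite subr_gt0.
have s0 : 0 < s by rewrite invr_gt0.
pose B := Q `^ s; pose M := (B `^ rho) `^ s.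
have B0 : 0 < B by rewrite powR_gt0.
have M0 : 0 < M by rewrite !powR_gt0.
rewrite -/s -/B -/M.
move: P0; rewrite le_eqVlt => /orP[/eqP P0|P0].
  by apply: (le_trans (hx 0%N)); rewrite -P0 mulr0 mul0r mulr_ge0 ?powR_ge0 // ltW.
have QB : Q <= B.
  rewrite -[leLHS](powRr1 (ltW Q0)) /B; apply: ler_powR => //.
  by rewrite /s invf_ge1 //; lra.
pose t n := B ^+ n * (M * P `^ s).
have t0 n : 0 < t n by rewrite !mulr_gt0 ?exprn_gt0 ?powR_gt0.
pose y n := x n / t n.
have y0 n : 0 <= y n by rewrite divr_ge0 // ltW.
have tE n : t n = Q ^+ n * P * t n.+1 `^ rho.
  have lnt k : ln (t k) = k%:R * (s * ln Q) + (s * (rho * (s * ln Q)) + s * ln P).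
    rewrite /t lnM ?posrE ?exprn_gt0 ?mulr_gt0 ?powR_gt0 // lnM ?posrE ?powR_gt0 //.
    by rewrite lnXn // /M /B !ln_powR mulr_natl.
  apply: ln_inj; rewrite ?posrE ?mulr_gt0 ?exprn_gt0 ?powR_gt0 //.
  rewrite lnM ?posrE ?mulr_gt0 ?exprn_gt0 ?powR_gt0 // lnM ?posrE ?exprn_gt0 //.
  rewrite lnXn // ln_powR !lnt -mulr_natl -natr1 /s; field.
  by rewrite gt_eqF.
have yr n : y n <= y n.+1 `^ rho.
  rewrite {1}/y ler_pdivrMr // tE.
  have -> : (x n.+1 / t n.+1) `^ rho * (Q ^+ n * P * t n.+1 `^ rho) = Q ^+ n * P * x n.+1 `^ rho.
    rewrite mulrCA -powRM ?divfK ?gt_eqF // ?(ltW (t0 _)) //.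
    by rewrite divr_ge0 // ltW.
  exact: hx.
pose S := sup (range y).
have ub : has_ubound (range y).
  exists (W / (M * P `^ s)) => _ [n _ <-].
  have W0 : 0 <= W by have := xW 0%N; rewrite expr0 mul1r; exact: le_trans.
  have MP : 0 < M * P `^ s by rewrite mulr_gt0 ?powR_gt0.
  rewrite /y /t ler_pdivrMr; last exact: (t0 n).
  rewrite [leRHS](_ : _ = B ^+ n * W); last by field; rewrite (gt_eqF M0) (gt_eqF (powR_gt0 s P0)).
  apply: (le_trans (xW n)); rewrite ler_wpM2r //.
  by apply: lerXn2r; rewrite ?nnegrE // ltW.
have yS n : y n <= S by apply: ub_le_sup => //; exists n.
have SS : S <= S `^ rho.
  apply: ge_sup; first by exists (y 0%N), 0%N.
  move=> _ [n _ <-]; apply: (le_trans (yr n)).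
  by apply: ge0_ler_powR; rewrite ?nnegrE ?(ltW rho0) // (le_trans (y0 n)).
have S1 : S <= 1.
  rewrite leNgt; apply/negP => S1; have S0 : 0 < S by lra.
  have : S `^ rho < S.
    by rewrite /powR gt_eqF // -[ltRHS]lnK ?posrE // ltr_expR gtr_pMl // ln_gt0.
  by rewrite ltNge SS.
have := le_trans (yS 0%N) S1; by rewrite /y ler_pdivrMr // mul1r /t expr0 mul1r.
Qed.

Section reiteration.
Context d (T : measurableType d) (R : realType).
Variable m : {measure set T -> \bar R}.

Lemma A_convex_interp_calderon (Y0 Y1 : fspace T R) : A_convex m Y0 -> A_convex m Y1 ->
  exists2 C : R, 0 < C & forall (th r : R) f, 0 < th < 1 -> 0 < r ->
   order_cont m Y0 \/ order_cont m Y1 -> interp m Y0 Y1 th f ->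
   fs_norm (interp m Y0 Y1 th) f < r -> calderon m Y0 Y1 th (fun x => nc (f x)) (C * r).
Proof.
move=> [q0 [C0 C01 hC0]] [q1 [C1 C11 hC1]].
have [K0 hY0] := qbfs_qlat q0; have [K1 hY1] := qbfs_qlat q1.
pose K := Num.max K0 K1.
have {}hY0 : qlat m Y0 K by apply: qlat_mono hY0; rewrite le_max lexx.
have {}hY1 : qlat m Y1 K by apply: qlat_mono hY1; rewrite le_max lexx orbT.
have [p0 /andP[p00 p01] h0] := power_mean_bound hY0 C01 hC0.
have [p1 /andP[p10 p11] h1] := power_mean_bound hY1 C11 hC1.
pose p := Num.min p0 p1; have p_gt : 0 < p by rewrite lt_min p00.
have pp0 : p <= p0 by rewrite ge_min lexx.
have pp1 : p <= p1 by rewrite ge_min lexx orbT.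
have [|c0 c00 PM0] := h0 p; first by rewrite p_gt.
have [|c1 c10 PM1] := h1 p; first by rewrite p_gt.
pose Cp := Num.max c0 c1; have Cp0 : 0 < Cp by rewrite lt_max c00.
have KK : 1 <= K by case: hY0.
have K0' : 0 < K by lra.
have cA : 0 < calderon_cst p by rewrite powR_gt0 // addr_gt0 // mulr_gt0 // expR_gt0.
exists (2 * K ^+ 2 * (calderon_cst p * (K * (Cp + 1)))).
  by rewrite !mulr_gt0 ?exprn_gt0 // addr_gt0.
move=> th r f th01 r0 oc hf fr.
have [] := @interp_calderon _ _ _ m Y0 Y1 K p Cp hY0 hY1 _ Cp0 _ _ th r f th01 r0 oc hf fr.
- by rewrite p_gt (le_trans pp0).
- move=> n g n0 hg; apply: (dom_ler (PM0 n g n0 hg)); by rewrite le_max lexx.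
- move=> n g n0 hg; apply: (dom_ler (PM1 n g n0 hg)); by rewrite le_max lexx orbT.
move=> a [b h]; exists a, b.
by rewrite (_ : 2 * K ^+ 2 * _ * r = 2 * K ^+ 2 * (calderon_cst p * (K * (Cp * r + r)))) //; ring.
Qed.

Lemma powR_small (a C e : R) : 0 < a -> 0 < C -> 0 < e -> exists2 del, 0 < del & C * del `^ a <= e.
Proof.
move=> a0 C0 e0; exists ((e / C) `^ a^-1); first by apply: powR_gt0; exact: divr_gt0.
by rewrite -powRrM mulVf ?gt_eqF // powRr1 ?divr_ge0 ?(ltW e0) ?(ltW C0) // mulrC divfK // gt_eqF.
Qed.

(** For g in D, a restriction of |g| is its own geometric mean, so [interp_comparable] bounds its
    norm in X by powers of its norms in Y0 and Y1; it suffices that one of these tends to 0. Density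
    extends this to X. *)
Lemma interp_order_cont (Y0 Y1 X : fspace T R) (K th : R) (D : set (T -> R[i])) :
  qlat m Y0 K -> qlat m Y1 K -> qlat m X K -> 0 < th < 1 -> qn_equiv X (interp m Y0 Y1 th) ->
  qn_dense D X -> D `<=` fs_mem Y0 -> D `<=` fs_mem Y1 ->
  order_cont m Y0 \/ order_cont m Y1 -> order_cont m X.
Proof.
move=> hY0 hY1 hX th01 [XI [c c0 hc]] [DX dX] D0 D1 oc f Xf E mE dE E0 e e0.
have [th0 th1] := andP th01.
have K1 : 1 <= K by case: hX.
have K0 : 0 < K by lra.
pose e' := e / (2 * K); have e'0 : 0 < e' by rewrite divr_gt0 // mulr_gt0.
have [g Dg fg] := dX f Xf e' e'0.
have Xg := DX g Dg; have Y0g := D0 g Dg; have Y1g := D1 g Dg.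
have mg : measurable_fun setT (fun x => nc (g x)) by apply: measurable_nc; exact: (fs_mem_L0 hX Xg).
have key n r0 r1 : 0 < r0 -> 0 < r1 -> dom m Y0 (cut (E n) (fun x => nc (g x))) r0 ->
    dom m Y1 (cut (E n) (fun x => nc (g x))) r1 ->
    dom m X (cut (E n) (fun x => nc (g x))) (c * (2 * (r0 `^ (1 - th) * r1 `^ th))).
  move=> r00 r10 h0 h1; pose u := cut (E n) (fun x => nc (g x)).
  have u0 x : 0 <= u x by rewrite /u /cut; case: ifP => // _; exact: nc_ge0.
  have mu : measurable_fun setT u by exact: measurable_cut.
  have [|||In nI] := @interp_comparable _ _ _ m Y0 Y1 K hY0 hY1 th u u r0 r1 1 (fun x => (u x)%:C%C)
     th01 r00 r10 mu mu u0 u0 h0 h1 _ _ (L0_real mu).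
  - by move=> x; rewrite mul1r.
  - by move=> x; rewrite mul1r.
  - apply: aeW => x; rewrite nc_real ger0_norm // -powRD ?subrK ?powRr1 //.
    by rewrite oner_eq0.
  have Xu : X (fun x => (u x)%:C%C) by rewrite XI.
  apply: (rep_dom m Xu); have /andP[h _] := hc _ Xu.
  by move: h; rewrite ler_pdivrMl // => /le_trans; apply; rewrite ler_pM2l.
have fin (Y : fspace T R) n : Y g -> qlat m Y K ->
    dom m Y (cut (E n) (fun x => nc (g x))) (fs_norm Y g + 1).
  by move=> Yg hY; apply: dom_cut; apply: (dom_ler (dom_fs m Yg (lexx _))); rewrite lerDl.
have n0 : 0 < fs_norm Y0 g + 1 by rewrite ltr_wpDl // (fs_norm_ge0 hY0 Y0g).
have n1 : 0 < fs_norm Y1 g + 1 by rewrite ltr_wpDl // (fs_norm_ge0 hY1 Y1g).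
have [n hn] : exists n, dom m X (cut (E n) (fun x => nc (g x))) e'.
  case: oc => oc.
    have cn : 0 < c * 2 * (fs_norm Y1 g + 1) `^ th by rewrite !mulr_gt0 // powR_gt0.
    have th' : 0 < 1 - th by rewrite subr_gt0.
    have [del d0 hd] := powR_small th' cn e'0.
    have [n hn] := oc g Y0g E mE dE E0 del d0; exists n.
    apply: (dom_ler (key n _ _ d0 n1 hn (fin _ _ Y1g hY1))); apply: le_trans hd.
    by rewrite le_eqVlt; apply/orP; left; apply/eqP; ring.
  have cn : 0 < c * 2 * (fs_norm Y0 g + 1) `^ (1 - th) by rewrite !mulr_gt0 // powR_gt0.
  have [del d0 hd] := powR_small th0 cn e'0.
  have [n hn] := oc g Y1g E mE dE E0 del d0; exists n.
  apply: (dom_ler (key n _ _ n0 d0 (fin _ _ Y0g hY0) hn)); apply: le_trans hd.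
  by rewrite le_eqVlt; apply/orP; left; apply/eqP; ring.
exists n; have Xfg := fs_memB hX Xf Xg.
have hfg := dom_cut (E n) (dom_fs m Xfg (ltW fg)).
apply: (dom_le (dom_add hX hfg hn)).
  by rewrite /e' (_ : K * _ = e) //; field; rewrite gt_eqF.
apply: aeW => x; rewrite normr_normD /cut; case: ifP => _; last by rewrite !normr0 addr0.
rewrite !(ger0_norm (nc_ge0 _)).
have -> : f x = (f - g) x + g x by rewrite [X in X + _](_ : _ = f x - g x) ?subrK.
exact: ler_ncD.
Qed.

Lemma equiv_calderon (Y0 Y1 X : fspace T R) (K th : R) : A_convex m Y0 -> A_convex m Y1 ->
  qlat m X K -> 0 < th < 1 -> qn_equiv X (interp m Y0 Y1 th) ->
  order_cont m Y0 \/ order_cont m Y1 ->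
  exists2 C : R, 1 <= C & forall u r, 0 < r -> dom m X u r -> calderon m Y0 Y1 th u (C * r).
Proof.
move=> aY0 aY1 hX th01 [XI [c c0 hc]] oc.
have [C C0 hC] := A_convex_interp_calderon aY0 aY1.
exists (1 + C * (c + 1)); first by rewrite lerDl mulr_ge0 // ltW // addr_gt0.
move=> u r r0 [f [Xf fr uf]].
have If : interp m Y0 Y1 th f by rewrite -[interp _ _ _ _ _]/(fs_mem (interp m Y0 Y1 th) f) -XI.
have fI : fs_norm (interp m Y0 Y1 th) f < (c + 1) * r.
  have /andP[_ h] := hc f Xf; apply: (le_lt_trans h).
  apply: (@le_lt_trans _ _ (c * r)); first by rewrite ler_pM2l.
  by rewrite ltr_pM2r // ltrDl.
have r0' : 0 < (c + 1) * r by rewrite mulr_gt0 // addr_gt0.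
have [a [b [ha hb hab]]] := hC th _ f th01 r0' oc If fI.
have le : C * ((c + 1) * r) <= (1 + C * (c + 1)) * r.
  have -> : (1 + C * (c + 1)) * r = r + C * ((c + 1) * r) by ring.
  by rewrite lerDr ltW.
exists a, b; split; [exact: dom_ler ha le|exact: dom_ler hb le|].
near=> x; apply: (@le_trans _ _ `|nc (f x)|); last by near: x.
by rewrite (ger0_norm (nc_ge0 _)); near: x.
Unshelve. all: by end_near.
Qed.

(** Each double substitution bounds [h_ n] by a^(1-lam) d^(lam mu) times [h_ n.+1] to the power rho
    = lam (1 - mu), and multiplies norms by C^2. Weights Q^-n make the norms summable, and
    [iteration_bound] removes the powers Q^n left pointwise. The relation on th says lam mu / (1 -
    rho) = th. *)
Lemma calderon_iterate (X0 X1 X2 X3 : fspace T R) (K C lam mu th : R) :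
  qlat m X0 K -> qlat m X1 K -> qlat m X3 K -> 0 < lam < 1 -> 0 < mu < 1 ->
  th * (1 - lam * (1 - mu)) = lam * mu -> 1 <= C ->
  (forall u r, 0 < r -> dom m X1 u r -> calderon m X0 X2 lam u (C * r)) ->
  (forall u r, 0 < r -> dom m X2 u r -> calderon m X1 X3 mu u (C * r)) ->
  exists2 C' : R, 1 <= C' & forall u r, 0 < r -> dom m X1 u r -> calderon m X0 X3 th u (C' * r).
Proof.
move=> hX0 hX1 hX3 /andP[l0 l1] /andP[m0 m1] thE C1 h1 h2.
have K1 : 1 <= K by case: hX0.
have K0 : 0 < K by lra.
have C0 : 0 < C by lra.
have C2 : 1 <= C ^+ 2 by rewrite exprn_ege1.
have C20 : 0 < C ^+ 2 by lra.
pose rho := lam * (1 - mu).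
have rho0 : 0 < rho by rewrite mulr_gt0 // subr_gt0.
have rho1 : rho < 1 by rewrite /rho; nra.
pose q := (4 * K)^-1.
have q0 : 0 < q by rewrite invr_gt0 mulr_gt0.
have Kq : 2 * K * q <= 1.
  by rewrite ler_pdivrMr ?mulr_gt0 // mul1r ler_pM2r // ler_nat.
(* Q^-1 C^2 = q: one step of growth and one weight together give the ratio that [dom_series]
   accepts. *)
pose Q := 4 * K * C ^+ 2.
have Q1 : 1 <= Q by rewrite /Q; nra.
have Q0 : 0 < Q by lra.
have Qq : Q^-1 * C ^+ 2 = q by rewrite /Q /q; field; rewrite !gt_eqF.
pose M := ((Q `^ (1 - rho)^-1) `^ rho) `^ (1 - rho)^-1.
have M0 : 0 <= M by exact: powR_ge0.
exists (1 + (M + 1) * (2 * K ^+ 2 * C ^+ 2)).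
  by rewrite lerDl !mulr_ge0 ?exprn_ge0 ?addr_ge0 // ltW.
move=> u r r0 hu.
pose next (h : T -> R) (s : R) (abd : (T -> R) * (T -> R) * (T -> R)) :=
  [/\ dom m X0 abd.1.1 (C ^+ 2 * s), dom m X1 abd.1.2 (C ^+ 2 * s), dom m X3 abd.2 (C ^+ 2 * s) &
   \forall x \ae m, `|h x| <= `|abd.1.1 x| `^ (1 - lam) *
      (`|abd.1.2 x| `^ (1 - mu) * `|abd.2 x| `^ mu) `^ lam].
have hnext h s : 0 < s -> dom m X1 h s -> exists abd, next h s abd.
  move=> s0 /(h1 _ _ s0)[a [b [ha hb hab]]].
  have Cs0 : 0 < C * s by rewrite mulr_gt0.
  have [h' [dd [hh' hd hhd]]] := h2 _ _ Cs0 hb.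
  exists (a, h', dd); have e : C ^+ 2 * s = C * (C * s) by ring.
  rewrite /next /= e; split => //.
    apply: (dom_ler ha); rewrite ler_peMl // ltW //.
  near=> x; apply: (@le_trans _ _ (`|a x| `^ (1 - lam) * `|b x| `^ lam)); first by near: x.
  rewrite ler_wpM2l ?powR_ge0 //; apply: ge0_ler_powR; rewrite ?nnegrE ?(ltW l0) ?mulr_ge0 ?powR_ge0 //.
  by near: x.
pose rs n := (C ^+ 2) ^+ n * r.
have rs0 n : 0 < rs n by rewrite mulr_gt0 // exprn_gt0.
have [nx hnx] : exists nx : (T -> R) -> nat -> (T -> R) * (T -> R) * (T -> R),
    forall h n, dom m X1 h (rs n) -> next h (rs n) (nx h n).
  suff /choice[nx' hnx'] : forall hn : (T -> R) * nat, exists abd,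
      dom m X1 hn.1 (rs hn.2) -> next hn.1 (rs hn.2) abd.
    by exists (fun h n => nx' (h, n)) => h n; exact: hnx' (h, n).
  move=> [h n] /=; have [hh|hh] := pselect (dom m X1 h (rs n)); last by exists (u, u, u).
  by have [abd ?] := hnext h (rs n) (rs0 n) hh; exists abd.
pose h_ := fix h_ n := if n is k.+1 then (nx (h_ k) k).1.2 else u.
have rsS n : C ^+ 2 * rs n = rs n.+1 by rewrite /rs [_ ^+ n.+1]exprS mulrA.
have hh n : dom m X1 (h_ n) (rs n).
  elim: n => [|n IH] /=; first by rewrite /rs expr0 mul1r.
  by have [_ h _ _] := hnx _ _ IH; rewrite -rsS.
pose a_ n := (nx (h_ n) n).1.1; pose d_ n := (nx (h_ n) n).2.
have hs n : [/\ dom m X0 (a_ n) (rs n.+1), dom m X3 (d_ n) (rs n.+1) &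
   \forall x \ae m, `|h_ n x| <= `|a_ n x| `^ (1 - lam) *
      (`|h_ n.+1 x| `^ (1 - mu) * `|d_ n x| `^ mu) `^ lam].
  by have [hA _ hD hle] := hnx _ _ (hh n); rewrite -rsS.
have Cr0 : 0 <= C ^+ 2 * r by rewrite mulr_ge0 // ltW.
have scaled n : `|Q^-1 ^+ n| * rs n = r * q ^+ n /\ `|Q^-1 ^+ n| * rs n.+1 = C ^+ 2 * r * q ^+ n.
  have e1 : Q^-1 ^+ n * (C ^+ 2) ^+ n = q ^+ n by rewrite -exprMn Qq.
  have e2 : `|Q^-1 ^+ n| * rs n = r * q ^+ n.
    by rewrite ger0_norm ?exprn_ge0 ?invr_ge0 ?(ltW Q0) // /rs mulrA e1 mulrC.
  by split => //; rewrite -rsS mulrCA e2 mulrA.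
have [|U hU sU] := dom_series hX0 q0 Kq Cr0 (u := fun n x => Q^-1 ^+ n * a_ n x).
  move=> n; have [ha _ _] := hs n; have := dom_scale hX0 (Q^-1 ^+ n) ha.
  by rewrite (scaled n).2.
have [|V hV sV] := dom_series hX3 q0 Kq Cr0 (u := fun n x => Q^-1 ^+ n * d_ n x).
  move=> n; have [_ hd _] := hs n; have := dom_scale hX3 (Q^-1 ^+ n) hd.
  by rewrite (scaled n).2.
have [|W hW sW] := dom_series hX1 q0 Kq (ltW r0) (u := fun n x => Q^-1 ^+ n * h_ n x).
  move=> n; have := dom_scale hX1 (Q^-1 ^+ n) (hh n).
  by rewrite (scaled n).1.
have single (g : nat -> R) S : (forall n, \sum_(k < n) `|Q^-1 ^+ k * g k| <= S) ->
    forall n, `|g n| <= Q ^+ n * `|S|.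
  move=> gS n; have := gS n.+1; rewrite big_ord_recr /= => /(le_trans _) h.
  have {}h : `|Q^-1 ^+ n * g n| <= S by apply: h; rewrite lerDr sumr_ge0.
  have iQ : 0 <= Q^-1 ^+ n by rewrite exprn_ge0 // invr_ge0 ltW.
  move: h; rewrite normrM (ger0_norm iQ) exprVn ler_pdivrMl ?exprn_gt0 // => /le_trans; apply.
  by rewrite ler_wpM2l ?ler_norm // exprn_ge0 // ltW.
have hle : \forall x \ae m, forall n, `|h_ n x| <= `|a_ n x| `^ (1 - lam) *
      (`|h_ n.+1 x| `^ (1 - mu) * `|d_ n x| `^ mu) `^ lam.
  by apply: ae_foralln => n; case: (hs n).
exists (fun x => (M + 1) * U x), (fun x => (M + 1) * V x).
have M10 : 0 < M + 1 by lra.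
have cle : (M + 1) * (2 * K ^+ 2 * (C ^+ 2 * r)) <= (1 + (M + 1) * (2 * K ^+ 2 * C ^+ 2)) * r.
  have -> : (1 + (M + 1) * (2 * K ^+ 2 * C ^+ 2)) * r = r + (M + 1) * (2 * K ^+ 2 * (C ^+ 2 * r)) by ring.
  by rewrite lerDr ltW.
split.
- by have := dom_scale hX0 (M + 1) hU; rewrite (gtr0_norm M10) => /dom_ler; apply.
- by have := dom_scale hX3 (M + 1) hV; rewrite (gtr0_norm M10) => /dom_ler; apply.
near=> x.
have aU : forall n, `|a_ n x| <= Q ^+ n * `|U x|.
  by apply: (single (fun n => a_ n x)); near: x.
have dV : forall n, `|d_ n x| <= Q ^+ n * `|V x|.
  by apply: (single (fun n => d_ n x)); near: x.
have hW' : forall n, `|h_ n x| <= Q ^+ n * `|W x|.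
  by apply: (single (fun n => h_ n x)); near: x.
have hx : forall n, `|h_ n x| <= `|a_ n x| `^ (1 - lam) *
      (`|h_ n.+1 x| `^ (1 - mu) * `|d_ n x| `^ mu) `^ lam by near: x.
pose P := `|U x| `^ (1 - lam) * `|V x| `^ (lam * mu).
have P0 : 0 <= P by rewrite mulr_ge0 ?powR_ge0.
have step n : `|h_ n x| <= Q ^+ n * P * `|h_ n.+1 x| `^ rho.
  apply: (le_trans (hx n)).
  have pl (c s t : R) : 0 <= c -> 0 <= s -> s <= t -> s `^ c <= t `^ c.
    by move=> ? s0 st; apply: ge0_ler_powR; rewrite ?nnegrE // (le_trans s0).
  have Qn0 : 0 <= Q ^+ n by rewrite exprn_ge0 // ltW.
  rewrite (powRM _ (powR_ge0 _ _) (powR_ge0 _ _)) -!powRrM.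
  have i1 : `|a_ n x| `^ (1 - lam) <= (Q ^+ n * `|U x|) `^ (1 - lam).
    by apply: pl; rewrite // subr_ge0 ltW.
  have i2 : `|d_ n x| `^ (mu * lam) <= (Q ^+ n * `|V x|) `^ (mu * lam).
    by apply: pl; rewrite // mulr_ge0 // ltW.
  (* The exponents 1 - lam and mu lam add up to at most 1. *)
  have Qe : (Q ^+ n) `^ (1 - lam) * (Q ^+ n) `^ (mu * lam) <= Q ^+ n.
    rewrite -powRD; last by rewrite (gt_eqF (exprn_gt0 n Q0)) implybT.
    rewrite -[leRHS](powRr1 Qn0); apply: ler_powR; first exact: exprn_ege1.
    by nra.
  apply: (@le_trans _ _ ((Q ^+ n * `|U x|) `^ (1 - lam) * (`|h_ n.+1 x| `^ rho * (Q ^+ n * `|V x|) `^ (mu * lam)))).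
    rewrite [(1 - mu) * lam]mulrC; apply: ler_pM => //; rewrite ?mulr_ge0 ?powR_ge0 //.
    by rewrite ler_wpM2l ?powR_ge0.
  rewrite (powRM _ Qn0 (normr_ge0 (U x))) (powRM _ Qn0 (normr_ge0 (V x))) /P [lam * mu]mulrC.
  set qa := (Q ^+ n) `^ (1 - lam) in Qe *; set qb := (Q ^+ n) `^ (mu * lam) in Qe *.
  set ua := `|U x| `^ _; set va := `|V x| `^ _; set ha := _ `^ rho.
  have -> : qa * ua * (ha * (qb * va)) = (qa * qb) * (ua * va * ha) by ring.
  by rewrite -[leRHS]mulrA ler_wpM2r // !mulr_ge0 ?powR_ge0.
have rho01 : 0 < rho < 1 by rewrite rho0.
have := @iteration_bound R (fun n => `|h_ n x|) Q P `|W x| rho Q1 P0 rho01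
  (fun n => normr_ge0 _) hW' step.
rewrite -/M /= => /le_trans; apply.
rewrite /P (powRM _ (powR_ge0 _ _) (powR_ge0 _ _)) -!powRrM.
have r1 : 1 - rho != 0 by rewrite gt_eqF // subr_gt0.
have -> : lam * mu / (1 - rho) = th by rewrite -thE -/rho mulfK.
have -> : (1 - lam) / (1 - rho) = 1 - th.
  have -> : 1 - lam = (1 - th) * (1 - rho) by rewrite mulrBl mul1r /rho thE; ring.
  by rewrite mulfK.
rewrite !normrM (gtr0_norm M10) (powRM _ (ltW M10) (normr_ge0 _)) (powRM _ (ltW M10) (normr_ge0 _)).
rewrite mulrACA -powRD ?subrK ?(powRr1 (ltW M10)); last by rewrite (gt_eqF M10) implybT.
by rewrite ler_wpM2r ?mulr_ge0 ?powR_ge0 // lerDl.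
Unshelve. all: by end_near.
Qed.

(** The two factors from X3, with exponents (1 - mu) th and mu, are both at most the sum of their
    moduli, and so merge into one factor with exponent eta. *)
Lemma calderon_compose (X0 X1 X2 X3 : fspace T R) (K C C' mu th eta : R) :
  qlat m X0 K -> qlat m X1 K -> qlat m X3 K -> 0 < th < 1 -> 0 < mu < 1 ->
  eta = (1 - mu) * th + mu -> 1 <= C -> 1 <= C' ->
  (forall u r, 0 < r -> dom m X2 u r -> calderon m X1 X3 mu u (C * r)) ->
  (forall u r, 0 < r -> dom m X1 u r -> calderon m X0 X3 th u (C' * r)) ->
  exists2 C'' : R, 1 <= C'' & forall u r, 0 < r -> dom m X2 u r -> calderon m X0 X3 eta u (C'' * r).
Proof.
move=> hX0 hX1 hX3 /andP[t0 t1] /andP[m0 m1] etaE C1 C1' h2 h1.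
have K1 : 1 <= K by case: hX0.
have K0 : 0 < K by lra.
have [CC CC'] : 0 < C /\ 0 < C' by split; lra.
exists (K * (C' * C + C)).
  have : 1 <= C' * C by rewrite mulr_ege1.
  move=> h; apply: (le_trans h); apply: (@le_trans _ _ (C' * C + C)); first by rewrite lerDl ltW.
  by rewrite ler_peMl // addr_ge0 ?mulr_ge0 // ltW.
move=> u r r0 /(h2 _ _ r0)[h [dd [hh hd hle]]].
have Cr0 : 0 < C * r by rewrite mulr_gt0.
have [a [v [ha hv hav]]] := h1 _ _ Cr0 hh.
have e : K * (C' * (C * r) + C * r) = K * (C' * C + C) * r by ring.
exists a, (fun x => `|v x| + `|dd x|); split.
- apply: (dom_ler ha); rewrite -e.
  apply: (@le_trans _ _ (C' * (C * r) + C * r)); first by rewrite lerDl ltW.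
  by rewrite ler_peMl // addr_ge0 ?mulr_ge0 // ltW.
- by rewrite -e; exact: dom_add.
near=> x.
apply: (@le_trans _ _ (`|h x| `^ (1 - mu) * `|dd x| `^ mu)); first by near: x.
have av : `|h x| <= `|a x| `^ (1 - th) * `|v x| `^ th by near: x.
rewrite normr_normD; set S := `|v x| + `|dd x|.
have vS : `|v x| <= S by rewrite lerDl.
have dS : `|dd x| <= S by rewrite lerDr.
have S0 : 0 <= S by rewrite addr_ge0.
apply: (@le_trans _ _ ((`|a x| `^ (1 - th) * S `^ th) `^ (1 - mu) * S `^ mu)).
  apply: ler_pM; rewrite ?powR_ge0 //; apply: ge0_ler_powR; rewrite ?nnegrE ?mulr_ge0 ?powR_ge0 ?subr_ge0 ?(ltW m1) ?(ltW m0) //.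
  apply: (le_trans av); rewrite ler_wpM2l ?powR_ge0 //; apply: ge0_ler_powR; rewrite ?nnegrE ?(ltW t0) //.
rewrite powRM ?powR_ge0 // -!powRrM -mulrA -powRD; last first.
  rewrite gt_eqF //; have : 0 < th * (1 - mu) by rewrite mulr_gt0 // subr_gt0.
  lra.
rewrite (_ : th * (1 - mu) + mu = eta); last by rewrite etaE; ring.
by rewrite (_ : (1 - th) * (1 - mu) = 1 - eta) // etaE; ring.
Unshelve. all: by end_near.
Qed.

End reiteration.

(** At Z = max(A, G, s) the ratio z = Z / s satisfies z <= c z^nu with nu < 1, hence z <=
    c^(1/(1-nu)). Finiteness of A and G is essential. *)
Lemma two_term_bound (R : realType) (A G s c lam mu : R) : 0 < lam < 1 -> 0 < mu < 1 ->
  0 < s -> 1 <= c ->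
  (forall Z, A <= Z -> G <= Z -> s <= Z -> A <= c * (s `^ (1 - lam) * Z `^ lam) /\
     G <= c * (Z `^ (1 - mu) * s `^ mu)) ->
  let nu := Num.max lam (1 - mu) in
  A <= c `^ (1 - nu)^-1 * s /\ G <= c `^ (1 - nu)^-1 * s.
Proof.
move=> /andP[l0 l1] /andP[m0 m1] s0 c1 h nu.
have nu1 : 0 < 1 - nu by rewrite subr_gt0 gt_max l1 ltrBlDr ltrDl.
pose Z := Num.max (Num.max A G) s.
have AZ : A <= Z by rewrite !le_max lexx.
have GZ : G <= Z by rewrite !le_max lexx orbT.
have sZ : s <= Z by rewrite le_max lexx orbT.
have [hA hG] := h Z AZ GZ sZ.
have Z0 : 0 < Z by exact: lt_le_trans sZ.
have c0 : 0 < c by lra.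
pose z := Z / s; have z1 : 1 <= z by rewrite /z ler_pdivlMr // mul1r.
have z0 : 0 < z by lra.
have ZE : Z = z * s by rewrite /z divfK // gt_eqF.
have e1 t : s `^ (1 - t) * Z `^ t = z `^ t * s.
  rewrite ZE (powRM _ (ltW z0) (ltW s0)) mulrCA -powRD ?subrK ?(powRr1 (ltW s0)) //.
  by rewrite (gt_eqF s0) implybT.
have e2 : Z `^ (1 - mu) * s `^ mu = z `^ (1 - mu) * s.
  by have := e1 (1 - mu); rewrite mulrC subKr.
rewrite e1 in hA; rewrite e2 in hG.
have zn t : t <= nu -> z `^ t <= z `^ nu by exact: ler_powR.
have zZ : z <= c * z `^ nu.
  rewrite /z ler_pdivrMr // -mulrA -/z /Z !ge_max -andbA; apply/and3P; split.
  - apply: (le_trans hA); rewrite ler_pM2l // ler_pM2r // zn // le_max lexx //.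
  - apply: (le_trans hG); rewrite ler_pM2l // ler_pM2r // zn // le_max lexx orbT //.
  - rewrite mulrA ler_peMl ?(ltW s0) // mulr_ege1 // -[leLHS](powRr0 z); apply: ler_powR => //.
    by rewrite le_max (ltW l0).
have zc : z <= c `^ (1 - nu)^-1.
  have zp : z `^ (1 - nu) <= c.
    rewrite -(ler_pM2r (powR_gt0 nu z0)) -powRD ?subrK ?(powRr1 (ltW z0)) //.
    by rewrite (gt_eqF z0) implybT.
  have n0 : 1 - nu != 0 by rewrite gt_eqF.
  have -> : z = (z `^ (1 - nu)) `^ (1 - nu)^-1 by rewrite -powRrM mulfV // powRr1 // ltW.
  apply: ge0_ler_powR => //.
  - by rewrite invr_ge0 ltW.
  - by rewrite nnegrE powR_ge0.
  - by rewrite nnegrE ltW.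
have ZC : Z <= c `^ (1 - nu)^-1 * s by rewrite ZE ler_pM2r.
by split; [exact: le_trans AZ ZC|exact: le_trans GZ ZC].
Qed.

(** * Geometric means and the reverse inclusion *)

Section weighted_means.
Variable R : realType.
Implicit Types (a b d t L : R).

Definition gmean a d t : R := a `^ (1 - t) * d `^ t.

Lemma gmean_ge0 a d t : 0 <= gmean a d t.
Proof. by rewrite mulr_ge0 ?powR_ge0. Qed.

Lemma gmeanC a d t : gmean a d t = gmean d a (1 - t).
Proof. by rewrite /gmean subKr mulrC. Qed.

Lemma gmean_id a t : 0 <= a -> gmean a a t = a.
Proof. by move=> a0; rewrite /gmean -powRD ?subrK ?powRr1 // oner_eq0. Qed.

Lemma gmean_le a b d t : 0 <= t -> 0 <= b -> b <= d -> gmean a b t <= gmean a d t.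
Proof.
move=> t0 b0 bd; rewrite /gmean ler_wpM2l ?powR_ge0 //.
by apply: ge0_ler_powR; rewrite ?nnegrE // (le_trans b0).
Qed.

Lemma gmeanZ a d t L : 0 <= t <= 1 -> 1 <= L -> 0 <= d -> gmean a (L * d) t <= L * gmean a d t.
Proof.
move=> /andP[t0 t1] L1 d0; have L0 : 0 <= L by lra.
rewrite /gmean (powRM _ L0 d0) mulrCA ler_wpM2r ?mulr_ge0 ?powR_ge0 //.
by rewrite -[leRHS](powRr1 L0); exact: ler_powR.
Qed.

Lemma gmean_comp a d t L : 0 <= t <= 1 -> 1 <= L -> 0 <= a -> 0 <= d ->
  a <= L * d -> d <= L * a ->
  [/\ gmean a d t <= L * a, gmean a d t <= L * d, a <= L * gmean a d t & d <= L * gmean a d t].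
Proof.
move=> t01 L1 a0 d0 ad da; have [t0 t1] := andP t01.
have t01' : 0 <= 1 - t <= 1 by apply/andP; split; lra.
split.
- rewrite -[X in L * X](gmean_id t a0); apply: le_trans (gmeanZ _ t01 L1 a0).
  exact: gmean_le.
- rewrite gmeanC -[X in L * X](gmean_id (1 - t) d0); apply: le_trans (gmeanZ _ t01' L1 d0).
  by apply: gmean_le => //; case/andP: t01'.
- rewrite -[X in X <= _](gmean_id t a0); apply: le_trans (gmeanZ _ t01 L1 d0).
  exact: gmean_le.
- rewrite gmeanC -[X in X <= _](gmean_id (1 - t) d0); apply: le_trans (gmeanZ _ t01' L1 a0).
  by apply: gmean_le => //; case/andP: t01'.
Qed.

Lemma gmean_gmean a d s t : 0 < s < 1 -> 0 < t < 1 ->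
  gmean a (gmean a d s) t = gmean a d (t * s).
Proof.
move=> /andP[s0 s1] /andP[t0 t1]; rewrite /gmean powRM ?powR_ge0 // -!powRrM mulrA -powRD.
  by rewrite (mulrC s); congr (_ `^ _ * _); ring.
have -> : 1 - t + (1 - s) * t = 1 - t * s by ring.
by rewrite gt_eqF // subr_gt0 mulr_ilt1 // ltW.
Qed.

End weighted_means.

Section equivalence.
Context d (T : measurableType d) (R : realType).
Variable m : {measure set T -> \bar R}.

Lemma measurable_gmean (a b : T -> R) t : measurable_fun setT a -> measurable_fun setT b ->
  measurable_fun setT (fun x => gmean (a x) (b x) t).
Proof. by move=> ma mb; apply: measurable_funM; exact: measurable_powRfun. Qed.

(** C does not depend on L: comparability only puts both means into X0 and X3, hence into X1 and X2,
    with norms of unknown size, which [two_term_bound] then estimates. *)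
Lemma gmean_bound (X0 X1 X2 X3 : fspace T R) (K lam mu th eta : R) :
  qlat m X0 K -> qlat m X1 K -> qlat m X2 K -> qlat m X3 K ->
  0 < lam < 1 -> 0 < mu < 1 -> 0 < th < 1 -> 0 < eta < 1 ->
  th = lam * eta -> eta = (1 - mu) * th + mu ->
  qn_equiv X1 (interp m X0 X2 lam) -> qn_equiv X2 (interp m X1 X3 mu) ->
  fs_mem X0 `&` fs_mem X3 `<=` fs_mem X1 -> fs_mem X0 `&` fs_mem X3 `<=` fs_mem X2 ->
  exists2 C : R, 0 < C & forall (a b : T -> R) s L, 0 < s ->
    measurable_fun setT a -> measurable_fun setT b -> (forall x, 0 <= a x) -> (forall x, 0 <= b x) ->
    dom m X0 a s -> dom m X3 b s -> (forall x, a x <= L * b x) -> (forall x, b x <= L * a x) ->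
    dom m X1 (fun x => gmean (a x) (b x) th) (C * s) /\
    dom m X2 (fun x => gmean (a x) (b x) eta) (C * s).
Proof.
move=> hX0 hX1 hX2 hX3 l01 m01 t01 e01 thE etaE [X1I [c1 c10 hc1]] [X2I [c2 c20 hc2]] i1 i2.
pose c := 1 + 2 * c1 + 2 * c2.
have c_1 : 1 <= c by rewrite /c; lra.
pose nu := Num.max lam (1 - mu).
exists (c `^ (1 - nu)^-1); first by rewrite powR_gt0; lra.
move=> a b s L' s0 ma mb a0 b0 ha hb ab' ba'.
pose L := Num.max L' 1.
have L1 : 1 <= L by rewrite le_max lexx orbT.
have ab x : a x <= L * b x.
  by apply: (le_trans (ab' x)); rewrite ler_wpM2r // le_max lexx.
have ba x : b x <= L * a x.
  by apply: (le_trans (ba' x)); rewrite ler_wpM2r // le_max lexx.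
have L0 : 0 <= L by lra.
have cmp t x : 0 < t < 1 -> [/\ gmean (a x) (b x) t <= L * a x, gmean (a x) (b x) t <= L * b x,
    a x <= L * gmean (a x) (b x) t & b x <= L * gmean (a x) (b x) t].
  by move=> /andP[t0 t1]; apply: gmean_comp => //; rewrite !ltW.
pose psi t x := gmean (a x) (b x) t.
have psi0 t x : 0 <= psi t x by exact: gmean_ge0.
have mpsi t : measurable_fun setT (psi t) by exact: measurable_gmean.
pose cpsi t : T -> R[i] := fun x => (psi t x)%:C%C.
have mem t : 0 < t < 1 -> (fs_mem X0 `&` fs_mem X3) (cpsi t).
  move=> tt; split.
    have [] // := dom_mem hX0 (dom_scale hX0 L ha) (L0_real (mpsi t)).
    apply: aeW => x; rewrite nc_real (ger0_norm (psi0 t x)) (ger0_norm (mulr_ge0 L0 (a0 x))).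
    by have [] := cmp t x tt.
  have [] // := dom_mem hX3 (dom_scale hX3 L hb) (L0_real (mpsi t)).
  apply: aeW => x; rewrite nc_real (ger0_norm (psi0 t x)) (ger0_norm (mulr_ge0 L0 (b0 x))).
  by have [] := cmp t x tt.
have X1p : X1 (cpsi th) by apply: i1; exact: mem.
have X2p : X2 (cpsi eta) by apply: i2; exact: mem.
have := @two_term_bound R (fs_norm X1 (cpsi th)) (fs_norm X2 (cpsi eta)) s c lam mu l01 m01 s0 c_1.
rewrite /= -/nu => H.
have [Z AZ GZ sZ|A1 A2] := H.
  have Z0 : 0 < Z by exact: lt_le_trans sZ.
  have dA : dom m X1 (psi th) Z by exact: rep_dom X1p AZ.
  have dG : dom m X2 (psi eta) Z by exact: rep_dom X2p GZ.
  split.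
    have [|||_ nI] := @interp_comparable _ _ _ m X0 X2 K hX0 hX2 lam a (psi eta) s Z L (cpsi th)
       l01 s0 Z0 ma (mpsi eta) a0 (psi0 eta) ha dG _ _ (L0_real (mpsi th)).
    - by move=> x; have [] := cmp eta x e01.
    - by move=> x; have [] := cmp eta x e01.
    - apply: aeW => x; rewrite nc_real ger0_norm // -/(gmean (a x) (psi eta x) lam).
      by rewrite gmean_gmean // -thE.
    have /andP[h _] := hc1 _ X1p; move: h; rewrite ler_pdivrMl // => /le_trans; apply.
    apply: (@le_trans _ _ (c1 * (2 * (s `^ (1 - lam) * Z `^ lam)))); first by rewrite ler_pM2l.
    by rewrite mulrA ler_wpM2r ?mulr_ge0 ?powR_ge0 // /c; lra.
  have [|||_ nI] := @interp_comparable _ _ _ m X1 X3 K hX1 hX3 mu (psi th) b Z s L (cpsi eta)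
     m01 Z0 s0 (mpsi th) mb (psi0 th) b0 dA hb _ _ (L0_real (mpsi eta)).
  - by move=> x; have [] := cmp th x t01.
  - by move=> x; have [] := cmp th x t01.
  - apply: aeW => x; rewrite nc_real ger0_norm // -/(gmean (psi th x) (b x) mu).
    (* Seen from b, the exponent of a is (1 - mu)(1 - th) = 1 - eta. *)
    rewrite gmeanC /psi (gmeanC _ _ th) gmean_gmean; last 2 first.
    + by case/andP: t01 => ? ?; apply/andP; split; lra.
    + by case/andP: m01 => ? ?; apply/andP; split; lra.
    have -> : (1 - mu) * (1 - th) = 1 - eta by rewrite etaE; ring.
    by rewrite [leRHS]gmeanC subKr.
  have /andP[h _] := hc2 _ X2p; move: h; rewrite ler_pdivrMl // => /le_trans; apply.
  apply: (@le_trans _ _ (c2 * (2 * (Z `^ (1 - mu) * s `^ mu)))); first by rewrite ler_pM2l.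
  by rewrite mulrA ler_wpM2r ?mulr_ge0 ?powR_ge0 // /c; lra.
by split; [exact: rep_dom X1p A1|exact: rep_dom X2p A2].
Qed.

(** [calderon_split] cuts the product into pieces with comparable factors. Their ratios L i are
    unbounded, but C is independent of them, so the pieces sum up geometrically. *)
Lemma calderon_dom (X0 X3 X : fspace T R) (K C t : R) :
  qlat m X0 K -> qlat m X3 K -> qlat m X K -> 0 < t < 1 -> 0 < C ->
  order_cont m X0 \/ order_cont m X3 ->
  (forall (a b : T -> R) s L, 0 < s ->
    measurable_fun setT a -> measurable_fun setT b -> (forall x, 0 <= a x) -> (forall x, 0 <= b x) ->
    dom m X0 a s -> dom m X3 b s -> (forall x, a x <= L * b x) -> (forall x, b x <= L * a x) ->
    dom m X (fun x => gmean (a x) (b x) t) (C * s)) ->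
  forall u r, 0 < r -> calderon m X0 X3 t u r -> dom m X u (2 * K ^+ 2 * (C * r)).
Proof.
move=> hX0 hX3 hX t01 C0 oc hC u r r0 hu.
have K1 : 1 <= K by case: hX0.
have K0 : 0 < K by lra.
pose q := (4 * K)^-1.
have q0 : 0 < q by rewrite invr_gt0 mulr_gt0.
have q1 : 0 < q < 1 by rewrite q0 invf_lt1 ?mulr_gt0 //; lra.
have Kq : 2 * K * q <= 1.
  by rewrite ler_pdivrMr ?mulr_gt0 // mul1r ler_pM2r // ler_nat.
have [g0 [g1 [D [L [[mg0 mg1 g00 g10] [mD tD] [hD h0] hdom hle]]]]] :=
  calderon_split hX0 hX3 t01 q1 r0 oc hu.
have [t0 t1] := andP t01.
have gz (y : R) : gmean 0 y t = 0 by rewrite /gmean powR0 ?mul0r // gt_eqF // subr_gt0.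
have h : dom m X (fun x => gmean (g0 x) (g1 x) t) (2 * K ^+ 2 * (C * r)).
  apply: (dom_pieces hX (D := D) q0 Kq); first by rewrite mulr_ge0 // ltW.
    move=> i; have [d0 d1] := hdom i.
    have rq : 0 < r * q ^+ i by rewrite mulr_gt0 // exprn_gt0.
    have := @hC (cut (D i) g0) (cut (D i) g1) (r * q ^+ i) (L i) rq.
    rewrite -mulrA => H.
    have {}H : dom m X (fun x => gmean (cut (D i) g0 x) (cut (D i) g1 x) t) (C * (r * q ^+ i)).
      apply: H => //; first exact: measurable_cut.
      - exact: measurable_cut.
      - by move=> x; apply: cut_ge0.
      - by move=> x; apply: cut_ge0.
      - move=> x; rewrite /cut; case: ifPn => [/set_mem/hD[]|]; rewrite ?mulr0 //.
      - move=> x; rewrite /cut; case: ifPn => [/set_mem/hD[]|]; rewrite ?mulr0 //.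
    apply: (dom_le H) => //; apply: aeW => x; rewrite /cut; case: ifP => _ //.
    by rewrite gz.
  by move=> x /h0[-> _]; exact: gz.
apply: (dom_le h) => //; apply: filterS hle => x /le_trans; apply; exact: ler_norm.
Qed.

(** The transfer statements need positive radii, one of them with a strict inequality, whereas a
    norm may be 0. *)
Lemma le_of_add (C x y : R) : 0 < C -> (forall e, 0 < e -> x <= C * (y + e)) -> x <= C * y.
Proof.
move=> C0 h; apply/ler_addgt0Pr => e e0; have := h (e / C) (divr_gt0 e0 C0).
by rewrite mulrDr [C * (e / C)]mulrC divfK // gt_eqF.
Qed.

Lemma equiv_of_calderon (X0 X3 X : fspace T R) (K C t : R) :
  A_convex m X0 -> A_convex m X3 ->
  qlat m X0 K -> qlat m X3 K -> qlat m X K -> 0 < t < 1 -> 0 < C ->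
  order_cont m X0 \/ order_cont m X3 ->
  (forall u r, 0 < r -> dom m X u r -> calderon m X0 X3 t u (C * r)) ->
  (forall u r, 0 < r -> calderon m X0 X3 t u r -> dom m X u (C * r)) ->
  qn_equiv X (interp m X0 X3 t).
Proof.
move=> aX0 aX3 hX0 hX3 hX t01 C0 oc h1 h2.
have K1 : 1 <= K by case: hX0.
have K0 : 0 < K by lra.
have [c c0 hc] := A_convex_interp_calderon aX0 aX3.
have to f r : 0 < r -> X f -> fs_norm X f <= r ->
    interp m X0 X3 t f /\ fs_norm (interp m X0 X3 t) f <= 4 * K ^+ 2 * (C * r).
  move=> r0 Xf fr; have hf := h1 _ _ r0 (dom_fs m Xf fr).
  apply: (calderon_interp hX0 hX3 t01 _ oc hf); first by rewrite mulr_gt0.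
    exact: (fs_mem_L0 hX Xf).
  by apply: aeW => x; rewrite ger0_norm // nc_ge0.
have back f r : 0 < r -> interp m X0 X3 t f -> fs_norm (interp m X0 X3 t) f < r ->
    X f /\ fs_norm X f <= C * (c * r).
  move=> r0 hf fr; have cr : 0 < c * r by rewrite mulr_gt0.
  apply: (dom_mem hX (h2 _ _ cr (hc t r f t01 r0 oc hf fr))); first by case: hf.
  by apply: aeW => x; rewrite ger0_norm // nc_ge0.
have Inorm f : interp m X0 X3 t f -> 0 <= fs_norm (interp m X0 X3 t) f.
  move=> [Lf [F aF Ff]]; apply: lb_le_inf; first by exists (admissible_norm m X0 X3 F), F.
  by move=> _ [G [aG _] <-]; exact: (admissible_norm_ge0 hX0 aG).
split.
  apply/funext => f; apply/propext; split=> hf.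
    have n0 := fs_norm_ge0 hX hf.
    by have [] := to f (fs_norm X f + 1) (ltr_wpDl n0 ltr01) hf (ltW (ltr_pwDr ltr01 (lexx _))).
  have n0 := Inorm f hf.
  by have [] := back f (fs_norm (interp m X0 X3 t) f + 1) (ltr_wpDl n0 ltr01) hf (ltr_pwDr ltr01 (lexx _)).
pose c1 := 4 * K ^+ 2 * C; pose c2 := C * c.
have c10 : 0 < c1 by rewrite !mulr_gt0 // exprn_gt0.
have c20 : 0 < c2 by rewrite mulr_gt0.
exists (c1 + c2); first by rewrite addr_gt0.
move=> f Xf; have n0 := fs_norm_ge0 hX Xf.
have If : interp m X0 X3 t f.
  by have [] := to f (fs_norm X f + 1) (ltr_wpDl n0 ltr01) Xf (ltW (ltr_pwDr ltr01 (lexx _))).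
have I0 := Inorm f If.
have le1 : fs_norm (interp m X0 X3 t) f <= c1 * fs_norm X f.
  apply: le_of_add => // e e0; rewrite /c1 -mulrA.
  by have [] := to f (fs_norm X f + e) (ltr_wpDl n0 e0) Xf (ltW (ltr_pwDr e0 (lexx _))).
have le2 : fs_norm X f <= c2 * fs_norm (interp m X0 X3 t) f.
  apply: le_of_add => // e e0; rewrite /c2 -mulrA.
  by have [] := back f (fs_norm (interp m X0 X3 t) f + e) (ltr_wpDl I0 e0) If (ltr_pwDr e0 (lexx _)).
apply/andP; split.
  rewrite ler_pdivrMl ?addr_gt0 //; apply: (le_trans le2); rewrite ler_wpM2r // lerDr ltW //.
by apply: (le_trans le1); rewrite ler_wpM2r // lerDl ltW.
Qed.

End equivalence.

Theorem theorem1p2 (R : realType) (d : measure_display)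
    (Omega : measurableType d) (m : {measure set Omega -> \bar R})
    (m_separable : separable_measure m)
    (m_sigma_finite : sigma_finite [set: Omega] m)
    (X0 X1 X2 X3 : fspace Omega R)
    (X0_A_convex : A_convex m X0) (X1_A_convex : A_convex m X1)
    (X2_A_convex : A_convex m X2) (X3_A_convex : A_convex m X3)
    (X0_or_X3_separable : qn_separable X0 \/ qn_separable X3)
    (dense_X1 : qn_dense (fs_mem X0 `&` fs_mem X3) X1)
    (dense_X2 : qn_dense (fs_mem X0 `&` fs_mem X3) X2)
    (theta eta lambda mu : R)
    (theta01 : 0 <= theta <= 1) (eta01 : 0 <= eta <= 1)
    (lambda01 : 0 <= lambda <= 1) (mu01 : 0 <= mu <= 1)
    (theta_lt_eta : 0 < theta /\ theta < eta /\ eta < 1)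
    (theta_eq : theta = lambda * eta)
    (eta_eq : eta = (1 - mu) * theta + mu)
    (X1_eq : qn_equiv X1 (interp m X0 X2 lambda))
    (X2_eq : qn_equiv X2 (interp m X1 X3 mu)) :
  qn_equiv X1 (interp m X0 X3 theta) /\ qn_equiv X2 (interp m X0 X3 eta).
Proof.
have [t0 [te e1]] := theta_lt_eta.
have t1 : theta < 1 by lra.
have e0 : 0 < eta by lra.
have t01 : 0 < theta < 1 by rewrite t0.
have e01 : 0 < eta < 1 by rewrite e0.
(* lambda = theta / eta, and below mu = (eta - theta) / (1 - theta). *)
have l01 : 0 < lambda < 1 by apply/andP; split; nra.
have m01 : 0 < mu < 1 by apply/andP; split; nra.
have [q0 _] := X0_A_convex; have [q1 _] := X1_A_convex.
have [q2 _] := X2_A_convex; have [q3 _] := X3_A_convex.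
have [K0 h0] := qbfs_qlat q0; have [K1 h1] := qbfs_qlat q1.
have [K2 h2] := qbfs_qlat q2; have [K3 h3] := qbfs_qlat q3.
pose K := Num.max (Num.max K0 K1) (Num.max K2 K3).
have {}h0 : qlat m X0 K by apply: qlat_mono h0; rewrite !le_max lexx.
have {}h1 : qlat m X1 K by apply: qlat_mono h1; rewrite !le_max lexx ?orbT.
have {}h2 : qlat m X2 K by apply: qlat_mono h2; rewrite !le_max lexx ?orbT.
have {}h3 : qlat m X3 K by apply: qlat_mono h3; rewrite !le_max lexx ?orbT.
clearbody K.
have K_1 : 1 <= K by case: h0.
have oc03 : order_cont m X0 \/ order_cont m X3.
  by case: X0_or_X3_separable => s; [left; exact: (separable_order_cont h0 s)|right; exact: (separable_order_cont h3 s)].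
have [i1 _] := dense_X1; have [i2 _] := dense_X2.
have i0 : fs_mem X0 `&` fs_mem X3 `<=` fs_mem X0 by move=> f [].
have i3 : fs_mem X0 `&` fs_mem X3 `<=` fs_mem X3 by move=> f [].
have [oc1 oc2] : order_cont m X1 /\ order_cont m X2.
  (* Order continuity travels along the two interpolation identities: from X0 to X1 and then X2, or
     from X3 to X2 and then X1. *)
  case: oc03 => oc.
    have oc1 := interp_order_cont h0 h2 h1 l01 X1_eq dense_X1 i0 i2 (or_introl oc).
    by split => //; exact: (interp_order_cont h1 h3 h2 m01 X2_eq dense_X2 i1 i3 (or_introl oc1)).
  have oc2 := interp_order_cont h1 h3 h2 m01 X2_eq dense_X2 i1 i3 (or_intror oc).
  by split => //; exact: (interp_order_cont h0 h2 h1 l01 X1_eq dense_X1 i0 i2 (or_intror oc2)).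
have [C1 C11 f1] := equiv_calderon X0_A_convex X2_A_convex h1 l01 X1_eq (or_intror oc2).
have [C2 C21 f2] := equiv_calderon X1_A_convex X3_A_convex h2 m01 X2_eq (or_introl oc1).
pose C := C1 + C2; have C_1 : 1 <= C by rewrite /C; lra.
have mono (Y0 Y1 : fspace Omega R) t u s s' : s <= s' -> calderon m Y0 Y1 t u s -> calderon m Y0 Y1 t u s'.
  move=> ss [a [b [ha hb hab]]]; exists a, b; split => //; [exact: dom_ler ha ss|exact: dom_ler hb ss].
have {}f1 u r : 0 < r -> dom m X1 u r -> calderon m X0 X2 lambda u (C * r).
  by move=> r0 /(f1 _ _ r0); apply: mono; rewrite ler_pM2r // /C; lra.
have {}f2 u r : 0 < r -> dom m X2 u r -> calderon m X1 X3 mu u (C * r).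
  by move=> r0 /(f2 _ _ r0); apply: mono; rewrite ler_pM2r // /C; lra.
have thE : theta * (1 - lambda * (1 - mu)) = lambda * mu.
  by rewrite mulrBr mulr1 {1}theta_eq {1}eta_eq; ring.
have [D1 D11 g1] := calderon_iterate h0 h1 h3 l01 m01 thE C_1 f1 f2.
have [D2 D21 g2] := calderon_compose h0 h1 h3 t01 m01 eta_eq C_1 D11 f2 g1.
have [E E0 hE] := gmean_bound h0 h1 h2 h3 l01 m01 t01 e01 theta_eq eta_eq X1_eq X2_eq i1 i2.
have k1 := @calderon_dom _ _ _ m X0 X3 X1 K E theta h0 h3 h1 t01 E0 oc03.
have {}k1 u r : 0 < r -> calderon m X0 X3 theta u r -> dom m X1 u (2 * K ^+ 2 * (E * r)).
  by apply: k1 => a b s L s0 ma mb a0 b0 ha hb ab ba; have [] := hE a b s L.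
have k2 := @calderon_dom _ _ _ m X0 X3 X2 K E eta h0 h3 h2 e01 E0 oc03.
have {}k2 u r : 0 < r -> calderon m X0 X3 eta u r -> dom m X2 u (2 * K ^+ 2 * (E * r)).
  by apply: k2 => a b s L s0 ma mb a0 b0 ha hb ab ba; have [] := hE a b s L.
pose G := 2 * K ^+ 2 * E.
have Kp : 0 < K by lra.
have G0 : 0 < G by rewrite mulr_gt0 // mulr_gt0 // exprn_gt0.
have GE r : 2 * K ^+ 2 * (E * r) = G * r by rewrite /G; ring.
split.
  apply: (@equiv_of_calderon _ _ _ m X0 X3 X1 K (D1 + G)) => //; first by lra.
    by move=> u r r0 /(g1 _ _ r0); apply: mono; rewrite ler_pM2r //; lra.
  by move=> u r r0 /(k1 _ _ r0)/dom_ler; apply; rewrite GE ler_pM2r //; lra.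
apply: (@equiv_of_calderon _ _ _ m X0 X3 X2 K (D2 + G)) => //; first by lra.
  by move=> u r r0 /(g2 _ _ r0); apply: mono; rewrite ler_pM2r //; lra.
by move=> u r r0 /(k2 _ _ r0)/dom_ler; apply; rewrite GE ler_pM2r //; lra.
Qed.
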